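(* Let $\Omega\subset\mathbb{R}^2$ be a bounded domain with $C^2$ boundary, let the oblique (unit) vector field $\ell$ on $\partial\Omega$ be of class $C^1$, and let $\mathcal{T}_h$ be an exact conforming triangulation of $\Omega$ with associated curved Hermite finite element space $V_h$ of degree $k\ge 3$. Then for every $v_h\in V_h$, $$\begin{aligned}\sum_{K\in\mathcal{T}_h}\int_K(\Delta v_h)^2\,\mathrm{d}x=\ &\sum_{K\in\mathcal{T}_h}\int_K|D^2v_h|^2\,\mathrm{d}x+2\sum_{F\in\mathcal{F}_h^i}\int_F\Big[\frac{\partial v_h}{\partial n}\Big]\frac{\partial^2v_h}{\partial t_F^2}\,\mathrm{d}s\\&+\sum_{F\in\mathcal{F}_h^\partial}\int_F\Big(|\nabla v_h|^2(\dot\theta-\chi)-2\frac{\partial v_h}{\partial\ell^\perp}\dot{\Big(\frac{\partial v_h}{\partial\ell}\Big)}\Big)\mathrm{d}s.\end{aligned}$$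
   Context: **Domain and vector field.** $\partial\Omega$ is a closed $C^2$ curve parametrized by arc length $\boldsymbol{x}=(x_1,x_2):[0,L]\to\mathbb{R}^2$, $\boldsymbol{x}(0)=\boldsymbol{x}(L)$, oriented so that the unit outward normal is $n=(\dot x_2,-\dot x_1)$; a dot denotes the derivative with respect to the arc length $\varphi$. Set $\chi:=\ddot x_1\dot x_2-\ddot x_2\dot x_1$. The field $\ell=(\ell_1,\ell_2)$ is a unit vector field on $\partial\Omega$ (functions on $\partial\Omega$ are identified with functions of $\varphi$), and $\theta:[0,L]\to\mathbb{R}$ is the $C^1$ oriented (anticlockwise) angle from $n$ to $\ell$. On $\partial\Omega$: $\frac{\partial v}{\partial\ell}:=\ell_1\partial_1v+\ell_2\partial_2v$, $\frac{\partial v}{\partial\ell^\perp}:=-\ell_2\partial_1v+\ell_1\partial_2v$, and $\dot{(\frac{\partial v}{\partial\ell})}:=\frac{\mathrm d}{\mathrm d\varphi}\big(\frac{\partial v}{\partial\ell}(\boldsymbol{x}(\varphi))\big)$. **Triangulation.** A closed set $K\subset\mathbb{R}^2$ is a curved triangle if $K=F_K(\hat K)$, where $\hat K$ is a fixed straight reference triangle and $F_K=\tilde F_K+\Phi_K$ is a $C^1$ map, with $\tilde F_K(\hat x)=B_K\hat x+b_K$ an invertible affine map and $c_K:=\sup_{\hat x\in\hat K}\|D\Phi_K(\hat x)B_K^{-1}\|<1$. An exact conforming triangulation $\mathcal{T}_h$ of $\Omega$ is a conforming partition of $\overline\Omega$ into curved triangles (in particular covering $\Omega$ exactly), such that each element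 has at most one truly curved edge, any truly curved edge lies on $\partial\Omega$, and all other edges are straight segments. For each straight edge $F$ of $K$, $F_K$ restricted to the corresponding edge of $\hat K$ is affine onto $F$. The maps $F_K$ are of class $C^2$ on $\hat K$. $\mathcal{F}_h^\partial$ is the set of edges contained in $\partial\Omega$ and $\mathcal{F}_h^i$ the set of the remaining (interior) edges. **Finite element space.** With $\mathcal{P}_k(\hat K)$ the polynomials of total degree $\le k$, let $P_K:=\{\hat v\circ F_K^{-1}:\hat v\in\mathcal{P}_k(\hat K)\}$ and $$V_h:=\{v\in H^1(\Omega): v|_K\in P_K\ \forall K\in\mathcal{T}_h,\ v\text{ is }C^1\text{ at all vertices of }\mathcal{T}_h\},$$ where ''$C^1$ at a vertex'' means that the values of $v|_K$ and of $\nabla(v|_K)$ at the vertex agree for all elements $K$ containing it. **Jumps.** For an interior edge $F=\partial K^+\cap\partial K^-$, $[\frac{\partial v}{\partial n}]:=\frac{\partial v^+}{\partial n^+}+\frac{\partial v^-}{\partial n^-}$, with $v^\pm=v|_{K^\pm}$ and $n^\pm$ the unit outward normal of $K^\pm$; $t_F$ is a fixed unit tangent of $F$. $|\cdot|$ is the Euclidean norm of vectors and the Frobenius norm of matrices. *)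

(* Defs.v *)
From HB Require Import structures.
From mathcomp Require Import all_boot all_order all_algebra.
From mathcomp Require Import all_classical all_reals all_analysis.
Set Implicit Arguments.
Unset Strict Implicit.
Unset Printing Implicit Defensive.
Import Order.TTheory GRing.Theory Num.Theory.
Import numFieldNormedType.Exports.
Local Open Scope classical_set_scope.
Local Open Scope ring_scope.

Section Plane.
Context {R : realType}.
Notation plane := (R * R)%type.

(* The library norm on R * R is the max norm (same topology). *)
Definition dot (p q : plane) : R := p.1 * q.1 + p.2 * q.2.
Definition enorm (p : plane) : R := Num.sqrt (dot p p).

Definition e1 : plane := (1, 0).
Definition e2 : plane := (0, 1).

Definition perp (p : plane) : plane := (- p.2, p.1).
Definition rotation (a : R) (p : plane) : plane :=
  (cos a * p.1 - sin a * p.2, sin a * p.1 + cos a * p.2).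

Definition area : set plane -> \bar R :=
  (@lebesgue_measure R \x @lebesgue_measure R)%E.

Definition boundary (A : set plane) : set plane := closure A `\` A°.

(* [n] points out of [A] at the boundary point [p]. *)
Definition outward (A : set plane) (p n : plane) : Prop :=
  \forall e \near (0 : R)^'+, A (p - e *: n) /\ ~ A (p + e *: n).

Definition segment (p q : plane) : set plane :=
  [set (1 - s) *: p + s *: q | s in `[0, 1]%classic].
Definition straight (E : set plane) : Prop := exists p q, E = segment p q.

(* Limit of [g] at [p] along [A]. For [A] the interior of an element K and [g]
   a derivative of v, this is the derivative of v|_K extended to K by
   continuity. *)
Definition trace (A : set plane) (g : plane -> R) (p : plane) : R :=
  lim (g y @[y --> within A (nbhs p)]).

(* Arc length integral over a straight edge [E] with unit tangent [t]; the
   choice of the base point [get E] in [E] is immaterial. *)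
Definition edge_integral (E : set plane) (t : plane) (g : plane -> R) : R :=
  \int[@lebesgue_measure R]_(s in [set s | E (get E + s *: t)])
     g (get E + s *: t).

(* Derivatives in all (fixed) directions, up to order [k], exist and are
   continuous on the open set [U]; for finite-dimensional [V] this is C^k. *)
Fixpoint Ck {V W : normedModType R} (k : nat) (U : set V) (f : V -> W) : Prop :=
  (forall x, U x -> {for x, continuous f}) /\
  (if k is k'.+1 then
     forall v, (forall x, U x -> derivable f x v) /\ Ck k' U ('D_v f)
   else True).

(* C^k on a set that need not be open: [f] is C^k near it. *)
Definition Ck_on {V W : normedModType R} (k : nat) (A : set V) (f : V -> W) :=
  exists U : set V, [/\ open U, A `<=` U & Ck k U f].

(** Sobolev space H^1 *)

Definition L2 (Omega : set plane) (f : plane -> R) : Prop :=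
  measurable_fun Omega f /\
  area.-integrable Omega (fun p => (f p ^+ 2)%:E).

Definition test_function (Omega : set plane) (phi : plane -> R) : Prop :=
  [/\ forall k, Ck k [set: plane] phi,
      compact (closure [set p | phi p != 0]) &
      closure [set p | phi p != 0] `<=` Omega].

Definition weak_derivative (Omega : set plane) (e : plane) (f g : plane -> R) :=
  forall phi, test_function Omega phi ->
    \int[area]_(p in Omega) (f p * 'D_e phi p) =
    - \int[area]_(p in Omega) (g p * phi p).

Definition H1 (Omega : set plane) (f : plane -> R) : Prop :=
  [/\ L2 Omega f,
      exists2 g, L2 Omega g & weak_derivative Omega e1 f g &
      exists2 g, L2 Omega g & weak_derivative Omega e2 f g].

(** Domain and oblique field *)

Definition bounded_domain (Omega : set plane) : Prop :=
  [/\ open Omega, connected Omega, Omega !=set0 & bounded_set Omega].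

Definition normal (x : R -> plane) (s : R) : plane :=
  ((derive1 x s).2, - (derive1 x s).1).

Definition chi (x : R -> plane) (s : R) : R :=
  let x' := derive1 x s in let x'' := derive1 (derive1 x) s in
  x''.1 * x'.2 - x''.2 * x'.1.

(* A closed C^2 curve is encoded by its [L]-periodic C^2 extension to R. *)
Record C2_boundary (Omega : set plane) (L : R) (x : R -> plane) : Prop := {
  length_gt0 : 0 < L ;
  curve_C2 : Ck 2 [set: R] x ;
  curve_periodic : forall s, x (s + L) = x s ;
  curve_simple : {in `[0, L[ &, injective x} ;
  curve_arclength : forall s, enorm (derive1 x s) = 1 ;
  curve_onto : x @` `[0, L]%classic = boundary Omega ;
  curve_oriented : forall s, outward (closure Omega) (x s) (normal x s)
}.

(* [ell] is a function on the boundary, i.e. an [L]-periodic function of arc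
   length. The angle [theta] only matters on [0, L], and x(0) = x(L) may be
   reached with two values of [theta] differing by a multiple of 2 pi. *)
Record oblique_field (L : R) (x ell : R -> plane) (theta : R -> R) : Prop := {
  field_C1 : Ck 1 [set: R] ell ;
  field_periodic : forall s, ell (s + L) = ell s ;
  field_unit : forall s, enorm (ell s) = 1 ;
  angle_C1 : Ck_on 1 `[0, L]%classic theta ;
  angle_spec : forall s, s \in `[0, L] -> ell s = rotation (theta s) (normal x s)
}.

(** Reference triangle and curved elements *)

Section Reference.
Variable a : 'I_3 -> plane.

Definition noncollinear : Prop :=
  dot (perp (a (inord 1) - a (inord 0))) (a (inord 2) - a (inord 0)) != 0.

(* points whose barycentric coordinates satisfy [P] *)
Definition bary (P : ('I_3 -> R) -> Prop) : set plane :=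
  [set p | exists s : 'I_3 -> R,
     [/\ forall i, 0 <= s i, \sum_i s i = 1, P s & p = \sum_i s i *: a i]].

Definition ref_triangle : set plane := bary (fun=> True).

(* the edge opposite to the vertex [a i] *)
Definition ref_edge (i : 'I_3) : set plane := bary (fun s => s i = 0).

Definition opnorm (A : plane -> plane) : \bar R :=
  ereal_sup [set (enorm (A xi))%:E | xi in [set xi | enorm xi <= 1]].

Definition curved_element_map (F : plane -> plane) : Prop :=
  Ck_on 2 ref_triangle F /\
  exists (B : {linear plane -> plane}) (Binv : plane -> plane) (b : plane),
    let Phi := fun p : plane => F p - (B p + b) in
    [/\ cancel B Binv, cancel Binv B &
        (ereal_sup [set opnorm (fun xi => 'd Phi p (Binv xi))
                   | p in ref_triangle] < 1)%E].

(** Triangulations, indexed by a finite type of elements *)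

Variables (T : finType) (F : T -> plane -> plane).

Definition elt (K : T) : set plane := F K @` ref_triangle.
Definition vertex (K : T) (i : 'I_3) : plane := F K (a i).
Definition edge (K : T) (i : 'I_3) : set plane := F K @` ref_edge i.

Definition is_vertex (K : T) (z : plane) : Prop := exists i, z = vertex K i.
Definition is_edge (K : T) (E : set plane) : Prop := exists i, E = edge K i.

Definition boundary_edges (Omega : set plane) : set (set plane) :=
  [set E | (exists K, is_edge K E) /\ E `<=` boundary Omega].
Definition interior_edges (Omega : set plane) : set (set plane) :=
  [set E | (exists K, is_edge K E) /\ ~ (E `<=` boundary Omega)].

Record exact_triangulation (Omega : set plane) : Prop := {
  mesh_elements : forall K, curved_element_map (F K) ;
  mesh_cover : \bigcup_K elt K = closure Omega ;
  mesh_disjoint : forall K K', K != K' -> (elt K)° `&` (elt K')° = set0 ;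
  mesh_conforming : forall K K', K != K' ->
    [\/ elt K `&` elt K' = set0,
        exists z, [/\ is_vertex K z, is_vertex K' z &
                      elt K `&` elt K' = [set z]] |
        exists E, [/\ is_edge K E, is_edge K' E & elt K `&` elt K' = E]] ;
  mesh_edge_shared : forall K E, is_edge K E -> ~ (E `<=` boundary Omega) ->
    exists2 K', K' != K & is_edge K' E ;
  mesh_one_curved : forall K i j,
    ~ straight (edge K i) -> ~ straight (edge K j) -> i = j ;
  mesh_curved_boundary : forall K i,
    ~ straight (edge K i) -> edge K i `<=` boundary Omega ;
  mesh_straight_affine : forall K i, straight (edge K i) ->
    forall p q s, ref_edge i p -> ref_edge i q -> s \in `[0, 1] ->
      F K ((1 - s) *: p + s *: q) = (1 - s) *: F K p + s *: F K q
}.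

(** Finite element space *)

Definition poly_le (k : nat) (f : plane -> R) : Prop :=
  exists c : nat -> nat -> R, forall p,
    f p = \sum_(i < k.+1) \sum_(j < (k - i).+1) c i j * p.1 ^+ i * p.2 ^+ j.

(* An element of H^1 being a class of functions modulo null sets, [v|_K] in P_K
   is only imposed on the interior of K: the values of [v] on the edges are
   arbitrary. *)
Definition in_PK (k : nat) (K : T) (v : plane -> R) : Prop :=
  exists2 vhat, poly_le k vhat &
    forall p, ref_triangle p -> (elt K)° (F K p) -> v (F K p) = vhat p.

Definition C1_at (v : plane -> R) (z : plane) : Prop :=
  forall K K', elt K z -> elt K' z ->
    [/\ trace (elt K)° v z = trace (elt K')° v z,
        trace (elt K)° ('D_e1 v) z = trace (elt K')° ('D_e1 v) z &
        trace (elt K)° ('D_e2 v) z = trace (elt K')° ('D_e2 v) z].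

Definition in_Vh (Omega : set plane) (k : nat) (v : plane -> R) : Prop :=
  [/\ H1 Omega v, forall K, in_PK k K v &
      forall K z, is_vertex K z -> C1_at v z].

(** Terms of the identity *)

Section Terms.
Variable v : plane -> R.

Definition D2 (K : T) (e e' : plane) : plane -> R :=
  trace (elt K)° ('D_e ('D_e' v)).
Definition laplacian (K : T) (p : plane) : R := D2 K e1 e1 p + D2 K e2 e2 p.
Definition hess_norm2 (K : T) (p : plane) : R :=
  D2 K e1 e1 p ^+ 2 + D2 K e1 e2 p ^+ 2 + D2 K e2 e1 p ^+ 2 + D2 K e2 e2 p ^+ 2.

Definition outer_unit_normal (K : T) (E : set plane) (n : plane) : Prop :=
  [/\ enorm n = 1, forall p q, E p -> E q -> dot n (q - p) = 0 &
      forall p, E p -> ~ is_vertex K p -> outward (elt K) p n].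

Definition unit_tangent (E : set plane) (t : plane) : Prop :=
  enorm t = 1 /\ forall p q, E p -> E q -> exists s : R, q - p = s *: t.

(* The sum runs over the (two) elements having [E] as an edge. *)
Definition jump_dn (nu : T -> set plane -> plane) (E : set plane) (p : plane)
    : R :=
  \sum_(K : T | `[< is_edge K E >]) trace (elt K)° ('D_(nu K E) v) p.

(* For derivatives that are single-valued on edges the limit may be taken along
   the union of the interiors of all elements. *)
Definition skeleton_compl : set plane := \bigcup_K (elt K)°.

Definition d2t (t : plane) : plane -> R :=
  trace skeleton_compl ('D_t ('D_t v)).

Definition grad_norm2 (p : plane) : R :=
  trace skeleton_compl ('D_e1 v) p ^+ 2 + trace skeleton_compl ('D_e2 v) p ^+ 2.

(* derivative of [v] along the field [w], as a function of arc length *)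
Definition d_along (x w : R -> plane) (s : R) : R :=
  trace skeleton_compl ('D_(w s) v) (x s).

Definition boundary_term (x ell : R -> plane) (theta : R -> R) (s : R) : R :=
  grad_norm2 (x s) * (derive1 theta s - chi x s)
  - 2 * d_along x (fun r => perp (ell r)) s * derive1 (d_along x ell) s.

End Terms.
End Reference.
End Plane.

(* Main.v *)
(** Pulled back to the reference triangle, an element K is the image G(T0) of a
    C^2 chart with [|p - q| <= c |G p - G q|].  On K the difference
    (Δv)^2 - |D^2 v|^2 is 2 det D^2 v, the Jacobian of (∂_1 v, ∂_2 v), so by Green's
    formula its integral is the circulation of g_1 dg_2 - g_2 dg_1 along ∂K, where
    g = ∇v.  Green's formula for charts follows from a Goursat subdivision
    argument.

    On an interior edge, necessarily straight, with tangent t and normal n the form is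
    2 (∂_n v) (∂_tt v) ds - d(∂_n v ∂_t v).  Testing the weak derivatives of v against
    bumps concentrated on the edge shows that the two traces of v agree, hence so do
    those of ∂_tt v; the exact parts of the two sides cancel at the vertices, where
    v is C^1.

    Along the boundary ∇v is single-valued.  If v_l and v_m are its components along
    the field l and its rotation by a right angle, then
    g_1 dg_2 - g_2 dg_1 = (|∇v|^2 (θ' - χ) - 2 v_m v_l') ds + d(v_l v_m), because the
    angle of l turns at the rate θ' - χ; the exact terms add up to zero around the
    closed curve. *)

Require Import Defs.
From HB Require Import structures.
From mathcomp Require Import all_boot all_order all_algebra.
From mathcomp Require Import all_classical all_reals all_analysis.
From mathcomp Require Import ring lra.
Import Order.TTheory GRing.Theory Num.Theory.
Import numFieldNormedType.Exports.
Set Implicit Arguments.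
Unset Strict Implicit.
Unset Printing Implicit Defensive.
Local Open Scope classical_set_scope.
Local Open Scope ring_scope.

(** * Calculus of C^1 and C^2 functions *)

(** Every function on an element is represented by its pullback to the standard triangle, and
    Cramer's rule writes the pulled-back gradient of v as quotients of Jacobians of C^2 functions.
    These quotients are C^1 on a neighbourhood of the closed triangle, so each trace on ∂K is a
    value of such a quotient, and the arbitrary values of v on the edges never enter. No change of
    variables formula is used: the integral over the image of a triangle and the circulation along
    its boundary are both additive under subdivision and agree up to o(r^2) on triangles of size r.
    Symmetry of the Hessian also comes from circulations, those of the exact form dw, which vanish.
    The lower bound on |G p - G q| is global injectivity in quantitative form; it is extracted from
    c_K < 1. On ∂Ω two parametrizations meet. The edge parameter is known to be differentiable in
    arc length only in the relative interior of an edge, and an edge may contain the base point x(0)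
    = x(L). Integrals are therefore cut at the vertices, and orientation decides which of the two
    arcs between its end points an edge fills. *)

Section NormedCalculus.
Context {R : realType} {V : normedModType R}.
Implicit Types (p q v : V) (f g : V -> R) (U : set V).

(** [Ck] speaks of directional derivatives only; differentiability is added here so that ['D_v f p]
    is linear in [v]. *)
Definition C1 U f := forall p, U p ->
  differentiable f p /\ forall v, {for p, continuous ('D_v f)}.

Definition C2 U f := C1 U f /\ forall v, C1 U ('D_v f).

Lemma continuous_open_ext U f g p : open U -> U p ->
  (forall q, U q -> g q = f q) -> {for p, continuous f} -> {for p, continuous g}.
Proof.
move=> oU Up gf cf; rewrite /prop_for /continuous_at gf//.
apply: cvg_trans cf; apply: near_eq_cvg; near=> q; apply/esym/gf.
by near: q; apply: open_nbhs_nbhs.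
Unshelve. all: by end_near. Qed.

Lemma near_eq_differentiable f g p :
  (\near p, f p = g p) -> differentiable f p -> differentiable g p.
Proof.
move=> fg df; have /diff_locallyP[c /eqaddoP E] := df.
have E2 eps : 0 < eps -> \forall h \near (0 : V),
    `|(g \o shift p - (cst (g p) + 'd f p)) h| <= eps * `|h|.
  move=> e0; have A := E _ e0; have gp := nbhs_singleton fg.
  move: fg; rewrite (near_shift (0 : V) p) subr0 => B.
  near=> h; rewrite -[X in `|X| <= _]/(g (h + p) - (g p + 'd f p h)) -gp.
  have <- : f (h + p) = g (h + p) by near: h.
  by near: h.
have D : 'd g p = 'd f p :> (V -> R).
  by apply: diff_unique => //; apply/eqaddoP => eps e0; exact: E2.
apply/diff_locallyP; rewrite D; split => //.
by apply/eqaddoP => eps e0; exact: E2.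
Unshelve. all: by end_near. Qed.

Lemma C1_open_ext U f g : open U ->
  (forall p, U p -> f p = g p) -> C1 U f -> C1 U g.
Proof.
move=> oU fg Cf p Up; have [df c] := Cf p Up.
have E q : U q -> \near q, f q = g q.
  by move=> Uq; near=> z; apply: fg; near: z; apply: open_nbhs_nbhs.
split; first exact: near_eq_differentiable (E _ Up) df.
move=> v; apply: (continuous_open_ext oU Up _ (c v)) => q Uq.
by apply/esym/near_eq_derive; exact: E.
Unshelve. all: by end_near. Qed.

Lemma C1_continuous U f p : C1 U f -> U p -> {for p, continuous f}.
Proof. by move=> Cf /Cf[df _]; exact: differentiable_continuous. Qed.

Lemma C1_sub U U' f : U' `<=` U -> C1 U f -> C1 U' f.
Proof. by move=> VU Cf p /VU /Cf. Qed.

Lemma C1_cst U (c : R) : C1 U (cst c).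
Proof.
move=> p _; split=> [|v]; first exact: differentiable_cst.
have -> : 'D_v (cst c : V -> R) = cst 0 by apply/funext => q; exact: derive_cst.
exact: cst_continuous.
Qed.

Lemma C1D U f g : open U -> C1 U f -> C1 U g -> C1 U (f \+ g).
Proof.
move=> oU Cf Cg p Up; have [df f1] := Cf _ Up; have [dg g1] := Cg _ Up.
have E v q : U q -> 'D_v (f \+ g) q = 'D_v f q + 'D_v g q.
  by move=> /[dup] /Cf[df' _] /Cg[dg' _]; rewrite deriveD//; exact: diff_derivable.
split=> [|v]; first exact: differentiableD.
apply: (continuous_open_ext oU Up (E v)); apply: cvgD; [exact: f1|exact: g1].
Qed.

Lemma C1M U f g : open U -> C1 U f -> C1 U g -> C1 U (f \* g).
Proof.
move=> oU Cf Cg p Up; have [df f1] := Cf _ Up; have [dg g1] := Cg _ Up.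
have E v q : U q -> 'D_v (f \* g) q = f q * 'D_v g q + g q * 'D_v f q.
  move=> /[dup] /Cf[df' _] /Cg[dg' _].
  by rewrite -[LHS]/('D_v (f * g) q) deriveM//; exact: diff_derivable.
split=> [|v]; first exact: differentiableM.
apply: (continuous_open_ext oU Up (E v)); apply: cvgD; apply: cvgM.
- exact: differentiable_continuous.
- exact: g1.
- exact: differentiable_continuous.
- exact: f1.
Qed.

Lemma C1V U f : open U -> (forall p, U p -> f p != 0) ->
  C1 U f -> C1 U (fun p => (f p)^-1).
Proof.
move=> oU f0 Cf p Up; have [df f1] := Cf _ Up.
have E v q : U q -> 'D_v (fun p => (f p)^-1) q = - (f q) ^- 2 * 'D_v f q.
  move=> /[dup] /Cf[df' _] /f0 fq.
  by rewrite deriveV//; exact: diff_derivable.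
have cf : {for p, continuous f} by exact: differentiable_continuous.
split=> [|v]; first by apply: differentiableV => //; exact: f0.
apply: (continuous_open_ext oU Up (E v)); apply: cvgM; last exact: f1.
apply: cvgN; apply: cvgV; first by rewrite expf_neq0 ?f0.
by rewrite /GRing.exp /=; apply: cvgM.
Qed.

Lemma C1Z U f (c : R) : open U -> C1 U f -> C1 U (fun p => c * f p).
Proof. by move=> oU Cf; apply: (C1M oU _ Cf); exact: C1_cst. Qed.

Lemma C1B U f g : open U -> C1 U f -> C1 U g -> C1 U (f \- g).
Proof.
move=> oU Cf Cg; have := C1D oU Cf (C1Z (-1) oU Cg).
by apply: C1_open_ext => // p _ /=; rewrite mulN1r.
Qed.

Lemma is_derive_line f (z e : V) (t : R) : derivable f (z + t *: e) e ->
  is_derive t 1 (fun t => f (z + t *: e)) ('D_e f (z + t *: e)).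
Proof.
move=> df.
have E : (fun h : R => h^-1 *: (((fun t => f (z + t *: e)) \o shift t) (h *: (1 : R)) -
      f (z + t *: e))) = (fun h => h^-1 *: ((f \o shift (z + t *: e)) (h *: e) - f (z + t *: e))).
  by apply/funext => h /=; rewrite [_%:A]mulr1 scalerDl addrCA.
by split; [rewrite /derivable E|rewrite /derive E].
Qed.

Lemma MVT_line f (z e : V) (r : R) :
  (forall t, `|t| <= `|r| -> derivable f (z + t *: e) e) ->
  exists2 c, `|c| <= `|r| & f (z + r *: e) - f z = r * 'D_e f (z + c *: e).
Proof.
move=> df; pose h t := f (z + t *: e).
have dh (t : R) : `|t| <= `|r| -> is_derive t (1 : R) h ('D_e f (z + t *: e)).
  by move=> /df; exact: is_derive_line.
have ch (a b : R) : `|a| <= `|r| -> `|b| <= `|r| -> {within `[a, b], continuous h}.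
  move=> ha hb; apply: derivable_within_continuous => t; rewrite in_itv/= => /andP[at_ tb].
  by case: (dh t) => //; move: ha hb; rewrite !ler_norml => /andP[? ?] /andP[? ?]; lra.
have bd (a b t : R) : `|a| <= `|r| -> `|b| <= `|r| -> t \in `[a, b] -> `|t| <= `|r|.
  rewrite in_itv/= !ler_norml => /andP[? ?] /andP[? ?] /andP[? ?]; lra.
have r0 : `|0 : R| <= `|r| by rewrite normr0.
have bd' (a b t : R) : `|a| <= `|r| -> `|b| <= `|r| -> t \in `]a, b[ -> `|t| <= `|r|.
  by move=> ha hb tab; apply: (bd a b) => //; apply: subset_itv_oo_cc tab.
have [r0'|r0'] := leP 0 r.
- have [c cr] := @MVT_segment _ h (fun t => 'D_e f (z + t *: e)) 0 r r0'
    (fun t ht => dh t (bd' _ _ _ r0 (lexx _) ht)) (ch _ _ r0 (lexx _)).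
  rewrite /h scale0r addr0 subr0 mulrC => ->.
  by exists c => //; exact: bd cr.
- have [c cr] := @MVT_segment _ h (fun t => 'D_e f (z + t *: e)) r 0 (ltW r0')
    (fun t ht => dh t (bd' _ _ _ (lexx _) r0 ht)) (ch _ _ (lexx _) r0).
  rewrite /h scale0r addr0 sub0r => E.
  exists c; first exact: bd cr.
  by rewrite -opprB E; ring.
Qed.

End NormedCalculus.

(** * Differential calculus in the plane *)

Section PlaneCalculus.
Context {R : realType}.
Local Notation plane := (R * R)%type.
Implicit Types (p q v : plane) (f g : plane -> R).

Lemma normr_fst p : `|p.1| <= `|p|.
Proof. by rewrite prod_normE le_max lexx. Qed.

Lemma normr_snd p : `|p.2| <= `|p|.
Proof. by rewrite prod_normE le_max lexx orbT. Qed.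

Lemma norm_pair_le p (c : R) : `|p.1| <= c -> `|p.2| <= c -> `|p| <= c.
Proof. by move=> h1 h2; rewrite prod_normE ge_max h1. Qed.

Lemma norm_pair_lt p (c : R) : `|p.1| < c -> `|p.2| < c -> `|p| < c.
Proof. by move=> h1 h2; rewrite prod_normE gt_max h1. Qed.

Lemma near_planeP (P : plane -> Prop) p : (\forall q \near p, P q) <->
  exists2 d, 0 < d & forall x y, `|x - p.1| < d -> `|y - p.2| < d -> P (x, y).
Proof.
split=> [[[A B] /= [/nbhs_normP[d /= d0 dA] /nbhs_normP[e /= e0 eB]] AB]|[d d0 dP]].
- exists (Num.min d e) => [|x y]; first by rewrite lt_min d0.
  rewrite !lt_min => /andP[xd _] /andP[_ ye]; apply: AB; split.
    by apply: dA; rewrite /ball_/= distrC.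
  by apply: eB; rewrite /ball_/= distrC.
- exists (ball_ Num.norm p.1 d, ball_ Num.norm p.2 d) => /=.
    by split; apply/nbhs_normP; exists d.
  move=> [x y] [/= xd yd]; apply: dP; by rewrite distrC.
Qed.

Definition lform (a b : R) : plane -> R := fun h => h.1 * a + h.2 * b.

Lemma lform_is_linear a b : linear (lform a b).
Proof. by move=> k x y; rewrite /lform /= !mulrDl /= scalerDr -!scalerAl addrACA. Qed.

HB.instance Definition _ a b :=
  GRing.isLinear.Build R plane R _ (lform a b) (lform_is_linear a b).

Lemma continuous_fst : continuous (fst : plane -> R).
Proof. by move=> p; exact: cvg_fst. Qed.

Lemma continuous_snd : continuous (snd : plane -> R).
Proof. by move=> p; exact: cvg_snd. Qed.

Lemma lform_continuous a b : continuous (lform a b).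
Proof.
move=> p; apply: cvgD; apply: cvgM; try exact: cvg_cst.
- exact: continuous_fst.
- exact: continuous_snd.
Qed.

Lemma differentiable_grad f p (a b : R) :
  (forall eps, 0 < eps -> \forall q \near p,
     `|f q - f p - ((q.1 - p.1) * a + (q.2 - p.2) * b)| <= eps * `|q - p|) ->
  differentiable f p /\ forall v, 'D_v f p = v.1 * a + v.2 * b.
Proof.
move=> H.
have K eps : 0 < eps -> \forall h \near (0 : plane),
    `|(f \o shift p - (cst (f p) + lform a b)) h| <= eps * `|h|.
  move=> e0; have := H _ e0.
  rewrite (near_shift (0 : plane) p) subr0; apply: filterS => h.
  rewrite /= !addrK -/(lform a b h).
  have -> : f (h + p) - f p - lform a b h = f (h + p) - (f p + lform a b h) by ring.
  by [].
have D : 'd f p = lform a b :> (plane -> R).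
  apply: diff_unique; first exact: lform_continuous.
  by apply/eqaddoP => eps e0; exact: K.
have df : differentiable f p.
  apply/diff_locallyP; rewrite D; split; first exact: lform_continuous.
  by apply/eqaddoP => eps e0; exact: K.
by split => // v; rewrite deriveE// D.
Unshelve. all: by end_near. Qed.

Lemma linear_pairE (l : {linear plane -> R}) v : l v = v.1 * l e1 + v.2 * l e2.
Proof.
case: v => x y /=; have -> : (x, y) = x *: e1 + y *: e2 :> plane.
  by congr pair; rewrite /= ?mulr1 ?mulr0 ?addr0 ?add0r // /GRing.scale /= ?mulr1 ?mulr0 ?addr0 ?add0r.
by rewrite linearD !linearZ.
Qed.

Lemma derive_pairE f p v : differentiable f p ->
  'D_v f p = v.1 * 'D_e1 f p + v.2 * 'D_e2 f p.
Proof. by move=> df; rewrite !deriveE// linear_pairE. Qed.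

Lemma grad_differentiable f p : differentiable f p ->
  forall eps, 0 < eps -> \forall q \near p,
     `|f q - f p - ((q.1 - p.1) * 'D_e1 f p + (q.2 - p.2) * 'D_e2 f p)|
        <= eps * `|q - p|.
Proof.
move=> df eps e0; have /diff_locallyP[_ /eqaddoP/(_ _ e0)] := df.
rewrite [X in _ -> X](near_shift 0 p) subr0; apply: filterS => h /=.
rewrite !addrK -[h.1 * _ + _](derive_pairE h df) deriveE//.
rewrite -[X in `|X| <= _ -> _]/(f (h + p) - (f p + 'd f p h)).
by rewrite opprD addrA.
Qed.

Lemma differentiable_comp_pair (U : normedModType R) (X Y : U -> R) f (u : U) :
  differentiable X u -> differentiable Y u -> differentiable f (X u, Y u) ->
  differentiable (fun w => f (X w, Y w)) u /\
  forall v : U, 'D_v (fun w => f (X w, Y w)) u =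
    'D_v X u * 'D_e1 f (X u, Y u) + 'D_v Y u * 'D_e2 f (X u, Y u).
Proof.
move=> dX dY df; have dP := differentiable_pair dX dY.
have dC : differentiable (f \o (fun w => (X w, Y w))) u by exact: differentiable_comp.
split=> [//|v]; rewrite (@deriveE _ _ _ (f \o (fun w => (X w, Y w))))//.
by rewrite diff_comp//= diff_pair//= linear_pairE/= -!deriveE.
Qed.

Lemma pair_leg1 (x y r : R) : (x, y) + r *: e1 = (x + r, y) :> plane.
Proof. by congr pair; rewrite /= /GRing.scale /= ?mulr1 ?mulr0 ?addr0. Qed.

Lemma pair_leg2 (x y r : R) : (x, y) + r *: e2 = (x, y + r) :> plane.
Proof. by congr pair; rewrite /= /GRing.scale /= ?mulr1 ?mulr0 ?addr0. Qed.

(* mean value theorem along the two legs of the increment *)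
Lemma partials_differentiable (U : set plane) f p : open U -> U p ->
  (forall q, U q -> derivable f q e1) -> (forall q, U q -> derivable f q e2) ->
  {for p, continuous ('D_e1 f)} -> {for p, continuous ('D_e2 f)} ->
  differentiable f p.
Proof.
move=> oU Up d1 d2 c1 c2.
apply: (proj1 (@differentiable_grad f p ('D_e1 f p) ('D_e2 f p) _)) => eps e0.
have e20 : 0 < eps / 2 by rewrite divr_gt0.
have H1 : \forall q \near p, `|'D_e1 f p - 'D_e1 f q| <= eps / 2.
  exact: cvgr_dist_le c1 _ e20.
have H2 : \forall q \near p, `|'D_e2 f p - 'D_e2 f q| <= eps / 2.
  exact: cvgr_dist_le c2 _ e20.
have H3 : \forall q \near p, U q by apply: open_nbhs_nbhs.
have [d /= d0 B] := (near_planeP _ p).1 (filterI H3 (filterI H1 H2)).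
apply/near_planeP; exists d => //.
case: p Up c1 c2 H1 H2 H3 B => [x y] /= Up c1 c2 _ _ _ B x' y' dx dy.
have cU (r s : R) : `|r| <= `|x' - x| -> `|s| <= `|y' - y| ->
    [/\ U (x + r, y + s), `|'D_e1 f (x, y) - 'D_e1 f (x + r, y + s)| <= eps / 2 &
      `|'D_e2 f (x, y) - 'D_e2 f (x + r, y + s)| <= eps / 2].
  move=> hr hs; have [||u1 [u2 u3]] := B (x + r) (y + s); last (split; [exact: u1|exact: u2|exact: u3]).
    by rewrite addrAC subrr add0r (le_lt_trans hr).
  by rewrite addrAC subrr add0r (le_lt_trans hs).
have n0 (a : R) : `|0 : R| <= `|a| by rewrite normr0.
have [t|c hc Ec] := @MVT_line _ _ f (x, y) e1 (x' - x).
  move=> ht; apply: d1; rewrite pair_leg1 -[y]addr0.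
  by have [] := cU t 0 ht (n0 _).
have [t|c' hc' Ec'] := @MVT_line _ _ f (x', y) e2 (y' - y).
  move=> ht; apply: d2; rewrite pair_leg2 -[x'](subrKC x).
  by have [] := cU (x' - x) t (lexx _) ht.
move: Ec Ec'; rewrite !pair_leg1 !pair_leg2 !subrKC => Ec Ec'.
have [_ b1 _] := cU c 0 hc (n0 _).
have [_ _ b2] := cU (x' - x) c' (lexx _) hc'.
rewrite addr0 in b1; rewrite subrKC in b2.
have -> : f (x', y') - f (x, y) -
    ((x' - x) * 'D_e1 f (x, y) + (y' - y) * 'D_e2 f (x, y)) =
   - ((x' - x) * ('D_e1 f (x, y) - 'D_e1 f (x + c, y)) +
     (y' - y) * ('D_e2 f (x, y) - 'D_e2 f (x', y + c'))).
  have -> : f (x', y') - f (x, y) = (f (x', y') - f (x', y)) + (f (x', y) - f (x, y)).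
    by rewrite addrA subrK.
  by rewrite Ec Ec'; move: ('D__ f _) ('D__ f _) ('D__ f _) ('D__ f _) => *; ring.
rewrite normrN (le_trans (ler_normD _ _))// !normrM.
have [n1 n2] : `|x' - x| <= `|(x', y') - (x, y)| /\ `|y' - y| <= `|(x', y') - (x, y)|.
  by split; [exact: (normr_fst ((x', y') - (x, y)))|exact: (normr_snd ((x', y') - (x, y)))].
have := ler_pM (normr_ge0 _) (normr_ge0 _) n1 b1.
have := ler_pM (normr_ge0 _) (normr_ge0 _) n2 b2.
by lra.
Qed.

End PlaneCalculus.

(** * Line integrals *)

Section SegmentIntegral.
Context {R : realType}.
Local Notation mu := (@lebesgue_measure R).
Local Notation plane := (R * R)%type.

Lemma continuous_itv_within (a b : R) (k : R -> R) :
  (forall t, t \in `[a, b] -> {for t, continuous k}) -> {within `[a, b], continuous k}.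
Proof. by move=> ck; apply: continuous_in_subspaceT => t; rewrite inE => /ck. Qed.

Lemma continuous_itv_integrable (a b : R) (k : R -> R) :
  (forall t, t \in `[a, b] -> {for t, continuous k}) ->
  mu.-integrable `[a, b] (EFin \o k).
Proof.
move=> /continuous_itv_within ck.
by apply: continuous_compact_integrable => //; exact: segment_compact.
Qed.

Lemma eq_Rintegral_itv (a b : R) (k m : R -> R) :
  (forall t : R, t \in `[a, b] -> k t = m t) ->
  \int[mu]_(t in `[a, b]) k t = \int[mu]_(t in `[a, b]) m t.
Proof. by move=> km; apply: eq_Rintegral => t; rewrite inE => /km. Qed.

Lemma lebesgue_measure_segment (a b : R) : a <= b ->
  fine (mu `[a, b]%classic) = b - a.
Proof.
move=> ab; transitivity (fine (b - a)%:E) => //; congr fine.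
apply: etrans (lebesgue_measure_itv `[a, b]%R) _ => /=.
by rewrite lte_fin; case: ltgtP ab => //= -> _; rewrite subrr.
Qed.

Lemma FTC2_segment (a b : R) (W w : R -> R) : a <= b ->
  (forall t, t \in `[a, b] -> is_derive t 1 W (w t)) ->
  (forall t, t \in `[a, b] -> {for t, continuous w}) ->
  \int[mu]_(t in `[a, b]) w t = W b - W a.
Proof.
rewrite le_eqVlt => /orP[/eqP <- dW cw|ab dW cw].
  by rewrite subrr set_itv1 Rintegral_set1.
rewrite /Rintegral (@continuous_FTC2 _ w W)//.
- exact: continuous_itv_within.
- have cW t : t \in `[a, b] -> {for t, continuous W}.
    by move=> /dW[dWt _]; apply/differentiable_continuous/derivable1_diffP.
  split => [t /subset_itv_oo_cc/dW[]//||].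
    by apply: cvg_at_right_filter; apply: cW; rewrite in_itv/= lexx ltW.
  by apply: cvg_at_left_filter; apply: cW; rewrite in_itv/= lexx ltW.
- move=> t /subset_itv_oo_cc/dW[_]; by rewrite derive1E.
Qed.

Lemma primitive_segment (a b : R) (k : R -> R) : a <= b ->
  (forall t, t \in `[a, b] -> {for t, continuous k}) ->
  exists K, forall t, t \in `[a, b] -> is_derive t 1 K (k t).
Proof.
(* Clamping to [[a, b]] extends [k] continuously to the line; integrating from [a - 1] then gives a
   two-sided derivative at [a] and [b] as well. *)
move=> ab ck; pose c t := Num.max a (Num.min b t).
have cab t : c t \in `[a, b].
  by rewrite in_itv/= /c le_max lexx/= ge_max ab/= ge_min lexx.
have cE t : t \in `[a, b] -> c t = t.
  by rewrite in_itv/= /c => /andP[at_ tb]; rewrite (min_idPr tb) (max_idPr at_).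
have cc : continuous c.
  by move=> t; apply: continuous_max; [exact: cvg_cst|apply: continuous_min => //; exact: cvg_cst].
have ckc : continuous (k \o c).
  by move=> t; apply: continuous_comp; [exact: cc|exact: ck].
exists (fun x => \int[mu]_(t in `[a - 1, x]) (k \o c) t) => t tab.
have ab1 : a - 1 < t by move: tab; rewrite in_itv/= => /andP[? ?]; lra.
have := @continuous_FTC1_closed _ (k \o c) (a - 1) t (t + 1).
case=> //; first by rewrite ltrDl.
- by apply: continuous_itv_integrable => s _; exact: ckc.
- exact: ckc.
by move=> d1; rewrite derive1E /= cE// => <-; split.
Qed.

Lemma Rintegral_dist_le (a b e : R) (k m : R -> R) : a <= b ->
  (forall t, t \in `[a, b] -> {for t, continuous k}) ->
  (forall t, t \in `[a, b] -> {for t, continuous m}) ->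
  (forall t, t \in `[a, b] -> `|k t - m t| <= e) ->
  `|\int[mu]_(t in `[a, b]) k t - \int[mu]_(t in `[a, b]) m t| <= e * (b - a).
Proof.
move=> ab ck cm km; rewrite -RintegralB//; [|exact: continuous_itv_integrable..].
have ckm t : t \in `[a, b] -> {for t, continuous (fun t => k t - m t)}.
  by move=> tab; apply: cvgB; [exact: ck|exact: cm].
apply: (le_trans (le_normr_Rintegral _ _)) => //; first exact: continuous_itv_integrable.
have <- : \int[mu]_(t in `[a, b]) (cst e t) = e * (b - a).
  by rewrite Rintegral_cst// lebesgue_measure_segment.
apply: le_Rintegral => //.
- apply: continuous_itv_integrable => t /ckm /cvg_norm; exact.
- by apply: continuous_itv_integrable => t _; exact: cvg_cst.
Qed.

End SegmentIntegral.

Section LineIntegral.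
Context {R : realType}.
Local Notation mu := (@lebesgue_measure R).
Local Notation plane := (R * R)%type.
Implicit Types (p q d : plane) (f g : plane -> R).

(** The one-form [f dg] pulled back to the segment from [p] to [p + d]. *)
Definition line_integrand f g p d (t : R) : R :=
  f (p + t *: d) * 'D_d g (p + t *: d).

Definition line_integral f g p d : R :=
  \int[mu]_(t in `[0, 1]) line_integrand f g p d t.

Lemma line_continuous p d : continuous (fun t : R => p + t *: d).
Proof. by move=> t; apply: cvgD; [exact: cvg_cst|apply: cvgZr_tmp; exact: cvg_id]. Qed.

Definition in_seg (U : set plane) p d := forall t : R, t \in `[0, 1] -> U (p + t *: d).

Lemma line_integrand_continuous (U : set plane) f g p d :
  C1 U f -> C1 U g -> in_seg U p d ->
  forall t, t \in `[0, 1] -> {for t, continuous (line_integrand f g p d)}.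
Proof.
move=> Cf Cg sU t t01; have Up := sU _ t01.
have [df _] := Cf _ Up; have [_ dg] := Cg _ Up.
apply: cvgM.
  apply: (@continuous_comp _ _ _ (fun t : R => p + t *: d) f); first exact: line_continuous.
  exact: differentiable_continuous.
apply: (@continuous_comp _ _ _ (fun t : R => p + t *: d) ('D_d g)); first exact: line_continuous.
exact: dg.
Qed.

(** A primitive of the integrand turns the whole and both halves into differences of its values, so
    no substitution in integrals is required. *)
Lemma line_integral_split (U : set plane) f g p d :
  C1 U f -> C1 U g -> in_seg U p d ->
  line_integral f g p d = line_integral f g p (2^-1 *: d) +
    line_integral f g (p + 2^-1 *: d) (2^-1 *: d).
Proof.
move=> Cf Cg sU; have ck := line_integrand_continuous Cf Cg sU.
have [K dK] := primitive_segment ler01 ck.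
have dg (t : R) : t \in `[0, 1] -> differentiable g (p + t *: d) by move=> /sU /Cg[].
have hD q : differentiable g q -> 'D_(2^-1 *: d) g q = 2^-1 * 'D_d g q.
  by move=> dgq; rewrite !deriveE// linearZ.
rewrite /line_integral (FTC2_segment ler01 dK ck).
have h1 (t : R) : t \in `[0, 1] -> t / 2 \in `[0, 1] :> Prop.
  by rewrite !in_itv/= => /andP[? ?]; apply/andP; split; lra.
have h2 (t : R) : t \in `[0, 1] -> 2^-1 + t / 2 \in `[0, 1] :> Prop.
  by rewrite !in_itv/= => /andP[? ?]; apply/andP; split; lra.
have E1 (t : R) : t \in `[0, 1] -> line_integrand f g p (2^-1 *: d) t =
    line_integrand f g p d (t / 2) * 2^-1.
  move=> t01; rewrite /line_integrand scalerA hD; last exact/dg/h1.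
  by rewrite mulrCA [in RHS]mulrC.
have E2 (t : R) : t \in `[0, 1] -> line_integrand f g (p + 2^-1 *: d) (2^-1 *: d) t =
    line_integrand f g p d (2^-1 + t / 2) * 2^-1.
  move=> t01; rewrite /line_integrand scalerA -addrA -scalerDl hD; last exact/dg/h2.
  by rewrite mulrCA [in RHS]mulrC.
rewrite (eq_Rintegral_itv E1) (eq_Rintegral_itv E2).
have l1 : continuous (fun t : R => t / 2).
  by move=> t; apply: cvgM; [exact: cvg_id|exact: cvg_cst].
have l2 : continuous (fun t : R => 2^-1 + t / 2).
  by move=> t; apply: cvgD; [exact: cvg_cst|exact: l1].
have dK1 (t : R) : t \in `[0, 1] -> is_derive t (1 : R) (fun t : R => K (t / 2))
    (line_integrand f g p d (t / 2) / 2).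
  move=> /h1 /dK dKt; apply: (@is_derive1_comp _ K (fun t : R => t / 2) t _ 2^-1 dKt).
  by apply: is_derive_eq; rewrite /GRing.scale /=; ring.
have dK2 (t : R) : t \in `[0, 1] -> is_derive t (1 : R) (fun t : R => K (2^-1 + t / 2))
    (line_integrand f g p d (2^-1 + t / 2) / 2).
  move=> /h2 /dK dKt; apply: (@is_derive1_comp _ K (fun t : R => 2^-1 + t / 2) t _ 2^-1 dKt).
  by apply: is_derive_eq; rewrite /GRing.scale /=; ring.
rewrite (FTC2_segment ler01 dK1); last first.
  move=> t /h1 /ck c; apply: cvgM; last exact: cvg_cst.
  by apply: (@continuous_comp _ _ _ (fun t : R => t / 2) (line_integrand f g p d)); [exact: l1|exact: c].
rewrite (FTC2_segment ler01 dK2); last first.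
  move=> t /h2 /ck c; apply: cvgM; last exact: cvg_cst.
  by apply: (@continuous_comp _ _ _ (fun t : R => 2^-1 + t / 2) (line_integrand f g p d)); [exact: l2|exact: c].
have -> : 2^-1 + 1 / 2 = 1 :> R by lra.
by rewrite !mul0r addr0 mul1r; ring.
Qed.

Lemma line_integral_rev (U : set plane) f g p d :
  C1 U f -> C1 U g -> in_seg U p d ->
  line_integral f g (p + d) (- d) = - line_integral f g p d.
Proof.
move=> Cf Cg sU; have ck := line_integrand_continuous Cf Cg sU.
have [K dK] := primitive_segment ler01 ck.
rewrite /line_integral (FTC2_segment ler01 dK ck).
have h1 (t : R) : t \in `[0, 1] -> 1 - t \in `[0, 1] :> Prop.
  by rewrite !in_itv/= => /andP[? ?]; apply/andP; split; lra.
have E1 (t : R) : t \in `[0, 1] -> line_integrand f g (p + d) (- d) t =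
    line_integrand f g p d (1 - t) * (- 1).
  move=> t01; rewrite /line_integrand.
  have -> : p + d + t *: - d = p + (1 - t) *: d.
    by rewrite scalerBl scale1r scalerN addrA.
  have [dg _] := Cg _ (sU _ (h1 _ t01)).
  by rewrite !deriveE// linearN mulrN1 mulrN.
rewrite (eq_Rintegral_itv E1).
have l1 : continuous (fun t : R => 1 - t).
  by move=> t; apply: cvgB; [exact: cvg_cst|exact: cvg_id].
have dK1 (t : R) : t \in `[0, 1] -> is_derive t (1 : R) (fun t : R => K (1 - t))
    (line_integrand f g p d (1 - t) * - 1).
  move=> /h1 /dK dKt; apply: (@is_derive1_comp _ K (fun t : R => 1 - t) t _ (- 1) dKt).
  by apply: is_derive_eq; ring.
rewrite (FTC2_segment ler01 dK1); last first.
  move=> t /h1 /ck c; apply: cvgM; last exact: cvg_cst.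
  by apply: (@continuous_comp _ _ _ (fun t : R => 1 - t) (line_integrand f g p d)); [exact: l1|exact: c].
by rewrite subrr subr0 opprB.
Qed.

Lemma line_integral_cst (U : set plane) g p d : C1 U g -> in_seg U p d ->
  line_integral (cst 1) g p d = g (p + d) - g p.
Proof.
move=> Cg sU.
have dg (t : R) : t \in `[0, 1] -> is_derive t (1 : R) (fun t : R => g (p + t *: d))
    (line_integrand (cst 1) g p d t).
  move=> /sU /Cg[dg _]; rewrite /line_integrand mul1r.
  by apply: is_derive_line; exact: diff_derivable.
rewrite /line_integral (FTC2_segment ler01 dg) ?scale1r ?scale0r ?addr0//.
by apply: (@line_integrand_continuous U) => //; exact: C1_cst.
Qed.

Lemma line_integralB (U : set plane) f1 f2 g p d :
  C1 U f1 -> C1 U f2 -> C1 U g -> in_seg U p d ->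
  line_integral (f1 \- f2) g p d = line_integral f1 g p d - line_integral f2 g p d.
Proof.
move=> C1f C2f Cg sU; rewrite -RintegralB//.
- by apply: eq_Rintegral => t _; rewrite /line_integrand /= mulrBl.
- apply: continuous_itv_integrable; exact: (line_integrand_continuous C1f Cg sU).
- apply: continuous_itv_integrable; exact: (line_integrand_continuous C2f Cg sU).
Qed.

Lemma line_integralZ (U : set plane) (c : R) f g p d :
  C1 U f -> C1 U g -> in_seg U p d ->
  line_integral (fun q => c * f q) g p d = c * line_integral f g p d.
Proof.
move=> Cf Cg sU; rewrite -RintegralZl//.
- by apply: eq_Rintegral => t _; rewrite /line_integrand mulrA.
- apply: continuous_itv_integrable; exact: (line_integrand_continuous Cf Cg sU).
Qed.

End LineIntegral.

(** * The Goursat argument on triangles *)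

Section Triangles.
Context {R : realType}.
Local Notation mu := (@lebesgue_measure R).
Local Notation plane := (R * R)%type.
Implicit Types (p q d z w : plane) (f g : plane -> R).

Lemma plane_eq p q : p.1 = q.1 -> p.2 = q.2 -> p = q.
Proof. by case: p q => [a b] [c d] /= -> ->. Qed.

Definition std_triangle : set plane :=
  [set z | [/\ 0 <= z.1, 0 <= z.2 & z.1 + z.2 <= 1]].

Local Notation T0 := std_triangle.

(** Negative [r] is allowed: the middle one of the four half-size triangles is a point reflection of
    the others. *)
Definition tri q (r : R) : set plane := [set q + r *: z | z in T0].

Lemma std_triangle_convex z w (t : R) : T0 z -> T0 w -> t \in `[0, 1] ->
  T0 (z + t *: (w - z)).
Proof.
case: z w => [z1 z2] [w1 w2]; rewrite /T0 /= /GRing.scale /= in_itv/=.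
move=> [? ? ?] [? ? ?] /andP[? ?]; split; nra.
Qed.

Lemma std_triangle0 : T0 0. Proof. by rewrite /T0 /=; split; lra. Qed.
Lemma std_triangle_e1 : T0 e1. Proof. by rewrite /T0 /=; split; lra. Qed.
Lemma std_triangle_e2 : T0 e2. Proof. by rewrite /T0 /=; split; lra. Qed.

Lemma in_seg_tri q r z w : T0 z -> T0 w ->
  in_seg (tri q r) (q + r *: z) (r *: (w - z)).
Proof.
move=> Tz Tw t t01; exists (z + t *: (w - z)); first exact: std_triangle_convex.
by rewrite scalerDr -addrA !scalerA (mulrC t).
Qed.

(** Circulation of [f dg] around [tri q r]. A point reflection preserves orientation, so the path is
    counterclockwise for either sign of [r]. *)
Definition tri_integral f g q r : R :=
  line_integral f g q (r *: e1) +
  line_integral f g (q + r *: e1) (r *: (e2 - e1)) +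
  line_integral f g (q + r *: e2) (- (r *: e2)).

Lemma in_seg_tri_edges (U : set plane) q r : tri q r `<=` U ->
  [/\ in_seg U q (r *: e1), in_seg U (q + r *: e1) (r *: (e2 - e1)) &
      in_seg U (q + r *: e2) (- (r *: e2))].
Proof.
move=> tU; split => t t01; apply: tU.
- by have := @in_seg_tri q r _ _ std_triangle0 std_triangle_e1 _ t01;
    rewrite scaler0 addr0 subr0.
- exact: in_seg_tri std_triangle_e1 std_triangle_e2 _ t01.
- by have := @in_seg_tri q r _ _ std_triangle_e2 std_triangle0 _ t01;
    rewrite sub0r scalerN.
Qed.

(** Each of the three inner segments is run twice, in opposite directions, and cancels; the outer
    edges are halved. *)
Lemma tri_integral_split (U : set plane) f g q r :
  C1 U f -> C1 U g -> tri q r `<=` U ->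
  tri_integral f g q r =
    tri_integral f g q (r / 2) + tri_integral f g (q + (r / 2) *: e1) (r / 2) +
    tri_integral f g (q + (r / 2) *: e2) (r / 2) +
    tri_integral f g (q + (r / 2) *: e1 + (r / 2) *: e2) (- (r / 2)).
Proof.
move=> Cf Cg tU; have [s1 s2 s3] := in_seg_tri_edges tU.
have hT1 : T0 (2^-1 *: e1) by rewrite /T0 /= /GRing.scale /=; split; lra.
have hT2 : T0 (2^-1 *: e2) by rewrite /T0 /= /GRing.scale /=; split; lra.
have hT3 : T0 (2^-1 *: e1 + 2^-1 *: e2) by rewrite /T0 /= /GRing.scale /=; split; lra.
have s4 : in_seg U (q + (r / 2) *: e1) ((r / 2) *: (e2 - e1)).
  move=> t t01; apply: tU; have := @in_seg_tri q r _ _ hT1 hT2 _ t01.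
  by congr tri; apply: plane_eq; rewrite /= /GRing.scale /=; field.
have s5 : in_seg U (q + (r / 2) *: e2) ((r / 2) *: e1).
  move=> t t01; apply: tU; have := @in_seg_tri q r _ _ hT2 hT3 _ t01.
  by congr tri; apply: plane_eq; rewrite /= /GRing.scale /=; field.
have s6 : in_seg U (q + (r / 2) *: e1) ((r / 2) *: e2).
  move=> t t01; apply: tU; have := @in_seg_tri q r _ _ hT1 hT3 _ t01.
  by congr tri; apply: plane_eq; rewrite /= /GRing.scale /=; field.
rewrite /tri_integral (line_integral_split Cf Cg s1) (line_integral_split Cf Cg s2).
rewrite (line_integral_split Cf Cg s3).
have rh : 2^-1 * r = r / 2 by rewrite mulrC.
rewrite !scalerN !scalerA !rh.
have rr : r / 2 + r / 2 = r by lra.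
have -> : q + (r / 2) *: e1 + (r / 2) *: e1 = q + r *: e1.
  by rewrite -addrA -scalerDl rr.
have -> : q + (r / 2) *: e2 + (r / 2) *: e2 = q + r *: e2.
  by rewrite -addrA -scalerDl rr.
have -> : q + r *: e1 + (r / 2) *: (e2 - e1) = q + (r / 2) *: e2 + (r / 2) *: e1.
  by rewrite -{1}rr; apply: plane_eq; rewrite /= /GRing.scale /=; ring.
have -> : q + r *: e2 - (r / 2) *: e2 = q + (r / 2) *: e2.
  by rewrite -{1}rr; apply: plane_eq; rewrite /= /GRing.scale /=; ring.
have -> : q + (r / 2) *: e1 + (r / 2) *: e2 + - (r / 2) *: e1 = q + (r / 2) *: e2.
  by apply: plane_eq; rewrite /= /GRing.scale /=; ring.
have -> : q + (r / 2) *: e1 + (r / 2) *: e2 + - (r / 2) *: e2 = q + (r / 2) *: e1.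
  by apply: plane_eq; rewrite /= /GRing.scale /=; ring.
rewrite !scaleNr !opprK.
have L4 := line_integral_rev Cf Cg s4.
have L5 := line_integral_rev Cf Cg s5.
have L6 := line_integral_rev Cf Cg s6.
move: L4 L5 L6.
have -> : q + (r / 2) *: e1 + (r / 2) *: (e2 - e1) = q + (r / 2) *: e2.
  by apply: plane_eq; rewrite /= /GRing.scale /=; ring.
have -> : q + (r / 2) *: e2 + (r / 2) *: e1 = q + (r / 2) *: e1 + (r / 2) *: e2.
  by apply: plane_eq; rewrite /= /GRing.scale /=; ring.
move: (line_integral f g) => J -> -> ->.
by do 20?[match goal with |- context [J ?a ?b] => move: (J a b) => ? end]; ring.
Qed.

Lemma Rintegral_affine (a b : R) : \int[mu]_(t in `[0, 1]) (a + t * b) = a + b / 2.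
Proof.
have dW (t : R) : t \in `[0, 1] -> is_derive t (1 : R)
    (fun t : R => t * a + (t * t) * (b / 2)) (a + t * b).
  move=> _; apply: is_derive_eq.
  by rewrite /GRing.scale /=; lra.
rewrite (FTC2_segment ler01 dW); first by lra.
move=> t _; apply: cvgD; [exact: cvg_cst|].
by apply: cvgM; [exact: cvg_id|exact: cvg_cst].
Qed.

Lemma tri_dist q r p w : tri q r p -> tri q r w ->
  `|w.1 - p.1| <= `|r| /\ `|w.2 - p.2| <= `|r|.
Proof.
move=> [[z1 z2] + <-] [[w1 w2] + <-]; rewrite /T0 /= /GRing.scale /=.
move=> [? ? ?] [? ? ?].
rewrite (_ : q.1 + r * w1 - (q.1 + r * z1) = r * (w1 - z1)); last by ring.
rewrite (_ : q.2 + r * w2 - (q.2 + r * z2) = r * (w2 - z2)); last by ring.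
by rewrite !normrM !ler_piMr// ler_norml; apply/andP; split; lra.
Qed.

(** The error of replacing [f - f p] by its linear part and [dg] by its value at [p]. The two
    replacements cost [(A + 2 eps) eps r^2] and [2 A eps r^2]; [eps <= 1] absorbs the square of
    [eps]. *)
Lemma bilinear_form_bound (A eps r fy y1 y2 a1 a2 d1 d2 G1 G2 b1 b2 : R) :
  0 <= eps <= 1 -> `|a1| + `|a2| <= A -> `|b1| + `|b2| <= A ->
  `|d1| <= r -> `|d2| <= r -> `|y1| <= r -> `|y2| <= r ->
  `|fy - (y1 * a1 + y2 * a2)| <= eps * r ->
  `|G1 - b1| <= eps -> `|G2 - b2| <= eps ->
  `|fy * (d1 * G1 + d2 * G2) - (y1 * a1 + y2 * a2) * (d1 * b1 + d2 * b2)|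
    <= (3 * A + 2) * eps * r ^+ 2.
Proof.
move=> /andP[e0 e1'] Af Ag hd1 hd2 hy1 hy2.
set L := y1 * a1 + y2 * a2 => hf hg1 hg2.
have -> : fy * (d1 * G1 + d2 * G2) - L * (d1 * b1 + d2 * b2) =
   (fy - L) * (d1 * G1 + d2 * G2) + L * (d1 * (G1 - b1) + d2 * (G2 - b2)) by ring.
have r0 : 0 <= r by exact: le_trans hd1.
have A0 : 0 <= A by apply: le_trans Af; rewrite addr_ge0.
have nL : `|L| <= r * A.
  apply: (le_trans (ler_normD _ _)); rewrite !normrM.
  apply: (@le_trans _ _ (r * `|a1| + r * `|a2|)).
    by rewrite lerD// ler_wpM2r.
  by rewrite -mulrDr ler_wpM2l.
have nG : `|d1 * G1 + d2 * G2| <= r * (A + 2 * eps).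
  apply: (le_trans (ler_normD _ _)); rewrite !normrM.
  apply: (@le_trans _ _ (r * (`|b1| + eps) + r * (`|b2| + eps))); last first.
    by rewrite -mulrDr ler_wpM2l//; lra.
  rewrite lerD// ler_pM//.
    by rewrite -[X in `|X|](subrK b1) (le_trans (ler_normD _ _))// addrC lerD2l.
  by rewrite -[X in `|X|](subrK b2) (le_trans (ler_normD _ _))// addrC lerD2l.
have nE : `|d1 * (G1 - b1) + d2 * (G2 - b2)| <= r * (2 * eps).
  apply: (le_trans (ler_normD _ _)); rewrite !normrM.
  apply: (@le_trans _ _ (r * eps + r * eps)); last by lra.
  by rewrite lerD// ler_pM.
apply: (le_trans (ler_normD _ _)); rewrite !normrM.
apply: (@le_trans _ _ (eps * r * (r * (A + 2 * eps)) + r * A * (r * (2 * eps)))).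
  by rewrite lerD// ler_pM.
have : eps * eps <= eps by rewrite ler_piMl.
have := sqr_ge0 r; rewrite expr2; nra.
Qed.

(** With both factors linearized the integrand is affine in [t], so its integral is the value at the
    midpoint of the segment. *)
Lemma line_integral_local (U : set plane) f g p (A eps : R) P d (r : R) :
  open U -> C1 U f -> C1 U g -> 0 <= eps <= 1 ->
  `|'D_e1 f p| + `|'D_e2 f p| <= A -> `|'D_e1 g p| + `|'D_e2 g p| <= A ->
  `|d.1| <= r -> `|d.2| <= r -> in_seg U P d ->
  (forall t : R, t \in `[0, 1] -> let y := P + t *: d in
    [/\ `|y.1 - p.1| <= r /\ `|y.2 - p.2| <= r,
     `|f y - f p - ((y.1 - p.1) * 'D_e1 f p + (y.2 - p.2) * 'D_e2 f p)| <= eps * r,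
     `|'D_e1 g y - 'D_e1 g p| <= eps & `|'D_e2 g y - 'D_e2 g p| <= eps]) ->
  `|line_integral (f \- cst (f p)) g P d -
    ((P.1 - p.1 + d.1 / 2) * 'D_e1 f p + (P.2 - p.2 + d.2 / 2) * 'D_e2 f p) *
    (d.1 * 'D_e1 g p + d.2 * 'D_e2 g p)| <= (3 * A + 2) * eps * r ^+ 2.
Proof.
move=> oU Cf Cg e01 Af Ag d1 d2 sU H.
set a1 := 'D_e1 f p in Af H *; set a2 := 'D_e2 f p in Af H *.
set b1 := 'D_e1 g p in Ag H *; set b2 := 'D_e2 g p in Ag H *.
pose D := d.1 * b1 + d.2 * b2.
pose m (t : R) := (((P.1 - p.1) * a1 + (P.2 - p.2) * a2) * D) + t * ((d.1 * a1 + d.2 * a2) * D).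
have -> : ((P.1 - p.1 + d.1 / 2) * a1 + (P.2 - p.2 + d.2 / 2) * a2) * (d.1 * b1 + d.2 * b2)
   = \int[mu]_(t in `[0, 1]) m t by rewrite Rintegral_affine /D; field.
rewrite -[leRHS]mulr1 -[X in _ <= _ * X](subr0 (1 : R)).
have ct : C1 U (cst (f p)) by exact: C1_cst.
apply: Rintegral_dist_le => //.
- have CB := C1B oU Cf ct; move=> t t01; exact: (line_integrand_continuous CB Cg sU t01).
- move=> t _; apply: cvgD; [exact: cvg_cst|].
  by apply: cvgM; [exact: cvg_id|exact: cvg_cst].
move=> t t01; have [[y1 y2] hf hg1 hg2] := H t t01.
have [dg _] := Cg _ (sU t t01).
rewrite /line_integrand (derive_pairE d dg) [(_ \- _) _]/=.
have -> : m t = (((P + t *: d).1 - p.1) * a1 + ((P + t *: d).2 - p.2) * a2) * D.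
  by rewrite /m /= /GRing.scale /=; ring.
exact: bilinear_form_bound hf hg1 hg2.
Qed.

(** Infinitesimal Green formula. Since [dg] integrates to zero around a closed path, [f] may be
    replaced by [f - f p], which is small on the triangle; the linear parts then give the Jacobian
    times the area. *)
Lemma tri_integral_local (U : set plane) f g p : open U -> U p -> C1 U f -> C1 U g ->
  forall eps, 0 < eps -> exists2 delta, 0 < delta &
    forall q r, tri q r p -> `|r| < delta ->
      `|tri_integral f g q r -
        r ^+ 2 / 2 * ('D_e1 f p * 'D_e2 g p - 'D_e2 f p * 'D_e1 g p)| <= eps * r ^+ 2.
Proof.
move=> oU Up Cf Cg eps e0.
pose A := `|'D_e1 f p| + `|'D_e2 f p| + `|'D_e1 g p| + `|'D_e2 g p|.
have A0 : 0 <= A by rewrite /A !addr_ge0.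
(* Each of the three edges will contribute an error of at most [(3 * A + 2) * e * r ^+ 2]. *)
pose e := Num.min 1 (eps / (3 * (3 * A + 2))).
have c0 : 0 < 3 * (3 * A + 2) by lra.
have ee : 0 < e by rewrite /e lt_min ltr01/= divr_gt0.
have e_le1 : e <= 1 by rewrite /e ge_min lexx.
have e_eps : 3 * (3 * A + 2) * e <= eps.
  by rewrite mulrC -ler_pdivlMr// /e ge_min lexx orbT.
have [dfp _] := Cf _ Up; have [dgp cg] := Cg _ Up.
have H1 := grad_differentiable dfp ee.
have H2 : \forall q \near p, `|'D_e1 g p - 'D_e1 g q| <= e.
  exact: cvgr_dist_le (cg e1) _ ee.
have H3 : \forall q \near p, `|'D_e2 g p - 'D_e2 g q| <= e.
  exact: cvgr_dist_le (cg e2) _ ee.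
have H4 : \forall q \near p, U q by apply: open_nbhs_nbhs.
have [delta delta0 B] := (near_planeP _ p).1 (filterI H4 (filterI H1 (filterI H2 H3))).
exists delta => // q r tp rd.
have tB w : tri q r w -> [/\ U w, `|w.1 - p.1| <= `|r| /\ `|w.2 - p.2| <= `|r|,
     `|f w - f p - ((w.1 - p.1) * 'D_e1 f p + (w.2 - p.2) * 'D_e2 f p)| <= e * `|r| &
     `|'D_e1 g w - 'D_e1 g p| <= e /\ `|'D_e2 g w - 'D_e2 g p| <= e].
  move=> tw; have [w1 w2] := tri_dist tp tw.
  have [Uw [h1 [h2 h3]]] := B w.1 w.2 (le_lt_trans w1 rd) (le_lt_trans w2 rd).
  move: w tw w1 w2 Uw h1 h2 h3 => [w1 w2] /= tw n1 n2 Uw h1 h2 h3.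
  split; [exact: Uw|by split| |by split; rewrite distrC; [exact: h2|exact: h3]].
  apply: (le_trans h1); rewrite ler_wpM2l ?(ltW ee)//.
  exact: norm_pair_le.
have tU : tri q r `<=` U by move=> w /tB[].
have [s1 s2 s3] := in_seg_tri_edges tU.
have [t1 t2 t3] := in_seg_tri_edges (@subset_refl _ (tri q r)).
have cI : C1 U (cst 1 : plane -> R) by exact: C1_cst.
have cS : C1 U (fun w => f p * (cst 1 : plane -> R) w) by exact: C1Z.
have Z P d : in_seg U P d ->
    line_integral (f \- cst (f p)) g P d = line_integral f g P d - f p * (g (P + d) - g P).
  move=> sU; have -> : f \- cst (f p) = f \- (fun w => f p * (cst 1 : plane -> R) w).
    by apply/funext => w /=; rewrite mulr1.
  rewrite (line_integralB Cf cS Cg sU) (line_integralZ _ cI Cg sU).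
  by rewrite (line_integral_cst Cg sU).
have E : tri_integral f g q r = tri_integral (f \- cst (f p)) g q r.
  rewrite /tri_integral (Z _ _ s1) (Z _ _ s2) (Z _ _ s3).
  have -> : q + r *: e1 + r *: (e2 - e1) = q + r *: e2.
    by apply: plane_eq; rewrite /= /GRing.scale /=; ring.
  rewrite addrK.
  move: (line_integral _ _ q _) (line_integral _ _ _ (r *: (e2 - e1))) => I1 I2.
  move: (line_integral _ _ _ (- _)) (g q) (g (q + r *: e1)) (g (q + r *: e2)) => I3 g1 g2 g3.
  by move: (f p) => fp; ring.
have loc P d : `|d.1| <= `|r| -> `|d.2| <= `|r| -> in_seg (tri q r) P d ->
  `|line_integral (f \- cst (f p)) g P d -
    ((P.1 - p.1 + d.1 / 2) * 'D_e1 f p + (P.2 - p.2 + d.2 / 2) * 'D_e2 f p) *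
    (d.1 * 'D_e1 g p + d.2 * 'D_e2 g p)| <= (3 * A + 2) * e * r ^+ 2.
  move=> d1 d2 sT; rewrite -[r ^+ 2]real_normK ?num_real//.
  apply: (line_integral_local oU Cf Cg) => //.
  - by rewrite (ltW ee).
  - by rewrite /A -addrA lerDl addr_ge0.
  - by rewrite /A -addrA lerDr addr_ge0.
  - by move=> t /sT /tU.
  - by move=> t /sT /tB[_ w1 w2 [w3 w4]]; split; [exact: w1|exact: w2|exact: w3|exact: w4].
have nr1 (c : R) : `|c| <= 1 -> `|r * c| <= `|r|.
  by move=> c1; rewrite normrM ler_piMr.
have n0 : `|0 : R| <= 1 by rewrite normr0.
have n1 : `|1 : R| <= 1 by rewrite normr1.
have l1 := loc q (r *: e1) (nr1 1 n1) (nr1 0 n0) t1.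
have nT (c : R) : c = -1 \/ c = 0 \/ c = 1 -> `|c| <= 1.
  by case=> [->|[->|->]]; rewrite ?normrN ?normr0 ?normr1.
have nrN (c : R) : `|c| <= 1 -> `|- (r * c)| <= `|r| by move=> /nr1; rewrite normrN.
have c1 : (0 : R) - 1 = -1 by rewrite sub0r.
have c2 : (1 : R) - 0 = 1 by rewrite subr0.
have m1 : `|(r *: (e2 - e1) : plane).1| <= `|r|.
  by rewrite /= /GRing.scale /=; apply: nr1; apply: nT; rewrite c1; tauto.
have m2 : `|(r *: (e2 - e1) : plane).2| <= `|r|.
  by rewrite /= /GRing.scale /=; apply: nr1; apply: nT; rewrite c2; tauto.
have m3 : `|(- (r *: e2) : plane).1| <= `|r|.
  by rewrite /= /GRing.scale /=; apply: nrN; apply: nT; tauto.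
have m4 : `|(- (r *: e2) : plane).2| <= `|r|.
  by rewrite /= /GRing.scale /=; apply: nrN; apply: nT; tauto.
have l2 := loc _ _ m1 m2 t2.
have l3 := loc _ _ m3 m4 t3.
rewrite E /tri_integral.
move: l1 l2 l3.
set I1 := line_integral _ _ q _; set I2 := line_integral _ _ _ (r *: (e2 - e1)).
set I3 := line_integral _ _ _ (- _).
set M1 := (X in `|I1 - X|); set M2 := (X in `|I2 - X|); set M3 := (X in `|I3 - X|).
move=> h1 h2 h3.
have -> : r ^+ 2 / 2 * ('D_e1 f p * 'D_e2 g p - 'D_e2 f p * 'D_e1 g p) = M1 + M2 + M3.
  rewrite /M1 /M2 /M3 /= /GRing.scale /=.
  by move: ('D__ f p) ('D__ f p) ('D__ g p) ('D__ g p) => *; field.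
have -> : I1 + I2 + I3 - (M1 + M2 + M3) = (I1 - M1) + (I2 - M2) + (I3 - M3) by ring.
apply: (le_trans (ler_normD _ _)); apply: (le_trans (lerD (ler_normD _ _) (lexx _))).
apply: (@le_trans _ _ (3 * (3 * A + 2) * e * r ^+ 2)); last first.
  by rewrite ler_wpM2r ?sqr_ge0.
rewrite (_ : 3 * (3 * A + 2) * e * r ^+ 2 = (3 * A + 2) * e * r ^+ 2 +
   (3 * A + 2) * e * r ^+ 2 + (3 * A + 2) * e * r ^+ 2); last by ring.
by apply: lerD => //; apply: lerD.
Qed.

Lemma std_triangle_compact : compact T0.
Proof.
have cS : compact (`[0, 1]%classic `*` `[0, 1]%classic : set plane).
  by apply: compact_setX; exact: segment_compact.
apply: (subclosed_compact _ cS).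
- have -> : T0 = (fst @^-1` [set x : R | 0 <= x]) `&` (snd @^-1` [set x : R | 0 <= x]) `&`
      ((fun z : plane => z.1 + z.2) @^-1` [set x : R | x <= 1]).
    by apply/seteqP; split=> z; rewrite /T0 /=; [case|case=> -[]].
  have cD : continuous (fun z : plane => z.1 + z.2).
    by move=> z; apply: cvgD; [exact: continuous_fst|exact: continuous_snd].
  apply: closedI; first apply: closedI.
  + exact: (continuous_closedP _).1 continuous_fst _ (@closed_ge R 0).
  + exact: (continuous_closedP _).1 continuous_snd _ (@closed_ge R 0).
  + exact: (continuous_closedP _).1 cD _ (@closed_le R 1).
- by move=> [x y] [/= ? ? ?]; split; rewrite /= in_itv/=; apply/andP; split; lra.
Qed.

Lemma plane_affine_continuous q (r : R) : continuous (fun z : plane => q + r *: z).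
Proof. by move=> z; apply: cvgD; [exact: cvg_cst|exact: scaler_continuous]. Qed.

Lemma tri_compact q r : compact (tri q r).
Proof.
apply: continuous_compact; last exact: std_triangle_compact.
apply: continuous_subspaceT; exact: plane_affine_continuous.
Qed.

Lemma plane_hausdorff : hausdorff_space plane.
Proof. exact: norm_hausdorff. Qed.

Lemma tri_closed q r : closed (tri q r).
Proof. apply: compact_closed; [exact: plane_hausdorff|exact: tri_compact]. Qed.

Lemma tri_sub1 q r : tri q (r / 2) `<=` tri q r.
Proof.
move=> _ [z [? ? ?] <-]; exists (2^-1 *: z); last by rewrite scalerA.
by rewrite /T0 /= /GRing.scale /=; split; lra.
Qed.

Lemma tri_sub2 q r : tri (q + (r / 2) *: e1) (r / 2) `<=` tri q r.
Proof.
move=> _ [z [? ? ?] <-]; exists (2^-1 *: (e1 + z)).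
  by rewrite /T0 /= /GRing.scale /=; split; lra.
by rewrite -addrA -scalerDr scalerA.
Qed.

Lemma tri_sub3 q r : tri (q + (r / 2) *: e2) (r / 2) `<=` tri q r.
Proof.
move=> _ [z [? ? ?] <-]; exists (2^-1 *: (e2 + z)).
  by rewrite /T0 /= /GRing.scale /=; split; lra.
by rewrite -addrA -scalerDr scalerA.
Qed.

Lemma tri_sub4 q r : tri (q + (r / 2) *: e1 + (r / 2) *: e2) (- (r / 2)) `<=` tri q r.
Proof.
move=> _ [z [? ? ?] <-]; exists (2^-1 *: (e1 + e2 - z)).
  by rewrite /T0 /= /GRing.scale /=; split; lra.
by apply: plane_eq; rewrite /= /GRing.scale /=; field.
Qed.

(* A nested sequence of triangles with comparable defects shrinks to a point where
   the defect is negligible with respect to the area. *)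
Lemma goursat (E : plane -> R -> R) :
  (forall q r, r != 0 -> tri q r `<=` T0 -> E q r = E q (r / 2) + E (q + (r / 2) *: e1) (r / 2) +
    E (q + (r / 2) *: e2) (r / 2) +
    E (q + (r / 2) *: e1 + (r / 2) *: e2) (- (r / 2))) ->
  (forall p, T0 p -> forall eps, 0 < eps -> exists2 delta, 0 < delta &
    forall q r, r != 0 -> tri q r p -> tri q r `<=` T0 -> `|r| < delta -> `|E q r| <= eps * r ^+ 2) ->
  E 0 1 = 0.
Proof.
move=> Esplit Eloc; apply/eqP; apply: contraT; rewrite -normr_gt0 => E0.
pose P (x : plane * R) := x.2 != 0 /\ tri x.1 x.2 `<=` T0.
(* Some quarter carries at least a quarter of the defect. The implication from [P x] makes the
   relation total, as [choice] requires. *)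
have step (x : plane * R) : exists y : plane * R, P x ->
    [/\ P y, tri y.1 y.2 `<=` tri x.1 x.2, `|y.2| = `|x.2| / 2 &
      `|E x.1 x.2| <= 4 * `|E y.1 y.2|].
  have [Px|nPx] := pselect (P x); last by exists x.
  case: x Px => q r [/= r0 qr].
  have r20 : r / 2 != 0 by rewrite mulf_neq0.
  have nr2 : `|r / 2| = `|r| / 2 by rewrite normrM normfV (@ger0_norm _ 2).
  have := Esplit q r r0 qr.
  set a := E q (r / 2); set b := E _ (r / 2); set c := E _ (r / 2); set d := E _ (- _).
  move=> Eq.
  have [a4|a4] := leP `|E q r| (4 * `|a|).
    exists (q, r / 2) => _; split => //; last exact: tri_sub1.
    by split => //; apply: subset_trans qr; exact: tri_sub1.
  have [b4|b4] := leP `|E q r| (4 * `|b|).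
    exists (q + (r / 2) *: e1, r / 2) => _; split => //; last exact: tri_sub2.
    by split => //; apply: subset_trans qr; exact: tri_sub2.
  have [c4|c4] := leP `|E q r| (4 * `|c|).
    exists (q + (r / 2) *: e2, r / 2) => _; split => //; last exact: tri_sub3.
    by split => //; apply: subset_trans qr; exact: tri_sub3.
  have [d4|d4] := leP `|E q r| (4 * `|d|).
    exists (q + (r / 2) *: e1 + (r / 2) *: e2, - (r / 2)) => _; split => //=; last by rewrite normrN.
      by split; [rewrite oppr_eq0|apply: subset_trans qr; exact: tri_sub4].
    exact: tri_sub4.
  exfalso; have : `|E q r| <= `|a| + `|b| + `|c| + `|d|.
    rewrite Eq (le_trans (ler_normD _ _))// lerD2r (le_trans (ler_normD _ _))// lerD2r.
    exact: ler_normD.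
  by lra.
have [nx nxP] := choice step.
pose x n := iter n nx (0 : plane, 1 : R).
have Px0 : P (0, 1).
  by split; [exact: oner_neq0|move=> _ [z Tz <-] /=; rewrite add0r scale1r].
have Px n : P (x n).
  by elim: n => [//|n IH]; have [] := nxP _ IH.
have xS n : [/\ tri (x n.+1).1 (x n.+1).2 `<=` tri (x n).1 (x n).2,
   `|(x n.+1).2| = `|(x n).2| / 2 & `|E (x n).1 (x n).2| <= 4 * `|E (x n.+1).1 (x n.+1).2|].
  by have [] := nxP _ (Px n).
have xr n : `|(x n).2| = 2^-1 ^+ n.
  elim: n => [|n IH]; first by rewrite expr0 normr1.
  by have [_ -> _] := xS n; rewrite IH exprSr.
(* The defect shrinks at most by the factor 4 per step, exactly like the square of the size. Their
   ratio stays at least [|E 0 1|], which contradicts the local bound with half that constant at the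
   common point of the triangles. *)
have xE n : `|E 0 1| * (2^-1 ^+ n) ^+ 2 <= `|E (x n).1 (x n).2|.
  elim: n => [|n IH]; first by rewrite expr0 expr1n mulr1.
  have [_ _ h] := xS n; rewrite (exprSr _ n).
  by have := le_trans IH h; rewrite !expr2; lra.
have xm n m : (n <= m)%N -> tri (x m).1 (x m).2 `<=` tri (x n).1 (x n).2.
  move=> /subnK <-; elim: (m - n)%N => [//|k IH].
  by apply: subset_trans IH; rewrite addSn; have [] := xS (k + n)%N.
have xq m : tri (x m).1 (x m).2 (x m).1.
  by exists 0; [exact: std_triangle0|rewrite scaler0 addr0].
have [p [Tp clp]] : T0 `&` cluster ((fun n => (x n).1) @ \oo) !=set0.
  apply: std_triangle_compact; exists 0%N => // n _ /=.
  by apply: (Px n).2; exact: xq.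
have pn n : tri (x n).1 (x n).2 p.
  apply: tri_closed => B /clp; apply; exists n => // m /= nm.
  exact: xm nm _ (xq m).
have e0 : 0 < `|E 0 1| / 2 by rewrite divr_gt0.
have [delta d0 H] := Eloc p Tp _ e0.
have [n nd] : exists n, 2^-1 ^+ n < delta.
  have : (fun n => (2^-1 : R) ^+ n) @ \oo --> (0 : R).
    by apply: cvg_expr; rewrite ger0_norm ?invr_ge0// invf_lt1 ?ltr1n.
  move=> /cvgrPdist_lt/(_ _ d0)[n _ /(_ n (leqnn n))] /=.
  by rewrite sub0r normrN ger0_norm ?exprn_ge0 ?invr_ge0// => ?; exists n.
have [x0 xT] := Px n.
have := H (x n).1 (x n).2 x0 (pn n) xT; rewrite xr => /(_ nd).
have := xE n; have -> : (x n).2 ^+ 2 = (2^-1 ^+ n) ^+ 2 by rewrite -xr real_normK ?num_real.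
have : 0 < (2^-1 ^+ n) ^+ 2 :> R by rewrite !exprn_gt0 ?invr_gt0.
move=> s0 h1 h2; have := le_trans h1 h2; nra.
Qed.

End Triangles.

(** * Area of triangles and curves *)

Section Area.
Context {R : realType}.
Local Notation mu := (@lebesgue_measure R).
Local Notation plane := (R * R)%type.
Local Notation T0 := (@std_triangle R).
Local Open Scope ereal_scope.

(** Inverse of [t |-> a + b * t] for nonzero [b]: images under the affine map are treated as
    preimages under this one, hence are measurable. *)
Definition affine_inv (a b : R) : measurableTypeR R -> measurableTypeR R :=
  fun y => (b^-1 * (y - a))%R.

Lemma measurable_affine_inv a b : measurable_fun setT (affine_inv a b).
Proof.
apply: measurable_realfun.continuous_measurable_fun => y; apply: cvgM; first exact: cvg_cst.
by apply: cvgB; [exact: cvg_id|exact: cvg_cst].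
Qed.

Lemma affine_image (a b : R) (A : set R) : b != 0%R ->
  [set (a + b * t)%R | t in A] = affine_inv a b @^-1` A.
Proof.
move=> b0; apply/seteqP; split=> [_ [t At <-]|y /= Ay].
  by rewrite /affine_inv /= addrAC subrr add0r mulrA mulVf// mul1r.
by exists (affine_inv a b y) => //; rewrite /affine_inv mulrA divff// mul1r subrKC.
Qed.

(** The pushforward of the measure under [affine_inv], divided by [|b|], has the right value on
    half-open intervals, hence is Lebesgue measure. For negative [b] the preimage of an interval is
    closed at the other end. *)
Lemma lebesgue_affine (a b : R) (A : set R) : b != 0%R -> measurable A ->
  mu [set (a + b * t)%R | t in A] = `|b|%:E * mu A.
Proof.
move=> b0 mA; have nb0 : (0 < `|b|)%R by rewrite normr_gt0.
have nbV : (0 <= `|b|^-1)%R by rewrite invr_ge0.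
have H := @lebesgue_measure_unique R
   (mscale (NngNum nbV) (pushforward mu (affine_inv a b))).
rewrite (H (measurable_affine_inv a b) _ A mA); last first.
  move=> _ [[u v] /= _ <-]; rewrite /mscale/= /pushforward.
  have [b1|b1] := ltP 0%R b.
    have -> : affine_inv a b @^-1` `]u, v]%classic = `](a + b * u)%R, (a + b * v)%R]%classic.
      apply/seteqP; split=> y /=; rewrite !in_itv/= /affine_inv.
        by rewrite ltr_pdivlMl// ler_pdivrMl// => /andP[? ?]; apply/andP; split; lra.
      by rewrite ltr_pdivlMl// ler_pdivrMl// => /andP[? ?]; apply/andP; split; lra.
    rewrite !lebesgue_measure_itv/= !lte_fin gtr0_norm//.
    rewrite ltrD2l ltr_pM2l//; case: ifPn => _; last by rewrite mule0.
    rewrite -!EFinD -EFinM; congr EFin; rewrite opprD addrACA subrr add0r -mulrBr.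
    by rewrite mulrA mulVf// ?mul1r// gt_eqF.
  have {}b1 : (b < 0)%R by rewrite lt_neqAle b0.
  have -> : affine_inv a b @^-1` `]u, v]%classic = `[(a + b * v)%R, (a + b * u)%R[%classic.
    apply/seteqP; split=> y /=; rewrite !in_itv/= /affine_inv.
      by rewrite ltr_ndivlMl// ler_ndivrMl// => /andP[? ?]; apply/andP; split; lra.
    by rewrite ltr_ndivlMl// ler_ndivrMl// => /andP[? ?]; apply/andP; split; lra.
  rewrite !lebesgue_measure_itv/= !lte_fin ltr0_norm//.
  rewrite ltrD2l ltr_nM2l//; case: ifPn => _; last by rewrite mule0.
  rewrite -!EFinD -EFinM; congr EFin; rewrite opprD addrACA subrr add0r -mulrBr.
  by field.
transitivity (`|b|%:E * ((`|b|^-1)%:E * mu (affine_inv a b @^-1` A))) => //.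
by rewrite -affine_image// muleA -EFinM divff ?mul1e// normr_eq0.
Qed.

(** An open set is the countable union of the squares it contains that have a rational centre and
    half side [1 / (n + 1)]. *)
Lemma plane_open_measurable (A : set plane) : open A -> measurable A.
Proof.
move=> oA.
pose box (x : (rat * rat) * nat) : set plane :=
  ball (ratr x.1.1 : R) (x.2.+1%:R^-1)%R `*` ball (ratr x.1.2 : R) (x.2.+1%:R^-1)%R.
have -> : A = \bigcup_(x in [set x | box x `<=` A]) box x.
  apply/seteqP; split=> [p Ap|p [x /= xA]]; last exact: xA.
  have [d /= d0 dA] := (near_planeP A p).1 (open_nbhs_nbhs (conj oA Ap)).
  have d20 : (0 < d / 2)%R by rewrite divr_gt0.
  pose n := Num.bound (d / 2)^-1; pose e : R := (n.+1%:R^-1)%R.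
  have e0 : (0 < e)%R by rewrite /e invr_gt0.
  have ed : (e < d / 2)%R.
    rewrite /e -[ltRHS]invrK ltf_pV2 ?posrE ?invr_gt0//.
    apply: (lt_trans (archi_boundP _)); first by rewrite invr_ge0 ltW.
    by rewrite ltr_nat.
  have [q1 q1p] := @rat_in_itvoo R (p.1 - e)%R (p.1 + e)%R ltac:(lra).
  have [q2 q2p] := @rat_in_itvoo R (p.2 - e)%R (p.2 + e)%R ltac:(lra).
  move: q1p q2p; rewrite !in_itv/= => /andP[? ?] /andP[? ?].
  exists ((q1, q2), n).
    move=> [x y] [/=]; rewrite /ball/= !ltr_norml -/e => /andP[? ?] /andP[? ?].
    by apply: dA; rewrite ltr_norml; apply/andP; split; lra.
  by split; rewrite /ball/= ltr_norml -/e; apply/andP; split; lra.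
rewrite bigcup_mkcond; apply: countable_bigcupT_measurable.
  exact: countableP.
move=> x; case: ifP => // _; apply: measurableX; exact: measurable_realfun.measurable_ball.
Qed.

Lemma plane_closed_measurable (A : set plane) : closed A -> measurable A.
Proof. by move=> /closed_openC /plane_open_measurable /measurableC; rewrite setCK. Qed.

Lemma plane_compact_measurable (A : set plane) : compact A -> measurable A.
Proof.
by move=> cA; apply: plane_closed_measurable; apply: compact_closed => //; exact: plane_hausdorff.
Qed.

Lemma area_xsection (A : set plane) : area A = \int[mu]_x mu (xsection A x).
Proof. by []. Qed.

Lemma area_ysection (A : set plane) : measurable A ->
  area A = \int[mu]_y mu (ysection A y).
Proof.
move=> mA; have := @indic_fubini_tonelli _ _ _ _ R mu mu A mA.
move=> H; rewrite area_xsection.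
transitivity (\int[mu]_x fubini_F mu (EFin \o \1_A) x).
  apply: eq_integral => x _.
  exact: (esym (congr1 (fun f => f x) (indic_fubini_tonelli_FE mu mA))).
rewrite H; apply: eq_integral => x _.
exact: (congr1 (fun f => f x) (indic_fubini_tonelli_GE mu mA)).
Qed.

(** Cavalieri's principle: the vertical sections are translated by an amount depending on [x] and
    scaled by a fixed factor. *)
Lemma area_shear_x (A A' : set plane) (c : R -> R) (b : R) : b != 0%R ->
  measurable A -> measurable A' ->
  (forall x, xsection A' x = [set (c x + b * t)%R | t in xsection A x]) ->
  area A' = `|b|%:E * area A.
Proof.
move=> b0 mA mA' AA'; rewrite !area_xsection -ge0_integralZl//.
- apply: eq_integral => x _; rewrite AA' lebesgue_affine//.
  exact: measurable_xsection.
- exact: measurable_fun_xsection.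
Qed.

Lemma area_shear_y (A A' : set plane) (c : R -> R) (b : R) : b != 0%R ->
  measurable A -> measurable A' ->
  (forall y, ysection A' y = [set (c y + b * t)%R | t in ysection A y]) ->
  area A' = `|b|%:E * area A.
Proof.
move=> b0 mA mA' AA'; rewrite !area_ysection// -ge0_integralZl//.
- apply: eq_integral => x _; rewrite AA' lebesgue_affine//.
  exact: measurable_ysection.
- exact: measurable_fun_ysection.
Qed.

Lemma std_triangle_measurable : measurable T0.
Proof. by apply: plane_compact_measurable; exact: std_triangle_compact. Qed.

Lemma area_std_triangle : area T0 = (2^-1)%:E.
Proof.
rewrite area_xsection.
transitivity (\int[mu]_(x in `[0%R, 1%R]) (1 - x)%:E).
  rewrite [RHS]integral_mkcond; apply: eq_integral => x _; rewrite patchE.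
  case: ifPn => [|/negP]; rewrite inE /= in_itv/= => x01.
    have -> : xsection T0 x = `[0%R, (1 - x)%R]%classic.
      apply/seteqP; split=> y; rewrite /xsection /= inE in_itv/= /std_triangle/=.
        by case=> ? ? ?; apply/andP; split; lra.
      by move: x01 => /andP[? ?] /andP[? ?]; split; lra.
    rewrite lebesgue_measure_itv/= lte_fin; case: ifPn => [_|]; first by rewrite sube0.
    by rewrite -leNgt => ?; congr EFin; move: x01 => /andP[? ?]; lra.
  have -> : xsection T0 x = set0; last by rewrite measure0.
  rewrite -subset0 => y; rewrite /xsection /= inE /std_triangle/= => -[? ? ?].
  by apply: x01; apply/andP; split; lra.
have [cw dW] : (forall t : R, t \in `[0%R, 1%R] -> {for t, continuous (fun x : R => 1 - x)%R}) /\
    (forall t : R, t \in `[0%R, 1%R] -> is_derive t (1 : R)%R (fun x : R => x - x * x / 2)%R (1 - t)%R).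
  split=> t _; first by apply: cvgB; [exact: cvg_cst|exact: cvg_id].
  by apply: is_derive_eq; rewrite /GRing.scale /=; lra.
have := FTC2_segment (@ler01 R) dW cw.
have /integrable_fin_num : mu.-integrable `[0%R, 1%R] (EFin \o (fun x : R => 1 - x)%R).
  exact: continuous_itv_integrable.
move=> /(_ (measurable_itv _)) /fineK <-; rewrite /Rintegral => ->.
by congr EFin; lra.
Qed.

Lemma affine_triangle_compact (P U V : plane) :
  compact [set (P + (z.1 *: U + z.2 *: V))%R | z in T0].
Proof.
apply: continuous_compact; last exact: std_triangle_compact.
apply: continuous_subspaceT => z; apply: cvgD; first exact: cvg_cst.
by apply: cvgD; apply: cvgZr_tmp; [exact: continuous_fst|exact: continuous_snd].
Qed.

(** Two shears lead from [T0] to the triangle: a horizontal one with factor [U.1], then a vertical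
    one with factor [D / U.1]. If [U.1] vanishes, exchanging [U] and [V] restores the first. *)
Lemma area_triangle (P U V : plane) : (U.1 * V.2 - U.2 * V.1 != 0)%R ->
  area [set (P + (z.1 *: U + z.2 *: V))%R | z in T0] =
  (`|U.1 * V.2 - U.2 * V.1| / 2)%:E.
Proof.
wlog U0 : U V / (U.1 != 0)%R => [wl D0|].
  have [U1|] := eqVneq U.1 0%R; last by move=> U1; exact: wl.
  have V1 : (V.1 != 0)%R.
    by apply: contra D0 => /eqP V1; rewrite U1 V1 mul0r mulr0 subrr.
  have D0' : (V.1 * U.2 - V.2 * U.1 != 0)%R.
    by rewrite -oppr_eq0 opprB [(V.2 * _)%R]mulrC [(V.1 * _)%R]mulrC.
  have := wl V U V1 D0'; rewrite -normrN opprB [(V.2 * _)%R]mulrC [(V.1 * _)%R]mulrC => <-.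
  congr area; apply/seteqP; split=> _ [z [z1 z2 z3] <-]; exists (z.2, z.1) => /=.
  - by split=> //=; rewrite addrC.
  - by rewrite [(_ *: V + _)%R]addrC.
  - by split=> //=; rewrite addrC.
  - by rewrite [(_ *: U + _)%R]addrC.
set D := (U.1 * V.2 - U.2 * V.1)%R => D0.
pose S1 : set plane := [set ((P.1, 0%R) + (z.1 *: (U.1, 0%R) + z.2 *: (V.1, 1%R)))%R | z in T0].
have mS1 : measurable S1.
  by apply: plane_compact_measurable; exact: affine_triangle_compact.
have aS1 : area S1 = (`|U.1| / 2)%:E.
  rewrite (@area_shear_y T0 S1 (fun y => P.1 + V.1 * y)%R U.1)//.
  - by rewrite area_std_triangle -EFinM.
  - exact: std_triangle_measurable.
  move=> y; apply/seteqP; split=> x; rewrite /ysection /= inE.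
    move=> [z Tz /= [<- <-]]; exists z.1; rewrite /GRing.scale /=.
      by rewrite inE !(mulr0, add0r, addr0, mulr1); case: z Tz.
    by ring.
  move=> [s]; rewrite inE => Ts <-; exists (s, y) => //.
  by apply: plane_eq; rewrite /= /GRing.scale /=; ring.
set S2 := (X in area X).
rewrite (@area_shear_x S1 S2 (fun x => P.2 + U.2 / U.1 * (x - P.1))%R (D / U.1)%R)//.
- rewrite aS1 -EFinM normrM normfV mulrA divfK// normr_eq0//.
- by rewrite mulf_neq0// invr_eq0.
- by apply: plane_compact_measurable; exact: affine_triangle_compact.
move=> x; apply/seteqP; split=> y; rewrite /xsection /= inE.
  move=> [z Tz /= [<- <-]]; exists z.2; rewrite /GRing.scale /=.
    rewrite inE; by exists z => //; apply: plane_eq; rewrite /= /GRing.scale /=; ring.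
  by rewrite /D; field.
move=> [t]; rewrite inE => -[z Tz [<- <-]] <-; exists z => //.
by apply: plane_eq; rewrite /= /GRing.scale /=; [ring|rewrite /D; field].
Qed.

Lemma area_box (a b c d : R) : (a <= b)%R -> (c <= d)%R ->
  area (`[a, b]%classic `*` `[c, d]%classic) = ((b - a) * (d - c))%:E.
Proof.
move=> ab cd; have := @product_measure1E _ _ _ _ R mu mu `[a, b]%classic `[c, d]%classic.
have m (u v : R) : (u <= v)%R -> mu `[u, v]%classic = (v - u)%:E.
  move=> uv; rewrite -(lebesgue_measure_segment uv) fineK//.
  by rewrite lebesgue_measure_itv/= lte_fin; case: ifP.
move=> H; apply: etrans (H (measurable_itv _) (measurable_itv _)) _.
by apply: etrans (congr2 _ (m _ _ ab) (m _ _ cd)) _; rewrite EFinM.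
Qed.

(** [N + 1] squares of half side [C / N] centred on the curve cover it; their total area is at most
    [8 * C ^+ 2 / N]. *)
Lemma lipschitz_curve_null (g : R -> plane) (C : R) : (0 <= C)%R ->
  (forall s t : R, s \in `[0%R, 1%R] -> t \in `[0%R, 1%R] ->
    (`|(g s).1 - (g t).1| <= C * `|s - t|)%R /\ (`|(g s).2 - (g t).2| <= C * `|s - t|)%R) ->
  measurable [set g t | t in `[0%R, 1%R]%classic] ->
  area [set g t | t in `[0%R, 1%R]%classic] = 0.
Proof.
move=> C0 gL mA; set A := [set g t | t in _] in mA *.
apply/eqP; rewrite eq_le; apply/andP; split; last exact: (@measure_ge0 _ _ _ (mu \x mu)).
apply/lee_addgt0Pr => e e0; rewrite add0e.
pose N := (Num.bound (8 * C ^+ 2 / e)).+1; pose h : R := (C / N%:R)%R.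
have N0 : (0 < N%:R :> R)%R by rewrite ltr0n.
have N1 : (1 <= N%:R :> R)%R by rewrite ler1n.
have Ne : (8 * C ^+ 2 / N%:R <= e)%R.
  have q0 : (0 <= 8 * C ^+ 2 / e)%R by rewrite divr_ge0 ?mulr_ge0 ?sqr_ge0// ltW.
  have qN : (8 * C ^+ 2 / e < N%:R)%R.
    by apply: lt_trans (archi_boundP q0) _; rewrite /N ltr_nat.
  by move: qN; rewrite ltr_pdivrMr// ler_pdivrMr// [(e * _)%R]mulrC => /ltW.
have h0 : (0 <= h)%R by rewrite /h divr_ge0// ltW.
pose box (i : nat) : set plane :=
  `[((g (i%:R / N%:R)).1 - h)%R, ((g (i%:R / N%:R)).1 + h)%R]%classic `*`
  `[((g (i%:R / N%:R)).2 - h)%R, ((g (i%:R / N%:R)).2 + h)%R]%classic.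
have mbox i : measurable (box i) by apply: measurableX; exact: measurable_itv.
have abox i : area (box i) = (4 * h ^+ 2)%:E.
  rewrite area_box; [|lra|lra]; congr EFin; ring.
have Abox : A `<=` \big[setU/set0]_(i < N.+1) box i.
  move=> _ [t /= t01 <-]; have /andP[t0 t1] : (0 <= t <= 1)%R by move: t01; rewrite in_itv.
  have tN0 : (0 <= t * N%:R)%R by rewrite mulr_ge0// ltW.
  have /andP[i1 i2] := truncn_itv tN0; set i := Num.truncn (t * N%:R) in i1 i2.
  have iN : (i <= N)%N.
    by rewrite -(ler_nat R) (le_trans i1)// ler_piMl// ltW.
  rewrite -bigcup_mkord; exists i; first by rewrite /= ltnS.
  have iN01 : (i%:R / N%:R : R)%R \in `[0%R, 1%R].
    rewrite in_itv/=; apply/andP; split; first by rewrite divr_ge0 ?ler0n// ltW.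
    by rewrite ler_pdivrMr// mul1r ler_nat.
  have dist : (`|t - i%:R / N%:R| <= N%:R^-1)%R.
    rewrite ger0_norm; last by rewrite subr_ge0 ler_pdivrMr.
    rewrite lerBlDr -[X in (_ <= X + _)%R]mul1r -mulrDl ler_pdivlMr// ltW//.
    by rewrite addrC -natr1 in i2 *.
  have [d1 d2] := gL t _ t01 iN01.
  have CC : (C * `|t - i%:R / N%:R| <= h)%R by rewrite /h ler_wpM2l.
  have := le_trans d1 CC; have := le_trans d2 CC; rewrite !ler_norml => /andP[? ?] /andP[? ?].
  by split; rewrite /= in_itv/=; apply/andP; split; lra.
apply: (@le_trans _ _ (area (\big[setU/set0]_(i < N.+1) box i))).
  apply: (@le_measure _ _ _ (mu \x mu)); rewrite ?inE//.
  by apply: bigsetU_measurable => i _; exact: mbox.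
have BI := @Boole_inequality _ _ _ (mu \x mu) box N.+1 (fun i _ => mbox i).
apply: (le_trans BI).
rewrite (eq_bigr (fun=> (4 * h ^+ 2)%:E)); last by move=> i _; exact: abox.
rewrite sumEFin lee_fin big_const_ord iter_addr addr0.
rewrite -[(_ *+ N.+1)%R]mulr_natr (le_trans _ Ne)//.
have -> : (4 * h ^+ 2 * N.+1%:R = 4 * C ^+ 2 * (N.+1%:R / N%:R) / N%:R :> R)%R.
  by rewrite /h; field; lra.
rewrite ler_wpM2r ?invr_ge0 ?(ltW N0)//.
have : (N.+1%:R / N%:R <= 2 :> R)%R by rewrite ler_pdivrMr// -natr1; lra.
have := sqr_ge0 C; nra.
Qed.

End Area.

(** * Charts of the standard triangle *)

Lemma MVT_chord {R : realType} {V : normedModType R} (f : V -> R) (q d : V) :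
  (forall t : R, t \in `[0, 1] -> derivable f (q + t *: d) d) ->
  exists2 c : R, c \in `[0, 1] & f (q + d) - f q = 'D_d f (q + c *: d).
Proof.
move=> df; pose h (t : R) := f (q + t *: d).
have dh (t : R) : t \in `[0, 1] -> is_derive t (1 : R) h ('D_d f (q + t *: d)).
  by move=> /df dft; apply: is_derive_line.
have dh' (t : R) : t \in `]0, 1[ -> is_derive t (1 : R) h ('D_d f (q + t *: d)).
  by move=> t01; apply: dh; apply: subset_itv_oo_cc t01.
have ch : {within `[0, 1], continuous h}.
  by apply: derivable_within_continuous => t /dh[].
have [c c01] := MVT_segment ler01 dh' ch.
by rewrite /h scale1r scale0r addr0 subr0 mulr1 => E; exists c.
Qed.

Lemma derive_sqdist {R : realType} {V : normedModType R} (f g : V -> R) (a b : R) (p v : V) :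
  derivable f p v -> derivable g p v ->
  'D_v (fun q => (f q - a) * (f q - a) + (g q - b) * (g q - b)) p =
  2 * ((f p - a) * 'D_v f p + (g p - b) * 'D_v g p).
Proof.
move=> df dg.
have sq (h : V -> R) (c : R) : derivable h p v ->
    is_derive p v (fun q => (h q - c) * (h q - c)) (2 * ((h p - c) * 'D_v h p)).
  move=> dh; have dh' : is_derive p v h ('D_v h p) by exact: derivableP.
  have dc : is_derive p v (fun q => h q - c) ('D_v h p).
    by apply: is_derive_eq; rewrite subr0.
  have [D E] := is_deriveM dc dc; split; first exact: D.
  by rewrite [LHS]E /GRing.scale /=; ring.
have := is_deriveD (sq f a df) (sq g b dg).
by move=> [_ E]; rewrite [LHS]E mulrDr.
Qed.

(** At a critical point of the squared distance from [G q] to a target, the two residuals solve this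
    system, whose determinant is the Jacobian of the chart. *)
Lemma cramer2_eq0 {R : realType} (a b x1 x2 z1 z2 : R) : x1 * z2 - x2 * z1 != 0 ->
  2 * (a * x1 + b * z1) = 0 -> 2 * (a * x2 + b * z2) = 0 -> a = 0 /\ b = 0.
Proof.
move=> J0 E1 E2.
have Ea : a * (x1 * z2 - x2 * z1) =
    (2 * (a * x1 + b * z1) * z2 - 2 * (a * x2 + b * z2) * z1) / 2 by field.
have Eb : b * (x1 * z2 - x2 * z1) =
    (2 * (a * x2 + b * z2) * x1 - 2 * (a * x1 + b * z1) * x2) / 2 by field.
move: Ea Eb; rewrite E1 E2 !mul0r subrr mul0r => /eqP + /eqP.
by rewrite !mulf_eq0 (negbTE J0) !orbF => /eqP -> /eqP ->.
Qed.

Section Charts.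
Context {R : realType}.
Local Notation plane := (R * R)%type.
Local Notation T0 := (@std_triangle R).
Implicit Types (p q : plane) (f : plane -> R).

Lemma plane_norm_lt p (c : R) : `|p| < c -> `|p.1| < c /\ `|p.2| < c.
Proof. by rewrite prod_normE gt_max => /andP[]. Qed.

Lemma plane_norm_le p (c : R) : `|p| <= c -> `|p.1| <= c /\ `|p.2| <= c.
Proof. by rewrite prod_normE ge_max => /andP[]. Qed.

Lemma near_plane_ball (P : plane -> Prop) p : (\forall q \near p, P q) ->
  exists2 d, 0 < d & forall q, `|q - p| < d -> P q.
Proof.
move=> /near_planeP[d d0 dP]; exists d => // -[x y] /plane_norm_lt[/= ? ?].
exact: dP.
Qed.

Lemma norm_convex_lt p q q' (c d : R) : `|q - p| < d -> `|q' - p| < d ->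
  c \in `[0, 1] -> `|q + c *: (q' - q) - p| < d.
Proof.
move=> hq hq'; rewrite in_itv/= => /andP[c0 c1].
have -> : q + c *: (q' - q) - p = (1 - c) *: (q - p) + c *: (q' - p).
  by apply: plane_eq; rewrite /= /GRing.scale /=; ring.
apply: (le_lt_trans (ler_normD _ _)); rewrite !normrZ ger0_norm ?subr_ge0// (ger0_norm c0).
pose m := Num.max `|q - p| `|q' - p|.
have md : m < d by rewrite gt_max hq hq'.
have m1 : 0 <= (1 - c) * (m - `|q - p|).
  by rewrite mulr_ge0 ?subr_ge0// le_max lexx.
have m2 : 0 <= c * (m - `|q' - p|).
  by rewrite mulr_ge0 ?subr_ge0// le_max lexx orbT.
by lra.
Qed.

(** Both end points vary, as needed for local injectivity. The mean value theorem on the chord and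
    continuity of the partial derivatives at [p] give the bound. *)
Lemma C1_strict_differentiable (U : set plane) f p : open U -> U p -> C1 U f ->
  forall eps, 0 < eps -> exists2 delta, 0 < delta &
    forall q q', `|q - p| < delta -> `|q' - p| < delta ->
     `|f q' - f q - ((q'.1 - q.1) * 'D_e1 f p + (q'.2 - q.2) * 'D_e2 f p)|
       <= eps * `|q' - q|.
Proof.
move=> oU Up Cf eps e0; have e20 : 0 < eps / 2 by rewrite divr_gt0.
have [_ cf] := Cf _ Up.
have H1 : \forall q \near p, `|'D_e1 f p - 'D_e1 f q| <= eps / 2.
  exact: cvgr_dist_le (cf e1) _ e20.
have H2 : \forall q \near p, `|'D_e2 f p - 'D_e2 f q| <= eps / 2.
  exact: cvgr_dist_le (cf e2) _ e20.
have H3 : \forall q \near p, U q by apply: open_nbhs_nbhs.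
have [d /= d0 B] := near_plane_ball (filterI H3 (filterI H1 H2)).
exists d => // q q' hq hq'.
have [t t01|c c01] := @MVT_chord _ _ f q (q' - q).
  have [Ut _] := B _ (norm_convex_lt hq hq' t01); have [dft _] := Cf _ Ut.
  exact: diff_derivable.
have [Uc [b1 b2]] := B _ (norm_convex_lt hq hq' c01).
rewrite subrKC derive_pairE; last by have [] := Cf _ Uc.
move: b1 b2; set z := q + c *: (q' - q).
move: ('D_e1 f p) ('D_e2 f p) ('D_e1 f z) ('D_e2 f z) (f q' - f q) => f1 f2 g1 g2 F b1 b2 ->.
have [n1 n2] := plane_norm_le (lexx `|q' - q|).
have -> : (q' - q).1 * g1 + (q' - q).2 * g2 - ((q'.1 - q.1) * f1 + (q'.2 - q.2) * f2) =
   - ((q' - q).1 * (f1 - g1) + (q' - q).2 * (f2 - g2)) by rewrite /=; ring.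
rewrite normrN (le_trans (ler_normD _ _))// !normrM.
have := ler_pM (normr_ge0 _) (normr_ge0 _) n1 b1.
have := ler_pM (normr_ge0 _) (normr_ge0 _) n2 b2.
by lra.
Qed.

Definition jacobian_det (X Y : plane -> R) p : R :=
  'D_e1 X p * 'D_e2 Y p - 'D_e2 X p * 'D_e1 Y p.

Local Notation J := jacobian_det.

(* [s] is the orientation of the chart *)
Record chart (X Y : plane -> R) (U : set plane) (s c : R) : Prop := Chart {
  chart_open : open U ;
  chart_sub : T0 `<=` U ;
  chart_C1x : C1 U X ;
  chart_C1y : C1 U Y ;
  chart_lower : forall p q, T0 p -> T0 q -> `|p - q| <= c * `|(X p, Y p) - (X q, Y q)| ;
  chart_sign : s = 1 \/ s = -1 ;
  chart_det : forall p, T0 p -> 0 < s * J X Y p }.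

Variables (X Y : plane -> R) (U : set plane) (s c : R).
Hypothesis chG : chart X Y U s c.

Definition chart_map : plane -> plane := fun p => (X p, Y p).
Local Notation G := chart_map.

Lemma chart_det_neq0 p : T0 p -> J X Y p != 0.
Proof. by move=> /(chart_det chG); apply: contraTneq => ->; rewrite mulr0 ltxx. Qed.

Lemma chart_inj p q : T0 p -> T0 q -> G p = G q -> p = q.
Proof.
move=> Tp Tq E; have := chart_lower chG Tp Tq.
by rewrite -/(G p) -/(G q) E subrr normr0 mulr0 normr_le0 subr_eq0 => /eqP.
Qed.

Lemma chart_cst_ge0 : 0 <= c.
Proof.
have := chart_lower chG (@std_triangle0 R) (@std_triangle_e1 R).
have n1 : 0 < `|0 - e1 : plane|.
  by rewrite normr_gt0 sub0r oppr_eq0; apply/eqP => -[/eqP]; rewrite oner_eq0.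
move=> /(lt_le_trans n1) h; rewrite leNgt; apply/negP => c0; move: h.
by rewrite ltNge => /negP; apply; rewrite mulr_le0_ge0// ltW.
Qed.

Lemma chart_continuous p : U p -> {for p, continuous G}.
Proof.
move=> Up.
have hx := C1_continuous (chart_C1x chG) Up.
have hy := C1_continuous (chart_C1y chG) Up.
exact: (cvg_pair hx hy).
Qed.

(* the coordinates of the inverse of the differential of the chart at [p] *)
Definition inv1 p (w : plane) : R := (w.1 * 'D_e2 Y p - w.2 * 'D_e2 X p) / J X Y p.
Definition inv2 p (w : plane) : R := (w.2 * 'D_e1 X p - w.1 * 'D_e1 Y p) / J X Y p.

(** Strict differentiability of [X] and [Y], solved for the increment of the argument by Cramer's
    rule. *)
Lemma chart_strict p : T0 p -> forall eps, 0 < eps -> exists2 delta, 0 < delta &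
  forall q q', `|q - p| < delta -> `|q' - p| < delta ->
    `|q'.1 - q.1 - inv1 p (G q' - G q)| <= eps * `|q' - q| /\
    `|q'.2 - q.2 - inv2 p (G q' - G q)| <= eps * `|q' - q|.
Proof.
move=> Tp eps e0; have Up := chart_sub chG Tp; have J0 := chart_det_neq0 Tp.
pose A := `|'D_e1 X p| + `|'D_e2 X p| + `|'D_e1 Y p| + `|'D_e2 Y p|.
have A0 : 0 <= A by rewrite /A !addr_ge0.
have nJ : 0 < `|J X Y p| by rewrite normr_gt0.
(* Solving the system adds two errors, each multiplied by an entry of the inverse matrix of size at
   most [A / |J|]. *)
pose e := eps * `|J X Y p| / (2 * (A + 1)).
have ee : 0 < e by rewrite /e divr_gt0 ?mulr_gt0//; lra.
have [d1 d10 H1] := C1_strict_differentiable (chart_open chG) Up (chart_C1x chG) ee.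
have [d2 d20 H2] := C1_strict_differentiable (chart_open chG) Up (chart_C1y chG) ee.
exists (Num.min d1 d2); first by rewrite lt_min d10.
move=> q q'; rewrite !lt_min => /andP[q1 q2] /andP[q1' q2'].
move: (H1 _ _ q1 q1') (H2 _ _ q2 q2') => {H1 H2}; rewrite /inv1 /inv2 /= /e.
move: nJ J0 A0; rewrite /A /jacobian_det.
move: (X q' - X q) (Y q' - Y q) (q'.1 - q.1) (q'.2 - q.2) (normr_ge0 (q' - q)).
move: ('D_e1 X p) ('D_e2 X p) ('D_e1 Y p) ('D_e2 Y p) `|q' - q|.
move=> x1 x2 y1 y2 n dX dY u v n0 nJ J0 A0; set j := x1 * y2 - x2 * y1 in nJ J0 *.
set B := `|x1| + `|x2| + `|y1| + `|y2| in A0 *.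
set e' := eps * `|j| / (2 * (B + 1)) => hX hY.
have key (a b : R) : `|a| <= B -> `|b| <= B ->
    `|((dX - (u * x1 + v * x2)) * a - (dY - (u * y1 + v * y2)) * b) / j| <= eps * n.
  move=> ha hb; rewrite normrM normfV ler_pdivrMr//.
  rewrite (le_trans (ler_normB _ _))// !normrM.
  apply: (@le_trans _ _ (e' * n * B + e' * n * B)); first by rewrite lerD// ler_pM.
  have -> : e' * n * B + e' * n * B = (eps * n * `|j|) * (B / (B + 1)).
    by rewrite /e'; field; lra.
  rewrite ler_piMr// ?mulr_ge0 ?(ltW e0)// ler_pdivrMr; lra.
have [a1 a2 a3 a4] : [/\ `|x1| <= B, `|x2| <= B, `|y1| <= B & `|y2| <= B].
  by rewrite /B; have := normr_ge0 x1; have := normr_ge0 x2; have := normr_ge0 y1;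
     have := normr_ge0 y2; split; lra.
split.
- have -> : u - (dX * y2 - dY * x2) / j =
     - (((dX - (u * x1 + v * x2)) * y2 - (dY - (u * y1 + v * y2)) * x2) / j).
    by rewrite /j; field.
  by rewrite normrN; exact: key.
- have -> : v - (dY * x1 - dX * y1) / j =
      (((dX - (u * x1 + v * x2)) * y1 - (dY - (u * y1 + v * y2)) * x1) / j).
    by rewrite /j; field.
  exact: key.
Qed.

Lemma inv_bound p : T0 p -> exists2 A, 0 <= A & forall w : plane,
  `|inv1 p w| <= A * `|w| /\ `|inv2 p w| <= A * `|w|.
Proof.
move=> Tp; have J0 := chart_det_neq0 Tp.
exists ((`|'D_e1 X p| + `|'D_e2 X p| + `|'D_e1 Y p| + `|'D_e2 Y p|) / `|J X Y p|).
  by rewrite divr_ge0// !addr_ge0.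
move=> w; have [w1 w2] := plane_norm_le (lexx `|w|).
have nJ : 0 < `|J X Y p| by rewrite normr_gt0.
rewrite /inv1 /inv2; move: (J X Y p) J0 nJ => j J0 nJ.
move: ('D_e1 X p) ('D_e2 X p) ('D_e1 Y p) ('D_e2 Y p) => x1 x2 y1 y2.
have key (a b u v : R) : `|u| <= `|w| -> `|v| <= `|w| -> `|a| + `|b| <= `|x1| + `|x2| + `|y1| + `|y2| ->
   `|(u * a - v * b) / j| <= (`|x1| + `|x2| + `|y1| + `|y2|) / `|j| * `|w|.
  move=> hu hv hab; rewrite normrM normfV mulrAC ler_wpM2r ?invr_ge0//.
  rewrite (le_trans (ler_normB _ _))// !normrM.
  apply: (@le_trans _ _ (`|w| * `|a| + `|w| * `|b|)); first by rewrite lerD// ler_wpM2r.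
  by rewrite -mulrDr mulrC ler_wpM2r.
have := normr_ge0 x1; have := normr_ge0 x2; have := normr_ge0 y1; have := normr_ge0 y2.
by move=> ? ? ? ?; split; apply: key => //; lra.
Qed.

(** Inverse function theorem at [p]. The lower bound is strict differentiability with [eps = 1/2].
    For surjectivity the squared distance to [y] is minimized over a closed square around [p]; the
    minimum is not on the border, and an interior critical point is a solution because the Jacobian
    does not vanish. *)
Lemma chart_local p : T0 p -> exists2 rho, 0 < rho & exists2 k, 0 < k &
  [/\ forall q, `|q - p| <= rho -> U q /\ J X Y q != 0,
      forall q q', `|q - p| <= rho -> `|q' - p| <= rho -> `|q' - q| <= k * `|G q' - G q| &
      forall r, 0 < r <= rho -> forall y, `|y - G p| < r / (4 * k) ->
        exists2 q, `|q - p| < r & G q = y].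
Proof.
move=> Tp; have J0 := chart_det_neq0 Tp; have Up := chart_sub chG Tp.
have [A A0 HA] := inv_bound Tp.
have h20 : 0 < 2^-1 :> R by rewrite invr_gt0.
have [d d0 Hd] := chart_strict Tp h20.
have [_ cX] := chart_C1x chG Up; have [_ cY] := chart_C1y chG Up.
have cJ : {for p, continuous (J X Y)}.
  by apply: cvgB; apply: cvgM; [exact: cX|exact: cY|exact: cX|exact: cY].
have nJ : \forall q \near p, J X Y q != 0.
  have := cvgr_neq0 (J X Y p) cJ J0; exact.
have nU : \forall q \near p, U q by apply: open_nbhs_nbhs; split => //; exact: chart_open chG.
have [d' d0' Hd'] := near_plane_ball (filterI nU nJ).
pose rho := Num.min d d' / 2.
have rho0 : 0 < rho by rewrite /rho divr_gt0// lt_min d0.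
have rd : rho < d by rewrite /rho ltr_pdivrMr// (@le_lt_trans _ _ d)// ?ge_min ?lexx// ltr_pMr// ltr1n.
have rd' : rho < d' by rewrite /rho ltr_pdivrMr// (@le_lt_trans _ _ d')// ?ge_min ?lexx ?orbT// ltr_pMr// ltr1n.
pose k := 2 * (A + 1).
have k0 : 0 < k by rewrite /k; lra.
have H1 q : `|q - p| <= rho -> U q /\ J X Y q != 0.
  by move=> hq; apply: Hd'; exact: le_lt_trans hq rd'.
have H2 q q' : `|q - p| <= rho -> `|q' - p| <= rho -> `|q' - q| <= k * `|G q' - G q|.
  move=> hq hq'.
  have [a1 a2] := Hd q q' (le_lt_trans hq rd) (le_lt_trans hq' rd).
  have [b1 b2] := HA (G q' - G q).
  have g0 := normr_ge0 (G q' - G q).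
  suff : `|q' - q| <= 2^-1 * `|q' - q| + A * `|G q' - G q| by rewrite /k; nra.
  apply: norm_pair_le.
    rewrite -[X in `|X|](subrK (inv1 p (G q' - G q))).
    exact: le_trans (ler_normD _ _) (lerD a1 b1).
  rewrite -[X in `|X|](subrK (inv2 p (G q' - G q))).
  exact: le_trans (ler_normD _ _) (lerD a2 b2).
exists rho => //; exists k => //; split => // r /andP[r0 rrho] y hy.
pose Q : set plane := `[p.1 - r, p.1 + r]%classic `*` `[p.2 - r, p.2 + r]%classic.
have QP q : Q q <-> `|q - p| <= r.
  rewrite /Q /= !in_itv/=; split=> [[/andP[? ?] /andP[? ?]]|].
    by apply: norm_pair_le; rewrite /= ler_norml; apply/andP; split; lra.
  move=> /plane_norm_le[]; rewrite /= !ler_norml => /andP[? ?] /andP[? ?].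
  by split; apply/andP; split; lra.
have cQ : compact Q by apply: compact_setX; exact: segment_compact.
pose phi q : R := (X q - y.1) * (X q - y.1) + (Y q - y.2) * (Y q - y.2).
have QU q : Q q -> U q /\ J X Y q != 0 by move=> /QP hq; apply: H1; exact: le_trans rrho.
have C1phi : C1 U phi.
  have oU := chart_open chG.
  have cx := C1B oU (chart_C1x chG) (@C1_cst _ _ U y.1).
  have cy := C1B oU (chart_C1y chG) (@C1_cst _ _ U y.2).
  exact: (C1D oU (C1M oU cx cx) (C1M oU cy cy)).
have Qp : Q p by apply/QP; rewrite subrr normr0 ltW.
have cphi : {within Q, continuous phi}.
  apply: continuous_in_subspaceT => q; rewrite inE => Qq.
  exact: C1_continuous C1phi (QU _ Qq).1.
have [q Qq qmin] := @compact_EVT_min _ _ phi Q (ex_intro _ p Qp) cQ cphi.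
rewrite inE in Qq.
have qr : `|q - p| < r.
  rewrite lt_neqAle ((QP q).1 Qq) andbT; apply/eqP => qr.
  have pp : `|p - p| <= rho by rewrite subrr normr0 ltW.
  have qp : `|q - p| <= rho by rewrite qr.
  have h := H2 p q pp qp; rewrite qr in h.
  have big : r / k <= `|G q - G p| by rewrite ler_pdivrMr// mulrC.
  have := qmin p (mem_set Qp); rewrite leNgt => /negP; apply.
  pose e := r / (4 * k).
  have e0 : 0 < e by rewrite /e divr_gt0// mulr_gt0.
  have [y1 y2] := plane_norm_lt hy; rewrite -/e /= in y1 y2.
  have phip : phi p < 2 * e ^+ 2.
    move: y1 y2; rewrite !ltr_norml /phi expr2 => /andP[? ?] /andP[? ?]; nra.
  have e4 : 4 * e <= `|G q - G p|.
    by apply: le_trans big; rewrite /e le_eqVlt; apply/orP; left; apply/eqP; field; lra.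
  (* On the border some coordinate of [G q] is at least [4 * e] from that of [G p], and [y] is
     within [e] of [G p], which leaves [3 * e]. *)
  have phiq : 9 * e ^+ 2 <= phi q.
    have : 4 * e <= `|X q - X p| \/ 4 * e <= `|Y q - Y p|.
      by move: e4; rewrite prod_normE le_max => /orP[]; [left|right].
    have far (u v w : R) : `|w - u| < e -> 4 * e <= `|v - u| -> 9 * e ^+ 2 <= (v - w) * (v - w).
      rewrite ltr_norml ler_normr expr2 => /andP[? ?] /orP[?|?]; nra.
    have sq (z : R) : 0 <= z * z by rewrite -expr2 sqr_ge0.
    rewrite /phi => -[/(far _ _ _ y1)|/(far _ _ _ y2)] hh.
      by rewrite (le_trans hh)// lerDl.
    by rewrite (le_trans hh)// lerDr.
  have := exprn_gt0 2 e0; lra.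
exists q => //.
have [Uq Jq] := QU _ Qq.
have [dphi _] := C1phi _ Uq.
have [dX _] := chart_C1x chG Uq; have [dY _] := chart_C1y chG Uq.
have crit (e : plane) : `|e| <= 1 -> 'D_e phi q = 0.
  move=> ne; pose h (t : R) := phi (q + t *: e).
  pose eta := r - `|q - p|.
  have eta0 : 0 < eta by rewrite subr_gt0.
  have hin (t : R) : t \in `]- eta, eta[ -> Q (q + t *: e).
    rewrite in_itv/= -ltr_norml => ht; apply/QP.
    rewrite addrAC (le_trans (ler_normD _ _))// normrZ.
    have : `|t| * `|e| <= `|t| by rewrite ler_piMr.
    by rewrite /eta in ht; lra.
  have hd (t : R) : t \in `]- eta, eta[ -> is_derive t (1 : R) h ('D_e phi (q + t *: e)).
    move=> /hin /QU[Ut _]; apply: is_derive_line; apply: diff_derivable.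
    by have [] := C1phi _ Ut.
  have z0 : (0 : R) \in `]- eta, eta[ by rewrite in_itv/= oppr_lt0 eta0.
  have le2 : - eta <= eta by lra.
  have hq (t : R) : t \in `]- eta, eta[ -> h 0 <= h t.
    by move=> /hin Qt; rewrite /h scale0r addr0; apply: qmin; rewrite inE.
  have [_ D0] := derive1_at_min le2 (fun t ht => @ex_derive _ _ _ _ _ _ _ (hd t ht)) z0 hq.
  have [_] := hd 0 z0; rewrite D0 scale0r addr0 => <-; exact: erefl.
have E1 : 'D_e1 phi q = 0.
  by apply: crit; rewrite prod_normE /= normr1 normr0 ge_max lexx ler01.
have E2 : 'D_e2 phi q = 0.
  by apply: crit; rewrite prod_normE /= normr1 normr0 ge_max lexx ler01.
move: E1 E2; rewrite !derive_sqdist; do 4?[exact: diff_derivable].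
move: Jq; rewrite /jacobian_det /chart_map [y]surjective_pairing /=.
move: ('D_e1 X q) ('D_e2 X q) ('D_e1 Y q) ('D_e2 Y q) (X q) (Y q) y.1 y.2.
move=> x1 x2 z1 z2 u v y1 y2 Jq E1 E2.
have [] := cramer2_eq0 Jq E1 E2.
by move=> /subr0_eq -> /subr0_eq ->.
Qed.

(** First-order expansion of the inverse, stated for preimages in a fixed ball because the lower
    bound of the chart is assumed on [T0] only. *)
Lemma chart_inv_expansion p : T0 p -> exists2 rho, 0 < rho &
  forall eps, 0 < eps -> exists2 delta, 0 < delta & forall q, `|q - p| <= rho ->
    `|G q - G p| < delta ->
    `|q.1 - p.1 - inv1 p (G q - G p)| <= eps * `|G q - G p| /\
    `|q.2 - p.2 - inv2 p (G q - G p)| <= eps * `|G q - G p|.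
Proof.
move=> Tp; have [rho rho0 [k k0 [H1 H2 _]]] := chart_local Tp.
exists rho => // eps e0.
have [d d0 Hd] := chart_strict Tp (divr_gt0 e0 k0).
exists (d / k) => [|q qr]; first by rewrite divr_gt0.
rewrite ltr_pdivlMr// mulrC => Gd.
have pp : `|p - p| <= rho by rewrite subrr normr0 ltW.
have qk := H2 p q pp qr.
have pd : `|p - p| < d by rewrite subrr normr0.
have [a1 a2] := Hd p q pd (le_lt_trans qk Gd).
have b : eps / k * `|q - p| <= eps * `|G q - G p|.
  by rewrite mulrAC ler_pdivrMr// -mulrA ler_wpM2l ?(ltW e0)// mulrC.
by split; [exact: le_trans a1 b|exact: le_trans a2 b].
Qed.

Definition std_interior : set plane := [set z | [/\ 0 < z.1, 0 < z.2 & z.1 + z.2 < 1]].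

Lemma std_interior_sub : std_interior `<=` T0.
Proof. by move=> z [/ltW ? /ltW ? /ltW ?]; split. Qed.

Lemma std_interior_open : open std_interior.
Proof.
have -> : std_interior = (fst @^-1` [set x : R | 0 < x]) `&` (snd @^-1` [set x : R | 0 < x]) `&`
      ((fun z : plane => z.1 + z.2) @^-1` [set x : R | x < 1]).
  by apply/seteqP; split=> z; rewrite /std_interior /=; [case|case=> -[]].
have cD : continuous (fun z : plane => z.1 + z.2).
  by move=> z; apply: cvgD; [exact: continuous_fst|exact: continuous_snd].
apply: openI; first apply: openI.
- exact: (continuousP _).1 continuous_fst _ (@open_gt R 0).
- exact: (continuousP _).1 continuous_snd _ (@open_gt R 0).
- exact: (continuousP _).1 cD _ (@open_lt R 1).
Qed.

Lemma chart_image_open (V : set plane) : open V -> V `<=` T0 -> open [set G p | p in V].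
Proof.
move=> oV VT; rewrite openE => _ [p Vp <-].
have [rho rho0 [k k0 [H1 H2 H3]]] := chart_local (VT _ Vp).
have nV : \forall q \near p, V q by apply: open_nbhs_nbhs.
have [d d0 Hd] := near_plane_ball nV.
have r0 : 0 < Num.min rho d by rewrite lt_min rho0.
have {}H3 := H3 (Num.min rho d); rewrite r0 ge_min lexx in H3.
apply/near_planeP; exists (Num.min rho d / (4 * k)).
  by rewrite divr_gt0// mulr_gt0.
move=> x y hx hy; have [//|q + Gq] := H3 isT (x, y); first exact: norm_pair_lt.
by rewrite lt_min => /andP[_ /Hd Vq]; exists q.
Qed.

Lemma chart_image_compact (A : set plane) : compact A -> A `<=` T0 ->
  compact [set G p | p in A].
Proof.
move=> cA AT; apply: continuous_compact => //; apply: continuous_in_subspaceT => p.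
by rewrite inE => /AT /(chart_sub chG); exact: chart_continuous.
Qed.

Lemma chart_ray_ball p (w : plane) : T0 p -> exists2 rho, 0 < rho & forall eps, 0 < eps ->
  \forall t \near (0 : R)^'+, forall q, `|q - p| <= rho -> G q = G p + t *: w ->
    `|q.1 - p.1 - t * inv1 p w| <= eps * t /\ `|q.2 - p.2 - t * inv2 p w| <= eps * t.
Proof.
move=> Tp; have [rho rho0 H] := chart_inv_expansion Tp.
exists rho => // eps e0.
have W0 : 0 < `|w| + 1 by rewrite ltr_wpDl.
have [d d0 Hd] := H _ (divr_gt0 e0 W0).
have m0 : 0 < d / (`|w| + 1) by rewrite divr_gt0.
near=> t => q qr E.
have t0 : 0 < t by near: t; exact: nbhs_right_gt.
have tm : t < d / (`|w| + 1) by near: t; exact: nbhs_right_lt.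
have GE : G q - G p = t *: w by rewrite E addrAC subrr add0r.
have nG : `|G q - G p| = t * `|w| by rewrite GE normrZ gtr0_norm.
have tw : t * `|w| <= t * (`|w| + 1) by rewrite ler_wpM2l ?(ltW t0)// lerDl.
move: tm; rewrite ltr_pdivlMr// => tm2.
have Gd : `|G q - G p| < d by rewrite nG (le_lt_trans tw).
have [] := Hd q qr Gd; rewrite nG GE.
have -> : inv1 p (t *: w) = t * inv1 p w by rewrite /inv1 /= /GRing.scale /=; ring.
have -> : inv2 p (t *: w) = t * inv2 p w by rewrite /inv2 /= /GRing.scale /=; ring.
have b : eps / (`|w| + 1) * (t * `|w|) <= eps * t.
  by rewrite mulrAC ler_pdivrMr// -mulrA ler_wpM2l ?(ltW e0).
by move=> h1 h2; split; [exact: le_trans h1 b|exact: le_trans h2 b].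
Unshelve. all: by end_near. Qed.

(** For preimages in [T0] the lower bound of the chart forces [q] into the ball of [chart_ray_ball]
    once [t] is small. *)
Lemma chart_ray p (w : plane) : T0 p -> forall eps, 0 < eps ->
  \forall t \near (0 : R)^'+, forall q, T0 q -> G q = G p + t *: w ->
    `|q.1 - p.1 - t * inv1 p w| <= eps * t /\ `|q.2 - p.2 - t * inv2 p w| <= eps * t.
Proof.
move=> Tp eps e0; have [rho rho0 /(_ _ e0) H] := chart_ray_ball w Tp.
have C0 : 0 < (c + 1) * (`|w| + 1) by rewrite mulr_gt0// ltr_wpDl// chart_cst_ge0.
have m0 : 0 < rho / ((c + 1) * (`|w| + 1)) by rewrite divr_gt0.
near=> t => q Tq E.
have t0 : 0 < t by near: t; exact: nbhs_right_gt.
have tm : t < rho / ((c + 1) * (`|w| + 1)) by near: t; exact: nbhs_right_lt.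
have GE : G q - G p = t *: w by rewrite E addrAC subrr add0r.
have nG : `|G q - G p| = t * `|w| by rewrite GE normrZ gtr0_norm.
move: tm; rewrite ltr_pdivlMr// => tm1.
have Ht : forall q, `|q - p| <= rho -> G q = G p + t *: w ->
    `|q.1 - p.1 - t * inv1 p w| <= eps * t /\ `|q.2 - p.2 - t * inv2 p w| <= eps * t.
  by near: t.
apply: Ht => //.
apply: (le_trans (chart_lower chG Tq Tp)); rewrite -/(G q) -/(G p) nG.
apply: le_trans (ltW tm1).
have := chart_cst_ge0; have := normr_ge0 w; move: `|w| t0 => n t0 n0 c0.
have : 0 <= t * n by rewrite mulr_ge0// ltW.
have : 0 <= t * c by rewrite mulr_ge0// ltW.
by lra.
Unshelve. all: by end_near. Qed.

Definition push p (v : plane) : plane :=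
  (v.1 * 'D_e1 X p + v.2 * 'D_e2 X p, v.1 * 'D_e1 Y p + v.2 * 'D_e2 Y p).

Lemma inv1_push p v : T0 p -> inv1 p (push p v) = v.1.
Proof.
move=> /chart_det_neq0; rewrite /inv1 /push /jacobian_det /=.
by move: ('D_e1 X p) ('D_e2 X p) ('D_e1 Y p) ('D_e2 Y p) => x1 x2 y1 y2 J0; field.
Qed.

Lemma inv2_push p v : T0 p -> inv2 p (push p v) = v.2.
Proof.
move=> /chart_det_neq0; rewrite /inv2 /push /jacobian_det /=.
by move: ('D_e1 X p) ('D_e2 X p) ('D_e1 Y p) ('D_e2 Y p) => x1 x2 y1 y2 J0; field.
Qed.

Lemma push_inv p w : T0 p -> push p (inv1 p w, inv2 p w) = w.
Proof.
move=> /chart_det_neq0; rewrite /inv2 /inv1 /push /jacobian_det /=.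
move: ('D_e1 X p) ('D_e2 X p) ('D_e1 Y p) ('D_e2 Y p) => x1 x2 y1 y2 J0.
by apply: plane_eq => /=; field.
Qed.

(* An interior image point can be moved in every direction inside the image; seen through
   the inverse chart this excludes points on the three edges. *)
Lemma chart_interior : [set G p | p in T0]° = [set G p | p in std_interior].
Proof.
apply/seteqP; split; last first.
  rewrite -open_subsetE; last by apply: chart_image_open; [exact: std_interior_open|exact: std_interior_sub].
  by apply: image_subset; exact: std_interior_sub.
move=> y yI; have [p Tp pE] := interior_subset yI; exists p => //.
have half0 : 0 < 3^-1 :> R by rewrite invr_gt0.
have move_dir (v : plane) : exists2 t : R, 0 < t & exists q, [/\ T0 q,
     `|q.1 - p.1 - t * v.1| <= 3^-1 * t & `|q.2 - p.2 - t * v.2| <= 3^-1 * t].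
  have H := chart_ray (push p v) Tp half0.
  have K : \forall t \near (0 : R)^'+, [set G p | p in T0] (G p + t *: push p v).
    have cl : (fun t : R => G p + t *: push p v) @ (0 : R) --> (G p + 0 *: push p v).
      exact: line_continuous.
    have Z : \forall t \near (0 : R), [set G p | p in T0] (G p + t *: push p v).
      by apply: cl; rewrite scale0r addr0 pE.
    exact: cvg_at_right_filter Z.
  have [t [t0 [Ht [q Tq Eq]]]] := filter_ex (filterI (@nbhs_right_gt R 0) (filterI H K)).
  exists t => //; exists q; have := Ht q Tq Eq.
  by rewrite inv1_push// inv2_push// => -[].
case: Tp => p1 p2 p12; clear y yI pE; split.
- rewrite lt_neqAle p1 andbT; apply/eqP => E.
  have [t t0 [q [[q1 _ _]]]] := move_dir (-1, 0).
  by rewrite /= -E !ler_norml => /andP[? ?] _; lra.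
- rewrite lt_neqAle p2 andbT; apply/eqP => E.
  have [t t0 [q [[_ q2 _] _]]] := move_dir (0, -1).
  by rewrite /= -E !ler_norml => /andP[? ?]; lra.
- rewrite lt_neqAle p12 andbT; apply/eqP => E.
  have [t t0 [q [[_ _ q12]]]] := move_dir (1, 1).
  by rewrite /= !ler_norml => /andP[? ?] /andP[? ?]; lra.
Qed.

Lemma norm_sum_bounds (a b eps : R) : 0 < eps -> let M := `|a| + `|b| + eps + eps + 1 in
  [/\ `|a| + eps <= M, `|b| + eps <= M, `|a + b| + 2 * eps <= M & 0 < M].
Proof.
move=> eps0 M; have := normr_ge0 a; have := normr_ge0 b; have := ler_normD a b.
by rewrite /M; move: `|a| `|b| `|a + b| => *; split; lra.
Qed.

(** Either the coordinate starts at zero and grows at rate [a], which beats the error [eps], or it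
    starts above the gap [g], which [t] is too small to consume. *)
Lemma ray_coord_gt0 (t eps a g x y : R) : 0 < t -> (x = 0 -> eps < a) ->
  t * (`|a| + eps) < g -> x = 0 \/ g <= x -> - (eps * t) <= y - x - t * a -> 0 < y.
Proof.
move=> t0 xa tg [x0|gx] h.
  have : t * eps < t * a by rewrite ltr_pM2l// xa.
  by move: h; rewrite x0 [eps * t]mulrC; lra.
have ta : t * - a <= t * `|a| by rewrite ler_pM2l// -normrN ler_norm.
by move: h tg ta gx; rewrite mulrDr [eps * t]mulrC mulrN; lra.
Qed.

Lemma ray_sum_lt1 (t eps a b g x1 x2 y1 y2 : R) : 0 < t ->
  (x1 + x2 = 1 -> a + b < - (2 * eps)) -> t * (`|a + b| + 2 * eps) < g ->
  1 - (x1 + x2) = 0 \/ g <= 1 - (x1 + x2) -> y1 - x1 - t * a <= eps * t ->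
  y2 - x2 - t * b <= eps * t -> y1 + y2 < 1.
Proof.
move=> t0 xa tg xg h1 h2; rewrite -subr_gt0.
apply: (@ray_coord_gt0 t (2 * eps) (- (a + b)) g (1 - (x1 + x2))) => //.
- by move=> x0; rewrite ltrNr; apply: xa; move: x0; lra.
- by rewrite normrN.
- by move: h1 h2; rewrite mulrN mulrDr -mulrA; lra.
Qed.

(** The pulled-back direction must point strictly inward only at the edges that contain [p]. Local
    surjectivity supplies preimages of the points on the ray, and the ray expansion keeps their
    barycentric coordinates positive. *)
Lemma chart_inward p (w : plane) : T0 p ->
  (p.1 = 0 -> 0 < inv1 p w) -> (p.2 = 0 -> 0 < inv2 p w) ->
  (p.1 + p.2 = 1 -> inv1 p w + inv2 p w < 0) ->
  \forall t \near (0 : R)^'+, [set G p | p in std_interior] (G p + t *: w).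
Proof.
move=> Tp w1 w2 w3.
pose a := inv1 p w; pose b := inv2 p w.
have [eps e0 [h1 h2 h3]] : exists2 eps : R, 0 < eps & [/\ p.1 = 0 -> eps < a,
    p.2 = 0 -> eps < b & p.1 + p.2 = 1 -> a + b < - (2 * eps)].
  (* A quantity that is not positive belongs to an edge not containing [p] and is replaced by 1; the
     divisor 3 leaves room for the factor 2 in the third condition. *)
  pose m (x : R) := if 0 < x then x / 3 else 1.
  have m0 x : 0 < m x by rewrite /m; case: ifP => // x0; rewrite divr_gt0.
  exists (Num.min (m a) (Num.min (m b) (m (- (a + b))))); first by rewrite !lt_min !m0.
  split=> h.
  - by rewrite gt_min /m (w1 h); apply/orP; left; have := w1 h; rewrite -/a; lra.
  - by rewrite !gt_min /m (w2 h); apply/orP; right; apply/orP; left; have := w2 h; rewrite -/b; lra.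
  - have ab : 0 < - (a + b) by have := w3 h; rewrite -/a -/b; lra.
    have : Num.min (m a) (Num.min (m b) (m (- (a + b)))) <= m (- (a + b)).
      by rewrite !ge_min lexx !orbT.
    have -> : m (- (a + b)) = - (a + b) / 3 by rewrite /m ab.
    lra.
have [rho rho0 H] := chart_ray_ball w Tp.
have [rho' rho0' [k k0 [_ _ H3]]] := chart_local Tp.
pose r := Num.min rho rho'.
have r0 : 0 < r by rewrite lt_min rho0.
have rr : 0 < r <= rho' by rewrite r0 ge_min lexx orbT.
have W0 : 0 < `|w| + 1 by rewrite ltr_wpDl.
pose M := `|a| + `|b| + eps + eps + 1.
have [Ma Mb Mab M0] : [/\ `|a| + eps <= M, `|b| + eps <= M, `|a + b| + 2 * eps <= M & 0 < M].
  exact: norm_sum_bounds.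
have pos (x : R) : 0 <= x -> exists2 g : R, 0 < g & (x = 0 \/ g <= x).
  by rewrite le_eqVlt => /orP[/eqP <-|x0]; [exists 1 => //; left|exists x => //; right].
case: (Tp) => p1 p2 p12.
have [g1 g10 G1] := pos _ p1; have [g2 g20 G2] := pos _ p2.
have p12' : 0 <= 1 - (p.1 + p.2) by rewrite subr_ge0.
have [g3 g30 G3] := pos _ p12'.
near=> t.
have t0 : 0 < t by near: t; exact: nbhs_right_gt.
have tr : t * (`|w| + 1) < r / (4 * k).
  rewrite -ltr_pdivlMr//; near: t; apply: nbhs_right_lt.
  by rewrite divr_gt0// divr_gt0// mulr_gt0.
have tg1 : t * M < g1 by rewrite -ltr_pdivlMr//; near: t; apply: nbhs_right_lt; rewrite divr_gt0.
have tg2 : t * M < g2 by rewrite -ltr_pdivlMr//; near: t; apply: nbhs_right_lt; rewrite divr_gt0.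
have tg3 : t * M < g3 by rewrite -ltr_pdivlMr//; near: t; apply: nbhs_right_lt; rewrite divr_gt0.
have Ht : forall q, `|q - p| <= rho -> G q = G p + t *: w ->
    `|q.1 - p.1 - t * inv1 p w| <= eps * t /\ `|q.2 - p.2 - t * inv2 p w| <= eps * t.
  by near: t; exact: H.
have [|q qr Gq] := H3 r rr (G p + t *: w).
  rewrite addrAC subrr add0r normrZ gtr0_norm//.
  by apply: le_lt_trans tr; rewrite ler_wpM2l ?(ltW t0)// lerDl.
exists q => //.
have qrho : `|q - p| <= rho by apply: (ltW (lt_le_trans qr _)); rewrite /r ge_min lexx.
have [] := Ht q qrho Gq; rewrite -/a -/b !ler_norml => /andP[q1 q1'] /andP[q2 q2'].
split.
- exact: ray_coord_gt0 t0 h1 (le_lt_trans (ler_wpM2l (ltW t0) Ma) tg1) G1 q1.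
- exact: ray_coord_gt0 t0 h2 (le_lt_trans (ler_wpM2l (ltW t0) Mb) tg2) G2 q2.
- exact: ray_sum_lt1 t0 h3 (le_lt_trans (ler_wpM2l (ltW t0) Mab) tg3) G3 q1' q2'.
Unshelve. all: by end_near. Qed.

End Charts.

(** * Green's formula on a chart *)

Section AlmostDisjointUnion.
Context d {T : measurableType d} {R : realType} (mu : {measure set T -> \bar R}).

Lemma Rintegral_null (A : set T) (f : T -> R) : measurable A -> mu A = 0%E ->
  measurable_fun A f -> \int[mu]_(x in A) f x = 0.
Proof.
move=> mA A0 mf; rewrite /Rintegral null_set_integral//.
exact/measurable_realfun.measurable_EFinP.
Qed.

Lemma Rintegral_setU_null (A B : set T) (f : T -> R) : measurable A -> measurable B ->
  mu.-integrable (A `|` B) (EFin \o f) -> mu (A `&` B) = 0%E ->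
  \int[mu]_(x in A `|` B) f x = \int[mu]_(x in A) f x + \int[mu]_(x in B) f x.
Proof.
move=> mA mB mf AB0.
have mBA : measurable (B `\` A) by exact: measurableD.
have iB : mu.-integrable B (EFin \o f).
  by apply: integrableS mf => //; exact: measurableU.
have E : A `|` B = A `|` (B `\` A).
  by apply/seteqP; split=> x; [move=> [?|?]; [left|have [?|?] := pselect (A x); [left|right]]|move=> [?|[? ?]]; [left|right]].
rewrite [in LHS]E Rintegral_setU//; last 2 first.
- by rewrite -E.
- by apply/disj_setPS => x [? []].
congr (_ + _).
have E2 : B = (B `\` A) `|` (A `&` B).
  by apply/seteqP; split=> x; [move=> Bx; have [?|?] := pselect (A x); [right|left]|move=> [[]|[]]].
rewrite [in RHS]E2 Rintegral_setU//.
- rewrite [X in _ + X]Rintegral_null ?addr0//; first exact: measurableI.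
  apply/measurable_realfun.measurable_EFinP; apply: measurable_int.
  by apply: (integrableS mB _ _ iB) => //; exact: measurableI.
- exact: measurableI.
- by rewrite -E2.
- by apply/disj_setPS => x [[_ ?] []].
Qed.

End AlmostDisjointUnion.

Section PlaneIntegrable.
Context {R : realType}.
Local Notation mu := (@lebesgue_measure R).
Local Notation plane := (R * R)%type.

Lemma plane_within_measurable (K : set plane) (f : plane -> R) : measurable K ->
  {within K, continuous f} -> measurable_fun K f.
Proof.
move=> mK /continuousP cf; apply: (measurability _ (measurable_realfun.RGenOpens.measurableE R)).
move=> _ [_ [a [b ->] <-]].
have /cf/open_subspaceP[V oV VK] : open (`]a, b[%classic : set R) by exact: interval_open.
by rewrite setIC -VK; apply: measurableI => //; exact: plane_open_measurable.
Qed.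

Lemma area_le (A B : set plane) : measurable A -> measurable B -> A `<=` B ->
  (area A <= area B)%E.
Proof. by move=> mA mB AB; apply: (@le_measure _ _ _ (mu \x mu)%E); rewrite ?inE. Qed.

Lemma area_compact_lty (K : set plane) : compact K -> (area K < +oo)%E.
Proof.
move=> cK; have mK := plane_compact_measurable cK.
have [M [Mr HM]] := compact_bounded cK.
pose m := `|M| + 1.
have KB : K `<=` `[- m, m]%classic `*` `[- m, m]%classic.
  move=> z /(HM m) hz.
  have /hz/plane_norm_le[] : M < m by rewrite /m (le_lt_trans (ler_norm _))// ltrDl.
  by rewrite !ler_norml => ? ?; split; rewrite /= in_itv.
apply: (@le_lt_trans _ _ (area (`[- m, m]%classic `*` `[- m, m]%classic))).
  by apply: area_le => //; apply: measurableX; exact: measurable_itv.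
have m0 : 0 <= m by rewrite /m addr_ge0.
by rewrite area_box ?ltry//; lra.
Qed.

Lemma plane_within_integrable (K : set plane) (f : plane -> R) : compact K ->
  {within K, continuous f} -> (mu \x mu)%E.-integrable K (EFin \o f).
Proof.
move=> cK cf; have mK := plane_compact_measurable cK.
apply: measurable_bounded_integrable => //.
- exact: area_compact_lty.
- exact: plane_within_measurable.
- have [M [Mr HM]] := compact_bounded (continuous_compact cf cK).
  by exists M; split=> // x Mx y Ky; apply: (HM x Mx); exists y.
Qed.

End PlaneIntegrable.

Section Green.
Context {R : realType}.
Local Notation mu := (@lebesgue_measure R).
Local Notation plane := (R * R)%type.
Local Notation T0 := (@std_triangle R).
Variables (X Y : plane -> R) (U : set plane) (s c : R).
Hypothesis chG : chart X Y U s c.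
Implicit Types (f g : plane -> R).
Local Notation G := (chart_map X Y).
Local Notation J := (jacobian_det X Y).

(** By the lower bound the inverse chart is Lipschitz on the image, so continuity passes from the
    pullback [h] to [H]. *)
Lemma chart_within_continuous (h H : plane -> R) :
  (forall p, T0 p -> {for p, continuous h}) -> (forall p, T0 p -> H (G p) = h p) ->
  {within [set G p | p in T0], continuous H}.
Proof.
move=> ch Hh; apply/subspace_continuousP => _ [p Tp <-].
apply/cvgrPdist_le => e e0.
have cp : h q @[q --> p] --> h p by exact: ch.
have nh : \forall q \near p, `|h p - h q| <= e by exact: cvgr_dist_le cp _ e0.
have [d d0 Hd] := near_plane_ball nh.
have C0 : 0 < c + 1 by rewrite ltr_wpDl// (chart_cst_ge0 chG).
rewrite near_withinE; apply/near_planeP.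
exists (d / (c + 1)) => [|x y hx hy [q Tq E]]; first by rewrite divr_gt0.
rewrite -[X in `|X - _|]/(H (G p)) -[X in `|_ - X|]/(H (x, y)).
rewrite -E !Hh//; apply: Hd; apply: le_lt_trans (chart_lower chG Tq Tp) _.
rewrite -/(G q) -/(G p) E.
have : `|(x, y) - G p| < d / (c + 1) by apply: norm_pair_lt.
rewrite ltr_pdivlMr// mulrC; apply: le_lt_trans.
by rewrite ler_wpM2r// lerDl.
Qed.

Lemma chart_segment_null p d : in_seg T0 p d ->
  area [set G (p + t *: d) | t in `[0, 1]%classic] = 0%E.
Proof.
move=> sT.
have cS : compact [set p + t *: d | t in `[0, 1]%classic].
  apply: continuous_compact; last exact: segment_compact.
  by apply: continuous_subspaceT; exact: line_continuous.
have cG : compact [set G (p + t *: d) | t in `[0, 1]%classic].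
  rewrite -[X in compact X](image_comp (fun t : R => p + t *: d) G).
  by apply: (chart_image_compact chG) => // _ [t t01 <-]; exact: sT.
have sU t : t \in `[0, 1] -> U (p + t *: d) by move=> /sT; exact: (chart_sub chG).
have der (f : plane -> R) : C1 U f -> exists2 M : R, 0 <= M & forall a b : R,
    a \in `[0, 1] -> b \in `[0, 1] -> `|f (p + a *: d) - f (p + b *: d)| <= M * `|a - b|.
  move=> Cf.
  have cD (t : R) : t \in `[0, 1] -> {for t, continuous (fun t : R => 'D_d f (p + t *: d))}.
    move=> /sU /Cf[_ df]; apply: (@continuous_comp _ _ _ (fun t : R => p + t *: d) ('D_d f)).
      exact: line_continuous.
    exact: df.
  have [M [_ HM]] := compact_bounded (continuous_compact (continuous_itv_within cD) (@segment_compact R 0 1)).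
  exists (`|M| + 1) => [|a b]; first by rewrite addr_ge0.
  wlog ab : a b / a <= b.
    move=> h ha hb; have [/h|/ltW/h] := leP a b; first exact.
    by rewrite distrC (distrC a); apply.
  move=> ha hb.
  have sub (t : R) : t \in `[a, b] -> t \in `[0, 1] :> Prop.
    by move: ha hb; rewrite !in_itv/= => /andP[? ?] /andP[? ?] /andP[? ?]; apply/andP; split; lra.
  have dh (t : R) : t \in `[a, b] -> is_derive t (1 : R) (fun t : R => f (p + t *: d)) ('D_d f (p + t *: d)).
    move=> /sub /sU /Cf[df _]; apply: is_derive_line; exact: diff_derivable.
  have dh' (t : R) : t \in `]a, b[ -> is_derive t (1 : R) (fun t : R => f (p + t *: d)) ('D_d f (p + t *: d)).
    by move=> h; apply: dh; apply: subset_itv_oo_cc h.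
  have ch : {within `[a, b], continuous (fun t : R => f (p + t *: d))}.
    by apply: derivable_within_continuous => t /dh[].
  have [t tab E] := MVT_segment ab dh' ch.
  rewrite distrC E normrM (distrC a) ler_wpM2r//.
  apply: HM; first by rewrite (le_lt_trans (ler_norm _))// ltrDl.
  by exists t => //=; exact: sub.
have [M1 M10 H1] := der _ (chart_C1x chG).
have [M2 M20 H2] := der _ (chart_C1y chG).
apply: (@lipschitz_curve_null _ (fun t => G (p + t *: d)) (Num.max M1 M2)).
- by rewrite le_max M10.
- move=> a b ha hb; split.
    by apply: (le_trans (H1 _ _ ha hb)); rewrite ler_wpM2r// le_max lexx.
  by apply: (le_trans (H2 _ _ ha hb)); rewrite ler_wpM2r// le_max lexx orbT.
- exact: plane_compact_measurable.
Qed.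

Lemma std_triangle_connected : connected T0.
Proof.
have -> : T0 = \bigcup_(z in T0) [set t *: z | t in `[0, 1]%classic].
  apply/seteqP; split=> [z Tz|_ [z Tz [t /= t01 <-]]].
    by exists z => //; exists 1; rewrite /= ?in_itv/= ?ler01 ?lexx// scale1r.
  have := std_triangle_convex (@std_triangle0 R) Tz t01.
  by rewrite add0r subr0.
apply: bigcup_connected.
  exists 0 => z _; exists 0; rewrite /= ?in_itv/= ?ler01 ?lexx//.
  by rewrite scale0r.
move=> z _; apply: connected_continuous_connected.
  by apply/connected_intervalP; exact: interval_is_interval.
apply: continuous_subspaceT => t; apply: cvgZr_tmp; exact: cvg_id.
Qed.

Lemma tri_interior_open q r : r != 0 -> open [set q + r *: z | z in @std_interior R].
Proof.
move=> r0; have -> : [set q + r *: z | z in @std_interior R] =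
    (fun w : plane => r^-1 *: w - r^-1 *: q) @^-1` (@std_interior R).
  apply/seteqP; split=> [_ [z Tz <-]|w /= hw].
    by rewrite /= scalerDr addrAC subrr add0r scalerA mulVf// scale1r.
  exists (r^-1 *: w - r^-1 *: q) => //.
  by rewrite -scalerBr scalerA divff// scale1r subrKC.
apply: (continuousP _).1; last exact: std_interior_open.
by move=> w; apply: cvgB; [exact: scaler_continuous|exact: cvg_cst].
Qed.

Lemma push_comb p (r : R) (z : plane) :
  z.1 *: push X Y p (r *: e1) + z.2 *: push X Y p (r *: e2) = push X Y p (r *: z).
Proof.
apply: plane_eq; rewrite /= /GRing.scale /=.
  by move: ('D__ X p) ('D__ X p) => *; ring.
by move: ('D__ Y p) ('D__ Y p) => *; ring.
Qed.

Lemma push_det p (r b : R) :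
  (b *: push X Y p (r *: e1)).1 * (b *: push X Y p (r *: e2)).2 -
  (b *: push X Y p (r *: e1)).2 * (b *: push X Y p (r *: e2)).1 = b ^+ 2 * (r ^+ 2 * J p).
Proof.
rewrite /push /jacobian_det /= /GRing.scale /=.
by move: ('D__ X p) ('D__ X p) ('D__ Y p) ('D__ Y p) => *; ring.
Qed.

(** A point within [e] of [T0] lies in [- e + (1 + 4 * e) T0]: after the shift by [e] its coordinate
    sum is at most [1 + 4 * e]. *)
Lemma std_triangle_rescale_out (e : R) (w z : plane) : 0 < 1 + 4 * e -> T0 z ->
  `|w.1 - z.1| <= e -> `|w.2 - z.2| <= e ->
  T0 ((w.1 + e) / (1 + 4 * e), (w.2 + e) / (1 + 4 * e)).
Proof.
move=> b0 [z1 z2 z12]; rewrite !ler_norml => /andP[? ?] /andP[? ?].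
by split; rewrite /= -?mulrDl ?ler_pdivrMr ?divr_ge0//; lra.
Qed.

(** A perturbed centroid stays in the shrunken triangle; it provides the point at which the
    connectedness argument starts. *)
Lemma std_triangle_rescale_in (e : R) (w : plane) : e <= 1 / 24 -> 0 < 1 - 7 * e ->
  `|w.1 - 1 / 3| <= e -> `|w.2 - 1 / 3| <= e ->
  T0 ((w.1 - 2 * e) / (1 - 7 * e), (w.2 - 2 * e) / (1 - 7 * e)).
Proof.
move=> e24 b0; rewrite !ler_norml => /andP[? ?] /andP[? ?].
by split; rewrite /= -?mulrDl ?ler_pdivrMr ?divr_ge0//; lra.
Qed.

(** A point of [2 * e + (1 - 7 * e) T0] has coordinates at least [2 * e] and coordinate sum at most
    [1 - 3 * e], so a perturbation by [e] leaves a margin [e] at every edge. *)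
Lemma std_interior_shrink (e : R) (z z' : plane) : 0 < e -> 0 < 1 - 7 * e -> T0 z' ->
  `|2 * e + (1 - 7 * e) * z'.1 - z.1| <= e -> `|2 * e + (1 - 7 * e) * z'.2 - z.2| <= e ->
  std_interior z.
Proof.
move=> e0 b7 [z1 z2 z12]; rewrite !ler_norml => /andP[? ?] /andP[? ?].
have p1 := mulr_ge0 (ltW b7) z1; have p2 := mulr_ge0 (ltW b7) z2.
have : (1 - 7 * e) * (z'.1 + z'.2) <= 1 - 7 * e by rewrite ler_piMr// ltW.
by rewrite mulrDr => ?; split; lra.
Qed.

(* Small triangles are mapped onto almost affine ones: the image lies between two
   dilations of the affine image, the inner inclusion by a connectedness argument. *)
Lemma area_chart_tri p : T0 p -> forall eps, 0 < eps -> exists2 delta, 0 < delta &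
  forall q r, r != 0 -> tri q r p -> tri q r `<=` T0 -> `|r| < delta ->
    `|fine (area [set G z | z in tri q r]) - `|J p| * r ^+ 2 / 2| <= eps * r ^+ 2.
Proof.
move=> Tp eps eps0.
have nJ : 0 < `|J p| by rewrite normr_gt0; exact: (chart_det_neq0 chG).
(* The dilation factors will be [1 + 4 * e] and [1 - 7 * e]; for [e <= 1 / 24] their squares differ
   from 1 by less than [20 * e]. *)
pose e := Num.min (1 / 24) (eps / (20 * `|J p|)).
have e0 : 0 < e by rewrite lt_min; apply/andP; split; rewrite divr_gt0// mulr_gt0.
have e24 : e <= 1 / 24 by rewrite ge_min lexx.
have eeps : 20 * e * `|J p| <= eps.
  by rewrite mulrAC mulrC -ler_pdivlMr ?mulr_gt0// ge_min lexx orbT.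
have [d d0 Hd] := chart_strict chG Tp e0.
exists d => // q r r0 tp tT rd.
have nr : 0 < `|r| by rewrite normr_gt0.
have qt : tri q r q by exists 0; [exact: std_triangle0|rewrite scaler0 addr0].
have dist w : tri q r w -> `|w - p| < d.
  by move=> tw; have [? ?] := tri_dist tp tw; apply: le_lt_trans rd; exact: norm_pair_le.
(* The affine map with the value of the chart at [q] and its differential at [p]; strict
   differentiability covers the mismatch of the two points. *)
pose A (z : plane) := G q + (z.1 *: push X Y p (r *: e1) + z.2 *: push X Y p (r *: e2)).
have inv1A z : inv1 X Y p (A z - G q) = r * z.1.
  by rewrite /A addrAC subrr add0r push_comb (inv1_push chG).
have inv2A z : inv2 X Y p (A z - G q) = r * z.2.
  by rewrite /A addrAC subrr add0r push_comb (inv2_push chG).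
have Ainj z z' : A z = A z' -> z = z'.
  move=> E; apply: plane_eq; apply: (mulfI r0); first by rewrite -!inv1A E.
  by rewrite -!inv2A E.
have Gz z : T0 z -> exists2 w : plane, G (q + r *: z) = A w &
    `|w.1 - z.1| <= e /\ `|w.2 - z.2| <= e.
  move=> Tz; have tz : tri q r (q + r *: z) by exists z.
  have [a1 a2] := Hd q (q + r *: z) (dist _ qt) (dist _ tz).
  pose v := G (q + r *: z) - G q.
  exists (r^-1 * inv1 X Y p v, r^-1 * inv2 X Y p v).
    rewrite /A push_comb.
    have -> : r *: (r^-1 * inv1 X Y p v, r^-1 * inv2 X Y p v) = (inv1 X Y p v, inv2 X Y p v).
      by apply: plane_eq; exact: mulVKf.
    by rewrite (push_inv chG)// /v subrKC.
  have nz : `|q + r *: z - q| <= `|r|.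
    have [? ?] := tri_dist qt tz; exact: norm_pair_le.
  move: a1 a2; rewrite -/v /= /GRing.scale /= ![_ + r * _ - _]addrAC !subrr !add0r.
  have k (x : R) (i : R) : `|r * x - i| <= e * `|q + r *: z - q| -> `|r^-1 * i - x| <= e.
    move=> h; have : `|r| * `|r^-1 * i - x| <= e * `|r|.
      rewrite -normrM mulrBr mulrA divff// mul1r distrC (le_trans h)// ler_wpM2l// ltW//.
    by rewrite mulrC ler_pM2r.
  by rewrite ![- _ + _]addrC => h1 h2; split; exact: k.
have cA : compact [set G z | z in tri q r] by apply: (chart_image_compact chG); [exact: tri_compact|].
have mA := plane_compact_measurable cA.
have areaA (a b : R) : b != 0 -> area [set A (a + b * z.1, a + b * z.2) | z in T0] =
    (b ^+ 2 * (r ^+ 2 * `|J p|) / 2)%:E.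
  move=> b0.
  have D0 : b ^+ 2 * (r ^+ 2 * J p) != 0 by rewrite !mulf_neq0 ?expf_neq0// -normr_gt0.
  have -> : [set A (a + b * z.1, a + b * z.2) | z in T0] =
     [set (A (a, a) + (z.1 *: (b *: push X Y p (r *: e1)) + z.2 *: (b *: push X Y p (r *: e2)))) | z in T0].
    apply: eq_imagel => z _; rewrite /A /= -addrA; congr (_ + _).
    by rewrite addrACA !scalerA -!scalerDl ![_ * b]mulrC.
  by rewrite area_triangle push_det// (normrM (b ^+ 2)) (normrM (r ^+ 2)) !(ger0_norm (sqr_ge0 _)).
have outer : [set G z | z in tri q r] `<=` [set A (- e + (1 + 4 * e) * z.1, - e + (1 + 4 * e) * z.2) | z in T0].
  move=> _ [_ [z Tz <-] <-]; have [w -> [w1 w2]] := Gz z Tz.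
  have b0 : 0 < 1 + 4 * e by lra.
  exists ((w.1 + e) / (1 + 4 * e), (w.2 + e) / (1 + 4 * e)).
    exact: std_triangle_rescale_out b0 Tz w1 w2.
  by congr A; apply: plane_eq => /=; field; lra.
have b7 : 0 < 1 - 7 * e by lra.
pose C := [set A (2 * e + (1 - 7 * e) * z.1, 2 * e + (1 - 7 * e) * z.2) | z in T0].
have contA (a b : R) : continuous (fun z : plane => A (a + b * z.1, a + b * z.2)).
  move=> z; apply: cvgD; first exact: cvg_cst.
  apply: cvgD; apply: cvgZr_tmp => /=; (apply: cvgD; first exact: cvg_cst);
    (apply: cvgM; first exact: cvg_cst).
    exact: continuous_fst.
  exact: continuous_snd.
(* The part of the connected set [C] inside the image is nonempty, closed, and open in [C]: by the
   margin of [std_interior_shrink] its points come from the open triangle, whose image is open. *)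
have inner : C `<=` [set G z | z in tri q r].
  have cC : connected C.
    apply: connected_continuous_connected; first exact: std_triangle_connected.
    by apply: continuous_subspaceT; exact: contA.
  have key w : C (G w) -> tri q r w -> [set q + r *: z | z in @std_interior R] w.
    move=> [z' Tz' E] [z Tz Ew].
    exists z => //; have [w' Ew' [w1 w2]] := Gz z Tz.
    move: E; rewrite -Ew Ew' => /Ainj E; move: w1 w2; rewrite -E /=.
    exact: (std_interior_shrink e0 b7 Tz').
  have E := cC (C `&` [set G z | z in tri q r]).
  have -> : C = C `&` [set G z | z in tri q r]; last by move=> ? [].
  apply/esym/E.
  - pose z0 : plane := (1 / 3, 1 / 3).
    have Tz0 : T0 z0 by split; rewrite /z0 /=; lra.
    have [w Ew [w1 w2]] := Gz z0 Tz0.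
    exists (A w); split; last by exists (q + r *: z0) => //; exists z0.
    exists ((w.1 - 2 * e) / (1 - 7 * e), (w.2 - 2 * e) / (1 - 7 * e)).
      exact: std_triangle_rescale_in e24 b7 w1 w2.
    by congr A; apply: plane_eq => /=; field; lra.
  - exists [set G z | z in [set q + r *: z | z in @std_interior R]].
      apply: (chart_image_open chG); first exact: tri_interior_open.
      by move=> _ [z /std_interior_sub Tz <-]; apply: tT; exists z.
    apply/seteqP; split=> y [Cy [w tw Ew]]; split => //; exists w => //.
      by apply: key => //; rewrite Ew.
    by case: tw => z /std_interior_sub Tz <-; exists z.
  - exists [set G z | z in tri q r] => //.
    by apply: compact_closed => //; exact: plane_hausdorff.
have compI (a b : R) : measurable [set A (a + b * z.1, a + b * z.2) | z in T0].
  apply: plane_compact_measurable; apply: continuous_compact; last exact: std_triangle_compact.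
  by apply: continuous_subspaceT; exact: contA.
have Alty := area_compact_lty cA.
have Afin : area [set G z | z in tri q r] \is a fin_num.
  by rewrite ge0_fin_numE//; exact: (@measure_ge0 _ _ _ (mu \x mu)%E).
have up : fine (area [set G z | z in tri q r]) <= (1 + 4 * e) ^+ 2 * (r ^+ 2 * `|J p|) / 2.
  rewrite -lee_fin fineK// -(areaA (- e)); last by rewrite gt_eqF//; lra.
  by apply: area_le => //; exact: compI.
have lo : (1 - 7 * e) ^+ 2 * (r ^+ 2 * `|J p|) / 2 <= fine (area [set G z | z in tri q r]).
  rewrite -lee_fin fineK// -(areaA (2 * e)); last by rewrite gt_eqF.
  by apply: area_le => //; exact: compI.
have rJ : 0 <= r ^+ 2 * `|J p| by rewrite mulr_ge0 ?sqr_ge0.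
have ee : e * e <= e / 24 by rewrite ler_wpM2l ?(ltW e0)//; lra.
have fin : 20 * e * (r ^+ 2 * `|J p|) <= eps * r ^+ 2.
  rewrite [r ^+ 2 * _]mulrC mulrA ler_wpM2r ?sqr_ge0//.
move: up lo fin; have -> : `|J p| * r ^+ 2 / 2 = (r ^+ 2 * `|J p|) / 2 by ring.
have -> : (1 + 4 * e) ^+ 2 = 1 + 8 * e + 16 * (e * e) by ring.
have -> : (1 - 7 * e) ^+ 2 = 1 - 14 * e + 49 * (e * e) by ring.
move: (r ^+ 2 * `|J p|) rJ (fine _) (eps * _) => x x0 a rhs up lo fin.
have ex : 0 <= e * x by rewrite mulr_ge0// ltW.
have eex : e * e * x <= e / 24 * x by rewrite ler_wpM2r.
have ee0 : 0 <= e * e * x by rewrite -expr2 mulr_ge0// sqr_ge0.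
by rewrite ler_norml; apply/andP; split; clear -up lo fin ex eex ee0; lra.
Qed.

Lemma area_sub_null (A B : set plane) : measurable A -> measurable B -> A `<=` B ->
  area B = 0%E -> area A = 0%E.
Proof.
move=> mA mB AB B0; apply/eqP; rewrite eq_le; apply/andP; split.
  by rewrite -B0; exact: area_le.
exact: (@measure_ge0 _ _ _ (mu \x mu)%E).
Qed.

Lemma area_setU_null (A B : set plane) : measurable A -> measurable B ->
  area A = 0%E -> area B = 0%E -> area (A `|` B) = 0%E.
Proof.
move=> mA mB A0 B0; apply/eqP; rewrite eq_le; apply/andP; split; last first.
  exact: (@measure_ge0 _ _ _ (mu \x mu)%E).
have := @measureU2 _ _ _ (mu \x mu)%E A B mA mB.
by rewrite -[X in (_ <= X + _)%E]/(area A) -[X in (_ <= _ + X)%E]/(area B) A0 B0 adde0.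
Qed.

Lemma area_integral_setU (A B : set plane) (H : plane -> R) :
  measurable A -> measurable B -> (mu \x mu)%E.-integrable (A `|` B) (EFin \o H) ->
  area (A `&` B) = 0%E ->
  \int[area]_(y in A `|` B) H y = \int[area]_(y in A) H y + \int[area]_(y in B) H y.
Proof. by move=> mA mB iH AB0; exact: (@Rintegral_setU_null _ _ R (mu \x mu)%E A B H mA mB iH AB0). Qed.

Lemma Rintegral_near_cst (A : set plane) (H : plane -> R) (h e : R) : compact A ->
  {within A, continuous H} -> (forall y, A y -> `|H y - h| <= e) ->
  `|\int[area]_(y in A) H y - h * fine (area A)| <= e * fine (area A).
Proof.
move=> cA cH He; have mA := plane_compact_measurable cA.
have iH := plane_within_integrable cA cH.
have cc (k : R) : {within A, continuous (cst k : plane -> R)}.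
  by apply: continuous_subspaceT; exact: cst_continuous.
have cd : {within A, continuous (fun y => H y - h)}.
  by move=> y; apply: cvgB; [exact: cH|exact: cst_continuous].
have ih := plane_within_integrable cA (cc h).
have <- : \int[(mu \x mu)%E]_(y in A) (cst h y) = h * fine (area A) by rewrite Rintegral_cst.
have <- : \int[(mu \x mu)%E]_(y in A) (cst e y) = e * fine (area A) by rewrite Rintegral_cst.
rewrite -(RintegralB (mu := (mu \x mu)%E) mA iH ih).
apply: le_trans (le_normr_Rintegral (mu := (mu \x mu)%E) mA (plane_within_integrable cA cd)) _.
apply: (le_Rintegral (mu := (mu \x mu)%E)) => //.
- apply: plane_within_integrable => // y; apply: cvg_norm; exact: cd.
- exact: plane_within_integrable.
Qed.

(** The difference of the two sides is fed to [goursat]. It is additive because the pieces of the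
    image overlap in null curves. On a small triangle at [p] both sides are close to
    [H (G p) * |J p| * r ^+ 2 / 2]; the factor [s] is the sign of the Jacobian. *)
Theorem green f g (H : plane -> R) : C1 U f -> C1 U g ->
  (forall p, T0 p -> H (G p) * J p = jacobian_det f g p) ->
  \int[area]_(y in [set G p | p in T0]) H y = s * tri_integral f g 0 1.
Proof.
move=> Cf Cg HJ.
pose img q r := [set G z | z in tri q r].
have T1 : tri 0 1 = T0.
  apply/seteqP; split=> [_ [z Tz <-]|z Tz]; first by rewrite add0r scale1r.
  by exists z => //; rewrite add0r scale1r.
have ch p : T0 p -> {for p, continuous (fun p => jacobian_det f g p / J p)}.
  move=> Tp; have Up := chart_sub chG Tp.
  have [_ cX] := chart_C1x chG Up; have [_ cY] := chart_C1y chG Up.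
  have [_ cf] := Cf _ Up; have [_ cg] := Cg _ Up.
  apply: cvgM.
    by apply: cvgB; apply: cvgM; [exact: cf|exact: cg|exact: cf|exact: cg].
  apply: cvgV; first exact: (chart_det_neq0 chG).
  by apply: cvgB; apply: cvgM; [exact: cX|exact: cY|exact: cX|exact: cY].
have HE p : T0 p -> H (G p) = jacobian_det f g p / J p.
  by move=> Tp; rewrite -HJ// mulfK// (chart_det_neq0 chG).
have cH := chart_within_continuous ch HE.
have cimg q r : tri q r `<=` T0 -> compact (img q r).
  by move=> tT; apply: (chart_image_compact chG) => //; exact: tri_compact.
have cK : compact [set G p | p in T0].
  by have := cimg 0 1; rewrite /img T1; apply.
have iH := plane_within_integrable cK cH.
have iHs q r : tri q r `<=` T0 -> (mu \x mu)%E.-integrable (img q r) (EFin \o H).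
  move=> tT; apply: plane_within_integrable; first exact: cimg.
  by apply: continuous_subspaceW cH; exact: image_subset.
suff : \int[area]_(y in img 0 1) H y - s * tri_integral f g 0 1 = 0.
  by rewrite /img T1 => /subr0_eq.
apply: (goursat (E := fun q r => \int[area]_(y in img q r) H y - s * tri_integral f g q r)).
- move=> q r r0 tT.
  have r20 : r / 2 != 0 by rewrite mulf_neq0.
  have [t1 t2 t3 t4] : [/\ tri q (r / 2) `<=` T0, tri (q + (r / 2) *: e1) (r / 2) `<=` T0,
     tri (q + (r / 2) *: e2) (r / 2) `<=` T0 &
     tri (q + (r / 2) *: e1 + (r / 2) *: e2) (- (r / 2)) `<=` T0].
    split; apply: subset_trans tT; [exact: tri_sub1|exact: tri_sub2|exact: tri_sub3|exact: tri_sub4].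
  set A1 := img q (r / 2); set A2 := img _ (r / 2); set A3 := img _ (r / 2); set A4 := img _ (- _).
  have m1 : measurable A1 by apply: plane_compact_measurable; exact: cimg.
  have m2 : measurable A2 by apply: plane_compact_measurable; exact: cimg.
  have m3 : measurable A3 by apply: plane_compact_measurable; exact: cimg.
  have m4 : measurable A4 by apply: plane_compact_measurable; exact: cimg.
  have UA : img q r = A1 `|` A2 `|` A3 `|` A4.
    apply/seteqP; split; last first.
      move=> y [[[|]|]|]; apply: image_subset; [exact: tri_sub1|exact: tri_sub2|exact: tri_sub3|exact: tri_sub4].
    move=> _ [_ [z [z1 z2 z12] <-] <-].
    have [h1|h1] := leP (z.1 + z.2) (1 / 2).
      left; left; left; exists (q + r *: z) => //; exists (2 *: z).
        by split; rewrite /= /GRing.scale /=; lra.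
      by rewrite scalerA divfK.
    have [h2|h2] := leP (1 / 2) z.1.
      left; left; right; exists (q + r *: z) => //; exists (2 *: z - e1).
        by split; rewrite /= /GRing.scale /=; lra.
      by apply: plane_eq; rewrite /= /GRing.scale /=; field.
    have [h3|h3] := leP (1 / 2) z.2.
      left; right; exists (q + r *: z) => //; exists (2 *: z - e2).
        by split; rewrite /= /GRing.scale /=; lra.
      by apply: plane_eq; rewrite /= /GRing.scale /=; field.
    right; exists (q + r *: z) => //; exists (e1 + e2 - 2 *: z).
      by split; rewrite /= /GRing.scale /=; lra.
    by apply: plane_eq; rewrite /= /GRing.scale /=; field.
  pose seg p d := [set G (p + t *: d) | t in `[0, 1]%classic].
  have segT z w : T0 z -> T0 w -> in_seg T0 (q + r *: z) (r *: (w - z)).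
    by move=> Tz Tw t t01; apply: tT; exact: in_seg_tri.
  have Th1 : T0 (2^-1 *: e1) by split; rewrite /= /GRing.scale /=; lra.
  have Th2 : T0 (2^-1 *: e2) by split; rewrite /= /GRing.scale /=; lra.
  have Th3 : T0 (2^-1 *: e1 + 2^-1 *: e2) by split; rewrite /= /GRing.scale /=; lra.
  have segm p d : in_seg T0 p d -> measurable (seg p d).
    move=> sT; apply: plane_compact_measurable.
    rewrite -[X in compact X](image_comp (fun t : R => p + t *: d) G).
    apply: (chart_image_compact chG) => [|_ [t t01 <-]]; last exact: sT.
    apply: continuous_compact; last exact: segment_compact.
    by apply: continuous_subspaceT; exact: line_continuous.
  set S1 := seg (q + r *: (2^-1 *: e1)) (r *: (2^-1 *: e2 - 2^-1 *: e1)).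
  set S2 := seg (q + r *: (2^-1 *: e1)) (r *: (2^-1 *: e1 + 2^-1 *: e2 - 2^-1 *: e1)).
  set S3 := seg (q + r *: (2^-1 *: e2)) (r *: (2^-1 *: e1 + 2^-1 *: e2 - 2^-1 *: e2)).
  have mS1 : measurable S1 by apply: segm; exact: segT.
  have mS2 : measurable S2 by apply: segm; exact: segT.
  have mS3 : measurable S3 by apply: segm; exact: segT.
  have nS1 : area S1 = 0%E by apply: chart_segment_null; exact: segT.
  have nS2 : area S2 = 0%E by apply: chart_segment_null; exact: segT.
  have nS3 : area S3 = 0%E by apply: chart_segment_null; exact: segT.
  (* By injectivity on [T0], overlaps of the images are images of overlaps of the triangles. *)
  have cap a b x y z w (P : Prop) : tri a x `<=` T0 -> tri b y `<=` T0 -> T0 z -> T0 w ->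
      G (b + y *: w) = G (a + x *: z) -> (b + y *: w = a + x *: z -> P) -> P.
    by move=> ta tb Tz Tw E; apply; apply: (chart_inj chG) => //; [apply: tb; exists w|apply: ta; exists z].
  have mulr2I (u v : R) : r / 2 * u = r / 2 * v -> u = v by exact: mulfI.
  have n12 : A1 `&` A2 `<=` S2.
    move=> _ [[_ [z Tz <-] <-] [_ [w Tw <-]]] /(cap _ _ _ _ _ _ _ t1 t2 Tz Tw); apply.
    rewrite -addrA -scalerDr => /addrI E; exists 0; first by rewrite /= in_itv/= lexx ler01.
    have E1 : 1 + w.1 = z.1 by apply: mulr2I; move: (congr1 fst E).
    have E2 : 0 + w.2 = z.2 by apply: mulr2I; move: (congr1 snd E).
    case: Tz Tw => ? ? ? [? ? ?]; rewrite scale0r addr0; congr G; apply: plane_eq => /=.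
      by rewrite /GRing.scale /=; (have -> : z.1 = 1 by lra); field.
    by rewrite /GRing.scale /=; (have -> : z.2 = 0 by lra); field.
  have n123 : (A1 `|` A2) `&` A3 `<=` S3.
    move=> _ [[] [_ [z Tz <-] <-] [_ [w Tw <-]]].
    - move=> /(cap _ _ _ _ _ _ _ t1 t3 Tz Tw); apply.
      rewrite -addrA -scalerDr => /addrI E; exists 0; first by rewrite /= in_itv/= lexx ler01.
      have E1 : 0 + w.1 = z.1 by apply: mulr2I; move: (congr1 fst E).
      have E2 : 1 + w.2 = z.2 by apply: mulr2I; move: (congr1 snd E).
      case: Tz Tw => ? ? ? [? ? ?]; rewrite scale0r addr0; congr G; apply: plane_eq => /=.
        by rewrite /GRing.scale /=; (have -> : z.1 = 0 by lra); field.
      by rewrite /GRing.scale /=; (have -> : z.2 = 1 by lra); field.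
    - move=> /(cap _ _ _ _ _ _ _ t2 t3 Tz Tw); apply.
      rewrite -!addrA -!scalerDr => /addrI E; exists 1; first by rewrite /= in_itv/= lexx ler01.
      have E1 : 0 + w.1 = 1 + z.1 by apply: mulr2I; move: (congr1 fst E).
      have E2 : 1 + w.2 = 0 + z.2 by apply: mulr2I; move: (congr1 snd E).
      case: Tz Tw => ? ? ? [? ? ?]; rewrite scale1r; congr G; apply: plane_eq => /=; rewrite /GRing.scale /=.
        by (have -> : z.1 = 0 by lra); field.
      by (have -> : z.2 = 1 by lra); field.
  have n1234 : (A1 `|` A2 `|` A3) `&` A4 `<=` S1 `|` S2 `|` S3.
    move=> _ [[[]|] [_ [z Tz <-] <-] [_ [w Tw <-]]].
    - move=> /(cap _ _ _ _ _ _ _ t1 t4 Tz Tw); apply.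
      rewrite -!addrA scaleNr -scalerBr -scalerDr => /addrI E; left; left.
      have E1 : 1 + (0 - w.1) = z.1 by apply: mulr2I; move: (congr1 fst E).
      have E2 : 0 + (1 - w.2) = z.2 by apply: mulr2I; move: (congr1 snd E).
      case: Tz Tw => ? ? ? [? ? ?]; exists z.2; first by rewrite /= in_itv/=; apply/andP; split; lra.
      have E3 : z.1 = 1 - z.2 by lra.
      by congr G; apply: plane_eq; rewrite /= /GRing.scale /= ?E3; field.
    - move=> /(cap _ _ _ _ _ _ _ t2 t4 Tz Tw); apply.
      rewrite -!addrA scaleNr -scalerBr -!scalerDr => /addrI E; left; right.
      have E1 : 1 + (0 - w.1) = 1 + z.1 by apply: mulr2I; move: (congr1 fst E).
      have E2 : 0 + (1 - w.2) = 0 + z.2 by apply: mulr2I; move: (congr1 snd E).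
      case: Tz Tw => ? ? ? [? ? ?]; exists z.2; first by rewrite /= in_itv/=; apply/andP; split; lra.
      have E3 : z.1 = 0 by lra.
      by congr G; apply: plane_eq; rewrite /= /GRing.scale /= ?E3; field.
    - move=> /(cap _ _ _ _ _ _ _ t3 t4 Tz Tw); apply.
      rewrite -!addrA scaleNr -scalerBr -!scalerDr => /addrI E; right.
      have E1 : 1 + (0 - w.1) = 0 + z.1 by apply: mulr2I; move: (congr1 fst E).
      have E2 : 0 + (1 - w.2) = 1 + z.2 by apply: mulr2I; move: (congr1 snd E).
      case: Tz Tw => ? ? ? [? ? ?]; exists z.1; first by rewrite /= in_itv/=; apply/andP; split; lra.
      have E3 : z.2 = 0 by lra.
      by congr G; apply: plane_eq; rewrite /= /GRing.scale /= ?E3; field.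
  have I := iHs q r tT; rewrite UA in I.
  have sub0 : img q r `<=` [set G p | p in T0] by exact: image_subset.
  rewrite UA in sub0.
  have sub : A1 `|` A2 `|` A3 `<=` [set G p | p in T0].
    exact: subset_trans (@subsetUl _ _ A4) sub0.
  have i3 : (mu \x mu)%E.-integrable (A1 `|` A2 `|` A3) (EFin \o H).
    apply: plane_within_integrable; last exact: continuous_subspaceW cH.
    by apply: compactU; [apply: compactU|]; exact: cimg.
  have i2 : (mu \x mu)%E.-integrable (A1 `|` A2) (EFin \o H).
    apply: plane_within_integrable; first by apply: compactU; exact: cimg.
    by apply: continuous_subspaceW cH; apply: subset_trans sub; exact: subsetUl.
  have mA12 : measurable (A1 `|` A2) by exact: measurableU.
  have mA123 : measurable (A1 `|` A2 `|` A3) by exact: measurableU.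
  have mS12 : measurable (S1 `|` S2) by exact: measurableU.
  have mS : measurable (S1 `|` S2 `|` S3) by exact: measurableU.
  have area12 : area (A1 `&` A2) = 0%E.
    by apply: area_sub_null n12 nS2 => //; exact: measurableI.
  have area123 : area ((A1 `|` A2) `&` A3) = 0%E.
    by apply: area_sub_null n123 nS3 => //; exact: measurableI.
  have area1234 : area ((A1 `|` A2 `|` A3) `&` A4) = 0%E.
    apply: (area_sub_null _ mS n1234); first exact: measurableI.
    exact: (area_setU_null mS12 mS3 (area_setU_null mS1 mS2 nS1 nS2) nS3).
  rewrite UA.
  have -> : \int[area]_(y in A1 `|` A2 `|` A3 `|` A4) H y =
     \int[area]_(y in A1) H y + \int[area]_(y in A2) H y + \int[area]_(y in A3) H y + \int[area]_(y in A4) H y.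
    rewrite (area_integral_setU mA123 m4 I area1234).
    by rewrite (area_integral_setU mA12 m3 i3 area123) (area_integral_setU m1 m2 i2 area12).
  rewrite (tri_integral_split Cf Cg (subset_trans tT (chart_sub chG))).
  move: (\int[area]_(y in A1) H y) (\int[area]_(y in A2) H y) (\int[area]_(y in A3) H y) (\int[area]_(y in A4) H y).
  move=> I1 I2 I3 I4; set x1 := tri_integral _ _ q _; set x2 := tri_integral _ _ (q + _ *: e1) _.
  set x3 := tri_integral _ _ (q + _ *: e2) _; set x4 := tri_integral _ _ _ _.
  by move: x1 x2 x3 x4 => x1 x2 x3 x4; ring.
(* Three errors are kept below [eps / 4 * r ^+ 2] each: the variation of [H] (by [e3]), the area of
   the image (by [e2]) and the circulation. *)
- move=> p Tp eps eps0; have Up := chart_sub chG Tp.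
  have J0 := chart_det_neq0 chG Tp; have sJ := chart_det chG Tp.
  have HJp := HJ p Tp.
  set J0' := jacobian_det f g p in HJp; set h0 := H (G p) in HJp; set M := J p in J0 sJ HJp.
  have e10 : 0 < eps / 4 by rewrite divr_gt0.
  have [d1 d10 H1] := tri_integral_local (chart_open chG) Up Cf Cg e10.
  have h10 : 0 < `|h0| + 1 by rewrite ltr_wpDl.
  have M10 : 0 < `|M| + 1 by rewrite ltr_wpDl.
  pose e2 := Num.min (1 / 2) (eps / (4 * (`|h0| + 1))).
  have e20 : 0 < e2 by rewrite lt_min; apply/andP; split; rewrite divr_gt0// mulr_gt0.
  have e2h : e2 <= 1 / 2 by rewrite ge_min lexx.
  have e2e : `|h0| * e2 <= eps / 4.
    have : e2 <= eps / (4 * (`|h0| + 1)) by rewrite ge_min lexx orbT.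
    rewrite ler_pdivlMr ?mulr_gt0// => ?; have := ltW e20; have := normr_ge0 h0; nra.
  have [d2 d20 H2] := area_chart_tri Tp e20.
  pose e3 := eps / (4 * (`|M| + 1)).
  have e30 : 0 < e3 by rewrite divr_gt0// mulr_gt0.
  have e3e : e3 * (`|M| + 1) = eps / 4.
    by rewrite /e3 invfM mulrA mulfVK// gt_eqF.
  have cp : (fun p => jacobian_det f g p / J p) q @[q --> p] --> jacobian_det f g p / J p.
    exact: ch.
  have nh : \forall q \near p, `|jacobian_det f g p / J p - jacobian_det f g q / J q| <= e3.
    exact: cvgr_dist_le cp _ e30.
  have [d3 d30 H3] := near_plane_ball nh.
  exists (Num.min d1 (Num.min d2 d3)); first by rewrite !lt_min d10 d20.
  move=> q r r0 tp tT; rewrite !lt_min => /andP[r1 /andP[r2 r3]].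
  have := H1 q r tp r1; have := H2 q r r0 tp tT r2.
  have cA := cimg q r tT.
  have cHq : {within img q r, continuous H}.
    by apply: continuous_subspaceW cH; exact: image_subset.
  have := Rintegral_near_cst (h := h0) (e := e3) cA cHq.
  have near y : img q r y -> `|H y - h0| <= e3.
    move=> [w tw <-]; rewrite /h0 !HE//; last exact: tT.
    rewrite distrC; apply: H3.
    by have [? ?] := tri_dist tp tw; apply: le_lt_trans r3; exact: norm_pair_le.
  move=> /(_ near); rewrite -/(img q r) -/M -/(jacobian_det f g p) -/J0'.
  move: (\int[area]_(y in img q r) H y) (tri_integral f g q r) (fine (area (img q r))) => I t a.
  have r20 := sqr_ge0 r; move: (r ^+ 2) r20 => x x0 hI ha ht.
  have E : h0 * (`|M| * x / 2) = s * (x / 2 * J0').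
    rewrite -HJp; case: (chart_sign chG) sJ => ->; rewrite ?mul1r ?mulN1r ?oppr_gt0 => sJ.
      by rewrite gtr0_norm//; field.
    by rewrite ltr0_norm//; field.
  have -> : I - s * t = (I - h0 * a) + h0 * (a - `|M| * x / 2) + s * (x / 2 * J0' - t).
    by rewrite (mulrBr h0) E; ring.
  have s1 : `|s| = 1 by case: (chart_sign chG) => ->; rewrite ?normrN normr1.
  apply: (le_trans (ler_normD _ _)); apply: (le_trans (lerD (ler_normD _ _) (lexx _))).
  rewrite !normrM s1 mul1r [`|_ - t|]distrC.
  have a_le : a <= (`|M| + 1) * x.
    move: ha; rewrite ler_norml => /andP[_ ha].
    have : e2 * x <= 1 / 2 * x by rewrite ler_wpM2r.
    have : 0 <= `|M| * x by rewrite mulr_ge0.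
    by lra.
  have b1 : e3 * a <= eps / 4 * x by rewrite -e3e -mulrA ler_wpM2l// ltW.
  have b2 : `|h0| * `|a - `|M| * x / 2| <= eps / 4 * x.
    apply: (@le_trans _ _ (`|h0| * (e2 * x))); first by rewrite ler_wpM2l.
    by rewrite mulrA ler_wpM2r.
  have ex : 0 <= eps * x by rewrite mulr_ge0// ltW.
  by lra.
Qed.

End Green.

(** * Charts of curved elements *)

Section ReferenceTriangle.
Context {R : realType}.
Local Notation plane := (R * R)%type.
Local Notation T0 := (@std_triangle R).
Implicit Types (p q v : plane) (U : set plane).

(** Linearity of [l] is asked in the form in which difference quotients use it: on scaled
    differences. *)
Lemma derive_linear_comp {V : normedModType R} (l : plane -> R) (F : V -> plane) (p v : V) :
  (forall (k : R) x y, l (k *: (x - y)) = k * (l x - l y)) -> continuous l ->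
  derivable F p v -> derivable (l \o F) p v /\ 'D_v (l \o F) p = l ('D_v F p).
Proof.
move=> ll cl dF.
have : (h^-1 *: ((l \o F) (h *: v + p) - (l \o F) p)) @[h --> (0 : R)^'] --> l ('D_v F p).
  have -> : (fun h : R => h^-1 *: ((l \o F) (h *: v + p) - (l \o F) p) : R) =
     l \o (fun h : R => h^-1 *: (F (h *: v + p) - F p)).
    by apply/funext => h; rewrite /= ll.
  apply: continuous_cvg; first exact: cl.
  exact: dF.
move=> lim; split; last exact: cvg_lim lim.
by apply/cvg_ex; exists (l ('D_v F p)).
Qed.

Lemma Ck1_C1 U (l : plane -> R) (F : plane -> plane) :
  (forall (k : R) x y, l (k *: (x - y)) = k * (l x - l y)) -> continuous l ->
  open U -> Ck 1 U F -> C1 U (l \o F).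
Proof.
move=> ll cl oU [cF dF].
have cD v p : U p -> {for p, continuous ('D_v (l \o F))}.
  move=> Up; apply: (continuous_open_ext (f := l \o 'D_v F) oU Up).
    by move=> q Uq; rewrite /= (derive_linear_comp ll cl ((dF v).1 q Uq)).2.
  apply: continuous_comp; last exact: cl.
  exact: (dF v).2.1.
move=> p Up; split; last by move=> v; exact: cD.
apply: (partials_differentiable oU Up) => [q Uq|q Uq||]; try exact: cD.
  exact: (derive_linear_comp ll cl ((dF _).1 q Uq)).1.
exact: (derive_linear_comp ll cl ((dF _).1 q Uq)).1.
Qed.

Lemma Ck2_C2 U (l : plane -> R) (F : plane -> plane) :
  (forall (k : R) x y, l (k *: (x - y)) = k * (l x - l y)) -> continuous l ->
  open U -> Ck 2 U F -> C2 U (l \o F).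
Proof.
move=> ll cl oU [cF dF]; split.
  by apply: Ck1_C1 => //; split => // v; split; [exact: (dF v).1|split => //; exact: (dF v).2.1].
move=> v; apply: (C1_open_ext (f := l \o 'D_v F) oU) => [p Up|].
  by rewrite /= (derive_linear_comp ll cl ((dF v).1 p Up)).2.
apply: Ck1_C1 => //; exact: (dF v).2.
Qed.

Definition affine_map (u0 u1 u2 : plane) p : plane := u0 + p.1 *: u1 + p.2 *: u2.

Lemma affine_map_continuous (u0 u1 u2 : plane) : continuous (affine_map u0 u1 u2).
Proof.
move=> z; rewrite /affine_map; apply: cvgD.
  apply: cvgD; first exact: cvg_cst.
  apply: cvgZr_tmp; exact: continuous_fst.
apply: cvgZr_tmp; exact: continuous_snd.
Qed.

Lemma affine_form_differentiable (c0 c1 c2 : R) p :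
  differentiable (fun p : plane => c0 + p.1 * c1 + p.2 * c2) p /\
  (forall v, 'D_v (fun p : plane => c0 + p.1 * c1 + p.2 * c2) p = v.1 * c1 + v.2 * c2).
Proof.
apply: differentiable_grad => eps eps0; near=> q.
have -> : c0 + q.1 * c1 + q.2 * c2 - (c0 + p.1 * c1 + p.2 * c2) -
  ((q.1 - p.1) * c1 + (q.2 - p.2) * c2) = 0 by ring.
by rewrite normr0 mulr_ge0// ltW.
Unshelve. all: by end_near.
Qed.

Lemma affine_preimage_open U (u0 u1 u2 : plane) : open U -> open (affine_map u0 u1 u2 @^-1` U).
Proof. by move=> oU; apply: (continuousP _).1 oU; exact: affine_map_continuous. Qed.

Lemma affine_comp_differentiable (f : plane -> R) (u0 u1 u2 : plane) p :
  differentiable f (affine_map u0 u1 u2 p) ->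
  differentiable (f \o affine_map u0 u1 u2) p /\
  forall v, 'D_v (f \o affine_map u0 u1 u2) p =
    'D_(v.1 *: u1 + v.2 *: u2) f (affine_map u0 u1 u2 p).
Proof.
move=> df.
have [dX DX] := affine_form_differentiable u0.1 u1.1 u2.1 p.
have [dY DY] := affine_form_differentiable u0.2 u1.2 u2.2 p.
have [d1 d2] := differentiable_comp_pair dX dY df.
by split=> [|v]; [exact: d1|rewrite [LHS]d2 DX DY (derive_pairE _ df)].
Qed.

Lemma C1_affine_comp U (f : plane -> R) (u0 u1 u2 : plane) : open U -> C1 U f ->
  C1 (affine_map u0 u1 u2 @^-1` U) (f \o affine_map u0 u1 u2).
Proof.
move=> oU Cf p Up; split; first exact: (affine_comp_differentiable (Cf _ Up).1).1.
move=> v; have oV := affine_preimage_open (u0 := u0) (u1 := u1) (u2 := u2) oU.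
apply: (continuous_open_ext (f := ('D_(v.1 *: u1 + v.2 *: u2) f) \o affine_map u0 u1 u2) oV Up).
  by move=> q Uq; rewrite (affine_comp_differentiable (Cf _ Uq).1).2.
apply: continuous_comp; [exact: affine_map_continuous|exact: (Cf _ Up).2].
Qed.

Lemma C2_affine_comp U (f : plane -> R) (u0 u1 u2 : plane) : open U -> C2 U f ->
  C2 (affine_map u0 u1 u2 @^-1` U) (f \o affine_map u0 u1 u2).
Proof.
move=> oU [Cf C2f]; split; first exact: C1_affine_comp.
move=> v; have oV := affine_preimage_open (u0 := u0) (u1 := u1) (u2 := u2) oU.
apply: (C1_open_ext (f := ('D_(v.1 *: u1 + v.2 *: u2) f) \o affine_map u0 u1 u2) oV).
  by move=> q Uq; rewrite (affine_comp_differentiable (Cf _ Uq).1).2.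
by apply: C1_affine_comp => //; exact: C2f.
Qed.

Variable a : 'I_3 -> plane.

Definition ref_map p : plane :=
  affine_map (a (inord 0)) (a (inord 1) - a (inord 0)) (a (inord 2) - a (inord 0)) p.

(* The vertices are numbered counterclockwise in the standard triangle; the edge
   [i] runs from the vertex [i + 1] to the vertex [i + 2]. *)
Definition corner (i : 'I_3) : plane :=
  match val i with 0 => 0 | 1 => e1 | _ => e2 end.
Definition edge_base (i : 'I_3) : plane :=
  match val i with 0 => e1 | 1 => e2 | _ => 0 end.
Definition edge_dir (i : 'I_3) : plane :=
  match val i with 0 => e2 - e1 | 1 => - e2 | _ => e1 end.

Lemma ord3P (P : 'I_3 -> Prop) : P (inord 0) -> P (inord 1) -> P (inord 2) -> forall i, P i.
Proof.
move=> P0 P1 P2 i; rewrite -(inord_val i).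
by case: i => [[|[|[|//]]] ?].
Qed.

Lemma sum_ord3 (V : nmodType) (s : 'I_3 -> V) :
  \sum_i s i = s (inord 0) + s (inord 1) + s (inord 2).
Proof.
rewrite !big_ord_recl big_ord0 addr0 addrA; congr (s _ + s _ + s _); apply: val_inj;
  by rewrite /= inordK.
Qed.

Lemma ref_map_bary (s : 'I_3 -> R) : \sum_i s i = 1 ->
  \sum_i s i *: a i = ref_map (s (inord 1), s (inord 2)).
Proof.
rewrite !sum_ord3 /ref_map => s1.
have -> : s (inord 0) = 1 - s (inord 1) - s (inord 2) by rewrite -s1; ring.
by apply: plane_eq; rewrite /= /GRing.scale /=; ring.
Qed.

Definition bary_coord p (i : 'I_3) : R :=
  match val i with 0 => 1 - p.1 - p.2 | 1 => p.1 | _ => p.2 end.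

Lemma bary_coord0 p : bary_coord p (inord 0) = 1 - p.1 - p.2.
Proof. by rewrite /bary_coord /= inordK. Qed.
Lemma bary_coord1 p : bary_coord p (inord 1) = p.1.
Proof. by rewrite /bary_coord /= inordK. Qed.
Lemma bary_coord2 p : bary_coord p (inord 2) = p.2.
Proof. by rewrite /bary_coord /= inordK. Qed.
Definition bary_coordE := (bary_coord0, bary_coord1, bary_coord2).

Lemma baryE (P : ('I_3 -> R) -> Prop) :
  bary a P = [set ref_map p | p in [set p | T0 p /\ P (bary_coord p)]].
Proof.
apply/seteqP; split=> [_ [s [s0 s1 Ps ->]]|_ [p [Tp Pp] <-]].
  rewrite ref_map_bary//; exists (s (inord 1), s (inord 2)) => //.
  have E : s = bary_coord (s (inord 1), s (inord 2)).
    apply/funext; apply: ord3P; rewrite !bary_coordE//=.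
    by move: s1; rewrite sum_ord3 => <-; ring.
  split; last by rewrite -E.
  move: s1; rewrite sum_ord3 => s1.
  by have := s0 (inord 0); split; rewrite ?s0//=; lra.
have S : \sum_i bary_coord p i = 1 by rewrite sum_ord3 !bary_coordE; ring.
exists (bary_coord p); split => //.
  by case: Tp => ? ? ?; apply: ord3P; rewrite !bary_coordE//; lra.
by rewrite ref_map_bary// !bary_coordE; case: (p).
Qed.

Lemma ref_triangleE : ref_triangle a = [set ref_map p | p in T0].
Proof.
rewrite /ref_triangle baryE; congr image; apply/seteqP; split=> p; last by split.
by case.
Qed.

Lemma corner0 : corner (inord 0) = 0. Proof. by rewrite /corner /= inordK. Qed.
Lemma corner1 : corner (inord 1) = e1. Proof. by rewrite /corner /= inordK. Qed.
Lemma corner2 : corner (inord 2) = e2. Proof. by rewrite /corner /= inordK. Qed.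
Lemma edge_base0 : edge_base (inord 0) = e1. Proof. by rewrite /edge_base /= inordK. Qed.
Lemma edge_base1 : edge_base (inord 1) = e2. Proof. by rewrite /edge_base /= inordK. Qed.
Lemma edge_base2 : edge_base (inord 2) = 0. Proof. by rewrite /edge_base /= inordK. Qed.
Lemma edge_dir0 : edge_dir (inord 0) = e2 - e1. Proof. by rewrite /edge_dir /= inordK. Qed.
Lemma edge_dir1 : edge_dir (inord 1) = - e2. Proof. by rewrite /edge_dir /= inordK. Qed.
Lemma edge_dir2 : edge_dir (inord 2) = e1. Proof. by rewrite /edge_dir /= inordK. Qed.
Definition cornerE := (corner0, corner1, corner2).
Definition edge_baseE := (edge_base0, edge_base1, edge_base2).
Definition edge_dirE := (edge_dir0, edge_dir1, edge_dir2).

Lemma vertex_corner i : a i = ref_map (corner i).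
Proof.
move: i; apply: ord3P; rewrite cornerE /ref_map; apply: plane_eq; rewrite /= /GRing.scale /=; ring.
Qed.

Definition edge_point (i : 'I_3) (t : R) : plane := edge_base i + t *: edge_dir i.

Lemma edge_pointP i p : T0 p /\ bary_coord p i = 0 <->
  exists2 t : R, t \in `[0, 1] & p = edge_point i t.
Proof.
rewrite /edge_point; move: i; apply: ord3P; rewrite bary_coordE edge_baseE edge_dirE; split.
- move=> [[? ? ?] ?]; exists p.2; first by rewrite in_itv /=; lra.
  by apply: plane_eq; rewrite /= /GRing.scale /=; lra.
- move=> [t]; rewrite in_itv /= => /andP[? ?] ->; split; last by rewrite /= /GRing.scale /=; ring.
  by split; rewrite /= /GRing.scale /=; lra.
- move=> [[? ? ?] ?]; exists (1 - p.2); first by rewrite in_itv /=; lra.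
  by apply: plane_eq; rewrite /= /GRing.scale /=; lra.
- move=> [t]; rewrite in_itv /= => /andP[? ?] ->; split; last by rewrite /= /GRing.scale /=; ring.
  by split; rewrite /= /GRing.scale /=; lra.
- move=> [[? ? ?] ?]; exists p.1; first by rewrite in_itv /=; lra.
  by apply: plane_eq; rewrite /= /GRing.scale /=; lra.
- move=> [t]; rewrite in_itv /= => /andP[? ?] ->; split; last by rewrite /= /GRing.scale /=; ring.
  by split; rewrite /= /GRing.scale /=; lra.
Qed.

Lemma ref_edgeE i : ref_edge a i = [set ref_map (edge_point i t) | t in `[0, 1]%classic].
Proof.
rewrite /ref_edge baryE; apply/seteqP; split=> [_ [p /edge_pointP[t t01 ->] <-]|_ [t t01 <-]].
  by exists t.
by exists (edge_point i t) => //; apply/edge_pointP; exists t.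
Qed.

End ReferenceTriangle.
Lemma derive_sub_shift {R : realType} {V W : normedModType R} (f g : V -> W) (b dg : W) (p h : V) :
  derivable f p h -> is_derive p h g dg ->
  'D_h (fun q => f q - (g q + b)) p = 'D_h f p - dg.
Proof.
move=> df dgp; have df' : is_derive p h f ('D_h f p) by exact: DeriveDef.
have db : is_derive p h (cst b) 0 by exact: is_derive_cst.
have dgb : is_derive p h (g \+ cst b) (dg + 0) by exact: is_deriveD.
have := is_deriveB df' dgb; rewrite addr0 => D.
exact: (derive_val (is_derive := D)).
Qed.

(** * Global injectivity and orientation from the contraction condition *)

Section ElementChart.
Context {R : realType}.
Local Notation plane := (R * R)%type.
Local Notation T0 := (@std_triangle R).
Implicit Types (p q v : plane) (U : set plane).

Lemma dotBl p q v : dot (p - q) v = dot p v - dot q v.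
Proof. by rewrite /dot /=; ring. Qed.
Lemma dotZl (k : R) p v : dot (k *: p) v = k * dot p v.
Proof. by rewrite /dot /= /GRing.scale /=; ring. Qed.
Lemma dotC p q : dot p q = dot q p.
Proof. by rewrite /dot; ring. Qed.
Lemma dot_ge0 p : 0 <= dot p p.
Proof. by rewrite /dot -!expr2 addr_ge0 ?sqr_ge0. Qed.
Lemma dot_eq0 p : dot p p = 0 -> p = 0.
Proof.
rewrite /dot -!expr2 => /eqP; rewrite paddr_eq0 ?sqr_ge0// !sqrf_eq0 => /andP[/eqP ? /eqP ?].
exact: plane_eq.
Qed.
Lemma enorm_ge0 p : 0 <= enorm p. Proof. exact: sqrtr_ge0. Qed.
Lemma sqr_enorm p : enorm p ^+ 2 = dot p p.
Proof. by rewrite sqr_sqrtr// dot_ge0. Qed.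
Lemma enormZ (k : R) p : enorm (k *: p) = `|k| * enorm p.
Proof.
rewrite /enorm; have -> : dot (k *: p) (k *: p) = k ^+ 2 * dot p p.
  by rewrite /dot /= /GRing.scale /=; ring.
by rewrite sqrtrM ?sqr_ge0// sqrtr_sqr.
Qed.
Lemma enorm_eq0 p : enorm p = 0 -> p = 0.
Proof. by move=> /eqP; rewrite sqrtr_eq0 => h; apply: dot_eq0; apply/eqP; rewrite eq_le h dot_ge0. Qed.

Lemma cauchy_schwarz p q : `|dot p q| <= enorm p * enorm q.
Proof.
rewrite -(@ler_pXn2r _ 2%N) ?nnegrE ?mulr_ge0 ?enorm_ge0// exprMn !sqr_enorm.
rewrite real_normK ?num_real// -subr_ge0.
have -> : dot p p * dot q q - dot p q ^+ 2 = (p.1 * q.2 - p.2 * q.1) ^+ 2 by rewrite /dot; ring.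
exact: sqr_ge0.
Qed.

Lemma enorm_le p : enorm p <= `|p.1| + `|p.2|.
Proof.
rewrite -(@ler_sqr _ (enorm p))// ?nnegrE ?enorm_ge0 ?addr_ge0// sqr_enorm /dot.
rewrite -!expr2 -(real_normK (num_real p.1)) -(real_normK (num_real p.2)).
rewrite sqrrD addrAC lerDl mulrn_wge0// mulr_ge0//.
Qed.

Lemma norm_fst_enorm p : `|p.1| <= enorm p.
Proof.
rewrite -(@ler_pXn2r _ 2%N) ?nnegrE ?enorm_ge0// sqr_enorm real_normK ?num_real// /dot -!expr2.
by rewrite lerDl sqr_ge0.
Qed.

Lemma norm_snd_enorm p : `|p.2| <= enorm p.
Proof.
rewrite -(@ler_pXn2r _ 2%N) ?nnegrE ?enorm_ge0// sqr_enorm real_normK ?num_real// /dot -!expr2.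
by rewrite lerDr sqr_ge0.
Qed.

Lemma enorm_le_norm p : enorm p <= 2 * `|p|.
Proof.
apply: le_trans (enorm_le p) _.
by have := normr_fst p; have := normr_snd p; lra.
Qed.

Lemma sum_bilinear_det (u1 u2 m1 m2 : plane) :
  (u1.1 * u2.2 - u2.1 * u1.2) * (m1.1 * m2.2 - m2.1 * m1.2) =
  dot u1 m1 * dot u2 m2 - dot u1 m2 * dot u2 m1.
Proof. by rewrite /dot; ring. Qed.

(* the symmetric part of the form [(x, y) |-> dot (U x) (M y)] is positive definite *)
Lemma posdef_det_gt0 (u1 u2 m1 m2 : plane) :
  (forall x y : R, x != 0 \/ y != 0 -> 0 < dot (x *: u1 + y *: u2) (x *: m1 + y *: m2)) ->
  0 < (u1.1 * u2.2 - u2.1 * u1.2) * (m1.1 * m2.2 - m2.1 * m1.2).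
Proof.
move=> pd; rewrite sum_bilinear_det.
have E (x y : R) : dot (x *: u1 + y *: u2) (x *: m1 + y *: m2) =
  x ^+ 2 * dot u1 m1 + x * y * (dot u1 m2 + dot u2 m1) + y ^+ 2 * dot u2 m2.
  by rewrite /dot /= /GRing.scale /=; ring.
have a0 : 0 < dot u1 m1.
  by have := pd 1 0 (or_introl (oner_neq0 _)); rewrite E; congr (0 < _); ring.
(* For second coordinate [2 * dot u1 m1] this first coordinate minimizes the quadratic form; its
   value is the leading coefficient times the negated discriminant. *)
have := pd (- (dot u1 m2 + dot u2 m1)) (2 * dot u1 m1); rewrite E.
move: (dot u1 m1) (dot u2 m2) (dot u1 m2) (dot u2 m1) a0 => x y z w x0 h.
have {}h : 0 < x * (4 * (x * y) - (z + w) ^+ 2).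
  have := h (or_intror (lt0r_neq0 (mulr_gt0 (ltr0n _ 2) x0))).
  by congr (0 < _); ring.
move: h; rewrite pmulr_rgt0// => h.
have : 0 <= (z - w) ^+ 2 by exact: sqr_ge0.
have -> : (z - w) ^+ 2 = (z + w) ^+ 2 - 4 * (z * w) by ring.
lra.
Qed.

Lemma opnorm_bound (A : plane -> plane) (k : R) : (forall (t : R) p, A (t *: p) = t *: A p) ->
  (opnorm A <= k%:E)%E -> forall p, enorm (A p) <= k * enorm p.
Proof.
move=> lA h p.
have [p0|p0] := eqVneq (enorm p) 0.
  have -> : p = 0 *: p by rewrite scale0r (enorm_eq0 p0).
  by rewrite lA !enormZ normr0 !mul0r mulr0.
have pp : 0 < enorm p by rewrite lt_neqAle eq_sym p0 enorm_ge0.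
have : ((enorm (A ((enorm p)^-1 *: p)))%:E <= k%:E)%E.
  apply: le_trans h; apply: ereal_sup_ubound; exists ((enorm p)^-1 *: p) => //=.
  by rewrite enormZ ger0_norm ?invr_ge0 ?enorm_ge0// mulVf.
by rewrite lee_fin lA enormZ ger0_norm ?invr_ge0 ?enorm_ge0// mulrC ler_pdivrMr.
Qed.

Variables (a : 'I_3 -> plane) (F : plane -> plane).
Hypothesis ha : noncollinear a.
Hypothesis hF : curved_element_map a F.

Local Notation G := (F \o ref_map a).
Local Notation X := (fst \o F \o ref_map a).
Local Notation Y := (snd \o F \o ref_map a).

Lemma fst_lin (k : R) (x y : plane) : (k *: (x - y)).1 = k * (x.1 - y.1).
Proof. by []. Qed.
Lemma snd_lin (k : R) (x y : plane) : (k *: (x - y)).2 = k * (x.2 - y.2).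
Proof. by []. Qed.

Lemma derive_comb (f : plane -> R) p (u w : plane) (x y : R) : differentiable f p ->
  'D_(x *: u + y *: w) f p = x * 'D_u f p + y * 'D_w f p.
Proof.
move=> df; rewrite (derive_pairE (x *: u + y *: w) df) (derive_pairE u df) (derive_pairE w df).
move: ('D_e1 f p) ('D_e2 f p) => A B; rewrite /= /GRing.scale /=; ring.
Qed.

Lemma derive_comb_comp (l : plane -> R) (f : plane -> plane) p (u w : plane) (x y : R) :
  (forall (k : R) z z', l (k *: (z - z')) = k * (l z - l z')) -> continuous l ->
  differentiable (l \o f) p -> (forall h, derivable f p h) ->
  l ('D_(x *: u + y *: w) f p) = x * l ('D_u f p) + y * l ('D_w f p).
Proof.
move=> ll cl dl df; have E h := (derive_linear_comp ll cl (df h)).2.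
apply: eq_trans (esym (E (x *: u + y *: w))) _.
by apply: eq_trans (derive_comb u w x y dl) _; congr (_ * _ + _ * _); exact: E.
Qed.

Lemma element_C2 : exists U, [/\ open U, T0 `<=` ref_map a @^-1` U, C2 U (fst \o F) &
  C2 U (snd \o F)].
Proof.
have [[U [oU sU CF]] _] := hF; exists U; split => //.
- by move=> p Tp; apply: sU; rewrite ref_triangleE; exists p.
- by apply: Ck2_C2 => //; exact: continuous_fst.
- by apply: Ck2_C2 => //; exact: continuous_snd.
Qed.

Lemma plane_linearE (B : {linear plane -> plane}) h : B h = affine_map 0 (B e1) (B e2) h.
Proof.
rewrite /affine_map add0r -!linearZ -linearD; congr (B _).
by apply: plane_eq; rewrite /= /GRing.scale /=; ring.
Qed.

Lemma plane_linear_continuous (B : {linear plane -> plane}) : continuous B.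
Proof.
have -> : (B : plane -> plane) = affine_map 0 (B e1) (B e2) by apply/funext; exact: plane_linearE.
exact: affine_map_continuous.
Qed.

Lemma element_derivable p h : ref_triangle a p -> derivable F p h.
Proof.
have [[U [_ sU [_ /(_ h)[dF _]]]] _] := hF.
by move=> /sU; exact: dF.
Qed.

(** The bound on [D Phi B^-1] evaluated at [B h]. The constant [k] is the supremum itself, which is
    finite since it lies between 0 and 1. *)
Lemma element_contraction : exists (B : {linear plane -> plane}) (k : R),
  [/\ injective B, 0 <= k < 1 & forall p, ref_triangle a p -> forall h,
    derivable F p h /\ enorm ('D_h F p - B h) <= k * enorm (B h)].
Proof.
have [[U [oU sU CF]] [B [Binv [b /= [BK KB hsup]]]]] := hF.
have Ta0 : ref_triangle a (a (inord 0)).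
  by rewrite ref_triangleE (vertex_corner a); exists (corner (inord 0)) => //; rewrite corner0; exact: std_triangle0.
pose A p (xi : plane) : plane := 'd (fun q : plane => F q - (B q + b)) p (Binv xi).
move: hsup; rewrite -/A; set S := ereal_sup _ => hsup.
have S0 p : ref_triangle a p -> (0 <= opnorm (A p))%E.
  move=> Tp; apply: (@le_trans _ _ (enorm (A p 0))%:E); first by rewrite lee_fin enorm_ge0.
  apply: ereal_sup_ubound; exists 0 => //=.
  by rewrite /enorm /dot /= mulr0 addr0 sqrtr0.
have SS p : ref_triangle a p -> (opnorm (A p) <= S)%E.
  by move=> Tp; apply: ereal_sup_ubound; exists p.
have S00 : (0 <= S)%E by exact: le_trans (S0 _ Ta0) (SS _ Ta0).
have Sfin : S \is a fin_num by rewrite ge0_fin_numE// (lt_trans hsup) ?ltry.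
exists B, (fine S); split.
- exact: can_inj BK.
- by rewrite -lee_fin -lte_fin fineK// hsup andbT.
move=> p Tp h; have Up := sU _ Tp.
have dF : derivable F p h by have [_ /(_ h)[dF _]] := CF; exact: dF.
split => //.
have [V [oV TV [C1V _] [C2V _]]] := element_C2.
have Vp : V p by move: Tp; rewrite ref_triangleE => -[q Tq <-]; exact: TV.
have diffF : differentiable F p.
  have -> : F = (fun q => ((fst \o F) q, (snd \o F) q)) by apply/funext => q /=; case: (F q).
  by apply: differentiable_pair; [exact: (C1V _ Vp).1|exact: (C2V _ Vp).1].
have diffB : differentiable B p by apply: linear_differentiable; exact: plane_linear_continuous.
have diffP : differentiable (fun q : plane => F q - (B q + b)) p.
  apply: differentiableB => //; apply: differentiableD => //.
have linI (t : R) x : Binv (t *: x) = t *: Binv x.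
  by rewrite -{1}(KB x) -linearZ BK.
have lA (t : R) x : A p (t *: x) = t *: A p x by rewrite /A linI linearZ.
have := opnorm_bound (k := fine S) lA _ (B h); rewrite fineK// => /(_ (SS _ Tp)).
rewrite /A BK -deriveE//.
have dBh : is_derive p h B (B h).
  apply: DeriveDef; first exact: diff_derivable.
  by rewrite (deriveE _ diffB) diff_lin//; exact: plane_linear_continuous.
by rewrite (derive_sub_shift b dF dBh).
Qed.

Local Notation u1 := (a (inord 1) - a (inord 0)).
Local Notation u2 := (a (inord 2) - a (inord 0)).

Lemma ref_map_sub p q : ref_map a p - ref_map a q = (p.1 - q.1) *: u1 + (p.2 - q.2) *: u2.
Proof.
by rewrite /ref_map /affine_map; move: u1 u2 => w1 w2; apply: plane_eq; rewrite /= /GRing.scale /=; ring.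
Qed.

Lemma dot_derive_ge (B : plane -> plane) (k : R) p h :
  enorm ('D_h F p - B h) <= k * enorm (B h) ->
  (1 - k) * dot (B h) (B h) <= dot ('D_h F p) (B h).
Proof.
move=> ineq; have := cauchy_schwarz ('D_h F p - B h) (B h).
rewrite ler_norml => /andP[+ _]; rewrite dotBl => le1.
have := enorm_ge0 (B h); rewrite -sqr_enorm; have := sqr_enorm (B h).
move: le1 ineq; move: ('D_h F p) (enorm (B h)) (enorm _) (dot _ _) (dot _ _) => d x y z w.
by move=> *; nra.
Qed.

(** By Cauchy-Schwarz [D F] is strongly monotone relative to [B]. The mean value theorem for the
    scalar function [dot (F z) b] on a chord of the convex triangle carries this over to differences
    of [F]. *)
Lemma element_monotone : exists (B : {linear plane -> plane}) (k : R),
  [/\ injective B, 0 <= k < 1,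
    (forall p, ref_triangle a p -> forall h,
      (1 - k) * dot (B h) (B h) <= dot ('D_h F p) (B h)) &
    forall p q, T0 p -> T0 q ->
      (1 - k) * dot (B (ref_map a p - ref_map a q)) (B (ref_map a p - ref_map a q)) <=
      dot (F (ref_map a p) - F (ref_map a q)) (B (ref_map a p - ref_map a q))].
Proof.
have [B [k [injB k01 Bk]]] := element_contraction.
exists B, k; split => //.
  by move=> p Tp h; apply: dot_derive_ge; exact: (Bk p Tp h).2.
move=> p q Tp Tq.
set h := ref_map a p - ref_map a q; set b := B h.
have seg (t : R) : t \in `[0, 1] -> ref_triangle a (ref_map a q + t *: h).
  move=> t01; rewrite ref_triangleE; exists (q + t *: (p - q)); first exact: std_triangle_convex.
  by rewrite /h /ref_map /affine_map; move: u1 u2 => w1 w2; apply: plane_eq; rewrite /= /GRing.scale /=; ring.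
pose f (z : plane) := dot (F z) b.
have D z : ref_triangle a z -> derivable f z h /\ 'D_h f z = dot ('D_h F z) b.
  move=> Tz; have [dF _] := Bk z Tz h.
  apply: (derive_linear_comp (l := fun z => dot z b) _ _ dF) => [t x y|].
    by rewrite dotZl dotBl.
  move=> x; rewrite /dot; apply: cvgD; apply: cvgMl.
    exact: continuous_fst.
  exact: continuous_snd.
have [t t01 E] : exists2 t : R, t \in `[0, 1] & f (ref_map a q + h) - f (ref_map a q) = 'D_h f (ref_map a q + t *: h).
  apply: MVT_chord => t t01; exact: (D _ (seg t t01)).1.
have qh : ref_map a q + h = ref_map a p by rewrite /h addrC subrK.
move: E; rewrite qh /f -dotBl => ->.
rewrite (D _ (seg _ t01)).2; apply: dot_derive_ge; exact: (Bk _ (seg _ t01) h).2.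
Qed.

Lemma noncollinear_comb (x y : R) : x *: u1 + y *: u2 = 0 -> x = 0 /\ y = 0.
Proof.
move: ha; rewrite /noncollinear.
move: u1 u2 => w1 w2; rewrite /dot /perp /= => D E.
have E1 : x * w1.1 + y * w2.1 = 0 by exact: (congr1 fst E).
have E2 : x * w1.2 + y * w2.2 = 0 by exact: (congr1 snd E).
have D' : w1.1 * w2.2 - w1.2 * w2.1 != 0 by move: D; congr (_ != 0); ring.
split; apply: (mulfI D'); rewrite mulr0.
  by transitivity (w2.2 * (x * w1.1 + y * w2.1) - w2.1 * (x * w1.2 + y * w2.2)); [ring|rewrite E1 E2 !mulr0 subrr].
by transitivity (w1.1 * (x * w1.2 + y * w2.2) - w1.2 * (x * w1.1 + y * w2.1)); [ring|rewrite E1 E2 !mulr0 subrr].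
Qed.

(** Monotonicity bounds [B (p - q)] by the difference of the images, and inverting [B] gives the
    lower bound of the chart. Relative to [B] the differential is positive definite, so its
    determinant has the sign of that of [B] throughout, which is [s]. *)
Theorem element_chart : exists U s c, [/\ chart X Y U s c, C2 U X & C2 U Y].
Proof.
have [V [oV TV CX CY]] := element_C2.
have [B [k [injB /andP[k0 k1] BD BM]]] := element_monotone.
have kk : 0 < 1 - k by rewrite subr_gt0.
pose U := ref_map a @^-1` V.
have oU : open U by exact: affine_preimage_open.
have C2X : C2 U X by exact: C2_affine_comp.
have C2Y : C2 U Y by exact: C2_affine_comp.
pose m1 := B u1; pose m2 := B u2.
have Bcomb x y : B (x *: u1 + y *: u2) = x *: m1 + y *: m2 by rewrite linearD !linearZ.
have Bcomb0 x y : x *: m1 + y *: m2 = 0 -> x = 0 /\ y = 0.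
  by rewrite -Bcomb -(linear0 B) => /injB/noncollinear_comb.
pose dm := m1.1 * m2.2 - m2.1 * m1.2.
have dm0 : dm != 0.
  apply/eqP => dm0.
  have e1' : m2.1 *: m1 + (- m1.1) *: m2 = 0.
    by apply: plane_eq; rewrite /= /GRing.scale /=; [ring|rewrite -[RHS]oppr0 -dm0 /dm; ring].
  have e2' : m2.2 *: m1 + (- m1.2) *: m2 = 0.
    by apply: plane_eq; rewrite /= /GRing.scale /=; [rewrite -dm0 /dm; ring|ring].
  have [z1 _] := Bcomb0 _ _ e1'; have [z2 _] := Bcomb0 _ _ e2'.
  have m20 : 0 *: m1 + 1 *: m2 = 0 by apply: plane_eq; rewrite /= /GRing.scale /= ?z1 ?z2; ring.
  by have [_ /eqP] := Bcomb0 _ _ m20; rewrite oner_eq0.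
pose C0 := (`|m1.1| + `|m1.2| + `|m2.1| + `|m2.2|) / `|dm|.
have C00 : 0 <= C0 by rewrite divr_ge0// !addr_ge0.
pose s : R := Num.sg dm.
have s1 : s = 1 \/ s = -1 by rewrite /s; case: sgrP dm0 => //; [left|right].
have sdm : s * dm = `|dm| by rewrite /s -normrEsg.
have Jpos p : T0 p -> 0 < s * jacobian_det X Y p.
  move=> Tp; have Tap : ref_triangle a (ref_map a p) by rewrite ref_triangleE; exists p.
  have Vp : V (ref_map a p) by exact: TV.
  have dX := (CX.1 _ Vp).1; have dY := (CY.1 _ Vp).1.
  have DF h : derivable F (ref_map a p) h by exact: element_derivable.
  pose G1 := 'D_u1 F (ref_map a p); pose G2 := 'D_u2 F (ref_map a p).
  have e1u : (e1 : plane).1 *: u1 + (e1 : plane).2 *: u2 = u1 by rewrite /= scale1r scale0r addr0.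
  have e2u : (e2 : plane).1 *: u1 + (e2 : plane).2 *: u2 = u2 by rewrite /= scale1r scale0r add0r.
  have DX1 : 'D_e1 X p = G1.1.
    rewrite (affine_comp_differentiable dX).2 e1u.
    exact: (derive_linear_comp fst_lin continuous_fst (DF u1)).2.
  have DX2 : 'D_e2 X p = G2.1.
    rewrite (affine_comp_differentiable dX).2 e2u.
    exact: (derive_linear_comp fst_lin continuous_fst (DF u2)).2.
  have DY1 : 'D_e1 Y p = G1.2.
    rewrite (affine_comp_differentiable dY).2 e1u.
    exact: (derive_linear_comp snd_lin continuous_snd (DF u1)).2.
  have DY2 : 'D_e2 Y p = G2.2.
    rewrite (affine_comp_differentiable dY).2 e2u.
    exact: (derive_linear_comp snd_lin continuous_snd (DF u2)).2.
  have Dcomb (x y : R) : 'D_(x *: u1 + y *: u2) F (ref_map a p) = x *: G1 + y *: G2.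
    have fE (l : plane -> R) : (forall (t : R) z w, l (t *: (z - w)) = t * (l z - l w)) -> continuous l ->
      differentiable (l \o F) (ref_map a p) ->
      l ('D_(x *: u1 + y *: u2) F (ref_map a p)) = x * l G1 + y * l G2.
      by move=> ll cl dl; exact: derive_comb_comp.
    apply: plane_eq; first exact: (fE _ fst_lin continuous_fst dX).
    exact: (fE _ snd_lin continuous_snd dY).
  have pd (x y : R) : x != 0 \/ y != 0 -> 0 < dot (x *: G1 + y *: G2) (x *: m1 + y *: m2).
    move=> xy; rewrite -Dcomb -Bcomb; apply: lt_le_trans (BD _ Tap _).
    rewrite Bcomb mulr_gt0// lt_neqAle dot_ge0 andbT eq_sym; apply/eqP => /dot_eq0/Bcomb0[x0 y0].
    by case: xy; rewrite ?x0 ?y0 eqxx.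
  have := posdef_det_gt0 pd; rewrite -/dm /jacobian_det DX1 DX2 DY1 DY2.
  have sdm' : dm = s * `|dm| by rewrite /s -numEsg.
  have ndm : 0 < `|dm| by rewrite normr_gt0.
  by rewrite {1}sdm' mulrA pmulr_lgt0// mulrC.
exists U, s, (C0 * (2 / (1 - k))); split; [|exact: C2X|exact: C2Y].
split; [exact: oU|by move=> q Tq; exact: TV|exact: C2X.1|exact: C2Y.1| |exact: s1|exact: Jpos].
move=> p q Tp Tq; have := BM p q Tp Tq.
rewrite ref_map_sub Bcomb; set d1 := p.1 - q.1; set d2 := p.2 - q.2.
set b := d1 *: m1 + d2 *: m2.
set w := F (ref_map a p) - F (ref_map a q).
have -> : (X p, Y p) - (X q, Y q) = w by rewrite /w /=; case: (F _) (F _) => [? ?] [? ?].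
move=> bw; have eb0 := enorm_ge0 b.
have leb : (1 - k) * enorm b <= enorm w.
  have [b0|b0] := eqVneq (enorm b) 0; first by rewrite b0 mulr0 enorm_ge0.
  have bpos : 0 < enorm b by rewrite lt_neqAle eq_sym b0.
  rewrite -(ler_pM2r bpos) -mulrA -expr2 sqr_enorm; apply: (le_trans bw).
  exact: le_trans (ler_norm _) (cauchy_schwarz _ _).
have leb2 : enorm b <= 2 / (1 - k) * `|w|.
  rewrite mulrAC ler_pdivlMr// mulrC; exact: le_trans leb (enorm_le_norm w).
have b1 : `|b.1| <= enorm b by exact: norm_fst_enorm.
have b2 : `|b.2| <= enorm b by exact: norm_snd_enorm.
have dm_gt0 : 0 < `|dm| by rewrite normr_gt0.
have D1 : d1 = (b.1 * m2.2 - b.2 * m2.1) / dm.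
  by apply: (mulIf dm0); rewrite divfK// /b /dm /= /GRing.scale /=; ring.
have D2 : d2 = (m1.1 * b.2 - m1.2 * b.1) / dm.
  by apply: (mulIf dm0); rewrite divfK// /b /dm /= /GRing.scale /=; ring.
rewrite -mulrA; apply: (@le_trans _ _ (C0 * enorm b)); last by rewrite ler_wpM2l.
have key (x y : R) : `|x| + `|y| <= `|m1.1| + `|m1.2| + `|m2.1| + `|m2.2| ->
  `|(b.1 * x - b.2 * y) / dm| <= C0 * enorm b.
  move=> xy; rewrite normrM normfV /C0 mulrAC ler_pM2r ?invr_gt0//.
  apply: le_trans (ler_normB _ _) _; rewrite !normrM.
  move: b1 b2 xy (normr_ge0 x) (normr_ge0 y) (normr_ge0 b.1) (normr_ge0 b.2) eb0.
  move: `|b.1| `|b.2| (enorm b) (_ + _ + _ + _) `|x| `|y| => *; nra.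
apply: norm_pair_le; rewrite /= -/d1 -/d2 ?D1 ?D2.
  by apply: key; have := normr_ge0 m1.1; have := normr_ge0 m1.2; lra.
have -> : m1.1 * b.2 - m1.2 * b.1 = b.1 * (- m1.2) - b.2 * (- m1.1) by ring.
by apply: key; rewrite !normrN; have := normr_ge0 m2.1; have := normr_ge0 m2.2; lra.
Qed.
End ElementChart.

(** * Traces and the identity on one element *)

Section ChartTraces.
Context {R : realType}.
Local Notation plane := (R * R)%type.
Local Notation T0 := (@std_triangle R).
Implicit Types (p q : plane) (f g u : plane -> R).
Local Notation J := jacobian_det.

(** By Cramer's rule, [grad1] and [grad2] are the components of the gradient at [G p] of the
    function whose pullback is [g]. *)
Definition grad1 (X Y : plane -> R) g p : R := J g Y p / J X Y p.
Definition grad2 (X Y : plane -> R) g p : R := J X g p / J X Y p.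

Lemma jacobian_det_continuous (U : set plane) f g p : C1 U f -> C1 U g -> U p ->
  {for p, continuous (J f g)}.
Proof.
move=> Cf Cg Up; have [_ cf] := Cf _ Up; have [_ cg] := Cg _ Up.
by apply: cvgB; apply: cvgM; [exact: cf|exact: cg|exact: cf|exact: cg].
Qed.

Lemma jacobian_det_C1 (U : set plane) f g : open U -> C2 U f -> C2 U g -> C1 U (J f g).
Proof.
move=> oU [_ Cf] [_ Cg].
have -> : J f g = ('D_e1 f \* 'D_e2 g) \- ('D_e2 f \* 'D_e1 g) by [].
by apply: C1B => //; apply: C1M => //.
Qed.

(** A Jacobian without zeros on the whole open set makes the quotients [grad1] and [grad2] C^1
    there, not only on the closed triangle. *)
Lemma chart_shrink (X Y : plane -> R) (U : set plane) (s c : R) :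
  chart X Y U s c -> C2 U X -> C2 U Y ->
  exists U', [/\ chart X Y U' s c, C2 U' X, C2 U' Y & forall p, U' p -> J X Y p != 0].
Proof.
move=> ch CX CY; pose U' := U `&` [set p | J X Y p != 0].
have sU : U' `<=` U by move=> ? [].
have s2 f : C2 U f -> C2 U' f.
  by move=> [C1f C2f]; split=> [|v]; exact: C1_sub sU _.
have oU : open U'.
  rewrite openE => p [Up Jp].
  have cJ := jacobian_det_continuous (chart_C1x ch) (chart_C1y ch) Up.
  have nU : nbhs p U by exact: (open_nbhs_nbhs (conj (chart_open ch) Up)).
  have nJ : \forall q \near p, J X Y q != 0.
    exact: (cvgr_neq0 _ cJ Jp).
  by near=> q; split; near: q.
exists U'; split; [|exact: s2|exact: s2|by move=> p []].
case: ch => [oU0 sT C1x C1y lo sg dt]; split => //.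
- by move=> p Tp; split; [exact: sT|]; have := dt p Tp; apply: contraTneq => /= ->; rewrite mulr0 ltxx.
- exact: C1_sub sU _.
- exact: C1_sub sU _.
Unshelve. all: by end_near. Qed.

Lemma near_norm_lt p (d : R) : 0 < d -> \forall q \near p, `|q - p| < d.
Proof. move=> d0; apply/near_planeP; exists d => // x y h1 h2.
exact: norm_pair_lt. Qed.

Variables (X Y : plane -> R) (U : set plane) (s c : R).
Hypothesis chG : chart X Y U s c.
Local Notation G := (chart_map X Y).
Local Notation K := [set G p | p in T0].
Local Notation I := (@std_interior R).

(** The ray whose pulled-back direction points to the centroid enters the interior. Hence the
    filters that define traces are proper. *)
Lemma chart_closure p : T0 p -> closure K° (G p).
Proof.
move=> Tp B nB; rewrite (chart_interior chG).
pose z : plane := (1 / 3 - p.1, 1 / 3 - p.2).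
pose w := push X Y p z.
have H : \forall t \near (0 : R)^'+, [set G p | p in I] (G p + t *: w).
  apply: (chart_inward chG Tp); rewrite ?(inv1_push chG)// ?(inv2_push chG)//=; lra.
have Z : (fun t : R => G p + t *: w) t @[t --> (0 : R)] --> G p.
  rewrite -[X in _ --> X]addr0 -(scale0r w); apply: line_continuous.
have nB' : \forall t \near (0 : R)^'+, B (G p + t *: w).
  have := cvg_at_right_filter Z; exact.
by have [t [Ht Bt]] := filter_ex (filterI H nB'); exists (G p + t *: w).
Qed.

Lemma chart_near_inv p (P : plane -> Prop) : T0 p -> (\forall q \near p, P q) ->
  \forall y \near G p, forall q, T0 q -> y = G q -> P q.
Proof.
move=> Tp /near_plane_ball [d d0 H].
have c1 : 0 < c + 1 by have := chart_cst_ge0 chG; lra.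
have B : \forall y \near G p, `|G p - y| < d / (c + 1).
  have d1 : 0 < d / (c + 1) by rewrite divr_gt0.
  by near=> y; rewrite distrC; near: y; exact: near_norm_lt.
near=> y => q Tq yq; apply: H.
have := chart_lower chG Tq Tp; rewrite -/(G q) -/(G p) -yq => h.
apply: le_lt_trans h _; apply: (@le_lt_trans _ _ ((c + 1) * `|y - G p|)).
  by rewrite ler_wpM2r// lerDl.
rewrite mulrC -ltr_pdivlMr// distrC; near: y; exact: B.
Unshelve. all: by end_near. Qed.

Lemma trace_cvg p u g : T0 p -> (forall q, I q -> u (G q) = g q) ->
  {for p, continuous g} -> u y @[y --> within K° (nbhs (G p))] --> g p.
Proof.
move=> Tp ug cg.
apply/cvgrPdist_le => e e0.
have ng : \forall q \near p, `|g p - g q| <= e by exact: cvgr_dist_le cg _ e0.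
have := chart_near_inv Tp ng.
rewrite /within /= !nearE => /filterS; apply => y Hy.
rewrite (chart_interior chG) => -[q Iq E]; rewrite -E ug//.
by apply: Hy => //; exact: std_interior_sub.
Qed.

Lemma trace_chart p u g : T0 p -> (forall q, I q -> u (G q) = g q) ->
  {for p, continuous g} -> trace K° u (G p) = g p.
Proof.
move=> Tp ug cg; have Pr : ProperFilter (within K° (nbhs (G p))).
  by apply: within_nbhs_proper; exact: chart_closure.
apply: cvg_lim; first exact: Rhausdorff.
exact: trace_cvg.
Qed.

Lemma inv_gradE g p w : T0 p ->
  inv1 X Y p w * 'D_e1 g p + inv2 X Y p w * 'D_e2 g p =
  w.1 * grad1 X Y g p + w.2 * grad2 X Y g p.
Proof.
move=> /(chart_det_neq0 chG); rewrite /inv1 /inv2 /grad1 /grad2 /jacobian_det.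
move: ('D_e1 g p) ('D_e2 g p) ('D_e1 X p) ('D_e2 X p) ('D_e1 Y p) ('D_e2 Y p) w.1 w.2.
by move=> *; field.
Qed.

Lemma linear_comb_error (e c0 W g1 g2 i1 i2 d1 d2 v : R) : 0 <= e -> 0 <= W ->
  `|v - (d1 * g1 + d2 * g2)| <= e * (c0 * W) -> `|d1 - i1| <= e * W -> `|d2 - i2| <= e * W ->
  `|v - (i1 * g1 + i2 * g2)| <= e * (`|g1| + `|g2| + c0 + 1) * W.
Proof.
move=> e0 W0 hv h1 h2.
have -> : v - (i1 * g1 + i2 * g2) = (v - (d1 * g1 + d2 * g2)) + ((d1 - i1) * g1 + (d2 - i2) * g2).
  by ring.
apply: le_trans (ler_normD _ _) _; apply: le_trans (lerD hv (ler_normD _ _)) _.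
rewrite !normrM.
have k1 : `|d1 - i1| * `|g1| <= e * W * `|g1| by rewrite ler_wpM2r.
have k2 : `|d2 - i2| * `|g2| <= e * W * `|g2| by rewrite ler_wpM2r.
have eW : 0 <= e * W by rewrite mulr_ge0.
have -> : e * (`|g1| + `|g2| + c0 + 1) * W = e * W * `|g1| + e * W * `|g2| + e * (c0 * W) + e * W by ring.
by lra.
Qed.

(** The expansion of the inverse chart is inserted into that of [g]. Interior points suffice,
    because on the edges [u] is unrelated to [g]. *)
Lemma push_differentiable p u g : I p -> (forall q, I q -> u (G q) = g q) ->
  differentiable g p -> differentiable u (G p) /\
  forall v, 'D_v u (G p) = v.1 * grad1 X Y g p + v.2 * grad2 X Y g p.
Proof.
move=> Ip ug dg; have Tp := std_interior_sub Ip.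
apply: differentiable_grad => eps e0.
have c0 := chart_cst_ge0 chG.
set g1 := 'D_e1 g p; set g2 := 'D_e2 g p.
pose M := `|g1| + `|g2| + c + 1.
have M0 : 0 < M by rewrite /M; have := normr_ge0 g1; have := normr_ge0 g2; lra.
pose e := eps / M.
have e'0 : 0 < e by rewrite divr_gt0.
have ng := grad_differentiable dg e'0.
have N1 := chart_near_inv Tp ng.
have [rho rho0 /(_ e e'0)[d d0 Hd]] := chart_inv_expansion chG Tp.
have nr : \forall q \near p, `|q - p| <= rho.
  by near=> q; apply: ltW; near: q; exact: near_norm_lt.
have N2 := chart_near_inv Tp nr.
have N3 : \forall y \near G p, `|y - G p| < d by exact: near_norm_lt.
have N4 : \forall y \near G p, [set G q | q in I] y.
  apply: open_nbhs_nbhs; split; last by exists p.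
  by apply: (chart_image_open chG); [exact: std_interior_open|exact: std_interior_sub].
near=> y.
have [q Iq yE] : [set G q | q in I] y by near: y.
have Tq := std_interior_sub Iq.
have A1 : forall q, T0 q -> y = G q -> `|g q - g p -
  ((q.1 - p.1) * 'D_e1 g p + (q.2 - p.2) * 'D_e2 g p)| <= e * `|q - p| by near: y.
have A2 : forall q, T0 q -> y = G q -> `|q - p| <= rho by near: y.
have A3 : `|y - G p| < d by near: y.
have B1 := A1 q Tq (esym yE); have B2 := A2 q Tq (esym yE).
have low := chart_lower chG Tq Tp; rewrite -/(G q) -/(G p) in low.
rewrite -yE; rewrite -yE in A3.
rewrite (ug _ Iq) (ug _ Ip); set w := G q - G p in low A3 *.
have [h1 h2] := Hd q B2 A3; rewrite -/w in h1 h2.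
have E := inv_gradE g w Tp; rewrite -/g1 -/g2 in E.
have -> : ((G q).1 - (G p).1) * grad1 X Y g p + ((G q).2 - (G p).2) * grad2 X Y g p =
  inv1 X Y p w * g1 + inv2 X Y p w * g2 by rewrite E.
rewrite -/g1 -/g2 in B1.
have W0 := normr_ge0 w.
have eM : e * M = eps by rewrite /e divfK// gt_eqF.
have B1' : `|g q - g p - ((q.1 - p.1) * g1 + (q.2 - p.2) * g2)| <= e * (c * `|w|).
  by apply: le_trans B1 _; rewrite ler_wpM2l// ltW.
move: B1' h1 h2; rewrite -eM /M; move: `|w| W0 => W W0.
move: (inv1 _ _ _ _) (inv2 _ _ _ _) (q.1 - p.1) (q.2 - p.2) (g q - g p) => i1 i2 d1 d2 dg' B1' h1 h2.
apply: linear_comb_error h1 h2 => //; exact: ltW.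
Unshelve. all: by end_near. Qed.

End ChartTraces.

(** * Second derivatives and the determinant identity on one element *)

Section ElementCalculus.
Context {R : realType}.
Local Notation plane := (R * R)%type.
Local Notation T0 := (@std_triangle R).
Local Notation mu := (@lebesgue_measure R).
Implicit Types (p q : plane) (f g u : plane -> R).
Local Notation J := jacobian_det.
Local Notation I := (@std_interior R).

Definition edge_circulation f g (i : 'I_3) : R :=
  line_integral f g (edge_base i) (edge_dir i).

Lemma tri_integral_edges f g : tri_integral f g 0 1 = \sum_i edge_circulation f g i.
Proof.
rewrite sum_ord3 /tri_integral /edge_circulation !edge_baseE !edge_dirE !scale1r !add0r.
by move: (line_integral _ _ _ _) (line_integral _ _ _ _) (line_integral _ _ _ _) => *; rewrite addrC addrA.
Qed.

Lemma jacobian_det_antisym f g p : J f g p = - J g f p.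
Proof.
rewrite /jacobian_det.
by move: ('D_e1 f p) ('D_e2 f p) ('D_e1 g p) ('D_e2 g p) => *; ring.
Qed.

Variables (X Y : plane -> R) (U : set plane) (s c : R).
Hypothesis chG : chart X Y U s c.
Hypotheses (C2X : C2 U X) (C2Y : C2 U Y) (J0 : forall p, U p -> J X Y p != 0).
Local Notation G := (chart_map X Y).
Local Notation K := [set G p | p in T0].
Local Notation Dx := (grad1 X Y).
Local Notation Dy := (grad2 X Y).

Let oU : open U := chart_open chG.
Let sU : T0 `<=` U := chart_sub chG.

Lemma grad1_C1 g : C2 U g -> C1 U (Dx g).
Proof.
move=> C2g; have -> : Dx g = J g Y \* (fun p => (J X Y p)^-1) by [].
by apply: C1M => //; [exact: jacobian_det_C1|apply: C1V => //; exact: jacobian_det_C1].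
Qed.

Lemma grad2_C1 g : C2 U g -> C1 U (Dy g).
Proof.
move=> C2g; have -> : Dy g = J X g \* (fun p => (J X Y p)^-1) by [].
by apply: C1M => //; [exact: jacobian_det_C1|apply: C1V => //; exact: jacobian_det_C1].
Qed.

Lemma grad1_continuous g p : C1 U g -> U p -> {for p, continuous (Dx g)}.
Proof.
move=> C1g Up; apply: cvgM; first exact: (jacobian_det_continuous C1g C2Y.1 Up).
by apply: cvgV; [exact: J0|exact: (jacobian_det_continuous C2X.1 C2Y.1 Up)].
Qed.

Lemma grad2_continuous g p : C1 U g -> U p -> {for p, continuous (Dy g)}.
Proof.
move=> C1g Up; apply: cvgM; first exact: (jacobian_det_continuous C2X.1 C1g Up).
by apply: cvgV; [exact: J0|exact: (jacobian_det_continuous C2X.1 C2Y.1 Up)].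
Qed.

Lemma chain_rule g p d : C1 U g -> U p ->
  'D_d g p = Dx g p * 'D_d X p + Dy g p * 'D_d Y p.
Proof.
move=> C1g Up; have := J0 Up.
rewrite (derive_pairE d (C1g _ Up).1) (derive_pairE d (C2X.1 _ Up).1) (derive_pairE d (C2Y.1 _ Up).1).
rewrite /grad1 /grad2 /jacobian_det.
move: ('D_e1 g p) ('D_e2 g p) ('D_e1 X p) ('D_e2 X p) ('D_e1 Y p) ('D_e2 Y p) d.1 d.2.
by move=> *; field.
Qed.

Lemma jacobian_grad f g p : U p -> J f g p = J X Y p * (Dx f p * Dy g p - Dy f p * Dx g p).
Proof.
move=> Up; have := J0 Up; rewrite /grad1 /grad2 /jacobian_det.
move: ('D_e1 f p) ('D_e2 f p) ('D_e1 g p) ('D_e2 g p) ('D_e1 X p) ('D_e2 X p) ('D_e1 Y p) ('D_e2 Y p).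
by move=> *; field.
Qed.

Variables (w v : plane -> R).
Hypotheses (C2w : C2 U w) (vw : forall q, I q -> v (G q) = w q).
Local Notation g1 := (Dx w).
Local Notation g2 := (Dy w).

(** Pullback of the derivative of [v] in direction [e]. It is C^1 across the edges of [T0], where
    [v] itself need not be differentiable. *)
Definition grad_along (e p : plane) : R := e.1 * g1 p + e.2 * g2 p.

Lemma grad_along_C1 e : C1 U (grad_along e).
Proof.
have -> : grad_along e = (fun p => e.1 * g1 p) \+ (fun p => e.2 * g2 p) by [].
by apply: C1D => //; apply: C1Z => //; [exact: grad1_C1|exact: grad2_C1].
Qed.

Definition hess_along (e e' p : plane) : R :=
  e.1 * Dx (grad_along e') p + e.2 * Dy (grad_along e') p.

Lemma hess_along_continuous e e' p : U p -> {for p, continuous (hess_along e e')}.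
Proof.
move=> Up; apply: cvgD; apply: cvgMr.
  by apply: grad1_continuous => //; exact: grad_along_C1.
by apply: grad2_continuous => //; exact: grad_along_C1.
Qed.

Lemma derive_interior e q : I q -> 'D_e v (G q) = grad_along e q.
Proof.
move=> Iq; have Uq := sU (std_interior_sub Iq).
exact: (push_differentiable chG Iq vw (C2w.1 _ Uq).1).2.
Qed.

Lemma derive2_interior e e' q : I q -> 'D_e ('D_e' v) (G q) = hess_along e e' q.
Proof.
move=> Iq; have Uq := sU (std_interior_sub Iq).
have h q' : I q' -> 'D_e' v (G q') = grad_along e' q' by exact: derive_interior.
exact: (push_differentiable chG Iq h (grad_along_C1 _ Uq).1).2.
Qed.

Lemma trace_value p : T0 p -> trace K° v (G p) = w p.
Proof.
by move=> Tp; apply: (trace_chart chG Tp vw); exact: C1_continuous C2w.1 (sU Tp).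
Qed.

Lemma trace_derive e p : T0 p -> trace K° ('D_e v) (G p) = grad_along e p.
Proof.
move=> Tp; apply: (trace_chart chG Tp) => [q|]; first exact: derive_interior.
exact: C1_continuous (grad_along_C1 e) (sU Tp).
Qed.

Lemma trace_derive2 e e' p : T0 p -> trace K° ('D_e ('D_e' v)) (G p) = hess_along e e' p.
Proof.
move=> Tp; apply: (trace_chart chG Tp) => [q|]; first exact: derive2_interior.
exact: hess_along_continuous (sU Tp).
Qed.

Lemma grad_along_e1 : grad_along e1 = g1.
Proof. by apply/funext => p; rewrite /grad_along /= mul1r mul0r addr0. Qed.
Lemma grad_along_e2 : grad_along e2 = g2.
Proof. by apply/funext => p; rewrite /grad_along /= mul1r mul0r add0r. Qed.

Lemma closed_form_circulation p d : in_seg U p d ->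
  line_integral g1 X p d + line_integral g2 Y p d = w (p + d) - w p.
Proof.
move=> sg; rewrite -(line_integral_cst C2w.1 sg).
have C1g1 := grad1_C1 C2w; have C1g2 := grad2_C1 C2w.
have c1 := line_integrand_continuous C1g1 C2X.1 sg.
have c2 := line_integrand_continuous C1g2 C2Y.1 sg.
rewrite /line_integral -RintegralD//; try exact: continuous_itv_integrable.
apply: eq_Rintegral_itv => t t01; rewrite /line_integrand mul1r.
by rewrite (chain_rule d C2w.1 (sg _ t01)).
Qed.

(** The form [g1 dX + g2 dY = dw] is exact, so its circulation around every small triangle is zero.
    The local Green formula turns this into [J g1 X + J g2 Y = 0], which is the symmetry. *)
Lemma hess_sym p : T0 p -> Dx g2 p = Dy g1 p.
Proof.
have tele (x1 x2 x3 x4 x5 x6 w0 w1 w2 : R) : x1 + x2 = w0 - w2 ->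
  x3 + x4 = w2 - w1 -> x5 + x6 = w1 - w0 -> x5 + x3 + x1 + (x6 + x4 + x2) = 0 by lra.
move=> Tp; have Up := sU Tp.
have C1g1 := grad1_C1 C2w; have C1g2 := grad2_C1 C2w.
suff : J g1 X p + J g2 Y p = 0.
  move=> h; rewrite /grad1 /grad2; congr (_ / _).
  rewrite (jacobian_det_antisym X); move: (J _ _ p) (J _ _ p) h => x y h.
  by apply/eqP; rewrite -subr_eq0 opprK addrC h.
apply/eqP; rewrite -normr_le0; apply/ler_addgt0Pr => e e0; rewrite add0r.
have e4 : 0 < e / 4 by rewrite divr_gt0.
have [d1 d10 H1] := tri_integral_local oU Up C1g1 C2X.1 e4.
have [d2 d20 H2] := tri_integral_local oU Up C1g2 C2Y.1 e4.
pose r : R := Num.min (1 / 2) (Num.min (d1 / 2) (d2 / 2)).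
have r0 : 0 < r by rewrite !lt_min !divr_gt0.
have rh : r <= 1 / 2 by rewrite ge_min lexx.
have r1 : r < d1.
  by apply: (@le_lt_trans _ _ (d1 / 2)); [rewrite !ge_min lexx orbT|rewrite ltr_pdivrMr// ltr_pMr// ltr1n].
have r2 : r < d2.
  by apply: (@le_lt_trans _ _ (d2 / 2)); [rewrite !ge_min lexx !orbT|rewrite ltr_pdivrMr// ltr_pMr// ltr1n].
(* Then [tri q r] is [T0] contracted towards [p]: it contains [p] and stays in [T0], even when [p]
   is a vertex. *)
pose q := (1 - r) *: p.
have tp : tri q r p.
  by exists p => //; rewrite /q -scalerDl subrK scale1r.
have tT : tri q r `<=` T0.
  move=> _ [z Tz <-]; case: Tp Tz => ? ? ? [? ? ?].
  by split; rewrite /q /= /GRing.scale /=; nra.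
have [sg1 sg2 sg3] := in_seg_tri_edges (subset_trans tT sU).
have nr : `|r| = r by rewrite gtr0_norm.
have := H1 q r tp; have := H2 q r tp; rewrite nr => /(_ r2) B2 /(_ r1) B1.
have Z : tri_integral g1 X q r + tri_integral g2 Y q r = 0.
  have := closed_form_circulation sg1; have := closed_form_circulation sg2.
  have := closed_form_circulation sg3; rewrite /tri_integral.
  have -> : q + r *: e1 + r *: (e2 - e1) = q + r *: e2 by rewrite -addrA -scalerDr [e1 + _]addrC subrK.
  rewrite addrK.
  move: (w q) (w (q + r *: e1)) (w (q + r *: e2)) => w0 w1 w2.
  move: (line_integral _ _ _ _) => x1; move: (line_integral _ _ _ _) => x2.
  move: (line_integral _ _ _ _) => x3; move: (line_integral _ _ _ _) => x4.
  move: (line_integral _ _ _ _) => x5; move: (line_integral _ _ _ _) => x6.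
  exact: tele.
have x0 : 0 < r ^+ 2 by rewrite exprn_gt0.
rewrite -/(J g1 X p) in B1; rewrite -/(J g2 Y p) in B2.
rewrite -(ler_pM2l x0) -(gtr0_norm x0) -normrM (gtr0_norm x0).
move: B1 B2 Z; move: (tri_integral _ _ _ _) (tri_integral _ _ _ _) (r ^+ 2) (J g1 X p) (J g2 Y p) => t1 t2 x j1 j2.
by rewrite !ler_norml => /andP[? ?] /andP[? ?] ?; apply/andP; split; lra.
Qed.

Lemma hess_along_e (p : plane) : [/\ hess_along e1 e1 p = Dx g1 p, hess_along e1 e2 p = Dx g2 p,
  hess_along e2 e1 p = Dy g1 p & hess_along e2 e2 p = Dy g2 p].
Proof.
rewrite /hess_along grad_along_e1 grad_along_e2.
move: (Dx g1 p) (Dx g2 p) (Dy g1 p) (Dy g2 p) => x y z t.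
by rewrite /= !mul1r !mul0r !addr0 !add0r.
Qed.

(** The share of one edge in the circulation of [g1 dg2 - g2 dg1]; [s] makes the direction
    counterclockwise on the image. *)
Definition curl_term (i : 'I_3) : R :=
  s * (edge_circulation g1 g2 i - edge_circulation g2 g1 i).

(** Green's formula is applied to [g1 dg2] and to [g2 dg1]. Each yields one of the two copies of the
    determinant, and their difference is the antisymmetric form. *)
Lemma element_identity (h11 h12 h21 h22 : plane -> R) :
  (forall p, T0 p -> h11 (G p) = Dx g1 p) -> (forall p, T0 p -> h12 (G p) = Dx g2 p) ->
  (forall p, T0 p -> h21 (G p) = Dy g1 p) -> (forall p, T0 p -> h22 (G p) = Dy g2 p) ->
  \int[area]_(y in K) ((h11 y + h22 y) ^+ 2) =
  \int[area]_(y in K) (h11 y ^+ 2 + h12 y ^+ 2 + h21 y ^+ 2 + h22 y ^+ 2) + \sum_i curl_term i.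
Proof.
move=> E11 E12 E21 E22.
have C1g1 := grad1_C1 C2w; have C1g2 := grad2_C1 C2w.
have cK : compact K by apply: (chart_image_compact chG) => //; exact: std_triangle_compact.
have c11 p : T0 p -> {for p, continuous (Dx g1)} by move=> Tp; exact: grad1_continuous C1g1 (sU Tp).
have c12 p : T0 p -> {for p, continuous (Dx g2)} by move=> Tp; exact: grad1_continuous C1g2 (sU Tp).
have c21 p : T0 p -> {for p, continuous (Dy g1)} by move=> Tp; exact: grad2_continuous C1g1 (sU Tp).
have c22 p : T0 p -> {for p, continuous (Dy g2)} by move=> Tp; exact: grad2_continuous C1g2 (sU Tp).
have k11 := chart_within_continuous chG c11 E11.
have k12 := chart_within_continuous chG c12 E12.
have k21 := chart_within_continuous chG c21 E21.
have k22 := chart_within_continuous chG c22 E22.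
pose det y := h11 y * h22 y - h21 y * h12 y.
have kdet : {within K, continuous det}.
  by move=> y; apply: cvgB; apply: cvgM; [exact: k11|exact: k22|exact: k21|exact: k12].
have khess : {within K, continuous (fun y => h11 y ^+ 2 + h12 y ^+ 2 + h21 y ^+ 2 + h22 y ^+ 2)}.
  have sq (h : plane -> R) : {within K, continuous h} -> {within K, continuous (fun y => h y ^+ 2)}.
    move=> kh; have -> : (fun y => h y ^+ 2) = (fun y => h y * h y) by apply/funext => y; rewrite expr2.
    by move=> y; apply: cvgM; exact: kh.
  move=> y; apply: cvgD; last exact: (sq _ k22).
  apply: cvgD; last exact: (sq _ k21).
  apply: cvgD; [exact: (sq _ k11)|exact: (sq _ k12)].
have ihess := plane_within_integrable cK khess.
have idet := plane_within_integrable cK kdet.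
have mK := plane_compact_measurable cK.
have D1 : \int[area]_(y in K) det y = s * tri_integral g1 g2 0 1.
  apply: (green chG C1g1 C1g2) => p Tp.
  rewrite (jacobian_grad g1 g2 (sU Tp)) /det E11// E12// E21// E22//.
  by move: (Dx g1 p) (Dx g2 p) (Dy g1 p) (Dy g2 p) (J X Y p) => *; ring.
have kndet : {within K, continuous (fun y => - det y)} by move=> y; apply: cvgN; exact: kdet.
have D2 : \int[area]_(y in K) (- det y) = s * tri_integral g2 g1 0 1.
  apply: (green chG C1g2 C1g1) => p Tp.
  rewrite (jacobian_grad g2 g1 (sU Tp)) /det E11// E12// E21// E22//.
  by move: (Dx g1 p) (Dx g2 p) (Dy g1 p) (Dy g2 p) (J X Y p) => *; ring.
have indet := plane_within_integrable cK kndet.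
have kk : {within K, continuous (fun y => det y - (- det y))}.
  by move=> y; apply: cvgB; [exact: kdet|exact: kndet].
have ikk := plane_within_integrable cK kk.
have D3 : \int[area]_(y in K) (det y - (- det y)) = \sum_i curl_term i.
  rewrite (@RintegralB _ _ R (mu \x mu)%E K det (fun y => - det y) mK idet indet).
  transitivity (s * tri_integral g1 g2 0 1 - s * tri_integral g2 g1 0 1).
    exact: (congr2 (fun a b : R => a - b) D1 D2).
  by rewrite !tri_integral_edges -mulrBr -sumrB mulr_sumr.
rewrite -D3.
rewrite -(@RintegralD _ _ R (mu \x mu)%E K _ (fun y => det y - (- det y)) mK ihess ikk).
apply: eq_Rintegral => y /set_mem [p Tp <-].
rewrite /det E11// E12// E21// E22//; have -> := hess_sym Tp.
by move: (Dx g1 p) (Dy g1 p) (Dy g2 p) => *; ring.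
Qed.

End ElementCalculus.

(** * Edges of an element *)

Section SegmentCalculus.
Context {R : realType}.
Local Notation mu := (@lebesgue_measure R).

(** The end points are left out because they will be vertices, where the integrands of the theorem
    are not computed. Measurability of [f] follows from that of [g], an interval differing from its
    interior by two points. *)
Lemma eq_Rintegral_oo (a b : R) (f g : R -> R) :
  (forall t : R, t \in `]a, b[ -> f t = g t) ->
  {within `[a, b], continuous g} ->
  \int[mu]_(t in `[a, b]) f t = \int[mu]_(t in `[a, b]) g t.
Proof.
move=> fg cg.
have mg : measurable_fun [set` `[a, b]] g.
  by apply: measurable_realfun.subspace_continuous_measurable_fun => //.
have mgo : measurable_fun [set` `]a, b[] g.
  by apply: measurable_funS mg => //; exact: subset_itv_oo_cc.
have mfo : measurable_fun [set` `]a, b[] f.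
  by apply: eq_measurable_fun mgo => t; rewrite inE /= => h; rewrite fg.
have red (h : R -> R) : measurable_fun [set` `]a, b[] h ->
    (\int[mu]_(t in `[a, b]) (h t)%:E = \int[mu]_(t in `]a, b[) (h t)%:E)%E.
  move=> mh; rewrite -integral_itv_obnd_cbnd; last first.
    by apply/measurable_realfun.measurable_EFinP/measurable_realfun.measurable_fun_itv_bndo_bndcP.
  rewrite -integral_itv_bndo_bndc//.
  exact/measurable_realfun.measurable_EFinP.
rewrite /Rintegral !red//; congr fine; apply: eq_integral => t; rewrite inE /= => h.
by rewrite fg.
Qed.

Lemma FTC2_oo (a b : R) (W w f : R -> R) : a <= b ->
  {within `[a, b], continuous W} -> {within `[a, b], continuous w} ->
  (forall t : R, t \in `]a, b[ -> is_derive t 1 W (w t)) ->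
  (forall t : R, t \in `]a, b[ -> f t = w t) ->
  \int[mu]_(t in `[a, b]) f t = W b - W a.
Proof.
move=> ab cW cw dW fw; rewrite (eq_Rintegral_oo fw cw).
move: ab; rewrite le_eqVlt => /orP[/eqP <-|ab].
  by rewrite subrr set_itv1 Rintegral_set1.
rewrite /Rintegral (@continuous_FTC2 _ w W)//.
- have [_ ca cb] := (continuous_within_itvP _ ab).1 cW.
  by split => // t /dW[].
- by move=> t /dW[_]; rewrite derive1E.
Qed.

(** The edge parameter and the length along the tangent may run in opposite directions; the sign of
    [k] tells which case holds. *)
Lemma rescale_ends (t0 k al be : R) : k != 0 -> al <= be ->
  (forall s : R, s \in `[al, be] <-> t0 + s / k \in `[0, 1]) ->
  [/\ 0 < k, t0 + al / k = 0 & t0 + be / k = 1] \/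
  [/\ k < 0, t0 + al / k = 1 & t0 + be / k = 0].
Proof.
move=> k0 ab H.
have Hal : t0 + al / k \in `[0, 1] by apply/H; rewrite in_itv/= lexx.
have Hbe : t0 + be / k \in `[0, 1] by apply/H; rewrite in_itv/= lexx ab.
have E (t : R) : t0 + ((t - t0) * k) / k = t by rewrite mulfK// addrC subrK.
have H0 : (0 - t0) * k \in `[al, be] by apply/H; rewrite E in_itv/= lexx ler01.
have H1 : (1 - t0) * k \in `[al, be] by apply/H; rewrite E in_itv/= lexx ler01.
have M (x : R) : x = (t0 + x / k - t0) * k by rewrite addrAC subrr add0r divfK.
move: Hal Hbe H0 H1; rewrite !in_itv/= => /andP[a0 a1] /andP[b0 b1] /andP[l0 r0] /andP[l1 r1].
move: l0 r0 l1 r1 a0 a1 b0 b1; have := M al; have := M be.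
move: (t0 + al / k) (t0 + be / k) => x y -> -> l0 r0 l1 r1 x0 x1 y0 y1.
move: k0; rewrite neq_lt => /orP[kn|kp].
  right; split => //; apply/eqP; rewrite eq_le ?x1 ?y0 ?andbT /=.
    by move: l1; rewrite ler_nM2r// lerD2r.
  by move: r0; rewrite ler_nM2r// lerD2r.
left; split => //; apply/eqP; rewrite eq_le ?y1 ?x0 ?andbT /=.
  by move: l0; rewrite ler_pM2r// lerD2r.
by move: r1; rewrite ler_pM2r// lerD2r.
Qed.

Lemma is_derive_rescale (t0 k s : R) (f : R -> R) (d : R) : k != 0 ->
  is_derive (t0 + s / k) 1 f d -> is_derive s 1 (fun r => f (t0 + r / k)) (d / k).
Proof.
move=> k0 df.
have dl : is_derive s 1 (fun r : R => t0 + r / k) (k^-1).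
  have d1 : is_derive s 1 (cst t0 : R -> R) 0 by exact: is_derive_cst.
  have d2 : is_derive s 1 (k^-1 \*: (id : R -> R)) (k^-1 *: 1) by exact: is_deriveZ.
  have := is_deriveD d1 d2; rewrite add0r /GRing.scale /= mulr1.
  move=> h; suff E : (fun r : R => t0 + r / k) = (cst t0 + k^-1 \*: id) by rewrite E.
  by apply/funext => r; rewrite /= /GRing.scale /= mulrC.
pose l (r : R) := t0 + r / k; have dfl : is_derive (l s) 1 f d by exact: df.
have := is_derive1_comp (g := l) dfl dl.
by rewrite /GRing.scale /=.
Qed.

Lemma Rintegral_rescale (t0 k al be : R) (f : R -> R) : k != 0 -> al <= be ->
  (forall s : R, s \in `[al, be] <-> t0 + s / k \in `[0, 1]) ->
  (forall t : R, t \in `[0, 1] -> {for t, continuous f}) ->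
  \int[mu]_(s in `[al, be]) f (t0 + s / k) = `|k| * \int[mu]_(t in `[0, 1]) f t.
Proof.
move=> k0 ab H cf.
have [P dP] := primitive_segment ler01 cf.
rewrite (FTC2_segment ler01 dP cf).
pose W (s : R) := k * P (t0 + s / k).
have dW (s : R) : s \in `[al, be] -> is_derive s 1 W (f (t0 + s / k)).
  move=> /H/dP dPs; have h := is_derive_rescale k0 dPs.
  have := is_deriveZ k h; rewrite /GRing.scale /= mulrCA mulfV// mulr1; exact.
have cW (s : R) : s \in `[al, be] -> {for s, continuous (fun r : R => f (t0 + r / k))}.
  move=> /H h; apply: continuous_comp; last exact: cf.
  by apply: cvgD; [exact: cvg_cst|apply: cvgMl; exact: cvg_id].
rewrite (FTC2_segment ab dW cW) /W.
have [[kp -> ->]|[kn -> ->]] := rescale_ends k0 ab H.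
  by rewrite gtr0_norm// mulrBr.
by rewrite ltr0_norm// mulNr mulrBr opprB.
Qed.

(** At an end point only inward increments can be evaluated. They determine the derivative because
    its existence is assumed. *)
Lemma derive_affine_itv (f : R -> R) (a b d t : R) : t \in `[0, 1] ->
  is_derive t 1 f d -> (forall r : R, r \in `[0, 1] -> f r = a + r * b) -> d = b.
Proof.
move=> t01 df fE.
have cf : continuous (fun r : R => a + r * b).
  by move=> r; apply: cvgD; [exact: cvg_cst|apply: cvgMl; exact: cvg_id].
suff H : forall e, 0 < e -> `|d - b| <= e.
  apply/eqP; rewrite -subr_eq0 -normr_le0; apply/ler_addgt0Pr => e e0; rewrite add0r; exact: H.
move=> e e0; case: df => /cvg_ex[l lim] Dl.
have {Dl} El : l = d by rewrite -Dl; apply/esym/cvg_lim.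
rewrite El in lim.
have N : \forall h \near (0 : R)^', `|d - h^-1 *: (f (h *: 1 + t) - f t)| <= e.
  exact: cvgr_dist_le lim _ e0.
have [r r0 Nr] : exists2 r : R, 0 < r & forall h : R, `|h| < r -> h != 0 ->
    `|d - h^-1 *: (f (h *: 1 + t) - f t)| <= e.
  have [r r0 Hr] := (@nbhs_ballP _ _ (0 : R) _).1 N.
  by exists r => // h hr h0; apply: Hr => //; rewrite /ball /= sub0r normrN.
have [h hr [h0 h1]] : exists2 h : R, `|h| < r & h != 0 /\ t + h \in `[0, 1].
  pose m := Num.min (r / 2) (1 / 2).
  have m0 : 0 < m by rewrite lt_min divr_gt0//=.
  have mr : m < r.
    by apply: (@le_lt_trans _ _ (r / 2)); [rewrite ge_min lexx|rewrite ltr_pdivrMr// ltr_pMr// ltr1n].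
  have mh : m <= 1 / 2 by rewrite ge_min lexx orbT.
  move: t01; rewrite in_itv/= => /andP[t0 t1].
  have [th|th] := leP t (1 / 2).
    exists m; first by rewrite gtr0_norm.
    by rewrite gt_eqF// in_itv/=; split => //; apply/andP; split; lra.
  exists (- m); first by rewrite normrN gtr0_norm.
  by rewrite oppr_eq0 gt_eqF// in_itv/=; split => //; apply/andP; split; lra.
have := Nr h hr h0; rewrite /GRing.scale /= mulr1 [h + t]addrC !fE//.
have -> : a + (t + h) * b - (a + t * b) = h * b by ring.
by rewrite mulrA mulVf// mul1r.
Qed.

Lemma Rintegral_scaleB (a b k : R) (f g : R -> R) :
  (forall t : R, t \in `[a, b] -> {for t, continuous f}) ->
  (forall t : R, t \in `[a, b] -> {for t, continuous g}) ->
  \int[mu]_(t in `[a, b]) (k * (f t - g t)) =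
  k * (\int[mu]_(t in `[a, b]) f t - \int[mu]_(t in `[a, b]) g t).
Proof.
move=> cf cg; rewrite -RintegralB//; try exact: continuous_itv_integrable.
rewrite -RintegralZl//; apply: continuous_itv_integrable => t t01.
by apply: cvgB; [exact: cf|exact: cg].
Qed.

End SegmentCalculus.

(** * Inward directions and the circulation along a straight edge *)

Section Edges.
Context {R : realType}.
Local Notation plane := (R * R)%type.
Local Notation T0 := (@std_triangle R).
Local Notation mu := (@lebesgue_measure R).
Implicit Types (p q n : plane) (f g u : plane -> R) (i : 'I_3).
Local Notation J := jacobian_det.
Local Notation I := (@std_interior R).

Lemma edge_point_std i (t : R) : t \in `[0, 1] -> T0 (edge_point i t).
Proof. by move=> t01; have [] := (edge_pointP i (edge_point i t)).2 (ex_intro2 _ _ t t01 erefl). Qed.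

Lemma in_seg_edge i : in_seg T0 (edge_base i) (edge_dir i).
Proof. by move=> t; exact: edge_point_std. Qed.

Lemma edge_point_coord i (t : R) : bary_coord (edge_point i t) i = 0.
Proof.
move: i; apply: ord3P; rewrite bary_coordE /edge_point edge_baseE edge_dirE /= /GRing.scale /=; ring.
Qed.

Lemma edge_point_continuous i : continuous (@edge_point R i).
Proof. exact: line_continuous. Qed.

Lemma edge_point_relint i j (t : R) : 0 < t < 1 -> bary_coord (edge_point i t) j = 0 -> j = i.
Proof.
move=> /andP[t0 t1]; move: i j; apply: ord3P; apply: ord3P => //;
  rewrite bary_coordE /edge_point edge_baseE edge_dirE /= /GRing.scale /= => ?; exfalso; lra.
Qed.

Lemma edge_point0 i : exists j, @edge_point R i 0 = corner j.
Proof.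
move: i; apply: ord3P; rewrite /edge_point scale0r addr0 edge_baseE.
- by exists (inord 1); rewrite cornerE.
- by exists (inord 2); rewrite cornerE.
- by exists (inord 0); rewrite cornerE.
Qed.

Lemma edge_point1 i : exists j, @edge_point R i 1 = corner j.
Proof.
move: i; apply: ord3P; rewrite /edge_point scale1r edge_baseE edge_dirE.
- by exists (inord 2); rewrite cornerE addrC subrK.
- by exists (inord 0); rewrite cornerE subrr.
- by exists (inord 1); rewrite cornerE add0r.
Qed.

Lemma edge_point_inj i : injective (@edge_point R i).
Proof.
move: i; apply: ord3P => t t'; rewrite /edge_point edge_dirE => /addrI.
- by move=> /(congr1 snd); rewrite /= /GRing.scale /= !subr0 !mulr1.
- by move=> /(congr1 snd); rewrite /= /GRing.scale /= !mulrN1 => /oppr_inj.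
- by move=> /(congr1 fst); rewrite /= /GRing.scale /= !mulr1.
Qed.

Lemma corner_relint (i j : 'I_3) (t : R) : 0 < t < 1 -> edge_point i t <> corner j.
Proof.
move=> /andP[t0 t1]; rewrite /edge_point; move: i j; apply: ord3P; apply: ord3P;
 rewrite cornerE edge_baseE edge_dirE => E;
 have := congr1 fst E; have := congr1 snd E; rewrite /= /GRing.scale /=; lra.
Qed.

Lemma corner_std (j : 'I_3) : T0 (corner j).
Proof.
by move: j; apply: ord3P; rewrite cornerE; [exact: std_triangle0|exact: std_triangle_e1|exact: std_triangle_e2].
Qed.

Variables (X Y : plane -> R) (U : set plane) (s c : R).
Hypothesis chG : chart X Y U s c.
Hypotheses (C2X : C2 U X) (C2Y : C2 U Y) (J0 : forall p, U p -> J X Y p != 0).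
Local Notation G := (chart_map X Y).
Local Notation K := [set G p | p in T0].
Local Notation Dx := (grad1 X Y).
Local Notation Dy := (grad2 X Y).
Let oU : open U := chart_open chG.
Let sU : T0 `<=` U := chart_sub chG.

Definition edge_tangent i p : plane := ('D_(edge_dir i) X p, 'D_(edge_dir i) Y p).

Lemma edge_inv i p n : T0 p ->
  (edge_dir i).1 * inv2 X Y p n - (edge_dir i).2 * inv1 X Y p n =
  ((edge_tangent i p).1 * n.2 - (edge_tangent i p).2 * n.1) / J X Y p.
Proof.
move=> Tp; rewrite /edge_tangent.
rewrite (derive_pairE (edge_dir i) (C2X.1 _ (sU Tp)).1) (derive_pairE (edge_dir i) (C2Y.1 _ (sU Tp)).1).
have := chart_det_neq0 chG Tp; rewrite /inv1 /inv2 /jacobian_det.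
move: (edge_dir i) ('D_e1 X p) ('D_e2 X p) ('D_e1 Y p) ('D_e2 Y p) => -[d1 d2] *.
by rewrite /=; field.
Qed.

Lemma edge_inv_sign i p n : T0 p ->
  0 < s * ((edge_tangent i p).1 * n.2 - (edge_tangent i p).2 * n.1) ->
  0 < (edge_dir i).1 * inv2 X Y p n - (edge_dir i).2 * inv1 X Y p n.
Proof.
move=> Tp; rewrite edge_inv//; have := chart_det chG Tp.
move: (J X Y p) (_ - _) => j x; case: (chart_sign chG) => ->; rewrite ?mul1r ?mulN1r ?oppr_gt0.
  by move=> j0 x0; rewrite divr_gt0.
by move=> j0 x0; rewrite -mulrNN -invrN divr_gt0// oppr_gt0.
Qed.

(** The edges of [T0] run counterclockwise, so inward means to the left of the tangent, which the
    cross product detects; [s] corrects for orientation-reversing charts. *)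
Lemma edge_inward i (t : R) n : 0 < t < 1 ->
  0 < s * ((edge_tangent i (edge_point i t)).1 * n.2 - (edge_tangent i (edge_point i t)).2 * n.1) ->
  \forall e \near (0 : R)^'+, K° (G (edge_point i t) + e *: n).
Proof.
move=> t01 h; rewrite (chart_interior chG).
have T : T0 (edge_point i t) by apply: edge_point_std; rewrite in_itv/=; move: t01 => /andP[? ?]; apply/andP; split; lra.
have := edge_inv_sign T h.
move Ea : (inv1 X Y (edge_point i t) n) => a; move Eb : (inv2 X Y (edge_point i t) n) => b H.
have rl := edge_point_relint t01.
apply: (chart_inward chG T); rewrite ?Ea ?Eb.
- move=> p0; have Ei : inord 1 = i by apply: rl; rewrite bary_coordE.
  by move: H; rewrite -Ei edge_dirE /=; lra.
- move=> p0; have Ei : inord 2 = i by apply: rl; rewrite bary_coordE.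
  by move: H; rewrite -Ei edge_dirE /=; lra.
- move=> p0; have Ei : inord 0 = i by apply: rl; rewrite bary_coordE; lra.
  by move: H; rewrite -Ei edge_dirE /=; lra.
Qed.

Lemma edge_derive g i (t : R) : C1 U g -> t \in `[0, 1] ->
  is_derive t 1 (fun r : R => g (edge_point i r)) ('D_(edge_dir i) g (edge_point i t)).
Proof.
move=> C1g t01; apply: is_derive_line; apply: diff_derivable.
exact: (C1g _ (sU (edge_point_std i t01))).1.
Qed.

Lemma edge_continuous g i (t : R) : (forall p, U p -> {for p, continuous g}) -> t \in `[0, 1] ->
  {for t, continuous (fun r : R => g (edge_point i r))}.
Proof.
move=> cg t01; apply: continuous_comp; first exact: edge_point_continuous.
exact: cg (sU (edge_point_std i t01)).
Qed.

Section Straight.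
Variables (i : 'I_3) (P D : plane).
Hypothesis aff : forall t : R, t \in `[0, 1] -> G (edge_point i t) = P + t *: D.

Lemma straight_tangent (t : R) : t \in `[0, 1] -> edge_tangent i (edge_point i t) = D.
Proof.
move=> t01; apply: plane_eq; rewrite /edge_tangent /=.
  apply: (derive_affine_itv t01 (edge_derive i C2X.1 t01) (a := P.1)) => r r01.
  by have := congr1 fst (aff r01).
apply: (derive_affine_itv t01 (edge_derive i C2Y.1 t01) (a := P.2)) => r r01.
by have := congr1 snd (aff r01).
Qed.

Lemma straight_derive g (t : R) : C1 U g -> t \in `[0, 1] ->
  is_derive t 1 (fun r : R => g (edge_point i r))
    (D.1 * Dx g (edge_point i t) + D.2 * Dy g (edge_point i t)).
Proof.
move=> C1g t01; have := edge_derive i C1g t01.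
rewrite (chain_rule C2X C2Y J0 (edge_dir i) C1g (sU (edge_point_std i t01))).
have := straight_tangent t01; rewrite /edge_tangent => E.
have -> : 'D_(edge_dir i) X (edge_point i t) = D.1 by exact: (congr1 fst E).
have -> : 'D_(edge_dir i) Y (edge_point i t) = D.2 by exact: (congr1 snd E).
by rewrite mulrC [X in _ + X]mulrC.
Qed.

Lemma straight_dir_neq0 : D <> 0.
Proof.
move=> D0; have h : G (edge_point i 0) = G (edge_point i 1).
  by rewrite !aff ?D0 ?scaler0// in_itv/= ?lexx ?ler01.
have h' : edge_point i (0 : R) = edge_point i 1.
  by apply: (chart_inj chG) h; apply: edge_point_std; rewrite in_itv/= ?lexx ?ler01.
by have /eqP := edge_point_inj h'; rewrite eq_sym oner_eq0.
Qed.

Variables (w : plane -> R).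
Hypothesis C2w : C2 U w.
Local Notation g1 := (Dx w).
Local Notation g2 := (Dy w).
Local Notation ga := (grad_along X Y w).
Local Notation ha := (hess_along X Y w).

Variables (tau n : plane) (k : R).
Hypotheses (Dk : D = k *: tau) (tau1 : dot tau tau = 1) (n1 : dot n n = 1)
  (n_tau : dot n tau = 0) (n_out : 0 < s * (n.1 * D.2 - n.2 * D.1)).

Let g1C : C1 U g1 := grad1_C1 chG C2X C2Y J0 C2w.
Let g2C : C1 U g2 := grad2_C1 chG C2X C2Y J0 C2w.
Let gaC e : C1 U (ga e) := grad_along_C1 chG C2X C2Y J0 C2w e.

Lemma straight_derive_value (t : R) : t \in `[0, 1] ->
  is_derive t 1 (fun r : R => w (edge_point i r)) (k * ga tau (edge_point i t)).
Proof.
move=> t01; have := straight_derive C2w.1 t01; rewrite Dk /grad_along /= /GRing.scale /=.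
by rewrite mulrDr !mulrA.
Qed.

Lemma straight_derive_grad e (t : R) : t \in `[0, 1] ->
  is_derive t 1 (fun r : R => ga e (edge_point i r)) (k * ha tau e (edge_point i t)).
Proof.
move=> t01; have := straight_derive (gaC e) t01; rewrite Dk /hess_along /= /GRing.scale /=.
by rewrite mulrDr !mulrA.
Qed.

Lemma straight_scale_neq0 : k != 0.
Proof. by apply/eqP => k0; apply: straight_dir_neq0; rewrite Dk k0 scale0r. Qed.

(** A unit vector orthogonal to [tau] is [tau] turned by a right angle, up to the sign [kap].
    Pointing outward fixes this sign as [s * Num.sg k]. *)
Lemma normal_rotation : exists kap : R, [/\ n.1 = kap * tau.2, n.2 = - (kap * tau.1),
  kap * kap = 1 & s * kap * k = `|k|].
Proof.
pose kap := n.1 * tau.2 - n.2 * tau.1.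
move: tau1 n1 n_tau n_out; rewrite Dk /dot /= /GRing.scale /= => t1 nn nt no.
have E1 : n.1 = kap * tau.2.
  have -> : kap * tau.2 = n.1 * (tau.2 * tau.2) - tau.1 * (n.2 * tau.2) by rewrite /kap; ring.
  have -> : n.2 * tau.2 = - (n.1 * tau.1) by lra.
  have -> : tau.2 * tau.2 = 1 - tau.1 * tau.1 by lra.
  ring.
have E2 : n.2 = - (kap * tau.1).
  have -> : kap * tau.1 = tau.2 * (n.1 * tau.1) - n.2 * (tau.1 * tau.1) by rewrite /kap; ring.
  have -> : n.1 * tau.1 = - (n.2 * tau.2) by lra.
  have -> : tau.1 * tau.1 = 1 - tau.2 * tau.2 by lra.
  ring.
have kk : kap * kap = 1.
  move: nn; rewrite E1 E2 => nn.
  have : kap * kap * (tau.1 * tau.1 + tau.2 * tau.2) = 1 by rewrite -[RHS]nn; ring.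
  by rewrite t1 mulr1.
exists kap; split => //.
have h : 0 < s * kap * k by move: no; congr (0 < _); rewrite /kap; ring.
have ss : s * s = 1 by case: (chart_sign chG) => ->; ring.
have sq : (s * kap * k) ^+ 2 = `|k| ^+ 2.
  rewrite real_normK ?num_real//.
  have -> : (s * kap * k) ^+ 2 = (s * s) * (kap * kap) * k ^+ 2 by ring.
  by rewrite ss kk !mul1r.
apply/eqP; rewrite -(@eqrXn2 _ 2%N) ?(ltW h)//; exact/eqP.
Qed.

Lemma straight_hess e (t : R) : t \in `[0, 1] -> k * ha tau e (edge_point i t) =
  e.1 * 'D_(edge_dir i) g1 (edge_point i t) + e.2 * 'D_(edge_dir i) g2 (edge_point i t).
Proof.
move=> t01; have D0 := straight_derive_grad e t01.
have D1 := is_deriveZ e.1 (edge_derive i g1C t01).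
have D2 := is_deriveZ e.2 (edge_derive i g2C t01).
have D3 := is_deriveD D1 D2.
rewrite -[LHS](derive_val (is_derive := D0)); apply: etrans (derive_val (is_derive := D3)).
by [].
Qed.

Local Notation a t := (ga n (edge_point i t)).
Local Notation b t := (ga tau (edge_point i t)).

(** In the orthonormal frame of normal and tangent the form becomes, up to sign,
    [a db - b da = 2 a db - d(a b)], with [a] and [b] the normal and tangential derivatives; along a
    straight edge [db] is the second tangential derivative. *)
Lemma straight_curl :
  curl_term X Y s w i = 2 * (`|k| * \int[mu]_(t in `[0, 1]) (a t * ha tau tau (edge_point i t)))
   - Num.sg k * (a 1 * b 1 - a 0 * b 0).
Proof.
have [kap [N1 N2 kk sk]] := normal_rotation.
have k0 := straight_scale_neq0.
have sgk : s * kap = Num.sg k.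
  apply: (mulIf k0); rewrite sk; exact: normrEsg.
pose cu (t : R) := s * (line_integrand g1 g2 (edge_base i) (edge_dir i) t -
   line_integrand g2 g1 (edge_base i) (edge_dir i) t).
have sg : in_seg U (edge_base i) (edge_dir i) by move=> t /in_seg_edge/sU.
have c1 := line_integrand_continuous g1C g2C sg.
have c2 := line_integrand_continuous g2C g1C sg.
have ccu (t : R) : t \in `[0, 1] -> {for t, continuous cu}.
  by move=> t01; apply: cvgMr; apply: cvgB; [exact: c1|exact: c2].
have curlE : curl_term X Y s w i = \int[mu]_(t in `[0, 1]) cu t.
  by rewrite /cu (Rintegral_scaleB s c1 c2).
pose m (t : R) := a t * ha tau tau (edge_point i t).
have ca e (t : R) : t \in `[0, 1] -> {for t, continuous (fun r => ga e (edge_point i r))}.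
  by apply: edge_continuous => p Up; exact: C1_continuous (gaC e) Up.
have ch e e' (t : R) : t \in `[0, 1] -> {for t, continuous (fun r => ha e e' (edge_point i r))}.
  by apply: edge_continuous => p Up; exact: (hess_along_continuous chG C2X C2Y J0 C2w).
have cm (t : R) : t \in `[0, 1] -> {for t, continuous m}.
  by move=> t01; apply: cvgM; [exact: ca|exact: ch].
pose wd (t : R) := 2 * `|k| * m t - cu t.
have cwd (t : R) : t \in `[0, 1] -> {for t, continuous wd}.
  by move=> t01; apply: cvgB; [apply: cvgMr; exact: cm|exact: ccu].
pose W (t : R) := Num.sg k * (a t * b t).
have dW (t : R) : t \in `[0, 1] -> is_derive t 1 W (wd t).
  move=> t01.
  have da := straight_derive_grad n t01; have db := straight_derive_grad tau t01.
  have := is_deriveZ (Num.sg k) (is_deriveM da db); rewrite /GRing.scale /=.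
  suff -> : wd t = Num.sg k * (a t * (k * ha tau tau (edge_point i t)) + b t * (k * ha tau n (edge_point i t))) by [].
  rewrite /wd /m normrEsg /cu /line_integrand -!/(edge_point i t).
  have -> : 2 * (Num.sg k * k) * (a t * ha tau tau (edge_point i t)) - s *
      (g1 (edge_point i t) * 'D_(edge_dir i) g2 (edge_point i t) -
       g2 (edge_point i t) * 'D_(edge_dir i) g1 (edge_point i t)) =
     2 * Num.sg k * a t * (k * ha tau tau (edge_point i t)) - s *
      (g1 (edge_point i t) * 'D_(edge_dir i) g2 (edge_point i t) -
       g2 (edge_point i t) * 'D_(edge_dir i) g1 (edge_point i t)).
    move: (ga _ _) (ha _ _ _) (g1 _) (g2 _) ('D_(edge_dir i) _ _) ('D_(edge_dir i) _ _) => *; ring.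
  rewrite !straight_hess// /grad_along -sgk N1 N2.
  move: (g1 (edge_point i t)) (g2 (edge_point i t)) ('D_(edge_dir i) g1 (edge_point i t)) ('D_(edge_dir i) g2 (edge_point i t)).
  move=> x1 x2 y1 y2; move: tau1; rewrite /dot; move: tau.1 tau.2 => z1 z2 z12.
  apply/eqP; rewrite -subr_eq0; apply/eqP.
  transitivity (s * (x1 * y2 - x2 * y1) * (kap * kap * (z1 * z1 + z2 * z2) - 1)); first by ring.
  by rewrite kk z12 mulr1 subrr mulr0.
have := FTC2_segment ler01 dW cwd.
rewrite /wd; have -> : \int[mu]_(t in `[0, 1]) (2 * `|k| * m t - cu t) =
   2 * `|k| * \int[mu]_(t in `[0, 1]) m t - \int[mu]_(t in `[0, 1]) cu t.
  rewrite -RintegralZl//; last exact: continuous_itv_integrable.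
  have cm2 (t : R) : t \in `[0, 1] -> {for t, continuous (fun t => 2 * `|k| * m t)}.
    by move=> t01; apply: cvgMr; exact: cm.
  by rewrite -RintegralB//; exact: continuous_itv_integrable.
rewrite -curlE /W /m => /eqP; rewrite subr_eq => /eqP E.
by rewrite mulrA E mulrBr opprD; move: (curl_term _ _ _ _ _) (_ * _) (_ * _) => *; ring.
Qed.
End Straight.
End Edges.

(** * Geometry of the triangulation *)

Section MeshGeometry.
Context {R : realType}.
Local Notation plane := (R * R)%type.
Local Notation T0 := (@std_triangle R).
Implicit Types (p q n z : plane) (i j : 'I_3).
Local Notation J := jacobian_det.

Record C2chart (X Y : plane -> R) (U : set plane) (s c : R) : Prop := {
  C2chart_chart : chart X Y U s c ;
  C2chart_x : C2 U X ;
  C2chart_y : C2 U Y ;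
  C2chart_det : forall p, U p -> J X Y p != 0 }.

Variables (a : 'I_3 -> plane) (T : finType) (F : T -> plane -> plane).
Implicit Types (K : T) (E : set plane).

Definition elt_x K : plane -> R := fst \o F K \o ref_map a.
Definition elt_y K : plane -> R := snd \o F K \o ref_map a.
Local Notation G K := (chart_map (elt_x K) (elt_y K)).
Local Notation elt := (elt a F).
Local Notation edge := (edge a F).
Local Notation vertex := (vertex a F).
Local Notation is_edge := (is_edge a F).
Local Notation is_vertex := (is_vertex a F).

Lemma elt_mapE K p : G K p = F K (ref_map a p).
Proof. by rewrite /chart_map /elt_x /elt_y /=; case: (F K _). Qed.

Lemma eltE K : elt K = [set G K p | p in T0].
Proof.
rewrite /Defs.elt ref_triangleE image_comp; apply: eq_imagel => p _.
by rewrite elt_mapE.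
Qed.

Lemma edgeE K i : edge K i = [set G K (edge_point i t) | t in `[0, 1]%classic].
Proof.
rewrite /Defs.edge ref_edgeE image_comp; apply: eq_imagel => p _.
by rewrite elt_mapE.
Qed.

Lemma vertexE K i : vertex K i = G K (corner i).
Proof. by rewrite elt_mapE /Defs.vertex (vertex_corner a). Qed.

Lemma edge_sub_elt K i : edge K i `<=` elt K.
Proof.
by rewrite edgeE eltE => _ [t t01 <-]; exists (edge_point i t) => //; exact: edge_point_std.
Qed.

Lemma exists_C2chart K : noncollinear a -> curved_element_map a (F K) ->
  exists U s c, C2chart (elt_x K) (elt_y K) U s c.
Proof.
move=> ha hF; have [U [s [c [ch C2X C2Y]]]] := element_chart ha hF.
have [U' [ch' C2X' C2Y' J0]] := chart_shrink ch C2X C2Y.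
exists U', s, c; exact: Build_C2chart ch' C2X' C2Y' J0.
Qed.

Variables (Omega : set plane) (L : R) (x : R -> plane).
Hypotheses (hbd : C2_boundary Omega L x) (hT : exact_triangulation a F Omega).
Variables (U : T -> set plane) (s c : T -> R).
Hypothesis hC : forall K, C2chart (elt_x K) (elt_y K) (U K) (s K) (c K).

Let chG K := C2chart_chart (hC K).
Let C2X K := C2chart_x (hC K).
Let C2Y K := C2chart_y (hC K).
Let J0 K := C2chart_det (hC K).

Lemma elt_compact K : compact (elt K).
Proof.
by rewrite eltE; apply: (chart_image_compact (chG K)) => //; exact: std_triangle_compact.
Qed.

Lemma elt_closed K : closed (elt K).
Proof. by apply: compact_closed; [exact: plane_hausdorff|exact: elt_compact]. Qed.

Lemma elt_sub_closure K : elt K `<=` closure Omega.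
Proof. by rewrite -(mesh_cover hT) => z Kz; exists K. Qed.

(** Relative interior of the edge. It is described through the chart of [K]; that it depends on the
    edge alone is proved later. *)
Definition in_edge K i z := exists2 t : R, 0 < t < 1 & z = G K (edge_point i t).

Lemma in_edge_edge K i z : in_edge K i z -> edge K i z.
Proof. by move=> [t /andP[t0 t1] ->]; rewrite edgeE; exists t => //=; rewrite in_itv/= !ltW. Qed.

Lemma edge_point_std_oo i (t : R) : 0 < t < 1 -> T0 (edge_point i t).
Proof. by move=> /andP[t0 t1]; apply: edge_point_std; rewrite in_itv/= !ltW. Qed.

Lemma in_edge_not_vertex K i z : in_edge K i z -> ~ is_vertex K z.
Proof.
move=> [t t01 ->] [j]; rewrite vertexE => E.
apply: (corner_relint t01 (j := j)).
by apply: (chart_inj (chG K)) E; [exact: edge_point_std_oo|exact: corner_std].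
Qed.

Lemma in_edge_unique K i j z : in_edge K i z -> edge K j z -> j = i.
Proof.
move=> [t t01 ->]; rewrite edgeE => -[t' t'01 E].
apply: (edge_point_relint t01).
have <- : edge_point j t' = edge_point i t.
  by apply: (chart_inj (chG K)) E; [exact: edge_point_std|exact: edge_point_std_oo].
exact: edge_point_coord.
Qed.

(** By conformity the elements meet in a vertex or a common edge; a relative interior point is no
    vertex and lies on one edge of [K] only. *)
Lemma in_edge_shared K i K' z : in_edge K i z -> K' != K -> elt K' z -> is_edge K' (edge K i).
Proof.
move=> zi KK' K'z; have Kz := edge_sub_elt (in_edge_edge zi).
have KK : K != K' by rewrite eq_sym.
have [E0|[y [yK _ E1]]|[E [[j Ej] EK' EE]]] := mesh_conforming hT KK.
- have : (elt K `&` elt K') z by []. by rewrite E0.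
- have : (elt K `&` elt K') z by []. rewrite E1 => zy; case: (in_edge_not_vertex zi); by rewrite zy.
- have : (elt K `&` elt K') z by []. rewrite EE Ej => zE.
  by rewrite -(in_edge_unique zi zE) -Ej.
Qed.

Lemma interior_edge_straight K i : ~ (edge K i `<=` boundary Omega) -> straight (edge K i).
Proof.
by move=> nb; apply: contrapT => ns; apply: nb; exact: (mesh_curved_boundary hT ns).
Qed.

Section StraightEdge.
Variables (K : T) (i : 'I_3).
Hypothesis st : straight (edge K i).

Definition edge_start : plane := G K (edge_base i).
Definition edge_vec : plane := G K (edge_point i 1) - G K (edge_base i).

Lemma straight_affine (t : R) : t \in `[0, 1] ->
  G K (edge_point i t) = edge_start + t *: edge_vec.
Proof.
move=> t01; have m0 : ref_edge a i (ref_map a (edge_point i 0)).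
  by rewrite ref_edgeE; exists 0 => //=; rewrite in_itv/= lexx ler01.
have m1 : ref_edge a i (ref_map a (edge_point i 1)).
  by rewrite ref_edgeE; exists 1 => //=; rewrite in_itv/= lexx ler01.
have := mesh_straight_affine hT st m0 m1 t01.
have b0 : edge_base i = edge_point i (0 : R) by rewrite /edge_point scale0r addr0.
have -> : (1 - t) *: ref_map a (edge_point i 0) + t *: ref_map a (edge_point i 1) = ref_map a (edge_point i t).
  rewrite /ref_map /affine_map /edge_point; move: (edge_base i) (edge_dir i) (a (inord 0)) (a (inord 1)) (a (inord 2)) => e d a0 a1 a2.
  by apply: plane_eq; rewrite /= /GRing.scale /=; ring.
rewrite -!elt_mapE /edge_start /edge_vec b0 => ->.
move: (G K _) (G K _) => u1 u2; apply: plane_eq; rewrite /= /GRing.scale /=; ring.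
Qed.

Variables (tau : plane).
Hypothesis htau : unit_tangent (edge K i) tau.

Lemma tangent_unit : dot tau tau = 1.
Proof. by rewrite -sqr_enorm htau.1 expr1n. Qed.

(* coordinates along the line through [z0] with direction [tau] *)
Record edge_coordinates z0 (t0 k al be : R) : Prop := {
  edge_scale : k != 0 ;
  edge_vecE : edge_vec = k *: tau ;
  edge_le : al < be ;
  edge_range : forall r : R, r \in `[al, be] <-> t0 + r / k \in `[0, 1] ;
  edge_range_oo : forall r : R, (r \in `]al, be[) <-> 0 < t0 + r / k < 1 ;
  edge_line : forall r : R, edge K i (z0 + r *: tau) <-> r \in `[al, be] ;
  edge_lineE : forall r : R, r \in `[al, be] -> z0 + r *: tau = G K (edge_point i (t0 + r / k)) }.

Lemma exists_edge_coordinates z0 : edge K i z0 ->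
  exists t0 k al be, edge_coordinates z0 t0 k al be.
Proof.
move=> Ez0; have t1 := tangent_unit.
have m0 : edge K i edge_start.
  rewrite edgeE; exists 0; first by rewrite /= in_itv/= lexx ler01.
  by rewrite /edge_point scale0r addr0.
have m1 : edge K i (G K (edge_point i 1)) by rewrite edgeE; exists 1 => //=; rewrite in_itv/= lexx ler01.
have [k vk] := htau.2 _ _ m0 m1; rewrite -/edge_vec in vk.
have k0 : k != 0.
  apply/eqP => k0; have := straight_dir_neq0 (chG K) straight_affine.
  by rewrite vk k0 scale0r.
move: (Ez0); rewrite {1}edgeE => -[t0 t001 z0E].
have lineE r : t0 + r / k \in `[0, 1] -> z0 + r *: tau = G K (edge_point i (t0 + r / k)).
  move=> h; rewrite straight_affine// -z0E straight_affine// -addrA; congr (_ + _).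
  by rewrite vk !scalerA -scalerDl mulrDl divfK.
have inE r : edge K i (z0 + r *: tau) <-> t0 + r / k \in `[0, 1].
  split=> [|h]; last first.
    by rewrite edgeE lineE//; exists (t0 + r / k).
  rewrite edgeE => -[t' t'01]; rewrite straight_affine// -z0E straight_affine// -addrA => /addrI.
  rewrite vk !scalerA -scalerDl => E.
  have {}E : t' * k = t0 * k + r.
    have := congr1 (fun p => dot p tau) E; by rewrite !dotZl t1 !mulr1.
  by have -> : t0 + r / k = t'; [apply: (mulIf k0); rewrite mulrDl divfK|].
have dv (r : R) : (t0 + r / k) = (t0 * k + r) / k by rewrite mulrDl mulfK.
move: k0; rewrite neq_lt => /orP[kn|kp].
  have k0 : k != 0 by rewrite lt_eqF.
  have E (r : R) : r \in `[(1 - t0) * k, - t0 * k] <-> t0 + r / k \in `[0, 1].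
    by rewrite !in_itv/= dv ler_ndivlMr// ler_ndivrMr// mul0r mul1r; split=> /andP[? ?]; apply/andP; split; lra.
  exists t0, k, ((1 - t0) * k), (- t0 * k); split => //; first lra.
  - move=> r; rewrite !in_itv/= dv ltr_ndivlMr// ltr_ndivrMr// mul0r mul1r.
    by split=> /andP[? ?]; apply/andP; split; lra.
  - by move=> r; rewrite inE E.
  - by move=> r /E; exact: lineE.
have k0 : k != 0 by rewrite gt_eqF.
have E (r : R) : r \in `[- t0 * k, (1 - t0) * k] <-> t0 + r / k \in `[0, 1].
  by rewrite !in_itv/= dv ler_pdivlMr// ler_pdivrMr// mul0r mul1r; split=> /andP[? ?]; apply/andP; split; lra.
exists t0, k, (- t0 * k), ((1 - t0) * k); split => //; first lra.
- move=> r; rewrite !in_itv/= dv ltr_pdivlMr// ltr_pdivrMr// mul0r mul1r.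
  by split=> /andP[? ?]; apply/andP; split; lra.
- by move=> r; rewrite inE E.
- by move=> r /E; exact: lineE.
Qed.

End StraightEdge.

(** There are finitely many elements, all closed: those not containing [z] stay away from it, and
    the others have a common limit by hypothesis. *)
Lemma trace_skeleton (g : plane -> R) (l : R) z :
  (exists K, elt K z) ->
  (forall K, elt K z -> g y @[y --> within (elt K)° (nbhs z)] --> l) ->
  g y @[y --> within (skeleton_compl a F) (nbhs z)] --> l /\
  trace (skeleton_compl a F) g z = l.
Proof.
move=> [K0 K0z] H.
suff lim : g y @[y --> within (skeleton_compl a F) (nbhs z)] --> l.
  split => //; have Pr : ProperFilter (within (skeleton_compl a F) (nbhs z)).
    apply: within_nbhs_proper; move: (K0z); rewrite eltE => -[p Tp Ez].
    have cl := chart_closure (chG K0) Tp; rewrite Ez -eltE in cl.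
    by rewrite /infer; apply: (closure_subset _ cl) => y Ky; exists K0.
  apply: cvg_lim lim; exact: Rhausdorff.
apply/cvgrPdist_le => e e0; rewrite /within /= nearE.
have N K : \forall y \near z, (elt K)° y -> `|l - g y| <= e.
  have [Kz|nKz] := pselect (elt K z).
    by have /cvgrPdist_le/(_ e e0) := H K Kz.
  have : nbhs z (~` elt K) by apply: open_nbhs_nbhs; split => //; apply: closed_openC; exact: elt_closed.
  by apply: filterS => y nK /interior_subset.
have : \forall y \near z, forall K, (elt K)° y -> `|l - g y| <= e by exact: (filter_forall (nbhs_filter z) N).
by rewrite /within /= => /filterS; apply => y Hy [K _ Ky]; exact: Hy Ky.
Qed.

Lemma unit_normal_cases (tau n n' : plane) : dot tau tau = 1 -> dot n n = 1 -> dot n' n' = 1 ->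
  dot n tau = 0 -> dot n' tau = 0 -> n' = n \/ n' = - n.
Proof.
move=> t1 n1 n1' nt nt'.
have E (m : plane) : dot m tau = 0 -> dot m m = 1 -> exists k : R,
    [/\ m.1 = k * tau.2, m.2 = - (k * tau.1) & k = 1 \/ k = -1].
  move: t1; rewrite /dot => t1 mt m1; pose k := m.1 * tau.2 - m.2 * tau.1; exists k.
  have E1 : m.1 = k * tau.2.
    have -> : k * tau.2 = m.1 * (tau.2 * tau.2) - tau.1 * (m.2 * tau.2) by rewrite /k; ring.
    have -> : m.2 * tau.2 = - (m.1 * tau.1) by lra.
    have -> : tau.2 * tau.2 = 1 - tau.1 * tau.1 by lra.
    ring.
  have E2 : m.2 = - (k * tau.1).
    have -> : k * tau.1 = tau.2 * (m.1 * tau.1) - m.2 * (tau.1 * tau.1) by rewrite /k; ring.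
    have -> : m.1 * tau.1 = - (m.2 * tau.2) by lra.
    have -> : tau.1 * tau.1 = 1 - tau.2 * tau.2 by lra.
    ring.
  split => //; move: m1; rewrite E1 E2; move: (k) => k' m1.
  have : k' ^+ 2 = 1 by rewrite -m1 -[LHS]mulr1 -t1; ring.
  by move=> /eqP; rewrite sqrf_eq1 => /orP[/eqP|/eqP]; [left|right].
have [k [a1 a2 a3]] := E n nt n1; have [k' [b1 b2 b3]] := E n' nt' n1'.
case: a3 b3 a1 a2 b1 b2 => -> [] -> a1 a2 b1 b2.
- by left; apply: plane_eq; rewrite ?a1 ?a2 ?b1 ?b2.
- by right; apply: plane_eq; rewrite /= ?a1 ?a2 ?b1 ?b2; ring.
- by right; apply: plane_eq; rewrite /= ?a1 ?a2 ?b1 ?b2; ring.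
- by left; apply: plane_eq; rewrite ?a1 ?a2 ?b1 ?b2.
Qed.

Section Normal.
Variables (K : T) (i : 'I_3) (tau n : plane).
Hypotheses (st : straight (edge K i)) (htau : unit_tangent (edge K i) tau)
  (hn : outer_unit_normal a F K (edge K i) n).

Lemma normal_unit : dot n n = 1.
Proof. by have [n1 _ _] := hn; rewrite -sqr_enorm n1 expr1n. Qed.

Lemma edge_midpoint : exists z, in_edge K i z.
Proof. by exists (G K (edge_point i (1 / 2))), (1 / 2) => //; lra. Qed.

Lemma edge_vec_scale : exists2 k : R, k != 0 & edge_vec K i = k *: tau.
Proof.
have [z /in_edge_edge zE] := edge_midpoint.
by have [t0 [k [al [be [k0 Ek _ _ _ _ _]]]]] := exists_edge_coordinates st htau zE; exists k.
Qed.

Lemma normal_tangent : dot n tau = 0.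
Proof.
have [_ orth _] := hn; have [k k0 vk] := edge_vec_scale.
have m0 : edge K i (G K (edge_base i)).
  by rewrite edgeE; exists 0; [rewrite /= in_itv/= lexx ler01|rewrite /edge_point scale0r addr0].
have m1 : edge K i (G K (edge_point i 1)) by rewrite edgeE; exists 1 => //=; rewrite in_itv/= lexx ler01.
have := orth _ _ m0 m1; rewrite -/(edge_vec K i) vk dotC dotZl dotC.
by move/eqP; rewrite mulf_eq0 (negbTE k0) => /eqP.
Qed.

Lemma in_edge_tangent z : in_edge K i z -> exists2 t : R, 0 < t < 1 &
  z = G K (edge_point i t) /\ edge_tangent (elt_x K) (elt_y K) i (edge_point i t) = edge_vec K i.
Proof.
move=> [t t01 ->]; exists t => //; split => //.
apply: (straight_tangent (chG K) (C2X K) (C2Y K) (straight_affine st)).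
by move: t01 => /andP[? ?]; rewrite in_itv/= !ltW.
Qed.

(** A negative value would make the ray along [n] enter the element; zero is impossible for a unit
    vector orthogonal to the edge. *)
Lemma normal_out : 0 < s K * (n.1 * (edge_vec K i).2 - n.2 * (edge_vec K i).1).
Proof.
have [z zi] := edge_midpoint; have [_ _ out] := hn.
have [t t01 [zE tgE]] := in_edge_tangent zi.
have zo := out z (in_edge_edge zi) (in_edge_not_vertex zi).
have [k k0 vk] := edge_vec_scale.
have n1 := normal_unit; have nt := normal_tangent; have t1 := tangent_unit htau.
rewrite ltNge le_eqVlt; apply/negP => /orP[/eqP E|lt0].
  have : (n.1 * tau.2 - n.2 * tau.1) ^+ 2 = 1.
    have -> : (n.1 * tau.2 - n.2 * tau.1) ^+ 2 = dot n n * dot tau tau - dot n tau ^+ 2 by rewrite /dot; ring.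
    by rewrite n1 t1 nt; ring.
  have : s K * k * (n.1 * tau.2 - n.2 * tau.1) = 0.
    by rewrite -[RHS]E vk /= /GRing.scale /=; ring.
  move=> /eqP; rewrite !mulf_eq0 (negbTE k0) orbF => /orP[/eqP s0|/eqP ->].
    by move: s0; case: (chart_sign (chG K)) => -> /eqP; rewrite ?oppr_eq0 oner_eq0.
  by rewrite expr0n /= => /eqP; rewrite eq_sym oner_eq0.
have inw : \forall e \near (0 : R)^'+, (elt K)° (z + e *: n).
  rewrite eltE zE; apply: (edge_inward (chG K) (C2X K) (C2Y K) t01); rewrite tgE.
  by move: lt0; rewrite -oppr_gt0; congr (0 < _); ring.
have [e [Ke [_ nKe]]] := filter_ex (filterI inw zo).
by apply: nKe; exact: interior_subset.
Qed.

Lemma inward_dot z m : in_edge K i z -> dot n m < 0 ->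
  \forall e \near (0 : R)^'+, (elt K)° (z + e *: m).
Proof.
move=> zi nm; have [t t01 [-> tgE]] := in_edge_tangent zi.
have [k k0 vk] := edge_vec_scale.
have [ka [N1 N2 kk sk]] := normal_rotation (chG K) vk (tangent_unit htau) normal_unit normal_tangent normal_out.
rewrite eltE; apply: (edge_inward (chG K) (C2X K) (C2Y K) t01); rewrite tgE vk.
have -> : s K * ((k *: tau).1 * m.2 - (k *: tau).2 * m.1) = - (s K * ka * k * dot n m).
  rewrite /dot N1 N2 /= /GRing.scale /=.
  transitivity (ka * ka * (s K * (k * tau.1 * m.2 - k * tau.2 * m.1))); first by rewrite kk mul1r.
  ring.
by rewrite oppr_gt0 sk pmulr_rlt0 ?normr_gt0.
Qed.

End Normal.

Lemma interior_disjoint_ray K K' z m : K != K' ->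
  (\forall e \near (0 : R)^'+, (elt K)° (z + e *: m)) ->
  (\forall e \near (0 : R)^'+, (elt K')° (z + e *: m)) -> False.
Proof.
move=> KK h h'; have [e [Ke K'e]] := filter_ex (filterI h h').
have : ((elt K)° `&` (elt K')°) (z + e *: m) by [].
by rewrite (mesh_disjoint hT KK).
Qed.

Lemma itv_cc_inj (al be al' be' : R) : al <= be -> al' <= be' ->
  (forall r : R, r \in `[al, be] <-> r \in `[al', be']) -> al = al' /\ be = be'.
Proof.
move=> ab ab' H.
have h1 : al \in `[al', be'] by apply/H; rewrite in_itv/= lexx.
have h2 : be \in `[al', be'] by apply/H; rewrite in_itv/= lexx ab.
have h3 : al' \in `[al, be] by apply/H; rewrite in_itv/= lexx.
have h4 : be' \in `[al, be] by apply/H; rewrite in_itv/= lexx ab'.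
move: h1 h2 h3 h4; rewrite !in_itv/= => /andP[? ?] /andP[? ?] /andP[? ?] /andP[? ?].
by split; lra.
Qed.

Lemma in_edge_coordinates K i tau z t0 k al be : straight (edge K i) ->
  edge_coordinates K i tau z t0 k al be -> in_edge K i z <-> (0 : R) \in `]al, be[.
Proof.
move=> st [k0 vk ab rg rgo ln lnE]; rewrite rgo mul0r addr0.
have z0 : (0 : R) \in `[al, be] -> z = G K (edge_point i t0).
  by move=> /lnE; rewrite scale0r addr0 mul0r addr0.
split=> [[t t01 zE]|t01].
  have zE' : edge K i z by apply: in_edge_edge; exists t.
  have := ln 0; rewrite scale0r addr0 => /iffLR/(_ zE') h0.
  have t001 : t0 \in `[0, 1] by have := (rg 0).1 h0; rewrite mul0r addr0.
  have : G K (edge_point i t0) = G K (edge_point i t) by rewrite -z0.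
  move=> /(chart_inj (chG K) (edge_point_std i t001) (edge_point_std_oo i t01)) E.
  by rewrite (edge_point_inj E).
exists t0 => //; apply: z0; apply/rg; rewrite mul0r addr0.
by move: t01 => /andP[? ?]; rewrite in_itv/= !ltW.
Qed.

(** Length coordinates along the common tangent describe the edge for both elements, and the
    relative interior is the open interval in either. *)
Lemma in_edge_transfer K i K' i' tau z : straight (edge K i) -> edge K i = edge K' i' ->
  unit_tangent (edge K i) tau -> in_edge K i z -> in_edge K' i' z.
Proof.
move=> st E ht zi; have st' : straight (edge K' i') by rewrite -E.
have ht' : unit_tangent (edge K' i') tau by rewrite -E.
have zE := in_edge_edge zi; have zE' : edge K' i' z by rewrite -E.
have [t0 [k [al [be co]]]] := exists_edge_coordinates st ht zE.
have [t0' [k' [al' [be' co']]]] := exists_edge_coordinates st' ht' zE'.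
have [ea eb] : al = al' /\ be = be'.
  apply: itv_cc_inj; [exact: ltW (edge_le co)|exact: ltW (edge_le co')|].
  by move=> r; rewrite -(edge_line co) -(edge_line co') E.
apply/(in_edge_coordinates st' co'); rewrite -ea -eb; exact/(in_edge_coordinates st co).
Qed.

(** If the normals were equal, the opposite ray would enter the interiors of both elements, which
    are disjoint. *)
Lemma shared_normals K i K' i' tau n n' : K != K' -> straight (edge K i) ->
  edge K i = edge K' i' -> unit_tangent (edge K i) tau ->
  outer_unit_normal a F K (edge K i) n -> outer_unit_normal a F K' (edge K i) n' -> n' = - n.
Proof.
move=> KK st E ht hn hn'.
have st' : straight (edge K' i') by rewrite -E.
have ht' : unit_tangent (edge K' i') tau by rewrite -E.
rewrite E in hn'.
have n1 := normal_unit hn; have n1' := normal_unit hn'.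
have nt := normal_tangent st ht hn; have nt' := normal_tangent st' ht' hn'.
have [EN|//] := unit_normal_cases (tangent_unit ht) n1 n1' nt nt'; exfalso.
have [z zi] := edge_midpoint K i.
have zi' := in_edge_transfer st E ht zi.
have d : dot n (- n) < 0.
  by rewrite dotC -scaleN1r dotZl n1 mulr1 ltrN10.
have d' : dot n' (- n) < 0 by rewrite EN.
exact: (interior_disjoint_ray KK (inward_dot st ht hn zi d) (inward_dot st' ht' hn' zi' d')).
Qed.

Local Notation interior_edges := (interior_edges a F Omega).

Variables (nu : T -> set plane -> plane) (tau : set plane -> plane).
Hypothesis hnu : forall K E, interior_edges E -> is_edge K E ->
  outer_unit_normal a F K E (nu K E).
Hypothesis htau : forall E, interior_edges E -> unit_tangent E (tau E).

Section InteriorEdge.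
Variables (K K' : T) (i i' : 'I_3).
Hypotheses (KK : K != K') (EE : edge K i = edge K' i')
  (iE : interior_edges (edge K i)).

Lemma interior_straight : straight (edge K i).
Proof. by case: iE => _; exact: interior_edge_straight. Qed.

Lemma interior_normals : nu K' (edge K i) = - nu K (edge K i).
Proof.
apply: (shared_normals KK interior_straight EE (htau iE)); apply: hnu => //; first by exists i.
by exists i'.
Qed.

(** A third element would have its normal opposite to each of two opposite unit vectors. *)
Lemma interior_edge_elements K2 : is_edge K2 (edge K i) -> K2 = K \/ K2 = K'.
Proof.
move=> [j Ej]; apply: contrapT => /not_orP[/eqP n1 /eqP n2].
have N1 : nu K2 (edge K i) = - nu K (edge K i).
  apply: (shared_normals _ interior_straight Ej (htau iE)); first by rewrite eq_sym.
    by apply: hnu => //; exists i.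
  by apply: hnu => //; exists j.
have st' : straight (edge K' i') by rewrite -EE; exact: interior_straight.
have iE' : interior_edges (edge K' i') by rewrite -EE.
have EE' : edge K' i' = edge K2 j by rewrite -EE.
have N2 : nu K2 (edge K i) = - nu K' (edge K i).
  rewrite EE; apply: (shared_normals _ st' EE' (htau iE')); first by rewrite eq_sym.
    by apply: hnu => //; exists i'.
  by apply: hnu => //; exists j.
have nz : nu K (edge K i) = 0.
  have := N1; rewrite N2 interior_normals opprK.
  move: (nu K _) => m E; have E1 : m.1 = - m.1 by exact: (congr1 fst E).
  have E2 : m.2 = - m.2 by exact: (congr1 snd E).
  by apply: plane_eq => /=; lra.
have /normal_unit : outer_unit_normal a F K (edge K i) (nu K (edge K i)).
  by apply: hnu => //; exists i.
by rewrite nz /dot /= mulr0 addr0 => /eqP; rewrite eq_sym oner_eq0.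
Qed.

Lemma in_edge_elements z K2 : in_edge K i z -> elt K2 z -> K2 = K \/ K2 = K'.
Proof.
move=> zi K2z; have [->|n1] := eqVneq K2 K; first by left.
by apply: interior_edge_elements; exact: (in_edge_shared zi n1 K2z).
Qed.

(** At a boundary point the domain's outward normal leaves [closure Omega]. If it is transversal to
    the edge it enters one of the two adjacent elements; if tangent, it stays on the edge for a
    while. Both remain in [closure Omega]. *)
Lemma in_edge_Omega z : in_edge K i z -> Omega z.
Proof.
move=> zi; have zE := in_edge_edge zi.
have st := interior_straight; have ht := htau iE.
have clz : closure Omega z by apply: (elt_sub_closure (K := K)); exact: edge_sub_elt zE.
apply: contrapT => nO.
have bz : boundary Omega z by split => // /interior_subset.
move: (bz); rewrite -(curve_onto hbd) => -[r _ xr].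
have out := curve_oriented hbd r; rewrite xr in out.
set m := normal x r in out.
have m1 : dot m m = 1.
  have := curve_arclength hbd r; rewrite /m /normal /enorm /dot /= => E.
  have := congr1 (fun u => u ^+ 2) E; rewrite sqr_sqrtr ?expr1n; last exact: dot_ge0.
  by rewrite mulrNN addrC.
have iK : is_edge K (edge K i) by exists i.
have iK' : is_edge K' (edge K i) by exists i'.
have hn := hnu iE iK; have hn' := hnu iE iK'.
have no K2 : (\forall e \near (0 : R)^'+, (elt K2)° (z + e *: m)) -> False.
  move=> h; have [e [Ke [_ nKe]]] := filter_ex (filterI h out).
  by apply: nKe; apply: (elt_sub_closure (K := K2)); exact: interior_subset.
have [d0|d0|d0] := ltgtP (dot (nu K (edge K i)) m) 0.
- exact: (no K (inward_dot st ht hn zi d0)).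
- have st' : straight (edge K' i') by rewrite -EE.
  have ht' : unit_tangent (edge K' i') (tau (edge K i)) by rewrite -EE.
  have hn'' : outer_unit_normal a F K' (edge K' i') (nu K' (edge K i)) by rewrite -EE.
  have zi' := in_edge_transfer st EE ht zi.
  apply: (no K' (inward_dot st' ht' hn'' zi' _)).
  by rewrite interior_normals -scaleN1r dotZl mulN1r oppr_lt0.
have n1 := normal_unit hn; have nt := normal_tangent st ht hn.
have t1 := tangent_unit ht.
have [k mk] : exists k : R, m = k *: tau (edge K i).
  have [ka [N1 N2 kk]] : exists ka : R, [/\ (nu K (edge K i)).1 = ka * (tau (edge K i)).2,
      (nu K (edge K i)).2 = - (ka * (tau (edge K i)).1) & ka * ka = 1].
    have [k k0 vk] := edge_vec_scale st ht.
    by have [ka [? ? ? _]] := normal_rotation (chG K) vk t1 n1 nt (normal_out st ht hn); exists ka.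
  move: d0; rewrite /dot N1 N2; move: t1; rewrite /dot; move: (tau _) => t t1 d0.
  have d1 : t.2 * m.1 - t.1 * m.2 = 0.
    transitivity (ka * ka * (t.2 * m.1 - t.1 * m.2)); first by rewrite kk mul1r.
    transitivity (ka * (ka * t.2 * m.1 + - (ka * t.1) * m.2)); first by ring.
    by rewrite d0 mulr0.
  exists (dot m t); apply: plane_eq; rewrite /dot /= /GRing.scale /=.
    transitivity (m.1 * (t.1 * t.1 + t.2 * t.2)); first by rewrite t1 mulr1.
    transitivity ((m.1 * t.1 + m.2 * t.2) * t.1 + t.2 * (t.2 * m.1 - t.1 * m.2)); first by ring.
    by rewrite d1 mulr0 addr0.
  transitivity (m.2 * (t.1 * t.1 + t.2 * t.2)); first by rewrite t1 mulr1.
  transitivity ((m.1 * t.1 + m.2 * t.2) * t.2 - t.1 * (t.2 * m.1 - t.1 * m.2)); first by ring.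
  by rewrite d1 mulr0 subr0.
have [t0 [k' [al [be co]]]] := exists_edge_coordinates st ht zE.
have ab := (in_edge_coordinates st co).1 zi.
have near : \forall e \near (0 : R)^'+, edge K i (z + e *: m).
  have cv : (fun e : R => e * k) e @[e --> (0 : R)] --> (0 : R).
    by rewrite -[X in _ --> X](mul0r k); apply: cvgMl; exact: cvg_id.
  have nb : \forall r \near (0 : R), r \in `]al, be[.
    by apply: (near_in_itvoo ab).
  have ne : \forall e \near (0 : R)^'+, e * k \in `]al, be[ by exact: (cvg_at_right_filter cv nb).
  near=> e; have he : e * k \in `]al, be[ by near: e.
  rewrite mk scalerA; apply/(edge_line co); exact: subset_itv_oo_cc.
have [e [Ee [_ nEe]]] := filter_ex (filterI near out).
by apply: nEe; apply: (elt_sub_closure (K := K)); exact: edge_sub_elt Ee.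
Unshelve. all: by end_near. Qed.

Lemma in_edge_near_elements z : in_edge K i z ->
  \forall y \near z, forall K2, elt K2 y -> K2 = K \/ K2 = K'.
Proof.
move=> zi; suff N K2 : \forall y \near z, elt K2 y -> K2 = K \/ K2 = K' by exact: (filter_forall (nbhs_filter z) N).
have [Kz|nKz] := pselect (elt K2 z).
  by have h := in_edge_elements zi Kz; near=> y.
have : nbhs z (~` elt K2) by apply: open_nbhs_nbhs; split => //; apply: closed_openC; exact: elt_closed.
by apply: filterS => y nK /nK.
Unshelve. all: by end_near. Qed.

End InteriorEdge.

End MeshGeometry.

(** * Smooth bumps and area integrals *)

Section SmoothBump.
Context {R : realType}.
Local Notation plane := (R * R)%type.
Implicit Types (t : R) (m n : nat).

(** The negative powers close the family under differentiation: the derivative of [eta m] combines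
    [eta m.+1] and [eta m.+2]. *)
Definition eta m t : R := if 0 < t then t^-1 ^+ m * expR (- t^-1) else 0.

(** The [n]-th power of the bound of [y / n] by its exponential. *)
Lemma pow_le_expR (n : nat) (y : R) : 0 <= y -> y ^+ n <= n%:R ^+ n * expR y.
Proof.
case: n => [|n] y0; first by rewrite !expr0 mul1r; have := expR_ge1Dx y; lra.
have n0 : 0 < n.+1%:R :> R by rewrite ltr0n.
have yE : y = n.+1%:R * (y / n.+1%:R) by rewrite mulrCA divff ?mulr1// gt_eqF.
rewrite [in leRHS]yE expRM_natl -exprMn.
apply: lerXn2r; rewrite ?nnegrE// ?mulr_ge0 ?expR_ge0 ?ler0n//.
rewrite [leLHS]yE ler_pM2l//; have := expR_ge1Dx (y / n.+1%:R).
by move: (y / _) (expR _) => *; lra.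
Qed.

Lemma eta_ge0 m t : 0 <= eta m t.
Proof.
rewrite /eta; case: ifP => // t0; rewrite mulr_ge0 ?expR_ge0// exprn_ge0// invr_ge0 ltW//.
Qed.

Lemma eta_gt0 m t : 0 < t -> 0 < eta m t.
Proof. by move=> t0; rewrite /eta t0 mulr_gt0 ?expR_gt0// exprn_gt0// invr_gt0. Qed.

Lemma eta_eq0 m t : t <= 0 -> eta m t = 0.
Proof. by move=> t0; rewrite /eta ltNge t0. Qed.

Lemma eta0_le1 t : eta 0 t <= 1.
Proof.
rewrite /eta; case: ifP => t0; last by [].
by rewrite expr0 mul1r -expR0 ler_expR oppr_le0 invr_ge0 ltW.
Qed.

(** The quadratic bound makes the derivative at the origin zero; the exponent [m.+2] pays for the
    factor [t ^+ 2]. *)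
Lemma eta_le m : exists2 C : R, 0 <= C & forall t, eta m t <= C * t ^+ 2.
Proof.
exists (m.+2%:R ^+ m.+2); first by rewrite exprn_ge0// ler0n.
move=> t; rewrite /eta; case: ifP => [t0|_]; last by rewrite mulr_ge0 ?sqr_ge0// exprn_ge0// ler0n.
have tn : t != 0 by rewrite gt_eqF.
have ti : 0 <= t^-1 by rewrite invr_ge0 ltW.
have := pow_le_expR m.+2 ti; rewrite expRN.
have e0 := expR_gt0 t^-1.
rewrite -ler_pdivrMr// => h.
have -> : t^-1 ^+ m = t ^+ 2 * t^-1 ^+ m.+2.
  by rewrite -[m.+2]addn2 exprD mulrCA -exprMn mulfV// expr1n mulr1.
by rewrite -mulrA mulrC ler_wpM2r// sqr_ge0.
Qed.

Lemma is_derive_le_sqr (f : R -> R) (C : R) : f 0 = 0 -> (forall t, `|f t| <= C * t ^+ 2) ->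
  is_derive (0 : R) 1 f 0.
Proof.
move=> f0 fC.
have lim : h^-1 *: (f (h *: 1 + 0) - f 0) @[h --> (0 : R)^'] --> 0.
  apply/cvgrPdist_le => e e0.
  have C1 : 0 < `|C| + 1 by rewrite ltr_wpDl.
  have d0 : 0 < e / (`|C| + 1) by rewrite divr_gt0.
  near=> h; rewrite f0 subr0 addr0 /GRing.scale /= mulr1 sub0r normrN normrM normfV.
  have h0 : h != 0 by near: h; exact: nbhs_dnbhs_neq.
  have hp : 0 < `|h| by rewrite normr_gt0.
  rewrite mulrC ler_pdivrMr//; apply: le_trans (fC h) _.
  rewrite -(real_normK (num_real h)) expr2 mulrA ler_wpM2r//.
  have hs : `|h| <= e / (`|C| + 1).
    near: h; apply: nbhs_dnbhs; apply: (filterS (P := fun h : R => `|0 - h| < e / (`|C| + 1))).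
      by move=> h; rewrite sub0r normrN => /ltW.
    exact: (@nbhsx_ballx _ _ (0 : R) _ d0).
  move: hs; rewrite ler_pdivlMr// => hs.
  have := ler_norm C; nra.
split; first by apply/cvg_ex; exists 0.
exact: cvg_lim lim.
Unshelve. all: by end_near. Qed.

Lemma eta_derive m t : is_derive t 1 (eta m) (- m%:R * eta m.+1 t + eta m.+2 t).
Proof.
have [t0|t0|<-] := ltgtP 0 t.
- have E : \forall u \near t, u^-1 ^+ m * expR (- u^-1) = eta m u.
    near=> u; rewrite /eta ifT//; near: u; exact: lt_nbhsr.
  have tn : t != 0 by rewrite gt_eqF.
  apply: (near_eq_is_derive E).
  have DV : is_derive t 1 (fun u : R => u^-1) (- t ^- 2 *: 1) by apply: is_deriveV.
  pose h (y : R) := y ^+ m * expR (- y).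
  have Dh (y : R) : is_derive y 1 h (y ^+ m * (expR (- y) * -1) + expR (- y) * (m%:R * y ^+ m.-1)).
    have D1 : is_derive y 1 ((@id R) ^+ m) ((m%:R * y ^+ m.-1) *: 1) by exact: is_deriveX.
    have D2 : is_derive y 1 (expR \o (-%R : R -> R)) (expR (- y) * -1).
      apply: is_derive1_comp; exact: is_derive_expR.
    have := is_deriveM D1 D2; rewrite /GRing.scale /= mulr1.
    have -> : (@id R) ^+ m * (expR \o -%R) = h; last first.
      by rewrite exprfctE.
    by apply/funext => u; rewrite /h /= /GRing.mul /= fctE.
  have := is_derive1_comp (f := h) (Dh t^-1) DV.
  have -> : (t^-1 ^+ m * (expR (- t^-1) * -1) + expR (- t^-1) * (m%:R * t^-1 ^+ m.-1)) * (- t ^- 2 *: 1) =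
     - m%:R * eta m.+1 t + eta m.+2 t; last by [].
  rewrite /eta t0 /GRing.scale /= mulr1 -exprVn.
  move: t^-1 (expR _) => y e; case: m {h Dh E} => [|m]; rewrite ?exprS; first by rewrite /= !expr0; ring.
  by rewrite /= expr0; ring.
- have E : \forall u \near t, cst 0 u = eta m u.
    near=> u; rewrite eta_eq0//; apply: ltW; near: u; exact: lt_nbhsl.
  apply: (near_eq_is_derive E); rewrite !eta_eq0 ?(ltW t0)// mulr0 addr0.
  exact: is_derive_cst.
- rewrite !eta_eq0// mulr0 addr0; have [C C0 HC] := eta_le m.
  apply: (is_derive_le_sqr (C := C)); first exact: eta_eq0.
  by move=> t'; rewrite ger0_norm ?eta_ge0.
Unshelve. all: by end_near. Qed.

(* closed under directional derivatives, hence made of smooth functions *)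
Inductive bump_class : (plane -> R) -> Prop :=
| bump_eta m (c0 c1 c2 : R) : bump_class (fun z => eta m (c0 + z.1 * c1 + z.2 * c2))
| bump_scale (c : R) f : bump_class f -> bump_class (fun z => c * f z)
| bump_add f g : bump_class f -> bump_class g -> bump_class (fun z => f z + g z)
| bump_mul f g : bump_class f -> bump_class g -> bump_class (fun z => f z * g z).

Lemma bump_derive f : bump_class f -> (forall z, differentiable f z) /\
  forall v : plane, exists2 g, bump_class g & 'D_v f = g.
Proof.
elim=> {f} [m c0 c1 c2|c f _ [df Df]|f g bf [df Df] bg [dg Dg]|f g bf [df Df] bg [dg Dg]].
- have de t : differentiable (eta m) t by apply/derivable1_diffP; case: (eta_derive m t).
  pose A := fun z : plane => c0 + z.1 * c1 + z.2 * c2.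
  have dA z : differentiable A z := (affine_form_differentiable c0 c1 c2 z).1.
  have DA z v : 'D_v A z = v.1 * c1 + v.2 * c2 := (affine_form_differentiable c0 c1 c2 z).2 v.
  have dc z : differentiable (eta m \o A) z by apply: differentiable_comp.
  split=> [z|v]; first exact: dc.
  exists (fun z => (v.1 * c1 + v.2 * c2) * (- m%:R * eta m.+1 (A z) + eta m.+2 (A z))).
    by apply: bump_scale; apply: bump_add; [apply: bump_scale|]; exact: bump_eta.
  apply/funext => z; rewrite -[LHS]/('D_v (eta m \o A) z).
  have -> : 'D_v (eta m \o A) z = 'd (eta m) (A z) ('D_v A z).
    by rewrite (deriveE v (dc z)) (deriveE v (dA z)) (diff_comp (dA z) (de (A z))).
  rewrite DA (diff1E (de (A z))) derive1E.
  by have -> := derive_val (is_derive := eta_derive m (A z)).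
- have df' z : differentiable (cst c * f) z by apply: differentiableM => //; exact: differentiable_cst.
  split=> [z|v]; first exact: df'.
  have [g bg Dg] := Df v; exists (fun z => c * g z); first exact: bump_scale.
  apply/funext => z; rewrite -Dg -[RHS]/(c *: 'D_v f z) -deriveZ//; exact: diff_derivable.
- split=> [z|v]; first exact: differentiableD.
  have [f' bf' Df'] := Df v; have [g' bg' Dg'] := Dg v.
  exists (fun z => f' z + g' z); first exact: bump_add.
  apply/funext => z; rewrite -Df' -Dg' -deriveD//; exact: diff_derivable.
- split=> [z|v]; first exact: differentiableM.
  have [f' bf' Df'] := Df v; have [g' bg' Dg'] := Dg v.
  exists (fun z => f z * g' z + g z * f' z).
    by apply: bump_add; apply: bump_mul.
  apply/funext => z; rewrite -Df' -Dg'.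
  rewrite -[RHS]/(f z *: 'D_v g z + g z *: 'D_v f z) -deriveM//; exact: diff_derivable.
Qed.

Lemma bump_continuous f : bump_class f -> continuous f.
Proof. by move=> /bump_derive[df _] z; exact: differentiable_continuous. Qed.

Lemma bump_Ck f (k : nat) (U : set plane) : bump_class f -> Ck k U f.
Proof.
elim: k f => [|k IH] f bf; split=> //; try (by move=> z _; exact: bump_continuous).
move=> v; have [df Df] := bump_derive bf; split=> [z _|]; first exact: diff_derivable.
by have [g bg ->] := Df v; exact: IH.
Qed.

Lemma bump_C1 f (U : set plane) : bump_class f -> C1 U f.
Proof.
move=> bf z _; have [df Df] := bump_derive bf; split => // v.
by have [g bg ->] := Df v; exact: bump_continuous.
Qed.

Definition bump (rho t : R) : R := eta 0 (rho - t) * eta 0 (rho + t).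

Lemma bump_ge0 rho t : 0 <= bump rho t.
Proof. by rewrite mulr_ge0 ?eta_ge0. Qed.

Lemma bump_le1 rho t : bump rho t <= 1.
Proof. by rewrite mulr_ile1 ?eta_ge0 ?eta0_le1. Qed.

Lemma bump_eq0 rho t : rho <= `|t| -> bump rho t = 0.
Proof.
rewrite /bump ler_normr => /orP[h|h]; first by rewrite eta_eq0 ?mul0r//; lra.
by rewrite [X in _ * X]eta_eq0 ?mulr0//; lra.
Qed.

Lemma bump_gt0 rho t : `|t| < rho -> 0 < bump rho t.
Proof. by rewrite ltr_norml => /andP[? ?]; rewrite mulr_gt0// eta_gt0//; lra. Qed.

Lemma bump_continuous1 rho : continuous (bump rho).
Proof.
have ce m : continuous (eta m).
  by move=> t; case: (eta_derive m t) => d _; apply/differentiable_continuous/derivable1_diffP.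
move=> t.
have c1 : {for t, continuous (fun t : R => rho - t)} by apply: cvgB; [exact: cvg_cst|exact: cvg_id].
have c2 : {for t, continuous (fun t : R => rho + t)} by apply: cvgD; [exact: cvg_cst|exact: cvg_id].
have := continuous_comp c1 (ce 0 (rho - t)); have := continuous_comp c2 (ce 0 (rho + t)).
by move=> h2 h1; exact: (cvgM h1 h2).
Qed.

Lemma bump_class_affine rho (c0 c1 c2 : R) :
  bump_class (fun z => bump rho (c0 + z.1 * c1 + z.2 * c2)).
Proof.
have -> : (fun z : plane => bump rho (c0 + z.1 * c1 + z.2 * c2)) =
  (fun z => eta 0 ((rho - c0) + z.1 * (- c1) + z.2 * (- c2)) * eta 0 ((rho + c0) + z.1 * c1 + z.2 * c2)).
  by apply/funext => z; rewrite /bump; congr (eta _ _ * eta _ _); ring.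
by apply: bump_mul; exact: bump_eta.
Qed.

End SmoothBump.

(** * Comparison of the two Borel structures on the plane *)

Section BorelStructures.
Context {R : realType}.
Local Notation mu := (@lebesgue_measure R).
Local Notation plane := (R * R)%type.
Import HBNNSimple.

Lemma nnsfun_of d (M : measurableType d) (f : M -> R) : measurable_fun setT f ->
  finite_set (range f) -> (forall x, 0 <= f x) -> exists h : {nnsfun M >-> R}, (h : M -> R) = f.
Proof.
move=> mf ff f0.
pose m1 := isMeasurableFun.Build _ _ _ _ f mf.
pose m2 := FiniteImage.Build _ _ f ff.
pose m3 := isNonNegFun.Build _ _ f f0.
pose h : {nnsfun M >-> R} := HB.pack f m1 m2 m3.
by exists h.
Qed.

(* The pair type R * R carries two Borel structures, which differ only in their (opaque) displays. *)
Definition plane_borel : measurableType _ := (measurableTypeR R * measurableTypeR R)%type.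
Definition plane_default : measurableType _ := plane.

(** The integral is built from suprema over simple functions, and a simple function for one
    structure is also one for the other. *)
Lemma integral_area_structure (A : set plane) (f : plane -> \bar R) :
  (\int[area]_(z in A) f z = \int[(mu \x mu)%E]_(z in A) f z)%E.
Proof.
have nn (g : plane -> \bar R) :
  ereal_sup [set sintegral area h | h in [set h : {nnsfun plane_default >-> R} | forall x, ((h x)%:E <= g x)%E]] =
  ereal_sup [set sintegral (mu \x mu)%E h | h in [set h : {nnsfun plane_borel >-> R} | forall x, ((h x)%:E <= g x)%E]].
  congr ereal_sup; apply/seteqP; split=> _ [h hg <-].
    have mh : measurable_fun setT (h : plane_default -> R) by exact: measurable_funPT.
    have mh' : measurable_fun setT (h : plane_borel -> R) by exact: mh.
    have h0 x : 0 <= h x by exact: fun_ge0.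
  have [h' E] := nnsfun_of mh' (fimfunP h) h0.
    exists h'; first by move=> x; rewrite E.
    by rewrite E.
  have mh : measurable_fun setT (h : plane_borel -> R) by exact: measurable_funPT.
  have mh' : measurable_fun setT (h : plane_default -> R) by exact: mh.
  have h0 x : 0 <= h x by exact: fun_ge0.
  have [h' E] := nnsfun_of mh' (fimfunP h) h0.
  exists h'; first by move=> x; rewrite E.
  by rewrite E.
rewrite /integral; congr (_ - _)%E; exact: nn.
Qed.

Lemma L2_integrable_sqr (A : set plane) (f : plane -> R) : L2 A f ->
  (mu \x mu)%E.-integrable A (fun z => (f z ^+ 2)%:E).
Proof.
move=> [_ /integrableP[m1 m2]]; apply/integrableP; split; first exact: m1.
by rewrite -integral_area_structure.
Qed.

End BorelStructures.

(** * Area integrals: supports, null sets and dominated convergence *)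

Section AreaIntegrals.
Context {R : realType}.
Local Notation mu := (@lebesgue_measure R).
Local Notation plane := (R * R)%type.
Implicit Types (A B N : set plane) (f g h : plane -> R).

Lemma area_integral_support A B f : (forall z, A z -> ~ B z -> f z = 0) ->
  (forall z, B z -> ~ A z -> f z = 0) ->
  \int[area]_(z in A) f z = \int[area]_(z in B) f z.
Proof.
move=> AB BA; rewrite (@Rintegral_mkcond _ _ R (mu \x mu)%E A) (@Rintegral_mkcond _ _ R (mu \x mu)%E B).
congr (Rintegral _ _ _); apply/funext => z; rewrite !patchE.
case: ifPn; case: ifPn => //; rewrite !notin_setE !inE => h1 h2; first by rewrite AB.
by rewrite BA.
Qed.

Lemma area_integral_negligible A N f : measurable A -> measurable N ->
  (mu \x mu)%E.-integrable A (EFin \o f) -> area N = 0%E ->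
  \int[area]_(z in A) f z = \int[area]_(z in A `\` N) f z.
Proof.
move=> mA mN iA N0; rewrite /Rintegral; congr fine.
exact: (@negligible_integral _ _ R (mu \x mu)%E A N (EFin \o f) mN mA iA N0).
Qed.

Lemma area_integral_disjoint A B f : measurable A -> measurable B ->
  (mu \x mu)%E.-integrable (A `|` B) (EFin \o f) -> A `&` B = set0 ->
  \int[area]_(z in A `|` B) f z = \int[area]_(z in A) f z + \int[area]_(z in B) f z.
Proof.
move=> mA mB iAB AB0; apply: (@Rintegral_setU _ _ R (mu \x mu)%E A B f mA mB iAB).
by apply/disj_setPS; rewrite AB0.
Qed.

(** The product is dominated by [|C| * (1 + f ^+ 2)], which is integrable on a set of finite
    area. *)
Lemma L2_mul_integrable A f g (C : R) : measurable A -> (area A < +oo)%E -> L2 A f ->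
  measurable_fun A g -> (forall z, A z -> `|g z| <= C) ->
  (mu \x mu)%E.-integrable A (EFin \o (fun z => f z * g z)).
Proof.
move=> mA Alty fL2 mg gC; have if2 := L2_integrable_sqr fL2; case: fL2 => mf _.
have i1 : (mu \x mu)%E.-integrable A (cst 1%E).
  apply/integrableP; split; first exact: measurable_cst.
  under eq_integral do rewrite abse1.
  by rewrite integral_cst// mul1e.
have C0 : 0 <= `|C| by [].
have i2 : (mu \x mu)%E.-integrable A (fun z => `|C|%:E * (1%E + (f z ^+ 2)%:E))%E.
  have iD := @integrableD _ _ R (mu \x mu)%E A mA _ _ i1 if2.
  exact: (@integrableZl _ _ R (mu \x mu)%E A mA `|C| _ iD).
apply: (@le_integrable _ _ R (mu \x mu)%E A mA _ _ _ _ i2).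
  apply/measurable_realfun.measurable_EFinP.
  by apply: measurable_realfun.measurable_funM; [exact: mf|exact: mg].
move=> z Az; rewrite [leRHS](_ : _ = (Num.norm (`|C| * (1 + f z ^+ 2)))%:E)//.
rewrite /= lee_fin normrM.
have := gC z Az; have := ler_norm C; have := normr_ge0 (f z); have := normr_ge0 (g z).
rewrite -(real_normK (num_real (f z))); move: `|f z| `|g z| `|C| C0 => x y c c0 y0 x0 cC yC.
rewrite (ger0_norm (_ : 0 <= c * (1 + x ^+ 2))); last by rewrite mulr_ge0// addr_ge0// sqr_ge0.
have : 0 <= (x - 1) ^+ 2 by exact: sqr_ge0.
nra.
Qed.

Lemma L2_integrable A f : measurable A -> (area A < +oo)%E -> L2 A f ->
  (mu \x mu)%E.-integrable A (EFin \o f).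
Proof.
move=> mA Alty fL2; have := L2_mul_integrable (g := cst 1) (C := 1) mA Alty fL2.
have -> : (fun z => f z * cst 1 z) = f by apply/funext => z; rewrite /= mulr1.
apply; first exact: measurable_cst.
by move=> z _; rewrite normr1.
Qed.

(** Meant for bumps [phi m] that concentrate on an edge [N]: off [N] they are eventually zero, and
    [|h|] dominates. *)
Lemma area_dominated_cvg0 A N h (phi : nat -> plane -> R) : measurable A -> measurable N ->
  area N = 0%E -> (mu \x mu)%E.-integrable A (EFin \o h) ->
  (forall m, measurable_fun A (phi m)) -> (forall m z, `|phi m z| <= 1) ->
  (forall z, A z -> ~ N z -> \forall m \near \oo, phi m z = 0) ->
  \int[area]_(z in A) (h z * phi m z) @[m --> \oo] --> 0.
Proof.
move=> mA mN N0 ih mphi phi1 phi0.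
have mh : measurable_fun A h.
  by apply/measurable_realfun.measurable_EFinP; exact: measurable_int ih.
have aeN : {ae (mu \x mu)%E, forall z, ~ N z}.
  by exists N; split => // z /= /contrapT.
have H := @dominated_convergence _ _ R (mu \x mu)%E A mA
  (fun m z => (h z * phi m z)%:E) (cst 0%E) (fun z => `|h z|%:E).
case: H.
- move=> m; apply/measurable_realfun.measurable_EFinP.
  apply: measurable_realfun.measurable_funM; [exact: mh|exact: mphi].
- exact: measurable_cst.
- apply: (filterS (F := almost_everywhere (mu \x mu)%E) _ aeN) => z nN Az; apply: cvg_near_cst.
  near=> m; have -> : phi m z = 0 by near: m; exact: phi0.
  by rewrite mulr0.
- exact: integrable_abse ih.
- by apply: aeW => z m Az; rewrite /= lee_fin normrM ler_piMr.
move=> _ _; rewrite integral0 => H; exact: (fine_cvg H).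
Unshelve. all: by end_near. Qed.

End AreaIntegrals.

(** * Continuity across interior edges *)

Lemma derive_scaleB {R : realType} {V : normedModType R} (f g : V -> R) (a b : R) (p d : V) :
  derivable f p d -> derivable g p d ->
  'D_d ((fun q => a * f q) \- (fun q => b * g q)) p = a * 'D_d f p - b * 'D_d g p.
Proof.
move=> df dg.
have Df : derivable (a \*: f) p d by exact: derivableZ.
have Dg : derivable (b \*: g) p d by exact: derivableZ.
by rewrite [LHS](deriveB Df Dg) !deriveZ.
Qed.

(** * Divergence theorem on one element *)

Section ElementDivergence.
Context {R : realType}.
Local Notation plane := (R * R)%type.
Local Notation T0 := (@std_triangle R).
Local Notation mu := (@lebesgue_measure R).
Implicit Types (p q e : plane) (f g : plane -> R) (i j : 'I_3).
Local Notation J := jacobian_det.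

Variables (X Y : plane -> R) (U : set plane) (s c : R).
Hypothesis chG : chart X Y U s c.
Hypotheses (C2X : C2 U X) (C2Y : C2 U Y) (J0 : forall p, U p -> J X Y p != 0).
Local Notation G := (chart_map X Y).
Local Notation K := [set G p | p in T0].
Local Notation Dx := (grad1 X Y).
Local Notation Dy := (grad2 X Y).
Let oU : open U := chart_open chG.
Let sU : T0 `<=` U := chart_sub chG.

Lemma C1_chart_comp (phi : plane -> R) : C1 setT phi ->
  C1 U (phi \o G) /\ forall p d, U p -> 'D_d (phi \o G) p =
    'D_d X p * 'D_e1 phi (G p) + 'D_d Y p * 'D_e2 phi (G p).
Proof.
move=> Cphi.
have D p : U p -> differentiable (phi \o G) p /\ forall d, 'D_d (phi \o G) p =
    'D_d X p * 'D_e1 phi (G p) + 'D_d Y p * 'D_e2 phi (G p).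
  move=> Up; apply: differentiable_comp_pair; [exact: (C2X.1 _ Up).1|exact: (C2Y.1 _ Up).1|].
  exact: (Cphi _ I).1.
split; last by move=> p d /D[].
move=> p Up; split; first exact: (D p Up).1.
move=> d; apply: (continuous_open_ext (f := fun q => 'D_d X q * 'D_e1 phi (G q) + 'D_d Y q * 'D_e2 phi (G q)) oU Up).
  by move=> q Uq; rewrite (D q Uq).2.
have cG := chart_continuous chG Up.
apply: cvgD; apply: cvgM.
- exact: (C2X.1 _ Up).2.
- exact: (continuous_comp cG ((Cphi _ I).2 e1)).
- exact: (C2Y.1 _ Up).2.
- exact: (continuous_comp cG ((Cphi _ I).2 e2)).
Qed.

Variables (w : plane -> R).
Hypothesis C2w : C2 U w.

(** The flux of the field [v * phi * e] is the circulation of [w (phi \o G) d(e.1 Y - e.2 X)], and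
    its divergence appears as the Jacobian of this form. *)
Lemma divergence_jacobian (phi : plane -> R) e p : C1 setT phi -> U p ->
  J (w \* (phi \o G)) ((fun q => e.1 * Y q) \- (fun q => e.2 * X q)) p =
  J X Y p * (grad_along X Y w e p * phi (G p) + w p * 'D_e phi (G p)).
Proof.
move=> Cphi Up; have [C1P DP] := C1_chart_comp Cphi.
have dw := (C2w.1 _ Up).1; have dP := (C1P _ Up).1.
have dX := (C2X.1 _ Up).1; have dY := (C2Y.1 _ Up).1.
have D1 d : 'D_d (w \* (phi \o G)) p = w p * 'D_d (phi \o G) p + phi (G p) * 'D_d w p.
  by rewrite [LHS]deriveM//; exact: diff_derivable.
have D2 d : 'D_d ((fun q => e.1 * Y q) \- (fun q => e.2 * X q)) p = e.1 * 'D_d Y p - e.2 * 'D_d X p.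
  by apply: derive_scaleB; exact: diff_derivable.
have De := derive_pairE e (Cphi (G p) I).1.
have := J0 Up; move=> jne; move: (jne).
rewrite /jacobian_det !D1 !D2 !DP// /grad_along /grad1 /grad2 De /jacobian_det => {}jne; move: jne.
move: ('D_e1 w p) ('D_e2 w p) ('D_e1 X p) ('D_e2 X p) ('D_e1 Y p) ('D_e2 Y p) (w p) (phi (G p)) ('D_e1 phi (G p)) ('D_e2 phi (G p)) e.1 e.2.
by move=> *; field.
Qed.

Lemma divergence_theorem (phi hv hd : plane -> R) e : C1 setT phi ->
  (forall p, T0 p -> hv (G p) = w p) -> (forall p, T0 p -> hd (G p) = grad_along X Y w e p) ->
  \int[area]_(z in K) (hv z * 'D_e phi z) =
    s * tri_integral (w \* (phi \o G)) ((fun q => e.1 * Y q) \- (fun q => e.2 * X q)) 0 1 -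
    \int[area]_(z in K) (hd z * phi z).
Proof.
move=> Cphi hvE hdE; have [C1P DP] := C1_chart_comp Cphi.
have cK : compact K by apply: (chart_image_compact chG) => //; exact: std_triangle_compact.
have mK := plane_compact_measurable cK.
have cw p : T0 p -> {for p, continuous w} by move=> /sU; exact: C1_continuous C2w.1.
have cga p : T0 p -> {for p, continuous (grad_along X Y w e)}.
  by move=> Tp; exact: (C1_continuous (grad_along_C1 chG C2X C2Y J0 C2w e) (sU Tp)).
have khv := chart_within_continuous chG cw hvE.
have khd := chart_within_continuous chG cga hdE.
have kphi : {within K, continuous phi}.
  by apply: continuous_subspaceT => z; exact: C1_continuous Cphi I.
have kdphi : {within K, continuous ('D_e phi)}.
  by apply: continuous_subspaceT => z; exact: (Cphi z I).2.
have k1 : {within K, continuous (fun z => hv z * 'D_e phi z)}.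
  by move=> z; apply: cvgM; [exact: khv|exact: kdphi].
have k2 : {within K, continuous (fun z => hd z * phi z)}.
  by move=> z; apply: cvgM; [exact: khd|exact: kphi].
have i1 := plane_within_integrable cK k1; have i2 := plane_within_integrable cK k2.
apply/eqP; rewrite eq_sym subr_eq; apply/eqP.
rewrite -(@RintegralD _ _ R (mu \x mu)%E K _ _ mK i1 i2).
apply/esym; apply: (green chG).
- exact: (C1M oU C2w.1 C1P).
- exact: (C1B oU (C1Z _ oU C2Y.1) (C1Z _ oU C2X.1)).
move=> p Tp; rewrite divergence_jacobian//; last exact: sU.
by rewrite hvE// hdE//; move: (J X Y p) (grad_along _ _ _ _ _) (phi _) (w p) ('D_e phi _) => *; ring.
Qed.

Variables (i : 'I_3) (P D : plane) (tau n : plane) (k : R).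
Hypothesis aff : forall t : R, t \in `[0, 1] -> G (edge_point i t) = P + t *: D.
Hypotheses (Dk : D = k *: tau) (tau1 : dot tau tau = 1) (n1 : dot n n = 1)
  (n_tau : dot n tau = 0) (n_out : 0 < s * (n.1 * D.2 - n.2 * D.1)).

(** Only edge [i] contributes. There the form has constant direction, and its cross product with [e]
    is [dot e n] times the length [|k|], up to the orientation. *)
Lemma divergence_edge (phi : plane -> R) e : C1 setT phi ->
  (forall j (t : R), j != i -> t \in `[0, 1] -> phi (G (edge_point j t)) = 0) ->
  s * tri_integral (w \* (phi \o G)) ((fun q => e.1 * Y q) \- (fun q => e.2 * X q)) 0 1 =
  dot e n * (`|k| * \int[mu]_(t in `[0, 1]) (w (edge_point i t) * phi (G (edge_point i t)))).
Proof.
move=> Cphi phi0; have [C1P DP] := C1_chart_comp Cphi.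
rewrite tri_integral_edges (bigD1 i)//= big1 ?addr0; last first.
  move=> j ji; rewrite /edge_circulation /line_integral.
  transitivity (\int[mu]_(t in `[0, 1]) ((fun=> 0) t : R)).
    by apply: eq_Rintegral_itv => t t01; rewrite /line_integrand -/(edge_point j t) /= phi0// mulr0 mul0r.
  rewrite -[RHS](mul0r (fine (mu `[0, 1]%classic))) -Rintegral_cst//.
have [ka [N1 N2 kk sk]] := normal_rotation chG Dk tau1 n1 n_tau n_out.
have k0 := straight_scale_neq0 chG aff Dk.
have E (t : R) : t \in `[0, 1] ->
  line_integrand (w \* (phi \o G)) ((fun q => e.1 * Y q) \- (fun q => e.2 * X q)) (edge_base i) (edge_dir i) t =
  (e.1 * D.2 - e.2 * D.1) * (w (edge_point i t) * phi (G (edge_point i t))).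
  move=> t01; have Up := sU (edge_point_std i t01).
  rewrite /line_integrand -/(edge_point i t) /=.
  have dX' : derivable X (edge_point i t) (edge_dir i) by exact: diff_derivable (C2X.1 _ Up).1.
  have dY' : derivable Y (edge_point i t) (edge_dir i) by exact: diff_derivable (C2Y.1 _ Up).1.
  have -> : 'D_(edge_dir i) ((fun q => e.1 * Y q) \- (fun q => e.2 * X q)) (edge_point i t) = e.1 * D.2 - e.2 * D.1.
    rewrite (derive_scaleB _ _ dY' dX').
    have := straight_tangent chG C2X C2Y aff t01; rewrite /edge_tangent => T.
    by rewrite (congr1 fst T : 'D_(edge_dir i) X _ = D.1) (congr1 snd T : 'D_(edge_dir i) Y _ = D.2).
  by rewrite mulrC.
have cm (t : R) : t \in `[0, 1] -> {for t, continuous (fun t : R => w (edge_point i t) * phi (G (edge_point i t)))}.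
  move=> t01; apply: cvgM.
    by apply: (edge_continuous chG) t01 => p Up; exact: C1_continuous C2w.1 Up.
  apply: (edge_continuous chG (g := phi \o G)) t01 => p Up; exact: C1_continuous C1P Up.
rewrite /edge_circulation /line_integral (eq_Rintegral_itv E) RintegralZl//; last exact: continuous_itv_integrable.
rewrite !mulrA; congr (_ * _).
rewrite -sk /dot N1 N2 Dk /= /GRing.scale /=.
transitivity (ka * ka * (s * (e.1 * (k * tau.2) - e.2 * (k * tau.1)))); first by rewrite kk mul1r.
ring.
Qed.

End ElementDivergence.

(** A primitive of [f] is nondecreasing with equal end values, hence constant, and [f] is its
    derivative. *)
Lemma continuous_ge0_integral0 {R : realType} (a b t0 : R) (f : R -> R) : t0 \in `]a, b[ ->
  (forall t : R, t \in `[a, b] -> {for t, continuous f}) ->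
  (forall t : R, t \in `[a, b] -> 0 <= f t) ->
  \int[@lebesgue_measure R]_(t in `[a, b]) f t = 0 -> f t0 = 0.
Proof.
move=> t0ab cf f0 I0.
have ab : a <= b by move: t0ab; rewrite in_itv/= => /andP[? ?]; lra.
have [P dP] := primitive_segment ab cf.
have := FTC2_segment ab dP cf; rewrite I0 => /esym/subr0_eq Pab.
have mono (u v : R) : a <= u -> u <= v -> v <= b -> P u <= P v.
  move=> au uv vb.
  have dPi (t : R) : t \in `[u, v] -> is_derive t 1 P (f t).
    by move=> tuv; apply: dP; move: tuv; rewrite !in_itv/= => /andP[? ?]; apply/andP; split; lra.
  have d1 (t : R) : t \in `]u, v[ -> is_derive t 1 P (f t) by move=> tuv; apply: dPi; exact: subset_itv_oo_cc.
  have d2 : {within `[u, v], continuous P}.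
    by apply: derivable_within_continuous => t tuv; case: (dPi t tuv).
  case: (MVT_segment uv d1 d2) => t tuv E.
  rewrite -subr_ge0 E mulr_ge0 ?subr_ge0//; apply: f0.
  by move: tuv; rewrite !in_itv/= => /andP[? ?]; apply/andP; split; lra.
have cst (u : R) : u \in `[a, b] -> P u = P a.
  rewrite in_itv/= => /andP[au ub]; apply/eqP; rewrite eq_le.
  by rewrite -{1}Pab mono//= mono.
have t0ab' : t0 \in `[a, b] by exact: subset_itv_oo_cc.
have E : \forall u \near t0, P u = (fun=> P a) u.
  by near=> u; apply: cst; apply: subset_itv_oo_cc; near: u; exact: near_in_itvoo.
have D0 : is_derive t0 1 (fun=> P a) (f t0) by apply: near_eq_is_derive E (dP _ t0ab').
by rewrite -(derive_val (is_derive := D0)) derive_cst.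
Unshelve. all: by end_near. Qed.

(** Fundamental lemma of the calculus of variations at one point: if [f 0] were nonzero, [f 0 * f]
    times a narrow bump would be nonnegative with zero integral, yet positive at the origin. *)
Lemma bump_localization {R : realType} (al be r0 : R) (f : R -> R) : 0 < r0 -> (0 : R) \in `]al, be[ ->
  (forall t : R, t \in `[al, be] -> {for t, continuous f}) ->
  (forall r : R, 0 < r -> r <= r0 -> \int[@lebesgue_measure R]_(t in `[al, be]) (f t * bump r t) = 0) ->
  f 0 = 0.
Proof.
move=> r00 h0 cf H; apply/eqP/negPn/negP => f0.
pose g t := f t * f 0.
have g0 : 0 < g 0 by rewrite /g -expr2 exprn_even_gt0.
have cg (t : R) : t \in `[al, be] -> {for t, continuous g}.
  by move=> /cf c; apply: cvgM; [exact: c|exact: cvg_cst].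
have [e e0 ge] : exists2 e : R, 0 < e & forall t : R, `|t| < e -> 0 <= g t.
  have : \forall t \near (0 : R), 0 < g t.
    have := cg 0 (subset_itv_oo_cc h0); move/cvgrPdist_lt/(_ _ g0); apply: filterS => t.
    by rewrite ltr_norml => /andP[_]; rewrite ltrBlDr ltrDl.
  by move=> /nbhs_norm0P[e /= e0 E]; exists e => // t /E /ltW.
pose r := Num.min e r0.
have rp : 0 < r by rewrite lt_min e0.
have P := H r rp; rewrite ge_min lexx orbT in P; have {}P := P isT.
have cb (t : R) : {for t, continuous (bump r)} by exact: bump_continuous1.
have Z := @continuous_ge0_integral0 R al be 0 (fun t => f 0 * (f t * bump r t)) h0.
suff E0 : f 0 * (f 0 * bump r 0) = 0.
  have b0 : 0 < bump r 0 by apply: bump_gt0; rewrite normr0.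
  have p : 0 < f 0 * (f 0 * bump r 0) by rewrite mulrA; exact: mulr_gt0.
  by rewrite E0 ltxx in p.
apply: Z.
- by move=> t tab; apply: cvgM; [exact: cvg_cst|apply: cvgM; [exact: cf|exact: cb]].
- move=> t _; have [tr|tr] := ltP `|t| r.
    rewrite mulrA [f 0 * _]mulrC mulr_ge0 ?bump_ge0// ge//.
    by apply: lt_le_trans tr _; rewrite ge_min lexx.
  by rewrite bump_eq0// !mulr0.
rewrite RintegralZl//; first by rewrite P mulr0.
apply: continuous_itv_integrable => t tab; apply: cvgM; [exact: cf|exact: cb].
Qed.

(** * Integration over the domain, element by element *)

Section MeshDomain.
Context {R : realType}.
Local Notation plane := (R * R)%type.
Local Notation T0 := (@std_triangle R).
Local Notation mu := (@lebesgue_measure R).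
Implicit Types (p q n z e : plane) (i j : 'I_3).

Variables (a : 'I_3 -> plane) (T : finType) (F : T -> plane -> plane).
Implicit Types (K : T) (E : set plane).
Local Notation G K := (chart_map (elt_x a F K) (elt_y a F K)).
Local Notation elt := (elt a F).
Local Notation edge := (edge a F).
Local Notation vertex := (vertex a F).
Local Notation is_edge := (is_edge a F).
Local Notation is_vertex := (is_vertex a F).
Local Notation in_edge := (in_edge a F).
Variables (Omega : set plane) (L : R) (x : R -> plane).
Hypotheses (hO : bounded_domain Omega) (hbd : C2_boundary Omega L x)
  (hT : exact_triangulation a F Omega).
Variables (U : T -> set plane) (s c : T -> R).
Hypothesis hC : forall K, C2chart (elt_x a F K) (elt_y a F K) (U K) (s K) (c K).
Let chG K := C2chart_chart (hC K).
Let C2X K := C2chart_x (hC K).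
Let C2Y K := C2chart_y (hC K).
Let J0 K := C2chart_det (hC K).

Lemma elt_interior K : (elt K)° = [set G K p | p in std_interior].
Proof. by rewrite eltE (chart_interior (chG K)). Qed.

(** Points of the boundary have points outside [closure Omega] arbitrarily near, along the normal,
    whereas a neighbourhood of an interior point of [K] lies in [closure Omega]. *)
Lemma elt_interior_Omega K : (elt K)° `<=` Omega.
Proof.
move=> z Kz; apply: contrapT => nO.
have clz : closure Omega z by apply: (elt_sub_closure hT (K := K)); exact: interior_subset.
have bz : boundary Omega z by split => // /interior_subset.
move: (bz); rewrite -(curve_onto hbd) => -[r _ xr].
have out := curve_oriented hbd r; rewrite xr in out.
have cv : z + e *: normal x r @[e --> (0 : R)] --> z.
  have E0 : z = z + 0 *: normal x r by rewrite scale0r addr0.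
  rewrite [X in _ --> X]E0.
  by apply: cvgD; [exact: cvg_cst|apply: cvgZr_tmp; exact: cvg_id].
have nK : \forall y \near z, elt K y by exact: Kz.
have ne : \forall e \near (0 : R)^'+, elt K (z + e *: normal x r) by exact: (cvg_at_right_filter cv nK).
have [e [Ke [_ nKe]]] := filter_ex (filterI ne out).
by apply: nKe; exact: (elt_sub_closure hT Ke).
Qed.

Definition elt_edges K : set plane := edge K (inord 0) `|` edge K (inord 1) `|` edge K (inord 2).

Lemma elt_edgesP K z : elt_edges K z <-> exists i, edge K i z.
Proof.
split=> [[[]|]|[i]]; [by exists (inord 0)|by exists (inord 1)|by exists (inord 2)|].
by elim/ord3P: i => ?; [left; left|left; right|right].
Qed.

Lemma elt_edges_or K z : elt K z -> (elt K)° z \/ elt_edges K z.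
Proof.
rewrite elt_interior eltE => -[p Tp <-].
have [[i pi]|np] := pselect (exists i, bary_coord p i = 0).
  right; apply/elt_edgesP; exists i; rewrite edgeE.
  by have [t t01 ->] := (edge_pointP i p).1 (conj Tp pi); exists t.
left; exists p => //; case: Tp => h1 h2 h3; split.
- rewrite lt_neqAle h1 andbT eq_sym; apply/eqP => E; apply: np.
  by exists (inord 1); rewrite /bary_coord /= inordK.
- rewrite lt_neqAle h2 andbT eq_sym; apply/eqP => E; apply: np.
  by exists (inord 2); rewrite /bary_coord /= inordK.
- rewrite lt_neqAle h3 andbT; apply/eqP => E; apply: np.
  by exists (inord 0); rewrite /bary_coord /= inordK//; lra.
Qed.

Lemma elt_interior_edges K z : (elt K)° z -> ~ elt_edges K z.
Proof.
rewrite elt_interior => -[p [h1 h2 h3] <-] /elt_edgesP[i]; rewrite edgeE => -[t t01].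
have Tp : T0 p by split; exact: ltW.
move=> /(chart_inj (chG K) (edge_point_std i t01) Tp) E.
have : bary_coord p i = 0 by rewrite -E; exact: edge_point_coord.
by rewrite /bary_coord; case: i {E} => -[|[|[|//]]] ? /=; lra.
Qed.

Lemma edge_compact K i : compact (edge K i).
Proof.
rewrite edgeE; apply: continuous_compact; last exact: segment_compact.
apply: continuous_in_subspaceT => t; rewrite inE => t01.
have cG := chart_continuous (chG K) (chart_sub (chG K) (edge_point_std i t01)).
have ce : {for (t : R), continuous (@edge_point R i)}.
  by apply: cvgD; [exact: cvg_cst|apply: cvgZr_tmp; exact: cvg_id].
exact: (continuous_comp ce cG).
Qed.

Lemma edge_measurable K i : measurable (edge K i).
Proof. by apply: plane_compact_measurable; exact: edge_compact. Qed.

Lemma edge_null K i : area (edge K i) = 0%E.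
Proof.
rewrite edgeE; apply: (chart_segment_null (chG K)).
move=> t t01; exact: edge_point_std.
Qed.

Lemma elt_edges_measurable K : measurable (elt_edges K).
Proof. by apply: measurableU; [apply: measurableU|]; exact: edge_measurable. Qed.

Lemma elt_edges_null K : area (elt_edges K) = 0%E.
Proof.
apply: area_setU_null; [apply: measurableU; exact: edge_measurable|exact: edge_measurable| |exact: edge_null].
by apply: area_setU_null; [exact: edge_measurable|exact: edge_measurable|exact: edge_null|exact: edge_null].
Qed.

Lemma elt_measurable K : measurable (elt K).
Proof. by apply: plane_compact_measurable; exact: elt_compact. Qed.

(** Agreement with [fK] and [fK'] is asked in the interiors only; the edges form a null set [N],
    which is removed on both sides. *)
Lemma integral_two_elements K K' (f fK fK' : plane -> R) : K != K' ->
  (mu \x mu)%E.-integrable Omega (EFin \o f) ->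
  (mu \x mu)%E.-integrable (elt K) (EFin \o fK) ->
  (mu \x mu)%E.-integrable (elt K') (EFin \o fK') ->
  (forall z, (elt K)° z -> f z = fK z) -> (forall z, (elt K')° z -> f z = fK' z) ->
  (forall z, Omega z -> ~ elt K z -> ~ elt K' z -> f z = 0) ->
  \int[area]_(z in Omega) f z = \int[area]_(z in elt K) fK z + \int[area]_(z in elt K') fK' z.
Proof.
move=> KK iO iK iK' fE fE' f0.
have mO : measurable Omega by apply: plane_open_measurable; case: hO.
set A := (elt K)°; set B := (elt K')°.
have mA : measurable A by apply: plane_open_measurable; exact: open_interior.
have mB : measurable B by apply: plane_open_measurable; exact: open_interior.
set N := elt_edges K `|` elt_edges K'.
have mN : measurable N by apply: measurableU; exact: elt_edges_measurable.
have N0 : area N = 0%E by apply: area_setU_null; [exact: elt_edges_measurable|exact: elt_edges_measurable|exact: elt_edges_null|exact: elt_edges_null].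
have AO : A `<=` Omega by exact: elt_interior_Omega.
have BO : B `<=` Omega by exact: elt_interior_Omega.
have iAB : (mu \x mu)%E.-integrable (A `|` B) (EFin \o f).
  apply: (@integrableS _ _ _ (mu \x mu)%E Omega) => //; first exact: measurableU.
  by move=> z [/AO|/BO].
have red K2 (g : plane -> R) : (mu \x mu)%E.-integrable (elt K2) (EFin \o g) -> (forall z, (elt K2)° z -> f z = g z) ->
    \int[area]_(z in (elt K2)°) f z = \int[area]_(z in elt K2) g z.
  move=> ig E.
  transitivity (\int[area]_(z in (elt K2)°) g z).
    by apply: (@eq_Rintegral _ _ R (mu \x mu)%E) => z; rewrite inE => /E.
  rewrite (area_integral_negligible (elt_measurable K2) (elt_edges_measurable K2) ig (elt_edges_null K2)).
  apply: area_integral_support => z.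
    by move=> Kz []; split; [exact: interior_subset|exact: elt_interior_edges].
  by move=> [Kz nz] nK; case: (elt_edges_or Kz).
rewrite -(red K fK iK fE) -(red K' fK' iK' fE').
rewrite -(area_integral_disjoint mA mB iAB); last exact: (mesh_disjoint hT KK).
rewrite (area_integral_negligible mO mN iO N0) (area_integral_negligible (measurableU _ _ mA mB) mN iAB N0).
apply: area_integral_support => z.
  move=> [Oz Nz] nAB; apply: f0 => // Kz; apply: nAB; split => //.
    by left; case: (elt_edges_or Kz) => // h; case: Nz; left.
  by right; case: (elt_edges_or Kz) => // h; case: Nz; right.
by move=> [[/AO ?|/BO ?] Nz] []; split.
Qed.

End MeshDomain.

(** * Bumps concentrated on an edge *)

Section TestFunctions.
Context {R : realType}.
Local Notation plane := (R * R)%type.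
Implicit Types (p q n z e t : plane).

Lemma orthonormal_expansion t n p : dot t t = 1 -> dot n n = 1 -> dot n t = 0 ->
  p = dot p t *: t + dot p n *: n.
Proof.
move=> t1 n1 nt.
have p1 : dot (perp t) (perp t) = 1 by rewrite -t1 /dot /perp /=; ring.
have pt : dot (perp t) t = 0 by rewrite /dot /perp /=; ring.
have E : p = dot p t *: t + dot p (perp t) *: perp t.
  move: t1; rewrite /dot => t1.
  apply: plane_eq; rewrite /dot /perp /= /GRing.scale /=.
    by transitivity (p.1 * (t.1 * t.1 + t.2 * t.2)); [rewrite t1 mulr1|ring].
  by transitivity (p.2 * (t.1 * t.1 + t.2 * t.2)); [rewrite t1 mulr1|ring].
have [->|->] := unit_normal_cases t1 p1 n1 pt nt; first exact: E.
rewrite {1}E; congr (_ + _); apply: plane_eq; rewrite /dot /perp /= /GRing.scale /=; ring.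
Qed.

Lemma orthonormal_bound t n p (r : R) : dot t t = 1 -> dot n n = 1 -> dot n t = 0 ->
  `|dot p t| <= r -> `|dot p n| <= r -> `|p.1| <= 2 * r /\ `|p.2| <= 2 * r.
Proof.
move=> t1 n1 nt; have ab e : dot e e = 1 -> `|e.1| <= 1 /\ `|e.2| <= 1.
  rewrite /dot -!expr2 => e1; have := sqr_ge0 e.1; have := sqr_ge0 e.2 => h2 h1.
  by split; rewrite -(ler_pXn2r (n := 2))// ?nnegrE// expr1n real_normK ?num_real//; lra.
have [ta tb] := ab t t1; have [na nb] := ab n n1.
have := orthonormal_expansion p t1 n1 nt.
move: (dot p t) (dot p n) => u w E hu hw.
have b (y y' : R) : `|y| <= 1 -> `|y'| <= 1 -> `|u * y + w * y'| <= 2 * r.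
  move=> hy hy'; apply: le_trans (ler_normD _ _) _; rewrite !normrM.
  have h1 : `|u| * `|y| <= r * 1 by apply: ler_pM.
  have h2 : `|w| * `|y'| <= r * 1 by apply: ler_pM.
  lra.
split; first by have /= := congr1 fst E; rewrite /GRing.scale /= => ->; exact: b.
by have /= := congr1 snd E; rewrite /GRing.scale /= => ->; exact: b.
Qed.

Lemma near_box t n z0 (P : set plane) : dot t t = 1 -> dot n n = 1 -> dot n t = 0 ->
  (\forall z \near z0, P z) ->
  exists2 r : R, 0 < r & forall z, `|dot (z - z0) t| <= r -> `|dot (z - z0) n| <= r -> P z.
Proof.
move=> t1 n1 nt /near_planeP[d d0 H]; exists (d / 4) => [|z ht hn]; first by rewrite divr_gt0.
have [b1 b2] := orthonormal_bound t1 n1 nt ht hn.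
by rewrite (surjective_pairing z); apply: H; [apply: le_lt_trans b1 _|apply: le_lt_trans b2 _]; lra.
Qed.

Variables (t n z0 : plane).
Hypotheses (t1 : dot t t = 1) (n1 : dot n n = 1) (nt : dot n t = 0).

(** The factor [la] squeezes the bump in the normal direction only: the support shrinks to a piece
    of the line through [z0], while the values on that line do not change. *)
Definition strip_bump (r la : R) z : R :=
  bump r (dot (z - z0) t) * bump r (la * dot (z - z0) n).

Lemma strip_bump_class r la : bump_class (strip_bump r la).
Proof.
have -> : strip_bump r la = (fun z =>
   bump r (- dot z0 t + z.1 * t.1 + z.2 * t.2) * bump r (- (la * dot z0 n) + z.1 * (la * n.1) + z.2 * (la * n.2))).
  by apply/funext => z; rewrite /strip_bump /dot /=; congr (bump _ _ * bump _ _); ring.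
by apply: bump_mul; exact: bump_class_affine.
Qed.

Lemma strip_bump_le1 r la z : `|strip_bump r la z| <= 1.
Proof.
have h0 : 0 <= strip_bump r la z by rewrite mulr_ge0 ?bump_ge0.
by rewrite ger0_norm// mulr_ile1 ?bump_ge0 ?bump_le1.
Qed.

Lemma strip_bump_neq0 r la z : strip_bump r la z != 0 ->
  `|dot (z - z0) t| < r /\ `|la * dot (z - z0) n| < r.
Proof.
move=> H; split; rewrite ltNge; apply/negP => h; move/negP: H; apply; apply/eqP.
  by rewrite /strip_bump bump_eq0 ?mul0r.
by rewrite /strip_bump [X in _ * X]bump_eq0 ?mulr0.
Qed.

Lemma strip_bump_line r la (u : R) : strip_bump r la (z0 + u *: t) = bump r u * bump r 0.
Proof.
rewrite /strip_bump; have -> : z0 + u *: t - z0 = u *: t by rewrite addrC addKr.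
by rewrite !dotZl t1 mulr1 [dot t n]dotC nt !mulr0.
Qed.

Lemma strip_bump_cvg0 r z : dot (z - z0) n != 0 -> \forall m \near \oo, strip_bump r m%:R z = 0.
Proof.
move=> nz; have : \forall m \near \oo, (r / `|dot (z - z0) n|) <= m%:R.
  exact: nbhs_infty_ger.
apply: filterS => m; rewrite ler_pdivrMr ?normr_gt0// => h.
rewrite /strip_bump [X in _ * X]bump_eq0 ?mulr0// normrM ger0_norm//.
Qed.

Lemma strip_bump_test (O : set plane) (r la : R) : 1 <= la ->
  (forall z, `|dot (z - z0) t| <= r -> `|dot (z - z0) n| <= r -> O z) ->
  test_function O (strip_bump r la).
Proof.
move=> la1 HO.
have cd (e : plane) : continuous (fun z => `|dot (z - z0) e|).
  move=> z; have cdot : {for z, continuous (fun z => dot (z - z0) e)}.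
    have -> : (fun z => dot (z - z0) e) = (fun z => - dot z0 e + z.1 * e.1 + z.2 * e.2).
      by apply/funext => y; rewrite /dot /=; ring.
    apply: differentiable_continuous; exact: (affine_form_differentiable _ _ _ z).1.
  exact: (continuous_comp cdot (@norm_continuous _ _ _)).
pose B := [set z | `|dot (z - z0) t| <= r] `&` [set z | `|dot (z - z0) n| <= r].
have clB : closed B.
  apply: closedI.
    by apply: (@closed_comp _ _ (fun z => `|dot (z - z0) t|) [set y | y <= r]); [move=> z _; exact: cd|exact: closed_le].
  by apply: (@closed_comp _ _ (fun z => `|dot (z - z0) n|) [set y | y <= r]); [move=> z _; exact: cd|exact: closed_le].
have sB : closure [set z | strip_bump r la z != 0] `<=` B.
  rewrite closureE; apply: smallest_sub => // z /strip_bump_neq0[h1 h2]; split; first exact: ltW.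
  apply: le_trans (ltW h2); rewrite normrM ler_peMl// ger0_norm//; exact: le_trans la1.
split; first by move=> k; exact: bump_Ck (strip_bump_class r la).
- suff cB : compact B by apply: subclosed_compact cB sB; exact: closed_closure.
  apply: (subclosed_compact clB (B := `[z0.1 - 2 * r, z0.1 + 2 * r]%classic `*` `[z0.2 - 2 * r, z0.2 + 2 * r]%classic)).
    by apply: compact_setX; exact: segment_compact.
  move=> z [/= h1 h2].
  have r0 : 0 <= r by exact: le_trans h1.
  have [b1 b2] := orthonormal_bound t1 n1 nt h1 h2.
  split; rewrite /= in_itv/=.
    by move: b1; rewrite /= ler_norml => /andP[? ?]; apply/andP; split; lra.
  by move: b2; rewrite /= ler_norml => /andP[? ?]; apply/andP; split; lra.
by move=> z /sB[/= h1 h2]; exact: HO.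
Qed.

End TestFunctions.

(** * Equality of the two traces on an interior edge *)

Section WeakContinuity.
Context {R : realType}.
Local Notation plane := (R * R)%type.
Local Notation T0 := (@std_triangle R).
Local Notation mu := (@lebesgue_measure R).
Implicit Types (p q n z e : plane) (i j : 'I_3).

Variables (a : 'I_3 -> plane) (T : finType) (F : T -> plane -> plane).
Implicit Types (K : T) (E : set plane).
Local Notation G K := (chart_map (elt_x a F K) (elt_y a F K)).
Local Notation elt := (elt a F).
Local Notation edge := (edge a F).
Local Notation vertex := (vertex a F).
Local Notation is_edge := (is_edge a F).
Local Notation is_vertex := (is_vertex a F).
Local Notation in_edge := (in_edge a F).
Variables (Omega : set plane) (L : R) (x : R -> plane).
Hypotheses (hO : bounded_domain Omega) (hbd : C2_boundary Omega L x)
  (hT : exact_triangulation a F Omega).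
Variables (U : T -> set plane) (s c : T -> R).
Hypothesis hC : forall K, C2chart (elt_x a F K) (elt_y a F K) (U K) (s K) (c K).
Let chG K := C2chart_chart (hC K).
Let C2X K := C2chart_x (hC K).
Let C2Y K := C2chart_y (hC K).
Let J0 K := C2chart_det (hC K).

Variables (v : plane -> R) (w : T -> plane -> R).
Hypotheses (C2w : forall K, C2 (U K) (w K))
  (vw : forall K q, std_interior q -> v (G K q) = w K q).

(* the function on [elt K] whose pullback to the reference triangle is [u] *)
Definition elt_push K (u : plane -> R) z : R := u (get [set p | T0 p /\ G K p = z]).

Lemma elt_pushE K u p : T0 p -> elt_push K u (G K p) = u p.
Proof.
move=> Tp; rewrite /elt_push; congr u.
have [Tq Eq] : [set q | T0 q /\ G K q = G K p] (get [set q | T0 q /\ G K q = G K p]).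
  by apply: getPex; exists p.
exact: (chart_inj (chG K) Tq Tp Eq).
Qed.

Lemma elt_push_continuous K u : (forall p, U K p -> {for p, continuous u}) ->
  {within elt K, continuous (elt_push K u)}.
Proof.
move=> cu; rewrite eltE; apply: (chart_within_continuous (chG K) (h := u)).
  by move=> p Tp; apply: cu; exact: (chart_sub (chG K)).
exact: elt_pushE.
Qed.

Lemma elt_push_integrable K u (g : plane -> R) : (forall p, U K p -> {for p, continuous u}) ->
  continuous g -> (mu \x mu)%E.-integrable (elt K) (EFin \o (fun z => elt_push K u z * g z)).
Proof.
move=> cu cg; have ku := elt_push_continuous cu.
have kg : {within elt K, continuous g} by exact: continuous_subspaceT.
have k : {within elt K, continuous (fun z => elt_push K u z * g z)}.
  by move=> z; apply: cvgM; [exact: ku|exact: kg].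
exact: (plane_within_integrable (elt_compact hC (K := K)) k).
Qed.

Local Notation flux K e := (elt_push K (grad_along (elt_x a F K) (elt_y a F K) (w K) e)).

Lemma element_flux K i tau n z0 t0 k al be (phi : plane -> R) e :
  straight (edge K i) -> unit_tangent (edge K i) tau -> outer_unit_normal a F K (edge K i) n ->
  edge_coordinates a F K i tau z0 t0 k al be -> C1 setT phi ->
  (forall j z, j != i -> edge K j z -> phi z = 0) ->
  \int[area]_(z in elt K) (elt_push K (w K) z * 'D_e phi z) =
  dot e n * (\int[mu]_(r in `[al, be]) (w K (edge_point i (t0 + r / k)) * phi (z0 + r *: tau))) -
  \int[area]_(z in elt K) (flux K e z * phi z).
Proof.
move=> st ht hn [k0 vk ab rg _ _ lnE] Cphi phi0.
rewrite eltE (divergence_theorem (chG K) (C2X K) (C2Y K) (J0 (K := K)) (C2w K) Cphi (hv := elt_push K (w K)) (hd := flux K e) (fun p Tp => @elt_pushE K (w K) p Tp) (fun p Tp => @elt_pushE K _ p Tp)) -eltE.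
congr (_ - _).
have t1 := tangent_unit ht; have n1 := normal_unit hn.
have nt := normal_tangent hT hC st ht hn; have no := normal_out hT hC st ht hn.
rewrite (divergence_edge (chG K) (C2X K) (C2Y K) (C2w K) (straight_affine hT st) vk t1 n1 nt no e Cphi); last first.
  by move=> j t ji t01; apply: (phi0 j) => //; rewrite edgeE; exists t.
congr (_ * _).
have cP := (C1_chart_comp (chG K) (C2X K) (C2Y K) Cphi).1.
rewrite -(Rintegral_rescale (f := fun t : R => w K (edge_point i t) * phi (G K (edge_point i t))) k0 (ltW ab) rg).
  by apply: eq_Rintegral_itv => r rab; rewrite lnE.
move=> t t01; apply: cvgM.
  by apply: (edge_continuous (chG K)) t01 => p Up; exact: C1_continuous (C2w K).1 Up.
by apply: (edge_continuous (chG K) (g := phi \o G K)) t01 => p Up; exact: C1_continuous cP Up.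
Qed.

Lemma bounded_box : exists2 B, compact B & Omega `<=` B.
Proof.
have [_ _ _ [M [_ HM]]] := hO; pose m := `|M| + 1.
have Mm : M < m by rewrite /m; apply: le_lt_trans (ler_norm M) _; rewrite ltrDl.
exists (`[- m, m]%classic `*` `[- m, m]%classic); first by apply: compact_setX; exact: segment_compact.
move=> z Oz; have := HM m Mm z Oz; rewrite /= prod_normE ge_max => /andP[h1 h2].
by split; rewrite /= in_itv/= -ler_norml.
Qed.

Lemma continuous_Omega (g : plane -> R) : continuous g ->
  measurable_fun Omega g /\ exists C : R, forall z, Omega z -> `|g z| <= C.
Proof.
move=> cg; have [B cB OB] := bounded_box.
have kg : {within B, continuous g} by exact: continuous_subspaceT.
split.
  apply: (@measurable_funS _ _ _ _ B) => //; first exact: plane_compact_measurable.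
  apply: plane_within_measurable => //; exact: plane_compact_measurable.
have [C [_ HC]] := compact_bounded (continuous_compact kg cB).
exists (`|C| + 1) => z /OB Bz; apply: (HC (`|C| + 1)); last by exists z.
by apply: le_lt_trans (ler_norm C) _; rewrite ltrDl.
Qed.

Lemma Omega_area : measurable Omega /\ (area Omega < +oo)%E.
Proof.
have mO : measurable Omega by apply: plane_open_measurable; case: hO.
split => //; have [B cB OB] := bounded_box.
exact: le_lt_trans (area_le mO (plane_compact_measurable cB) OB) (area_compact_lty cB).
Qed.

Variables (nu : T -> set plane -> plane) (tau : set plane -> plane).
Hypothesis hnu : forall K E, interior_edges a F Omega E -> is_edge K E ->
  outer_unit_normal a F K E (nu K E).
Hypothesis htau : forall E, interior_edges a F Omega E -> unit_tangent E (tau E).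
Hypothesis hv : H1 Omega v.

Section Edge.
Variables (K K' : T) (i i' : 'I_3).
Hypotheses (KK : K != K') (EE : edge K i = edge K' i')
  (iE : interior_edges a F Omega (edge K i)).
Local Notation n := (nu K (edge K i)).
Local Notation t := (tau (edge K i)).
Variables (z0 : plane) (t0 k t0' k' al be : R).
Hypotheses (co : edge_coordinates a F K i t z0 t0 k al be)
  (co' : edge_coordinates a F K' i' t z0 t0' k' al be).
Let jump (r : R) : R := w K (edge_point i (t0 + r / k)) - w K' (edge_point i' (t0' + r / k')).

Let mainK2 (K2 : T) (j : 'I_3) (t1 k1 : R) : edge_coordinates a F K2 j t z0 t1 k1 al be ->
  forall r : R, r \in `[al, be] -> {for r, continuous (fun r : R => w K2 (edge_point j (t1 + r / k1)))}.
Proof.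
move=> c2 r rab; have t01 := (edge_range c2 r).1 rab.
have c1 : {for (t1 + r / k1), continuous (fun u : R => w K2 (edge_point j u))}.
  by apply: (edge_continuous (chG K2)) t01 => p Up; exact: C1_continuous (C2w K2).1 Up.
have c0 : {for r, continuous (fun r : R => t1 + r / k1)}.
  by apply: cvgD; [exact: cvg_cst|apply: cvgMl; exact: cvg_id].
exact: (continuous_comp c0 c1).
Qed.

Lemma jump_continuous (r : R) : r \in `[al, be] -> {for r, continuous jump}.
Proof. by move=> rab; apply: cvgB; [exact: (mainK2 co)|exact: (mainK2 co')]. Qed.

(** The weak derivative is tested with [phi] and integrated by parts on the two elements. The jump
    of [v] remains on the edge, and the area integrals contain [phi] without derivatives. *)
Lemma weak_flux (phi g : plane -> R) e : test_function Omega phi -> C1 setT phi ->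
  (forall z, `|phi z| <= 1) -> L2 Omega g -> weak_derivative Omega e v g ->
  (forall z, Omega z -> ~ elt K z -> ~ elt K' z -> 'D_e phi z = 0) ->
  (forall j z, j != i -> edge K j z -> phi z = 0) ->
  (forall j z, j != i' -> edge K' j z -> phi z = 0) ->
  dot e n * (\int[mu]_(r in `[al, be]) (jump r * phi (z0 + r *: t))) =
  \int[area]_(z in elt K) (flux K e z * phi z) + \int[area]_(z in elt K') (flux K' e z * phi z)
  - \int[area]_(z in Omega) (g z * phi z).
Proof.
move=> tphi Cphi phi1 L2g wg supp phi0 phi0'.
have st := interior_straight hT iE; have st' : straight (edge K' i') by rewrite -EE.
have ht := htau iE; have ht' : unit_tangent (edge K' i') t by rewrite -EE.
have hn : outer_unit_normal a F K (edge K i) n by apply: hnu => //; exists i.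
have hn' : outer_unit_normal a F K' (edge K' i') (nu K' (edge K i)).
  by rewrite -EE; apply: hnu => //; exists i'.
have nE := interior_normals hT hC hnu htau KK EE iE.
have [mO Olty] := Omega_area.
have cd : continuous ('D_e phi) by move=> z; exact: (Cphi z I).2.
have [md [C dC]] := continuous_Omega cd.
have [L2v _ _] := hv.
have iv : (mu \x mu)%E.-integrable Omega (EFin \o (fun z => v z * 'D_e phi z)) by exact: L2_mul_integrable dC.
have cw K2 p : U K2 p -> {for p, continuous (w K2)} by exact: C1_continuous (C2w K2).1.
have pE K2 z : (elt K2)° z -> v z * 'D_e phi z = elt_push K2 (w K2) z * 'D_e phi z.
  rewrite (elt_interior hC) => -[p Ip <-]; congr (_ * _).
  rewrite elt_pushE; first exact: vw.
  by case: Ip => h1 h2 h3; split; exact: ltW.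
have split2 := integral_two_elements hO hbd hT hC KK iv (elt_push_integrable (cw K) cd)
  (elt_push_integrable (cw K') cd) (@pE K) (@pE K').
have := wg phi tphi; rewrite split2; last by move=> z h1 h2 h3; rewrite supp// mulr0.
rewrite (element_flux e st ht hn co Cphi phi0) (element_flux e st' ht' hn' co' Cphi phi0') nE.
have -> : dot e (- n) = - dot e n by rewrite dotC -scaleN1r dotZl mulN1r dotC.
have ck K2 j t1 k1 (h : edge_coordinates a F K2 j t z0 t1 k1 al be) (r : R) : r \in `[al, be] ->
  {for r, continuous (fun r : R => w K2 (edge_point j (t1 + r / k1)) * phi (z0 + r *: t))}.
  move=> rab; apply: cvgM; first exact: (mainK2 h).
  have c0 : {for r, continuous (fun r : R => z0 + r *: t)}.
    by apply: cvgD; [exact: cvg_cst|apply: cvgZr_tmp; exact: cvg_id].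
  exact: (continuous_comp c0 (C1_continuous Cphi I)).
have -> : \int[mu]_(r in `[al, be]) (jump r * phi (z0 + r *: t)) =
  \int[mu]_(r in `[al, be]) (w K (edge_point i (t0 + r / k)) * phi (z0 + r *: t)) -
  \int[mu]_(r in `[al, be]) (w K' (edge_point i' (t0' + r / k')) * phi (z0 + r *: t)).
  rewrite -[RHS]mul1r -(Rintegral_scaleB 1 (ck _ _ _ _ co) (ck _ _ _ _ co')).
  by apply: eq_Rintegral_itv => r _; rewrite mul1r /jump mulrBl.
move: (\int[mu]_(_ in _) _) (\int[mu]_(_ in _) _) (\int[area]_(_ in elt K) _) (\int[area]_(_ in elt K') _) (\int[area]_(_ in Omega) _) (dot e n) => A B C1 D E1 de.
by move=> h; lra.
Qed.

Section Limit.
Variable rho : R.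
Hypotheses (rho0 : 0 < rho)
  (box : forall z, `|dot (z - z0) t| <= rho -> `|dot (z - z0) n| <= rho ->
    [/\ Omega z, forall K2, elt K2 z -> K2 = K \/ K2 = K',
      forall j, j != i -> ~ edge K j z & forall j, j != i' -> ~ edge K' j z])
  (seg : forall u : R, `|u| <= rho -> u \in `[al, be]).
Local Notation phi := (fun m : nat => strip_bump t n z0 rho m%:R).

(** As the strip gets thinner the edge integral stays the same, since on the edge the bump does not
    depend on [m], while the area integrals tend to zero by dominated convergence. *)
Lemma flux_limit (g : plane -> R) e : L2 Omega g -> weak_derivative Omega e v g ->
  dot e n * (\int[mu]_(r in `[al, be]) (jump r * bump rho r)) = 0.
Proof.
move=> L2g wg.
have st := interior_straight hT iE; have ht := htau iE.
have hn : outer_unit_normal a F K (edge K i) n by apply: hnu => //; exists i.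
have t1 := tangent_unit ht; have n1 := normal_unit hn.
have nt := normal_tangent hT hC st ht hn.
have [mO Olty] := Omega_area.
have Cphi m : C1 setT (phi m) by exact: bump_C1 (strip_bump_class _ _ _ _ _).
have cphi m : continuous (phi m) by move=> z; exact: C1_continuous (Cphi m) I.
have phi1 m z : `|phi m z| <= 1 by exact: strip_bump_le1.
have inbox m z : (0 < m)%N -> phi m z != 0 -> `|dot (z - z0) t| <= rho /\ `|dot (z - z0) n| <= rho.
  move=> m0 /strip_bump_neq0[h1 h2]; split; first exact: ltW.
  apply: le_trans (ltW h2); rewrite normrM ler_peMl// ger0_norm//.
  by rewrite (ler_nat R 1 m).
have test m : (0 < m)%N -> test_function Omega (phi m).
  move=> m0; apply: (strip_bump_test t1 n1 nt); first by rewrite (ler_nat R 1 m).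
  by move=> z h1 h2; case: (box h1 h2).
have supp m z : (0 < m)%N -> Omega z -> ~ elt K z -> ~ elt K' z -> 'D_e (phi m) z = 0.
  move=> m0 Oz Kz K'z.
  have op : open (~` (elt K `|` elt K')) by apply: closed_openC; apply: closedU; exact: (elt_closed hC).
  have E : {near z, phi m =1 (fun=> 0)}.
    have : nbhs z (~` (elt K `|` elt K')) by apply: open_nbhs_nbhs; split => // -[].
    apply: filterS => y nK; apply/eqP/negPn/negP => /(inbox _ _ m0)[h1 h2].
    have [Oy el _ _] := box h1 h2.
    have : closure Omega y by exact: subset_closure.
    rewrite -(mesh_cover hT) => -[K2 _ K2y].
    by apply: nK; case: (el K2 K2y) => <-; [left|right].
  by rewrite (near_eq_derive e E) derive_cst.
have e0 m j z : (0 < m)%N -> j != i -> edge K j z -> phi m z = 0.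
  move=> m0 ji jz; apply/eqP/negPn/negP => /(inbox _ _ m0)[h1 h2].
  by have [_ _ h _] := box h1 h2; exact: h jz.
have e0' m j z : (0 < m)%N -> j != i' -> edge K' j z -> phi m z = 0.
  move=> m0 ji jz; apply/eqP/negPn/negP => /(inbox _ _ m0)[h1 h2].
  by have [_ _ _ h] := box h1 h2; exact: h jz.
have id m : (0 < m)%N -> _ := fun m0 => weak_flux (test m m0) (Cphi m) (phi1 m) L2g wg
  (fun z => @supp m z m0) (fun j z => @e0 m j z m0) (fun j z => @e0' m j z m0).
have off z : ~ edge K i z -> \forall m \near \oo, phi m z = 0.
  move=> nE; have [zn|zn] := eqVneq (dot (z - z0) n) 0; last exact: (strip_bump_cvg0 _ rho zn).
  near=> m; rewrite /strip_bump bump_eq0 ?mul0r// leNgt; apply/negP => /ltW/seg/(edge_line co).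
  have E := orthonormal_expansion (z - z0) t1 n1 nt; rewrite zn scale0r addr0 in E.
  by rewrite -E addrC subrK.
have mE : measurable (edge K i) by exact: edge_measurable.
have nullE : area (edge K i) = 0%E by exact: (edge_null hC).
have lim (A : set plane) h : measurable A -> (forall m, measurable_fun A (phi m)) ->
    (mu \x mu)%E.-integrable A (EFin \o h) -> \int[area]_(z in A) (h z * phi m z) @[m --> \oo] --> 0.
  move=> mA mphi ih; apply: (area_dominated_cvg0 mA mE nullE ih mphi phi1).
  by move=> z _; exact: off.
have limK K2 : \int[area]_(z in elt K2) (flux K2 e z * phi m z) @[m --> \oo] --> 0.
  apply: lim; first exact: (elt_measurable hC).
    move=> m; apply: plane_within_measurable; first exact: (elt_measurable hC).
    exact: continuous_subspaceT.
  have cu p : U K2 p -> {for p, continuous (grad_along (elt_x a F K2) (elt_y a F K2) (w K2) e)}.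
    by move=> Up; exact: C1_continuous (grad_along_C1 (chG K2) (C2X K2) (C2Y K2) (J0 (K := K2)) (C2w K2) e) Up.
  exact: (plane_within_integrable (elt_compact hC (K := K2)) (elt_push_continuous cu)).
have limO : \int[area]_(z in Omega) (g z * phi m z) @[m --> \oo] --> 0.
  by apply: lim => //; [move=> m; exact: (continuous_Omega (cphi m)).1|exact: L2_integrable].
have limR : \int[area]_(z in elt K) (flux K e z * phi m z) + \int[area]_(z in elt K') (flux K' e z * phi m z) -
   \int[area]_(z in Omega) (g z * phi m z) @[m --> \oo] --> (0 + 0 - 0 : R).
  by apply: cvgB; [apply: cvgD; exact: limK|exact: limO].
rewrite addr0 subr0 in limR.
have ij : mu.-integrable `[al, be] (EFin \o (fun r : R => jump r * bump rho r)).
  by apply: continuous_itv_integrable => r rab; apply: cvgM; [exact: jump_continuous|exact: bump_continuous1].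
set Z := \int[mu]_(r in `[al, be]) (jump r * bump rho r).
have EZ m : (0 < m)%N -> dot e n * (Z * bump rho 0) =
   \int[area]_(z in elt K) (flux K e z * phi m z) + \int[area]_(z in elt K') (flux K' e z * phi m z) -
   \int[area]_(z in Omega) (g z * phi m z).
  move=> m0; rewrite -(id m m0); congr (_ * _).
  transitivity (\int[mu]_(r in `[al, be]) (bump rho 0 * (jump r * bump rho r))).
    rewrite RintegralZl; [by rewrite mulrC|exact: measurable_itv|exact: ij].
  by apply: eq_Rintegral_itv => r _; rewrite (strip_bump_line _ t1 nt) mulrC mulrA.
have limL : dot e n * (Z * bump rho 0) @[m --> \oo] --> (0 : R).
  apply: cvg_trans limR; apply: near_eq_cvg; near=> m; rewrite -EZ//; near: m; exact: nbhs_infty_gt.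
have := cvg_unique (@Rhausdorff R) (cvg_cst _) limL => /(_ _ _)/eqP.
have b0 : bump rho 0 != 0 by apply: lt0r_neq0; apply: bump_gt0; rewrite normr0.
by rewrite mulrA mulf_eq0 (negbTE b0) orbF => /eqP.
Unshelve. all: by end_near. Qed.

End Limit.

Lemma jump0 : in_edge K i z0 -> jump 0 = 0.
Proof.
move=> zi; have st := interior_straight hT iE; have ht := htau iE.
have hn : outer_unit_normal a F K (edge K i) n by apply: hnu => //; exists i.
have t1 := tangent_unit ht; have n1 := normal_unit hn.
have nt := normal_tangent hT hC st ht hn.
have h0 := (in_edge_coordinates hC st co).1 zi.
have zi' := in_edge_transfer hT hC st EE ht zi.
have far K2 i2 : in_edge K2 i2 z0 -> \forall z \near z0, forall j, j != i2 -> ~ edge K2 j z.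
  move=> zi2; suff N j : \forall z \near z0, j != i2 -> ~ edge K2 j z by exact: (filter_forall (nbhs_filter z0) N).
  have [->|ji] := eqVneq j i2; first by near=> z.
  have : nbhs z0 (~` edge K2 j).
    apply: open_nbhs_nbhs; split.
      by apply: closed_openC; apply: compact_closed; [exact: plane_hausdorff|exact: (edge_compact hC)].
    by move=> /(in_edge_unique hC zi2) E; rewrite E eqxx in ji.
  by apply: filterS.
have nO : \forall z \near z0, Omega z.
  by apply: open_nbhs_nbhs; split; [case: hO|exact: (in_edge_Omega hbd hT hC hnu htau KK EE iE zi)].
have nel := in_edge_near_elements hT hC hnu htau KK EE iE zi.
have nb : \forall z \near z0, [/\ Omega z, forall K2, elt K2 z -> K2 = K \/ K2 = K',
      forall j, j != i -> ~ edge K j z & forall j, j != i' -> ~ edge K' j z].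
  near=> z; split; near: z => //; exact: far.
have [r1 r10 B1] := near_box t1 n1 nt nb.
move: (h0); rewrite in_itv/= => /andP[al0 be0].
pose r0 := Num.min r1 (Num.min (- al) be).
have r00 : 0 < r0 by rewrite !lt_min r10 oppr_gt0 al0 be0.
apply: (bump_localization r00 h0 (@jump_continuous)) => r rp rr0.
have rle : [/\ r <= r1, r <= - al & r <= be] by move: rr0; rewrite !le_min => /and3P[].
case: rle => h1 h2 h3.
have fl g e : L2 Omega g -> weak_derivative Omega e v g ->
    dot e n * \int[mu]_(u in `[al, be]) (jump u * bump r u) = 0.
  apply: flux_limit => //.
    by move=> z g1 g2; apply: B1; apply: le_trans h1.
  by move=> u; rewrite ler_norml in_itv/= => /andP[? ?]; apply/andP; split; lra.
(* Testing in the directions [e1] and [e2] shows that both components of [n] times the integral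
   vanish, and [n] is a unit vector. *)
have [_ [g1 L1 W1] [g2 L2' W2]] := hv.
have := fl g1 e1 L1 W1; have := fl g2 e2 L2' W2.
move: (\int[mu]_(_ in _) _) n1; rewrite /dot /= => Z n1.
rewrite !mul0r !mul1r add0r addr0 => E2 E1.
by rewrite -[LHS]mul1r -n1 mulrDl -!mulrA E1 E2 !mulr0 addr0.
Unshelve. all: by end_near. Qed.

End Edge.

Theorem trace_continuous K K' i i' z : K != K' -> edge K i = edge K' i' ->
  interior_edges a F Omega (edge K i) -> in_edge K i z ->
  trace (elt K)° v z = trace (elt K')° v z.
Proof.
move=> KK EE iE zi; have st := interior_straight hT iE; have ht := htau iE.
have st' : straight (edge K' i') by rewrite -EE.
have ht' : unit_tangent (edge K' i') (tau (edge K i)) by rewrite -EE.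
have zE := in_edge_edge zi; have zE' : edge K' i' z by rewrite -EE.
have [t0 [k [al [be co]]]] := exists_edge_coordinates hT hC st ht zE.
have [t0' [k' [al' [be' co']]]] := exists_edge_coordinates hT hC st' ht' zE'.
have [ea eb] : al = al' /\ be = be'.
  apply: itv_cc_inj; [exact: ltW (edge_le co)|exact: ltW (edge_le co')|].
  by move=> r; rewrite -(edge_line co) -(edge_line co') EE.
rewrite -{}ea -{}eb in co'.
have h0 := subset_itv_oo_cc ((in_edge_coordinates hC st co).1 zi).
have := jump0 KK EE iE co co' zi; rewrite /= !mul0r !addr0 => /eqP; rewrite subr_eq0 => /eqP E.
have tv K2 i2 t2 k2 : edge_coordinates a F K2 i2 (tau (edge K i)) z t2 k2 al be ->
    trace (elt K2)° v z = w K2 (edge_point i2 t2).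
  move=> c2; have := edge_lineE c2 h0; rewrite scale0r addr0 mul0r addr0 => zG.
  have t201 := (edge_range c2 0).1 h0; rewrite mul0r addr0 in t201.
  rewrite [in LHS]zG eltE.
  exact: (trace_value (chG K2) (C2w K2) (@vw K2) (edge_point_std i2 t201)).
by rewrite (tv _ _ _ _ co) (tv _ _ _ _ co').
Qed.

End WeakContinuity.

(** * Interior edges *)

Lemma sum_two {V : nmodType} {I : finType} (P : pred I) (f : I -> V) (j k : I) :
  j != k -> P j -> P k -> (forall l, P l -> l = j \/ l = k) -> \sum_(l | P l) f l = f j + f k.
Proof.
move=> jk Pj Pk H; rewrite (bigD1 j)//= (bigD1 k)/=; last by rewrite Pk eq_sym.
rewrite big1 ?addr0// => l /andP[/andP[/H[] -> ]]; rewrite eqxx// => _; by rewrite eqxx.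
Qed.

Lemma Rintegral_itvD {R : realType} (a b : R) (f g : R -> R) :
  (forall t : R, t \in `[a, b] -> {for t, continuous f}) ->
  (forall t : R, t \in `[a, b] -> {for t, continuous g}) ->
  \int[@lebesgue_measure R]_(t in `[a, b]) (f t + g t) =
  \int[@lebesgue_measure R]_(t in `[a, b]) f t + \int[@lebesgue_measure R]_(t in `[a, b]) g t.
Proof. by move=> cf cg; rewrite RintegralD//; exact: continuous_itv_integrable. Qed.

Lemma cancel_ends {R : realType} (A B a1 a2 b1 b2 : R) : a1 + b1 = 0 -> a2 + b2 = 0 ->
  2 * A - (a1 - a2) + (2 * B - (b1 - b2)) = 2 * (A + B).
Proof. by move=> *; lra. Qed.

Section InteriorSum.
Context {R : realType}.
Local Notation plane := (R * R)%type.
Local Notation T0 := (@std_triangle R).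
Local Notation mu := (@lebesgue_measure R).
Implicit Types (p q n z e : plane) (i j : 'I_3).

Variables (a : 'I_3 -> plane) (T : finType) (F : T -> plane -> plane).
Implicit Types (K : T) (E : set plane).
Local Notation G K := (chart_map (elt_x a F K) (elt_y a F K)).
Local Notation elt := (elt a F).
Local Notation edge := (edge a F).
Local Notation vertex := (vertex a F).
Local Notation is_edge := (is_edge a F).
Local Notation is_vertex := (is_vertex a F).
Local Notation in_edge := (in_edge a F).
Variables (Omega : set plane) (L : R) (x : R -> plane).
Hypotheses (hO : bounded_domain Omega) (hbd : C2_boundary Omega L x)
  (hT : exact_triangulation a F Omega).
Variables (U : T -> set plane) (s c : T -> R).
Hypothesis hC : forall K, C2chart (elt_x a F K) (elt_y a F K) (U K) (s K) (c K).
Let chG K := C2chart_chart (hC K).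
Let C2X K := C2chart_x (hC K).
Let C2Y K := C2chart_y (hC K).
Let J0 K := C2chart_det (hC K).

Variables (v : plane -> R) (w : T -> plane -> R).
Hypotheses (C2w : forall K, C2 (U K) (w K))
  (vw : forall K q, std_interior q -> v (G K q) = w K q).
Variables (nu : T -> set plane -> plane) (tau : set plane -> plane).
Hypothesis hnu : forall K E, interior_edges a F Omega E -> is_edge K E ->
  outer_unit_normal a F K E (nu K E).
Hypothesis htau : forall E, interior_edges a F Omega E -> unit_tangent E (tau E).
Hypothesis hv : H1 Omega v.
Hypothesis hvert : forall K z, is_vertex K z -> C1_at a F v z.

Local Notation ga K := (grad_along (elt_x a F K) (elt_y a F K) (w K)).
Local Notation ha K := (hess_along (elt_x a F K) (elt_y a F K) (w K)).
Local Notation curl K := (curl_term (elt_x a F K) (elt_y a F K) (s K) (w K)).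

Lemma elt_trace_value K p : T0 p -> trace (elt K)° v (G K p) = w K p.
Proof. by move=> Tp; rewrite eltE; exact: (trace_value (chG K) (C2w K) (@vw K) Tp). Qed.

Lemma elt_trace_derive K e p : T0 p -> trace (elt K)° ('D_e v) (G K p) = ga K e p.
Proof.
by move=> Tp; rewrite eltE; exact: (trace_derive (chG K) (C2X K) (C2Y K) (J0 (K := K)) (C2w K) (@vw K) e Tp).
Qed.

Lemma elt_trace_derive2 K e e' p : T0 p -> trace (elt K)° ('D_e ('D_e' v)) (G K p) = ha K e e' p.
Proof.
by move=> Tp; rewrite eltE; exact: (trace_derive2 (chG K) (C2X K) (C2Y K) (J0 (K := K)) (C2w K) (@vw K) e e' Tp).
Qed.

Lemma elt_cvg_derive K e p : T0 p -> 'D_e v y @[y --> within (elt K)° (nbhs (G K p))] --> ga K e p.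
Proof.
move=> Tp; rewrite eltE; apply: (trace_cvg (chG K) Tp (g := ga K e)).
  by move=> q Iq; exact: (derive_interior (chG K) (C2w K) (@vw K) e Iq).
exact: C1_continuous (grad_along_C1 (chG K) (C2X K) (C2Y K) (J0 (K := K)) (C2w K) e) (chart_sub (chG K) Tp).
Qed.

Lemma elt_cvg_derive2 K e e' p : T0 p ->
  'D_e ('D_e' v) y @[y --> within (elt K)° (nbhs (G K p))] --> ha K e e' p.
Proof.
move=> Tp; rewrite eltE; apply: (trace_cvg (chG K) Tp (g := ha K e e')).
  by move=> q Iq; exact: (derive2_interior (chG K) (C2X K) (C2Y K) (J0 (K := K)) (C2w K) (@vw K) e e' Iq).
exact: (hess_along_continuous (chG K) (C2X K) (C2Y K) (J0 (K := K)) (C2w K) (chart_sub (chG K) Tp)).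
Qed.

Lemma grad_alongN K e p : ga K (- e) p = - ga K e p.
Proof. by rewrite /grad_along /= !mulNr opprD. Qed.

(** The vertex condition concerns [e1] and [e2]; other directions follow since [grad_along] is
    linear in the direction. *)
Lemma vertex_grad K K' p p' : T0 p -> T0 p' -> G K p = G K' p' -> is_vertex K (G K p) ->
  forall e, ga K e p = ga K' e p'.
Proof.
move=> Tp Tp' E vx e.
have Kz : elt K (G K p) by rewrite eltE; exists p.
have K'z : elt K' (G K p) by rewrite eltE E; exists p'.
have [_ h1 h2] := hvert vx Kz K'z.
move: h1 h2; rewrite !(elt_trace_derive K _ Tp) E !(elt_trace_derive K' _ Tp').
by rewrite !grad_along_e1 !grad_along_e2 => h1 h2; rewrite /grad_along h1 h2.
Qed.

Section OneSide.
Variables (K : T) (i : 'I_3) (t n z0 : plane) (t0 k al be : R).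
Hypotheses (st : straight (edge K i)) (ht : unit_tangent (edge K i) t)
  (hn : outer_unit_normal a F K (edge K i) n)
  (co : edge_coordinates a F K i t z0 t0 k al be).
Let k0 : k != 0 := edge_scale co.
Let vk : edge_vec a F K i = k *: t := edge_vecE co.
Let pt (r : R) := edge_point i (t0 + r / k).

Lemma side_std (r : R) : r \in `[al, be] -> T0 (pt r) /\ z0 + r *: t = G K (pt r).
Proof.
move=> rab; split; last exact: (edge_lineE co).
by apply: edge_point_std; exact: (edge_range co r).1.
Qed.

Lemma side_value (r : R) : r \in `[al, be] -> is_derive r 1 (fun r => w K (pt r)) (ga K t (pt r)).
Proof.
move=> rab; have t01 := (edge_range co r).1 rab.
have := is_derive_rescale k0 (straight_derive_value (chG K) (C2X K) (C2Y K) (J0 (K := K)) (straight_affine hT st) (C2w K) vk t01).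
by rewrite mulrAC mulfV// mul1r.
Qed.

Lemma side_grad e (r : R) : r \in `[al, be] ->
  is_derive r 1 (fun r => ga K e (pt r)) (ha K t e (pt r)).
Proof.
move=> rab; have t01 := (edge_range co r).1 rab.
have := is_derive_rescale k0 (straight_derive_grad (chG K) (C2X K) (C2Y K) (J0 (K := K)) (straight_affine hT st) (C2w K) vk e t01).
by rewrite mulrAC mulfV// mul1r.
Qed.

Lemma side_grad_continuous e (r : R) : r \in `[al, be] -> {for r, continuous (fun r => ga K e (pt r))}.
Proof.
by move=> /(side_grad e) [d _]; apply: differentiable_continuous; exact/derivable1_diffP.
Qed.

Lemma side_hess_continuous e e' (r : R) : r \in `[al, be] -> {for r, continuous (fun r => ha K e e' (pt r))}.
Proof.
move=> rab; have t01 := (edge_range co r).1 rab.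
have c1 : {for (t0 + r / k), continuous (fun u : R => ha K e e' (edge_point i u))}.
  apply: (edge_continuous (chG K)) t01 => p Up.
  exact: (hess_along_continuous (chG K) (C2X K) (C2Y K) (J0 (K := K)) (C2w K) Up).
have c0 : {for r, continuous (fun r : R => t0 + r / k)}.
  by apply: cvgD; [exact: cvg_cst|apply: cvgMl; exact: cvg_id].
exact: (continuous_comp c0 c1).
Qed.

(** Length along the common tangent is the same coordinate for both adjacent elements. Passing to it
    absorbs the sign [Num.sg k], so that the two boundary terms can be compared end by end. *)
Lemma side_curl : curl K i = 2 * \int[mu]_(r in `[al, be]) (ga K n (pt r) * ha K t t (pt r))
  - (ga K n (pt be) * ga K t (pt be) - ga K n (pt al) * ga K t (pt al)).
Proof.
have t1 := tangent_unit ht; have n1 := normal_unit hn.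
have nt := normal_tangent hT hC st ht hn; have no := normal_out hT hC st ht hn.
rewrite (straight_curl (chG K) (C2X K) (C2Y K) (J0 (K := K)) (straight_affine hT st) (C2w K) vk t1 n1 nt no).
have cm (u : R) : u \in `[0, 1] -> {for u, continuous (fun u : R => ga K n (edge_point i u) * ha K t t (edge_point i u))}.
  move=> t01; apply: cvgM; apply: (edge_continuous (chG K)) t01 => p Up.
    exact: C1_continuous (grad_along_C1 (chG K) (C2X K) (C2Y K) (J0 (K := K)) (C2w K) n) Up.
  exact: (hess_along_continuous (chG K) (C2X K) (C2Y K) (J0 (K := K)) (C2w K) Up).
rewrite -(Rintegral_rescale k0 (ltW (edge_le co)) (edge_range co) cm) /pt.
congr (_ - _); have [[kp -> ->]|[kn -> ->]] := rescale_ends k0 (ltW (edge_le co)) (edge_range co).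
  by rewrite gtr0_sg// mul1r.
by rewrite ltr0_sg// mulN1r opprB.
Qed.

Lemma side_vertex (r : R) : r = al \/ r = be -> is_vertex K (G K (pt r)).
Proof.
have h : t0 + r / k = 0 \/ t0 + r / k = 1 -> is_vertex K (G K (pt r)).
  rewrite /pt => -[] ->.
    by have [j ->] := @edge_point0 R i; exists j; rewrite vertexE.
  by have [j ->] := @edge_point1 R i; exists j; rewrite vertexE.
by move=> E; apply: h; have [[kp e0 e1]|[kn e0 e1]] := rescale_ends k0 (ltW (edge_le co)) (edge_range co); case: E => ->; auto.
Qed.

Lemma side_in_edge (r : R) : r \in `]al, be[ -> in_edge K i (z0 + r *: t).
Proof.
move=> rab; exists (t0 + r / k); first exact: (edge_range_oo co r).1.
by apply: (edge_lineE co); exact: subset_itv_oo_cc.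
Qed.

End OneSide.

Lemma interior_edge_sum K K' i i' : K != K' -> edge K i = edge K' i' ->
  interior_edges a F Omega (edge K i) ->
  curl K i + curl K' i' = 2 * edge_integral (edge K i) (tau (edge K i))
    (fun p => jump_dn a F v nu (edge K i) p * d2t a F v (tau (edge K i)) p).
Proof.
move=> KK EE iE; have st := interior_straight hT iE; have ht := htau iE.
set E := edge K i in st ht iE *; set t := tau E in ht *.
have st' : straight (edge K' i') by rewrite -EE.
have ht' : unit_tangent (edge K' i') t by rewrite -EE.
have hn : outer_unit_normal a F K (edge K i) (nu K E) by apply: hnu => //; exists i.
have hn' : outer_unit_normal a F K' (edge K' i') (nu K' E).
  by rewrite -EE; apply: hnu => //; exists i'.
have nE : nu K' E = - nu K E := interior_normals hT hC hnu htau KK EE iE.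
set z0 := get E.
have z0E : edge K i z0.
  have [z /in_edge_edge zE] := edge_midpoint a F K i.
  by have /getPex : exists z, E z by exists z.
have z0E' : edge K' i' z0 by rewrite -EE.
have [t0 [k [al [be co]]]] := exists_edge_coordinates hT hC st ht z0E.
have [t0' [k' [al' [be' co']]]] := exists_edge_coordinates hT hC st' ht' z0E'.
have [ea eb] : al = al' /\ be = be'.
  apply: itv_cc_inj; [exact: ltW (edge_le co)|exact: ltW (edge_le co')|].
  by move=> r; rewrite -(edge_line co) -(edge_line co') EE.
rewrite -{}ea -{}eb in co'; have ab := edge_le co.
set pt := fun r : R => edge_point i (t0 + r / k); set pt' := fun r : R => edge_point i' (t0' + r / k').
have Tpt r := side_std co (r := r); have Tpt' r := side_std co' (r := r).
have Gpt r : r \in `[al, be] -> G K (pt r) = G K' (pt' r).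
  by move=> rab; rewrite -(Tpt r rab).2 -(Tpt' r rab).2.
have zin r := side_in_edge co (r := r).
have veq r : r \in `]al, be[ -> w K (pt r) = w K' (pt' r).
  move=> rab; have rab' := subset_itv_oo_cc rab.
  have := trace_continuous hO hbd hT hC C2w vw hnu htau hv KK EE iE (zin r rab).
  rewrite -/t {1}(Tpt r rab').2 (Tpt' r rab').2.
  by rewrite (elt_trace_value K (Tpt r rab').1) (elt_trace_value K' (Tpt' r rab').1).
(* Functions equal on an open interval have equal derivatives; this is applied to the traces and
   then to their tangential derivatives. *)
have deq (f f' g g' : R -> R) : (forall r, r \in `]al, be[ -> f r = f' r) ->
   (forall r, r \in `[al, be] -> is_derive r 1 f (g r)) -> (forall r, r \in `[al, be] -> is_derive r 1 f' (g' r)) ->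
   forall r, r \in `]al, be[ -> g r = g' r.
  move=> ff dg dg' r rab; have rab' := subset_itv_oo_cc rab.
  have nr : \forall u \near r, f u = f' u.
    by have := near_in_itvoo rab; apply: filterS => u; exact: ff.
  have d1 := near_eq_is_derive nr (dg r rab').
  by rewrite -(derive_val (is_derive := d1)) (derive_val (is_derive := dg' r rab')).
have geq := deq _ _ _ _ veq (fun r => side_value st co (r := r)) (fun r => side_value st' co' (r := r)).
have heq := deq _ _ _ _ geq (fun r => side_grad st co t (r := r)) (fun r => side_grad st' co' t (r := r)).
have jumpE r : r \in `]al, be[ -> jump_dn a F v nu E (z0 + r *: t) =
    ga K (nu K E) (pt r) + ga K' (nu K' E) (pt' r).
  move=> rab; have rab' := subset_itv_oo_cc rab.
  rewrite /jump_dn (sum_two _ KK).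
  - congr (_ + _).
      by rewrite (Tpt r rab').2; apply: elt_trace_derive; exact: (Tpt r rab').1.
    by rewrite (Tpt' r rab').2; apply: elt_trace_derive; exact: (Tpt' r rab').1.
  - by apply/asboolP; exists i.
  - by apply/asboolP; exists i'.
  - by move=> K2 /asboolP; exact: (interior_edge_elements hT hC hnu htau KK EE iE).
have d2E r : r \in `]al, be[ -> d2t a F v t (z0 + r *: t) = ha K t t (pt r).
  move=> rab; have rab' := subset_itv_oo_cc rab.
  have Kz : elt K (z0 + r *: t) by apply: edge_sub_elt; exact: in_edge_edge (zin r rab).
  apply: (trace_skeleton hC (g := 'D_t ('D_t v)) _ _).2; first by exists K.
  move=> K2 K2z; have [->|->] := in_edge_elements hT hC hnu htau KK EE iE (zin r rab) K2z.
    by rewrite (Tpt r rab').2; apply: elt_cvg_derive2; exact: (Tpt r rab').1.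
  by rewrite heq// (Tpt' r rab').2; apply: elt_cvg_derive2; exact: (Tpt' r rab').1.
pose f (r : R) := (ga K (nu K E) (pt r) + ga K' (nu K' E) (pt' r)) * ha K t t (pt r).
have cf (r : R) : r \in `[al, be] -> {for r, continuous f}.
  move=> rab; apply: cvgM; last exact: (side_hess_continuous co).
  by apply: cvgD; [exact: (side_grad_continuous st co)|exact: (side_grad_continuous st' co')].
have wcf (g : R -> R) : (forall r : R, r \in `[al, be] -> {for r, continuous g}) -> {within `[al, be], continuous g}.
  by move=> cg; apply: continuous_in_subspaceT => r; rewrite inE => /cg.
have -> : edge_integral E t (fun p => jump_dn a F v nu E p * d2t a F v t p) = \int[mu]_(r in `[al, be]) f r.
  rewrite /edge_integral -/z0.
  have -> : [set r | E (z0 + r *: t)] = [set` `[al, be]].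
    by apply/seteqP; split => r /(edge_line co).
  apply: eq_Rintegral_oo; last exact: wcf.
  by move=> r rab; rewrite jumpE// d2E.
pose m (r : R) := ga K (nu K E) (pt r) * ha K t t (pt r).
pose m' (r : R) := ga K' (nu K' E) (pt' r) * ha K' t t (pt' r).
have cm (r : R) : r \in `[al, be] -> {for r, continuous m}.
  by move=> rab; apply: cvgM; [exact: (side_grad_continuous st co)|exact: (side_hess_continuous co)].
have cm' (r : R) : r \in `[al, be] -> {for r, continuous m'}.
  by move=> rab; apply: cvgM; [exact: (side_grad_continuous st' co')|exact: (side_hess_continuous co')].
have fE : \int[mu]_(r in `[al, be]) f r = \int[mu]_(r in `[al, be]) m r + \int[mu]_(r in `[al, be]) m' r.
  rewrite -(Rintegral_itvD cm cm').
  apply/esym/eq_Rintegral_oo; last exact: wcf.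
  by move=> r rab; rewrite /m /m' -heq// -mulrDl.
have bd (r : R) : r = al \/ r = be ->
    ga K (nu K E) (pt r) * ga K t (pt r) + ga K' (nu K' E) (pt' r) * ga K' t (pt' r) = 0.
  move=> h; have rab : r \in `[al, be] by case: h => ->; rewrite in_itv/= lexx ltW.
  have vg := vertex_grad (Tpt r rab).1 (Tpt' r rab).1 (Gpt r rab) (side_vertex co h).
  by rewrite -!vg nE grad_alongN mulNr subrr.
have cE : curl K i = 2 * \int[mu]_(r in `[al, be]) m r -
  (ga K (nu K E) (pt be) * ga K t (pt be) - ga K (nu K E) (pt al) * ga K t (pt al)) := side_curl st ht hn co.
have cE' : curl K' i' = 2 * \int[mu]_(r in `[al, be]) m' r -
  (ga K' (nu K' E) (pt' be) * ga K' t (pt' be) - ga K' (nu K' E) (pt' al) * ga K' t (pt' al)) := side_curl st' ht' hn' co'.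
rewrite cE cE' fE; apply: cancel_ends; [exact: bd (or_intror erefl)|exact: bd (or_introl erefl)].
Qed.

End InteriorSum.

(** * The boundary curve *)

Section PiecewiseCalculus.
Import measurable_realfun.
Context {R : realType}.
Local Notation mu := (@lebesgue_measure R).
Implicit Types (f g h : R -> R) (a b c : R).

Lemma abs_measurable (A : set R) f : measurable_fun A f -> measurable_fun A (EFin \o (fun t : R => `|f t|)).
Proof.
by move=> mf; apply/measurable_EFinP; apply: measurableT_comp mf; exact: normr_measurable.
Qed.

Lemma integrable_oo a b f g : (forall t : R, t \in `]a, b[ -> f t = g t) ->
  {within `[a, b], continuous g} -> mu.-integrable `[a, b] (EFin \o f).
Proof.
move=> fg cg.
have ig : mu.-integrable `[a, b] (EFin \o g) by apply: continuous_compact_integrable => //; exact: segment_compact.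
have igo : mu.-integrable `]a, b[ (EFin \o g) by apply: integrableS ig => //; exact: subset_itv_oo_cc.
have ifo : mu.-integrable `]a, b[ (EFin \o f).
  by apply: eq_integrable igo => // t; rewrite inE /= => h; rewrite fg.
have mfo : measurable_fun `]a, b[ f.
  by apply/measurable_EFinP; exact: measurable_int ifo.
have mfc : measurable_fun `[a, b] f.
  by apply/measurable_fun_itv_bndo_bndcP/measurable_fun_itv_obnd_cbndP.
have [_ fin] := integrableP _ _ _ ifo.
apply/integrableP; split; first by apply/measurable_EFinP.
rewrite -integral_itv_obnd_cbnd; last first.
  have m : measurable_fun `]a, b] f by exact/measurable_fun_itv_bndo_bndcP.
  exact: (abs_measurable m).
rewrite -integral_itv_bndo_bndc//.
exact: (abs_measurable mfo).
Qed.

Lemma integrable_itv_cat a b c f : a <= b -> b <= c ->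
  mu.-integrable `[a, b] (EFin \o f) -> mu.-integrable `[b, c] (EFin \o f) ->
  mu.-integrable `[a, c] (EFin \o f) /\
  \int[mu]_(t in `[a, c]) f t = \int[mu]_(t in `[a, b]) f t + \int[mu]_(t in `[b, c]) f t.
Proof.
move=> ab bc i1 i2.
have i2' : mu.-integrable `]b, c] (EFin \o f) by apply: integrableS i2 => //; exact: subset_itv_oc_cc.
have E : [set` `[a, c]] = [set` `[a, b]] `|` [set` `]b, c]] by exact: itv_bndbnd_setU.
have i12 : mu.-integrable `[a, c] (EFin \o f).
  have [m1 f1] := integrableP _ _ _ i1; have [m2 f2] := integrableP _ _ _ i2'.
  rewrite E; apply/integrableP; split; first by apply/measurable_funU.
  rewrite ge0_integral_setU//; first exact: lte_add_pinfty.
    have m : measurable_fun (`[a, b] `|` `]b, c]) f.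
      by apply/measurable_EFinP; apply/measurable_funU.
    exact: (abs_measurable m).
  by apply/disj_setPS => t [/=]; rewrite !in_itv/= => /andP[_ h] /andP[]; rewrite ltNge h.
split => //; apply/eqP; rewrite addrC -subr_eq; apply/eqP.
rewrite (Rintegral_itvB i12) ?bnd_simp//.
by apply: Rintegral_itv_obnd_cbnd.
Qed.

(** Connectedness of the interval, obtained from the mean value theorem: the indicator of [P] has
    zero derivative. *)
Lemma locally_constant (a b : R) (P : R -> Prop) :
  (forall t : R, t \in `]a, b[ -> P t -> \forall u \near t, P u) ->
  (forall t : R, t \in `]a, b[ -> ~ P t -> \forall u \near t, ~ P u) ->
  forall t u : R, t \in `]a, b[ -> u \in `]a, b[ -> P t -> P u.
Proof.
move=> H H'; pose f (t : R) : R := `[< P t >]%:R.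
have df (t : R) : t \in `]a, b[ -> is_derive t 1 f 0.
  move=> tab; suff E : \forall u \near t, (fun=> f t) u = f u by apply: near_eq_is_derive E (is_derive_cst _ _ _).
  rewrite /f; case: asboolP => Pt.
    by have := H t tab Pt; apply: filterS => u Pu; rewrite asboolT.
  by have := H' t tab Pt; apply: filterS => u Pu; rewrite asboolF.
have cst (t u : R) : t \in `]a, b[ -> u \in `]a, b[ -> t <= u -> f t = f u.
  move=> tab uab tu.
  have sub (r : R) : r \in `[t, u] -> r \in `]a, b[.
    move: tab uab; rewrite !in_itv/= => /andP[? ?] /andP[? ?] /andP[? ?]; apply/andP; split; lra.
  have d1 (r : R) : r \in `]t, u[ -> is_derive r 1 f ((fun=> 0) r : R).
    by move=> h; apply: df; apply: sub; exact: subset_itv_oo_cc.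
  have d2 : {within `[t, u], continuous f}.
    by apply: derivable_within_continuous => r h; case: (df r (sub r h)).
  by case: (MVT_segment tu d1 d2) => r _; rewrite mul0r => /subr0_eq.
have feq (t u : R) : t \in `]a, b[ -> u \in `]a, b[ -> f t = f u.
  by move=> tab uab; have [tu|/ltW ut] := leP t u; [exact: cst|apply/esym; exact: cst].
move=> t u tab uab Pt; have := feq t u tab uab; rewrite /f asboolT//.
by case: asboolP => // _ /eqP; rewrite oner_eq0.
Qed.

(** Induction on the list of exceptional points, cutting the interval at each one inside it; the
    increments of [Psi] telescope. *)
Lemma FTC2_finite (V : seq R) (H Psi : R -> R) a b : a <= b ->
  mu.-integrable `[a, b] (EFin \o H) ->
  (forall u v : R, a <= u -> u <= v -> v <= b -> (forall t : R, t \in V -> t \notin `]u, v[) ->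
    \int[mu]_(t in `[u, v]) H t = Psi v - Psi u) ->
  \int[mu]_(t in `[a, b]) H t = Psi b - Psi a.
Proof.
elim: V a b => [|w V IH] a b ab iH hp; first exact: hp.
have sub (u v : R) : a <= u -> v <= b -> [set` `[u, v]] `<=` [set` `[a, b]].
  by move=> au vb t /=; rewrite !in_itv/= => /andP[? ?]; apply/andP; split; lra.
have iS (u v : R) : a <= u -> v <= b -> mu.-integrable `[u, v] (EFin \o H).
  by move=> au vb; apply: integrableS iH => //; exact: sub.
have [wab|wab] := boolP (w \in `]a, b[); last first.
  apply: IH => // u v au uv vb hV; apply: hp => // t; rewrite inE => /orP[/eqP ->|/hV//].
  apply: contra wab; rewrite !in_itv/= => /andP[? ?]; apply/andP; split; lra.
move: (wab); rewrite in_itv/= => /andP[aw wb].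
have [_ ->] := integrable_itv_cat (ltW aw) (ltW wb) (iS a w (lexx _) (ltW wb)) (iS w b (ltW aw) (lexx _)).
rewrite (IH a w) ?(ltW aw)//; [|exact: iS (ltW wb)|]; last first.
  move=> u v au uv vw hV; apply: hp => //; first lra.
  move=> t; rewrite inE => /orP[/eqP ->|/hV//]; rewrite in_itv/=; apply/negP => /andP[? ?]; lra.
rewrite (IH w b) ?(ltW wb)//; [|exact: iS (ltW aw) (lexx _)|]; last first.
  move=> u v wu uv vb hV; apply: hp => //; first lra.
  move=> t; rewrite inE => /orP[/eqP ->|/hV//]; rewrite in_itv/=; apply/negP => /andP[? ?]; lra.
by rewrite addrC addrA subrK.
Qed.

(** The chain rule read backwards: with Caratheodory slopes of [f] and [y], the slope of [sig] is
    their quotient near [r], where the slope of [f] does not vanish. *)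
Lemma is_derive_factor (f y sig : R -> R) (r f' y' : R) :
  (\forall u \near r, f (sig u) = y u) -> {for r, continuous sig} ->
  is_derive (sig r) 1 f f' -> f' != 0 -> is_derive r 1 y y' ->
  is_derive r 1 sig (y' / f').
Proof.
move=> E cs /is_derive1_caratheodory[g [gE gC g0]] f0 /is_derive1_caratheodory[k [kE kC k0]].
have Er : f (sig r) = y r := nbhs_singleton E.
have cgs : {for r, continuous (g \o sig)} by apply: continuous_comp.
have gn : \forall u \near r, g (sig u) != 0.
  have : g (sig r) != 0 by rewrite g0.
  move=> h; have := cgs; move/cvgr_neq0; exact.
have nE : \forall u \near r, (fun u => k u / g (sig u) * (u - r) + sig r) u = sig u.
  near=> u; have Eu : f (sig u) = y u by near: u.
  have gu : g (sig u) != 0 by near: u.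
  suff -> : k u / g (sig u) * (u - r) = sig u - sig r by rewrite subrK.
  apply: (mulfI gu); rewrite -gE Eu Er kE.
  by rewrite mulrA mulrCA mulfV// mulr1.
apply: (near_eq_is_derive nE).
apply/is_derive1_caratheodory; exists (fun u => k u / g (sig u)); split.
- by move=> z; rewrite subrr mulr0 add0r addrK.
- by apply: cvgM; [exact: kC|apply: cvgV; [rewrite g0|exact: cgs]].
- by rewrite k0 g0.
Unshelve. all: by end_near. Qed.

End PiecewiseCalculus.

Section PlaneCurves.
Context {R : realType}.
Local Notation plane := (R * R)%type.
Implicit Types (y : R -> plane) (r : R).

Lemma fst_sub_scale (k : R) (p q : plane) : (k *: (p - q)).1 = k * (p.1 - q.1).
Proof. by []. Qed.

Lemma snd_sub_scale (k : R) (p q : plane) : (k *: (p - q)).2 = k * (p.2 - q.2).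
Proof. by []. Qed.

Lemma derive_components y r : derivable y r 1 ->
  is_derive r 1 (fun u => (y u).1) (derive1 y r).1 /\ is_derive r 1 (fun u => (y u).2) (derive1 y r).2.
Proof.
move=> dy; rewrite derive1E.
have cf : continuous (fst : plane -> R) by move=> z; exact: cvg_fst.
have cs : continuous (snd : plane -> R) by move=> z; exact: cvg_snd.
have [d1 e1] := derive_linear_comp (l := fst) fst_sub_scale cf dy.
have [d2 e2] := derive_linear_comp (l := snd) snd_sub_scale cs dy.
by split; apply: DeriveDef.
Qed.

Lemma Ck1_derive1 (V : normedModType R) (A : set R) (y : R -> V) : Ck 1 A y ->
  forall r, A r -> derivable y r 1 /\ {for r, continuous (derive1 y)}.
Proof.
move=> [_ /(_ 1)[dy [cy _]]] r Ar; split; first exact: dy.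
have -> : derive1 y = 'D_1 y by apply/funext => u; rewrite derive1E.
exact: cy.
Qed.

Lemma Ck2_derive1 y : Ck 2 setT y -> Ck 1 setT y /\ Ck 1 setT (derive1 y).
Proof.
move=> [cy dy]; split; first by split => // v; split; [exact: (dy v).1|split => //; exact: (dy v).2.1].
have -> : derive1 y = 'D_1 y by apply/funext => u; rewrite derive1E.
exact: (dy 1).2.
Qed.

End PlaneCurves.

(** * The edge parameter along a differentiable curve *)

Section EdgeParameter.
Context {R : realType}.
Local Notation plane := (R * R)%type.
Local Notation T0 := (@std_triangle R).
Implicit Types (i : 'I_3).
Variables (X Y : plane -> R) (U : set plane) (s c : R).
Hypothesis chG : chart X Y U s c.
Hypotheses (C2X : C2 U X) (C2Y : C2 U Y).
Local Notation G := (chart_map X Y).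

Lemma edge_tangent_gt0 i p : T0 p -> 0 < dot (edge_tangent X Y i p) (edge_tangent X Y i p).
Proof.
move=> Tp; rewrite lt_neqAle dot_ge0 andbT eq_sym; apply/eqP => E.
have := chart_det_neq0 chG Tp.
move: E; rewrite /edge_tangent /dot /jacobian_det /=.
rewrite (derive_pairE (edge_dir i) (C2X.1 _ (chart_sub chG Tp)).1) (derive_pairE (edge_dir i) (C2Y.1 _ (chart_sub chG Tp)).1).
have : (@edge_dir R i).1 != 0 \/ (@edge_dir R i).2 != 0.
  by elim/ord3P: i; rewrite edge_dirE /= ?subr0 ?sub0r ?oppr_eq0 ?oner_eq0; [left|right|left].
move: ('D_e1 X p) ('D_e2 X p) ('D_e1 Y p) ('D_e2 Y p) (edge_dir i) => a b d e [d1 d2] /= h /eqP.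
rewrite -!expr2 paddr_eq0 ?sqr_ge0// !sqrf_eq0 => /andP[/eqP A0 /eqP B0].
have J1 : d1 * (a * e - b * d) = 0.
  by transitivity (e * (d1 * a + d2 * b) - b * (d1 * d + d2 * e)); [ring|rewrite A0 B0 !mulr0 subrr].
have J2 : d2 * (a * e - b * d) = 0.
  by transitivity (a * (d1 * d + d2 * e) - d * (d1 * a + d2 * b)); [ring|rewrite A0 B0 !mulr0 subrr].
move/eqP; apply; case: h => h; [apply: (mulfI h)|apply: (mulfI h)]; rewrite mulr0.
  by rewrite -[RHS]J1; ring.
by rewrite -[RHS]J2; ring.
Qed.

(** Along each edge of the standard triangle some coordinate moves at unit speed. *)
Lemma edge_point_lipschitz i (t t' : R) : t \in `[0, 1] -> t' \in `[0, 1] ->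
  `|t - t'| <= c * `|G (edge_point i t) - G (edge_point i t')|.
Proof.
move=> t01 t01'; apply: le_trans (chart_lower chG (edge_point_std i t01) (edge_point_std i t01')).
have : `|(edge_point i t - edge_point i t').1| <= `|edge_point i t - edge_point i t'| /\
   `|(edge_point i t - edge_point i t').2| <= `|edge_point i t - edge_point i t'|.
  by rewrite prod_normE !le_max !lexx orbT.
elim/ord3P: i; rewrite /edge_point edge_baseE edge_dirE => -[h1 h2].
- apply: le_trans h2; rewrite /= /GRing.scale /= !subr0 !mulr1 !add0r; exact: lexx.
- apply: le_trans h2; rewrite /= /GRing.scale /= !mulrN1 opprB addrCA addrAC subrr add0r distrC; exact: lexx.
- apply: le_trans h1; rewrite /= /GRing.scale /= !mulr1 !add0r; exact: lexx.
Qed.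

Variables (y : R -> plane) (sig : R -> R) (r : R) (i : 'I_3).
Hypothesis on : \forall u \near r, sig u \in `[0, 1] /\ y u = G (edge_point i (sig u)).
Hypothesis dy : derivable y r 1.

Lemma sig_continuous : {for r, continuous sig}.
Proof.
have cy : {for r, continuous y} by apply: differentiable_continuous; exact/derivable1_diffP.
have [r01 Er] := nbhs_singleton on.
apply/cvgrPdist_le => e e0.
have c1 : 0 < c + 1 by have := chart_cst_ge0 chG; lra.
have : \forall u \near r, `|y r - y u| <= e / (c + 1).
  by move/cvgrPdist_le: cy; apply; rewrite divr_gt0.
move=> H.
near=> u; have [u01 Eu] : sig u \in `[0, 1] /\ y u = G (edge_point i (sig u)) by near: u.
have hu : `|y r - y u| <= e / (c + 1) by near: u.
apply: le_trans (edge_point_lipschitz i r01 u01) _; rewrite -Er -Eu.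
apply: (@le_trans _ _ ((c + 1) * `|y r - y u|)); first by rewrite ler_wpM2r// lerDl.
by rewrite mulrC -ler_pdivlMr.
Unshelve. all: by end_near. Qed.

Local Notation D := (edge_tangent X Y i (edge_point i (sig r))).

(** The tangent of the edge has a nonzero component, and the backward chain rule is applied to that
    component. *)
Lemma sig_derive : exists2 lam : R, is_derive r 1 sig lam & derive1 y r = lam *: D.
Proof.
have [r01 Er] := nbhs_singleton on; have Tr := edge_point_std i r01.
have [dy1 dy2] := derive_components dy; have cs := sig_continuous.
have dX := edge_derive chG i C2X.1 r01; have dY := edge_derive chG i C2Y.1 r01.
have n1 : \forall u \near r, (fun t : R => X (edge_point i t)) (sig u) = (fun u => (y u).1) u.
  by apply: filterS on => u [_ ->].
have n2 : \forall u \near r, (fun t : R => Y (edge_point i t)) (sig u) = (fun u => (y u).2) u.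
  by apply: filterS on => u [_ ->].
have [lam dl] : exists lam : R, is_derive r 1 sig lam.
  have [D1|D1] := eqVneq ('D_(edge_dir i) X (edge_point i (sig r))) 0; last first.
    by exists ((derive1 y r).1 / 'D_(edge_dir i) X (edge_point i (sig r))); exact: is_derive_factor n1 cs dX D1 dy1.
  have D2 : 'D_(edge_dir i) Y (edge_point i (sig r)) != 0.
    apply/eqP => D2; have := edge_tangent_gt0 i Tr.
    by rewrite /edge_tangent /dot /= D1 D2 mulr0 addr0 ltxx.
  by exists ((derive1 y r).2 / 'D_(edge_dir i) Y (edge_point i (sig r))); exact: is_derive_factor n2 cs dY D2 dy2.
exists lam => //; apply: plane_eq.
  have d1 := near_eq_is_derive n1 (is_derive1_comp dX dl).
  by rewrite -(derive_val (is_derive := dy1)) (derive_val (is_derive := d1)) mulrC.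
have d2 := near_eq_is_derive n2 (is_derive1_comp dY dl).
by rewrite -(derive_val (is_derive := dy2)) (derive_val (is_derive := d2)) mulrC.
Qed.

End EdgeParameter.

(** * Edges lying on the boundary curve *)

Section BoundaryEdges.
Context {R : realType}.
Local Notation plane := (R * R)%type.
Local Notation T0 := (@std_triangle R).
Local Notation mu := (@lebesgue_measure R).
Implicit Types (p q n z e : plane) (i j : 'I_3).

Variables (a : 'I_3 -> plane) (T : finType) (F : T -> plane -> plane).
Implicit Types (K : T) (E : set plane).
Local Notation G K := (chart_map (elt_x a F K) (elt_y a F K)).
Local Notation elt := (elt a F).
Local Notation edge := (edge a F).
Local Notation vertex := (vertex a F).
Local Notation is_edge := (is_edge a F).
Local Notation is_vertex := (is_vertex a F).
Local Notation in_edge := (in_edge a F).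
Variables (Omega : set plane) (L : R) (x : R -> plane).
Hypotheses (hO : bounded_domain Omega) (hbd : C2_boundary Omega L x)
  (hT : exact_triangulation a F Omega).
Variables (U : T -> set plane) (s c : T -> R).
Hypothesis hC : forall K, C2chart (elt_x a F K) (elt_y a F K) (U K) (s K) (c K).
Let chG K := C2chart_chart (hC K).
Let C2X K := C2chart_x (hC K).
Let C2Y K := C2chart_y (hC K).
Let J0 K := C2chart_det (hC K).

Lemma curve_derivable r : derivable x r 1.
Proof. by have [h _] := Ck2_derive1 (curve_C2 hbd); exact: (Ck1_derive1 h I).1. Qed.

Lemma curve_continuous r : {for r, continuous x}.
Proof. by case: (curve_C2 hbd) => h _; exact: h. Qed.

Lemma normal_dot r : dot (normal x r) (normal x r) = 1.
Proof.
have := curve_arclength hbd r => E; have := congr1 (fun u => u ^+ 2) E.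
by rewrite sqr_enorm expr1n /normal /dot /= mulrNN addrC.
Qed.

Lemma boundary_curve r : boundary Omega (x r) /\ ~ Omega (x r).
Proof.
have out := curve_oriented hbd r.
have cv (k : R) : x r + e *: (k *: normal x r) @[e --> (0 : R)] --> x r.
  have E0 : x r = x r + (0 : R) *: (k *: normal x r) by rewrite scale0r addr0.
  rewrite [X in _ --> X]E0.
  by apply: cvgD; [exact: cvg_cst|apply: cvgZr_tmp; exact: cvg_id].
have nO : ~ Omega (x r).
  move=> Or; have nO : \forall y \near x r, Omega y by apply: open_nbhs_nbhs; split; [case: hO|].
  have ne : \forall e \near (0 : R)^'+, Omega (x r + e *: (1 *: normal x r)).
    exact: (cvg_at_right_filter (cv 1) nO).
  have [e [Oe [_ nKe]]] := filter_ex (filterI ne out).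
  by apply: nKe; apply: subset_closure; rewrite scale1r in Oe.
split => //; split; last by move=> /interior_subset.
rewrite (closure_id (closure Omega)).1; last exact: closed_closure.
move=> B Bx.
have ne : \forall e \near (0 : R)^'+, B (x r + e *: (-1 *: normal x r)).
  exact: (cvg_at_right_filter (cv (-1)) Bx).
have [e [Be [Ke _]]] := filter_ex (filterI ne out).
by exists (x r + e *: (-1 *: normal x r)); split => //; rewrite scaleN1r scalerN.
Qed.

Definition arc_coord K i (r : R) : R := get [set t : R | t \in `[0, 1] /\ x r = G K (edge_point i t)].

Lemma arc_coordP K i r : edge K i (x r) ->
  arc_coord K i r \in `[0, 1] /\ x r = G K (edge_point i (arc_coord K i r)).
Proof.
rewrite edgeE => -[t t01 E].
by have := getPex (P := [set t : R | t \in `[0, 1] /\ x r = G K (edge_point i t)]) (ex_intro _ t (conj t01 (esym E))).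
Qed.

Lemma arc_coord_unique K i r (t : R) : t \in `[0, 1] -> x r = G K (edge_point i t) -> arc_coord K i r = t.
Proof.
move=> t01 E; have Er : edge K i (x r) by rewrite edgeE; exists t.
have [a01 Ea] := arc_coordP Er; apply: (@edge_point_inj R i).
by apply: (chart_inj (chG K)); rewrite -?Ea ?E//; exact: edge_point_std.
Qed.

Lemma in_edgeP K i z : edge K i z -> z <> G K (edge_point i 0) -> z <> G K (edge_point i 1) -> in_edge K i z.
Proof.
rewrite edgeE => -[t t01 <-] n0 n1; exists t => //; move: t01; rewrite /= in_itv/= => /andP[t0 t1].
rewrite !lt_neqAle t0 t1 !andbT; apply/andP; split; last by apply/eqP => E; rewrite E in n1.
by rewrite eq_sym; apply/eqP => E; rewrite E in n0.
Qed.

Lemma in_edge_arc K i r : in_edge K i (x r) -> 0 < arc_coord K i r < 1.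
Proof.
move=> [t t01 E]; rewrite (arc_coord_unique _ E)//.
by move: t01 => /andP[? ?]; rewrite in_itv/= !ltW.
Qed.

(* the two parametrizations of the edge differ by a strictly monotone map of [0, 1] *)
Lemma in_edge_same K i K' i' z : edge K i = edge K' i' -> in_edge K i z -> in_edge K' i' z.
Proof.
move=> EE [t0 t001 ->].
pose P t (u : R) := u \in `[0, 1] /\ G K (edge_point i t) = G K' (edge_point i' u).
pose h (t : R) : R := get (P t).
have hP (t : R) : t \in `[0, 1] -> P t (h t).
  move=> t01; have : edge K i (G K (edge_point i t)) by rewrite edgeE; exists t.
  rewrite EE edgeE => -[u u01 E]; rewrite /h.
  by apply: (getPex (P := P t)); exists u.
have ch : {within `[0, 1], continuous h}.
  apply/subspace_continuousP => t /= t01; apply/cvgrPdist_le => e e0.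
  have c1 : 0 < c K' + 1 by have := chart_cst_ge0 (chG K'); lra.
  have cg : {for t, continuous (fun t : R => G K (edge_point i t))}.
    apply: continuous_comp; first exact: edge_point_continuous.
    by have cG := chart_continuous (chG K) (chart_sub (chG K) (edge_point_std i t01)).
  have N : \forall u \near t, `|G K (edge_point i t) - G K (edge_point i u)| <= e / (c K' + 1).
    by move/cvgrPdist_le: cg; apply; rewrite divr_gt0.
  rewrite /within /= nearE; apply: filterS N => u hu u01.
  have [ht Et] := hP t t01; have [hu' Eu] := hP u u01.
  apply: le_trans (edge_point_lipschitz (chG K') i' ht hu') _; rewrite -Et -Eu.
  apply: (@le_trans _ _ ((c K' + 1) * `|G K (edge_point i t) - G K (edge_point i u)|)).
    by rewrite ler_wpM2r// lerDl.
  by rewrite mulrC -ler_pdivlMr.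
have ih : {in `[0, 1] &, injective h}.
  move=> t u t01 u01 E; have [_ Et] := hP t t01; have [_ Eu] := hP u u01.
  apply: (@edge_point_inj R i); apply: (chart_inj (chG K)); [exact: edge_point_std|exact: edge_point_std|].
  by rewrite Et Eu E.
have z01 : (0 : R) \in `[0, 1] by rewrite in_itv/= lexx ler01.
have o01 : (1 : R) \in `[0, 1] by rewrite in_itv/= lexx ler01.
have t01 : t0 \in `[0, 1] by move: t001 => /andP[? ?]; rewrite in_itv/= !ltW.
have [ht Et] := hP t0 t01; have [h0 _] := hP 0 z01; have [h1 _] := hP 1 o01.
exists (h t0) => //; move: (t001) => /andP[t0p t0l].
move: h0 h1; rewrite !in_itv/= => /andP[a0 a1] /andP[b0 b1].
have [m|m] := itv_continuous_inj_mono ch ih.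
  have := m _ _ z01 t01 t0p; have := m _ _ t01 o01 t0l; lra.
have := m _ _ t01 z01 t0p; have := m _ _ o01 t01 t0l; lra.
Qed.

(** Elements and edges are closed and finite in number, so near [x r] only those through [x r]
    occur. A nearby boundary point is interior to no element, hence lies on an edge through [x r],
    and that edge can only be the given one. *)
Lemma boundary_edge_near K i r : in_edge K i (x r) -> \forall u \near r, in_edge K i (x u).
Proof.
move=> zi; set z := x r in zi.
have cl (A : set plane) : closed A -> \forall y \near z, A y -> A z.
  move=> cA; have [Az|nAz] := pselect (A z); first by near=> y.
  have : nbhs z (~` A) by apply: open_nbhs_nbhs; split => //; apply: closed_openC.
  by apply: filterS => y nAy /nAy.
have N1 : \forall y \near z, forall K2, elt K2 y -> elt K2 z.
  by apply: (filter_forall (nbhs_filter z)) => K2; apply: cl; exact: (elt_closed hC).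
have N2 : \forall y \near z, forall K2 j, edge K2 j y -> edge K2 j z.
  apply: (filter_forall (nbhs_filter z)) => K2; apply: (filter_forall (nbhs_filter z)) => j.
  by apply: cl; apply: compact_closed; [exact: plane_hausdorff|exact: (edge_compact hC)].
have nv (t : R) : t = 0 \/ t = 1 -> z <> G K (edge_point i t).
  move=> h E; apply: (in_edge_not_vertex hC zi); rewrite E.
  case: h => ->; [have [j ->] := @edge_point0 R i|have [j ->] := @edge_point1 R i]; by exists j; rewrite vertexE.
have N3 t : t = 0 \/ t = 1 -> \forall y \near z, y <> G K (edge_point i t).
  move=> /nv h; have cs : closed [set G K (edge_point i t)].
    by apply: compact_closed; [exact: plane_hausdorff|exact: compact_set1].
  by apply: filterS (cl _ cs) => y hy E; exact/h/hy.
have N : \forall y \near z, [/\ (forall K2, elt K2 y -> elt K2 z), (forall K2 j, edge K2 j y -> edge K2 j z),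
    y <> G K (edge_point i 0) & y <> G K (edge_point i 1)].
  near=> y; split; near: y => //; apply: N3; [by left|by right].
have N' : \forall u \near r, [/\ (forall K2, elt K2 (x u) -> elt K2 z), (forall K2 j, edge K2 j (x u) -> edge K2 j z),
    x u <> G K (edge_point i 0) & x u <> G K (edge_point i 1)] by exact: (@curve_continuous r _ N).
apply: filterS N' => u [M1 M2 M3 M4].
apply: in_edgeP M3 M4; have [[clu _] nOu] := boundary_curve u.
move: clu; rewrite -(mesh_cover hT) => -[K2 _ K2u].
have [/(elt_interior_Omega hbd hT) //|/elt_edgesP[j Ej]] := elt_edges_or hC K2u.
have [K2K|K2K] := eqVneq K2 K.
  by rewrite -(in_edge_unique hC zi (j := j)) -K2K//; exact: M2.
have [i2 E2] := in_edge_shared hT hC zi K2K (M1 _ K2u).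
by rewrite E2 -(in_edge_unique hC (in_edge_same E2 zi) (M2 _ _ Ej)).
Unshelve. all: by end_near. Qed.

Local Notation tang K i r := (edge_tangent (elt_x a F K) (elt_y a F K) i (edge_point i (arc_coord K i r))).

(** Positivity of [s K * lam] says that arc length runs counterclockwise around [K]; otherwise the
    domain's outward normal would point into [K]. *)
Lemma arc_coord_derive K i r : in_edge K i (x r) -> exists lam : R,
  [/\ is_derive r 1 (arc_coord K i) lam, derive1 x r = lam *: tang K i r & 0 < s K * lam].
Proof.
move=> zi.
have on : \forall u \near r, arc_coord K i u \in `[0, 1] /\ x u = G K (edge_point i (arc_coord K i u)).
  by apply: filterS (boundary_edge_near zi) => u /in_edge_edge/arc_coordP.
have [lam dl E] := sig_derive (chG K) (C2X K) (C2Y K) on (@curve_derivable r).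
exists lam; split => //.
have [r01 Er] := nbhs_singleton on; have D0 := edge_tangent_gt0 (chG K) (C2X K) (C2Y K) i (edge_point_std i r01).
have n1 := normal_dot r.
have l0 : lam != 0.
  by apply/eqP => l0; move: n1; rewrite /normal E l0 scale0r /dot /= oppr0 mulr0 addr0 => /eqP; rewrite eq_sym oner_eq0.
rewrite lt_neqAle eq_sym mulf_neq0//=; last by case: (chart_sign (chG K)) => ->; rewrite ?oppr_eq0 oner_eq0.
rewrite leNgt; apply/negP => neg.
have inw : \forall e \near (0 : R)^'+, (elt K)° (G K (edge_point i (arc_coord K i r)) + e *: normal x r).
  rewrite eltE; apply: (edge_inward (chG K) (C2X K) (C2Y K) (in_edge_arc zi)).
  rewrite /normal E; move: (tang K i r) D0 => D D0; rewrite /= /GRing.scale /=.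
  have -> : s K * (D.1 * - (lam * D.1) - D.2 * (lam * D.2)) = - (s K * lam) * dot D D by rewrite /dot; ring.
  by rewrite mulr_gt0// oppr_gt0.
rewrite -Er in inw; have [e [Ke [_ nKe]]] := filter_ex (filterI inw (curve_oriented hbd r)).
by apply: nKe; exact: (elt_sub_closure hT (interior_subset Ke)).
Qed.

Lemma boundary_inward K i r : in_edge K i (x r) ->
  \forall e \near (0 : R)^'+, (elt K)° (x r + e *: - normal x r).
Proof.
move=> zi; have [lam [_ E sl]] := arc_coord_derive zi.
have [r01 Er] := arc_coordP (in_edge_edge zi).
have D0 := edge_tangent_gt0 (chG K) (C2X K) (C2Y K) i (edge_point_std i r01).
suff : \forall e \near (0 : R)^'+, (elt K)° (G K (edge_point i (arc_coord K i r)) + e *: - normal x r) by rewrite -Er.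
rewrite eltE; apply: (edge_inward (chG K) (C2X K) (C2Y K) (in_edge_arc zi)).
rewrite /normal E; move: (tang K i r) D0 => D D0; rewrite /= /GRing.scale /=.
have -> : s K * (D.1 * - - (lam * D.1) - D.2 * - (lam * D.2)) = s K * lam * dot D D by rewrite /dot; ring.
exact: mulr_gt0.
Qed.

(** The inward normal ray at a relative interior point would enter the interiors of both
    elements. *)
Lemma boundary_edge_unique K i K' i' : edge K i `<=` boundary Omega ->
  edge K i = edge K' i' -> K = K' /\ i = i'.
Proof.
move=> EO EE; have [z zi] := edge_midpoint a F K i.
have [r _ xr] : (x @` `[0, L]) z by rewrite (curve_onto hbd); exact/EO/in_edge_edge.
rewrite -xr in zi; have zi' := in_edge_same EE zi.
have KK : K = K'.
  apply/eqP/negPn/negP => KK.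
  exact: (interior_disjoint_ray hT KK (boundary_inward zi) (boundary_inward zi')).
split => //; apply: (in_edge_unique hC zi'); rewrite -KK; exact: in_edge_edge.
Qed.

Lemma boundary_edge_elements K i r K2 : edge K i `<=` boundary Omega -> in_edge K i (x r) ->
  elt K2 (x r) -> K2 = K.
Proof.
move=> EO zi K2r; apply/eqP/negPn/negP => KK.
have [i2 E2] := in_edge_shared hT hC zi KK K2r.
by have [E _] := boundary_edge_unique EO E2; rewrite E eqxx in KK.
Qed.

End BoundaryEdges.

Lemma within_continuous_comp {R : realType} (u1 u2 : R) (h f : R -> R) :
  {within `[u1, u2], continuous f} -> (forall r : R, r \in `[u1, u2] -> {for f r, continuous h}) ->
  {within `[u1, u2], continuous (fun r => h (f r))}.
Proof.
move=> /subspace_continuousP cf ch; apply/subspace_continuousP => r rab.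
exact: (continuous_cvg _ (ch r rab) (cf r rab)).
Qed.

(** First coordinate of the derivative of [ell], with [C], [S] the cosine and sine of the angle, [y]
    the unit tangent and [z] its derivative, which is orthogonal to [y]; [rotation_rate2] is the
    second coordinate. *)
Lemma rotation_rate1 {R : realType} (C S th y1 y2 z1 z2 : R) :
  y1 * z1 + y2 * z2 = 0 -> y1 * y1 + y2 * y2 = 1 ->
  C * z2 + y2 * (- S * th) + (S * z1 + y1 * (C * th)) = (th - (z1 * y2 - z2 * y1)) * - (S * y2 + C * - y1).
Proof.
move=> ac ar; apply/eqP; rewrite -subr_eq0; apply/eqP.
transitivity ((C * z2 + S * z1) * (1 - (y1 * y1 + y2 * y2)) + (S * y1 + C * y2) * (y1 * z1 + y2 * z2)); first by ring.
by rewrite ac ar subrr !mulr0 addr0.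
Qed.

Lemma rotation_rate2 {R : realType} (C S th y1 y2 z1 z2 : R) :
  y1 * z1 + y2 * z2 = 0 -> y1 * y1 + y2 * y2 = 1 ->
  S * z2 + y2 * (C * th) - (C * z1 + y1 * (- S * th)) = (th - (z1 * y2 - z2 * y1)) * (C * y2 - S * - y1).
Proof.
move=> ac ar; apply/eqP; rewrite -subr_eq0; apply/eqP.
transitivity ((S * z2 - C * z1) * (1 - (y1 * y1 + y2 * y2)) + (S * y2 - C * y1) * (y1 * z1 + y2 * z2)); first by ring.
by rewrite ac ar subrr !mulr0 addr0.
Qed.

(** Pointwise form of the boundary computation: here [(e1, e2)] is [ell], [k] its rate of turning,
    [g] the gradient and [h] the derivative of [g] along the curve. The last bracket is the
    derivative of the product of the two oblique derivatives. *)
Lemma boundary_identity {R : realType} (e1 e2 k g1 g2 h1 h2 : R) : e1 * e1 + e2 * e2 = 1 ->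
  (g1 ^+ 2 + g2 ^+ 2) * k - 2 * (- e2 * g1 + e1 * g2) * (k * - e2 * g1 + k * e1 * g2 + (e1 * h1 + e2 * h2)) =
  (g1 * h2 - g2 * h1) -
  ((k * - e2 * g1 + k * e1 * g2 + (e1 * h1 + e2 * h2)) * (- e2 * g1 + e1 * g2) +
   (e1 * g1 + e2 * g2) * (- (k * e1) * g1 + k * - e2 * g2 + (- e2 * h1 + e1 * h2))).
Proof.
move=> E; apply/eqP; rewrite -subr_eq0; apply/eqP.
transitivity ((1 - (e1 * e1 + e2 * e2)) * (k * (g1 ^+ 2 + g2 ^+ 2) - (g1 * h2 - g2 * h1))); first by ring.
by rewrite E subrr mul0r.
Qed.

(** * The boundary integrand along one edge *)

Section BoundaryArcs.
Context {R : realType}.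
Local Notation plane := (R * R)%type.
Local Notation T0 := (@std_triangle R).
Local Notation mu := (@lebesgue_measure R).
Implicit Types (p q n z e : plane) (i j : 'I_3).

Variables (a : 'I_3 -> plane) (T : finType) (F : T -> plane -> plane).
Implicit Types (K : T) (E : set plane).
Local Notation G K := (chart_map (elt_x a F K) (elt_y a F K)).
Local Notation elt := (elt a F).
Local Notation edge := (edge a F).
Local Notation vertex := (vertex a F).
Local Notation is_edge := (is_edge a F).
Local Notation is_vertex := (is_vertex a F).
Local Notation in_edge := (in_edge a F).
Variables (Omega : set plane) (L : R) (x : R -> plane).
Hypotheses (hO : bounded_domain Omega) (hbd : C2_boundary Omega L x)
  (hT : exact_triangulation a F Omega).
Variables (U : T -> set plane) (s c : T -> R).
Hypothesis hC : forall K, C2chart (elt_x a F K) (elt_y a F K) (U K) (s K) (c K).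
Let chG K := C2chart_chart (hC K).
Let C2X K := C2chart_x (hC K).
Let C2Y K := C2chart_y (hC K).
Let J0 K := C2chart_det (hC K).

Variables (v : plane -> R) (w : T -> plane -> R).
Hypotheses (C2w : forall K, C2 (U K) (w K))
  (vw : forall K q, std_interior q -> v (G K q) = w K q).
Hypothesis hvert : forall K z, is_vertex K z -> C1_at a F v z.
Variables (ell : R -> plane) (theta : R -> R).
Hypothesis hell : oblique_field L x ell theta.

Local Notation ga K := (grad_along (elt_x a F K) (elt_y a F K) (w K)).
Local Notation Dx K := (grad1 (elt_x a F K) (elt_y a F K) (w K)).
Local Notation Dy K := (grad2 (elt_x a F K) (elt_y a F K) (w K)).
Local Notation curl K := (curl_term (elt_x a F K) (elt_y a F K) (s K) (w K)).

Let hx1 : Ck 1 setT x := (Ck2_derive1 (curve_C2 hbd)).1.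
Let hx2 : Ck 1 setT (derive1 x) := (Ck2_derive1 (curve_C2 hbd)).2.
Let x2d r := derive_components (Ck1_derive1 hx2 (r := r) I).1.

Lemma curve_accel r : (derive1 x r).1 * (derive1 (derive1 x) r).1 + (derive1 x r).2 * (derive1 (derive1 x) r).2 = 0.
Proof.
have [d1 d2] := x2d r.
have D := is_deriveD (is_deriveM d1 d1) (is_deriveM d2 d2).
have E : (fun u => (derive1 x u).1) * (fun u => (derive1 x u).1) + (fun u => (derive1 x u).2) * (fun u => (derive1 x u).2) = (fun=> 1 : R).
  apply/funext => u; have := congr1 (fun y => y ^+ 2) (curve_arclength hbd u).
  by rewrite sqr_enorm expr1n.
rewrite E in D.
have := derive_val (is_derive := D); rewrite derive_cst /GRing.scale /=.
by move: (derive1 (derive1 x) r) (derive1 x r) => [p1 p2] [q1 q2] /= h; lra.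
Qed.

(** The normal turns at rate [- chi] and [theta] adds its own rate. The open interval is needed
    because [theta] represents [ell] only on [[0, L]]. *)
Lemma field_derive r : r \in `]0, L[ -> derive1 ell r = (derive1 theta r - chi x r) *: perp (ell r).
Proof.
move=> rL; have rL' := subset_itv_oo_cc rL.
have [V [oV LV CV]] := angle_C1 hell.
have [dth _] := Ck1_derive1 CV (LV r rL').
have dtheta : is_derive r 1 theta (derive1 theta r) by rewrite derive1E; apply: DeriveDef.
have [de1 de2] := derive_components (Ck1_derive1 (field_C1 hell) (r := r) I).1.
have [d1 d2] := x2d r.
have dc := is_derive1_comp (is_derive_cos (theta r)) dtheta.
have ds := is_derive1_comp (is_derive_sin (theta r)) dtheta.
have N : \forall u \near r, ell u = rotation (theta u) (normal x u).
  have := near_in_itvoo rL; apply: filterS => u uL; apply: (angle_spec hell); exact: subset_itv_oo_cc.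
have D1 := is_deriveD (is_deriveM dc d2) (is_deriveM ds d1).
have D2 := is_deriveB (is_deriveM ds d2) (is_deriveM dc d1).
have n1 : \forall u \near r, ((cos \o theta) * (fun u => (derive1 x u).2) + (sin \o theta) * (fun u => (derive1 x u).1)) u = (fun u => (ell u).1) u.
  apply: filterS N => u ->; rewrite /rotation /normal /= -[LHS]/(_ * _ + _ * _) /=; ring.
have n2 : \forall u \near r, ((sin \o theta) * (fun u => (derive1 x u).2) - (cos \o theta) * (fun u => (derive1 x u).1)) u = (fun u => (ell u).2) u.
  apply: filterS N => u ->; rewrite /rotation /normal /= -[LHS]/(_ * _ - _ * _) /=; ring.
have D1' := near_eq_is_derive n1 D1; have D2' := near_eq_is_derive n2 D2.
have := derive_val (is_derive := D1'); rewrite (derive_val (is_derive := de1)) => F1.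
have := derive_val (is_derive := D2'); rewrite (derive_val (is_derive := de2)) => F2.
have ac := curve_accel r.
have ar : (derive1 x r).1 * (derive1 x r).1 + (derive1 x r).2 * (derive1 x r).2 = 1.
  have := congr1 (fun y => y ^+ 2) (curve_arclength hbd r); by rewrite sqr_enorm expr1n.
have er : ell r = rotation (theta r) (normal x r) by exact: nbhs_singleton N.
rewrite er; apply: plane_eq; [rewrite F1|rewrite F2].
  exact: (rotation_rate1 (cos (theta r)) (sin (theta r)) (derive1 theta r) ac ar).
exact: (rotation_rate2 (cos (theta r)) (sin (theta r)) (derive1 theta r) ac ar).
Qed.

Section OneEdge.
Variables (K : T) (i : 'I_3).
Hypothesis EO : edge K i `<=` boundary Omega.
Local Notation sg := (arc_coord a F x K i).
Local Notation pt r := (edge_point i (sg r)).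
Local Notation tang r := (edge_tangent (elt_x a F K) (elt_y a F K) i (pt r)).

Let C1g1 := grad1_C1 (chG K) (C2X K) (C2Y K) (J0 (K := K)) (C2w K).
Let C1g2 := grad2_C1 (chG K) (C2X K) (C2Y K) (J0 (K := K)) (C2w K).

(** In the relative interior of the edge only [K] contains the point; at an end point all elements
    around the vertex have the same gradient by the vertex condition. *)
Lemma boundary_trace e r : edge K i (x r) ->
  trace (skeleton_compl a F) ('D_e v) (x r) = ga K e (pt r).
Proof.
move=> Er; have [r01 xE] := arc_coordP Er; have Tr := edge_point_std i r01.
have Kr : elt K (x r) by exact: edge_sub_elt Er.
apply: (trace_skeleton hC (g := 'D_e v) _ _).2; first by exists K.
move=> K2 K2r.
have [z|nz] := pselect (is_vertex K (x r)).
  have [p Tp Ep] : [set G K2 p | p in T0] (x r) by rewrite -eltE.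
  have E : G K (pt r) = G K2 p by rewrite -xE.
  have vx : is_vertex K (G K (pt r)) by rewrite -xE.
  rewrite (vertex_grad hC C2w vw hvert Tr Tp E vx e) -Ep.
  exact: (elt_cvg_derive hC C2w vw).
have zi : in_edge K i (x r).
  apply: in_edgeP Er _ _ => E; apply: nz; rewrite E.
    by have [j ->] := @edge_point0 R i; exists j; rewrite vertexE.
  by have [j ->] := @edge_point1 R i; exists j; rewrite vertexE.
rewrite (boundary_edge_elements hO hbd hT hC EO zi K2r) xE.
exact: (elt_cvg_derive hC C2w vw).
Qed.

Lemma d_along_edge (e : R -> plane) r : edge K i (x r) ->
  d_along a F v x e r = (e r).1 * Dx K (pt r) + (e r).2 * Dy K (pt r).
Proof. by move=> Er; rewrite /d_along boundary_trace. Qed.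

(** The derivative of [arc_coord], solved from its proportionality to the tangent. As a quotient it
    is continuous up to the end points of the edge, where differentiability of [arc_coord] is not
    established. *)
Definition arc_speed (r : R) : R := dot (derive1 x r) (tang r) / dot (tang r) (tang r).

Definition curl_density (t : R) : R :=
  Dx K (edge_point i t) * 'D_(edge_dir i) (Dy K) (edge_point i t) -
  Dy K (edge_point i t) * 'D_(edge_dir i) (Dx K) (edge_point i t).

(** The function whose derivative is the exact part of the boundary form. *)
Definition arc_product (r : R) : R :=
  d_along a F v x ell r * d_along a F v x (fun r => perp (ell r)) r.

Lemma arc_speed_derive r : in_edge K i (x r) ->
  is_derive r 1 sg (arc_speed r) /\ 0 < s K * arc_speed r.
Proof.
move=> zi; have [lam [dl E sl]] := arc_coord_derive hO hbd hT hC zi.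
have [r01 _] := arc_coordP (in_edge_edge zi).
have D0 := edge_tangent_gt0 (chG K) (C2X K) (C2Y K) i (edge_point_std i r01).
suff -> : arc_speed r = lam by [].
by rewrite /arc_speed E dotZl mulfK// gt_eqF.
Qed.

Lemma arc_grad_derive g r : C1 (U K) g -> in_edge K i (x r) ->
  is_derive r 1 (fun r => g (pt r)) ('D_(edge_dir i) g (pt r) * arc_speed r).
Proof.
move=> Cg zi; have [r01 _] := arc_coordP (in_edge_edge zi).
exact: (is_derive1_comp (edge_derive (chG K) i Cg r01) (arc_speed_derive zi).1).
Qed.

Lemma curl_density_continuous (t : R) : t \in `[0, 1] -> {for t, continuous curl_density}.
Proof.
move=> t01.
have ce (g : plane -> R) : (forall p, U K p -> {for p, continuous g}) -> {for t, continuous (fun t : R => g (edge_point i t))}.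
  by move=> cg; exact: (edge_continuous (chG K) cg t01).
apply: cvgB; apply: cvgM.
- exact: (ce (Dx K) (fun p Up => C1_continuous C1g1 Up)).
- exact: (ce ('D_(edge_dir i) (Dy K)) (fun p Up => (C1g2 Up).2 _)).
- exact: (ce (Dy K) (fun p Up => C1_continuous C1g2 Up)).
- exact: (ce ('D_(edge_dir i) (Dx K)) (fun p Up => (C1g1 Up).2 _)).
Qed.

Lemma curl_primitive : exists2 W : R -> R, (forall t : R, t \in `[0, 1] -> is_derive t 1 W (curl_density t)) &
  curl K i = s K * (W 1 - W 0).
Proof.
have [W dW] := primitive_segment ler01 curl_density_continuous.
exists W => //; rewrite -(FTC2_segment ler01 dW curl_density_continuous) /curl_term.
have sgm : in_seg (U K) (edge_base i) (edge_dir i) by move=> t t01; apply: (chart_sub (chG K)); exact: in_seg_edge.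
have c1 := line_integrand_continuous C1g1 C1g2 sgm.
have c2 := line_integrand_continuous C1g2 C1g1 sgm.
congr (_ * _); rewrite /edge_circulation -[LHS]mul1r -(Rintegral_scaleB 1 c1 c2).
by apply: eq_Rintegral_itv => t _; rewrite mul1r.
Qed.

Section Arc.
Variables (p q : R).
Hypotheses (pq : p <= q) (arc : forall r, r \in `[p, q] -> edge K i (x r))
  (arco : forall r, r \in `]p, q[ -> in_edge K i (x r)).

Lemma arc_coord_within : {within `[p, q], continuous sg}.
Proof.
apply/subspace_continuousP => r /= rpq; apply/cvgrPdist_le => e e0.
have c1 : 0 < c K + 1 by have := chart_cst_ge0 (chG K); lra.
have N : \forall u \near r, `|x r - x u| <= e / (c K + 1).
  by have := curve_continuous hbd (r := r); move/cvgrPdist_le; apply; rewrite divr_gt0.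
rewrite /within /= nearE; apply: filterS N => u hu upq.
have [hr Er] := arc_coordP (arc rpq); have [hu' Eu] := arc_coordP (arc upq).
apply: le_trans (edge_point_lipschitz (chG K) i hr hu') _; rewrite -Er -Eu.
apply: (@le_trans _ _ ((c K + 1) * `|x r - x u|)); first by rewrite ler_wpM2r// lerDl.
by rewrite mulrC -ler_pdivlMr.
Qed.

Lemma arc_within (g : plane -> R) : (forall y, U K y -> {for y, continuous g}) ->
  {within `[p, q], continuous (fun r => g (pt r))}.
Proof.
move=> cg; apply: (within_continuous_comp (h := fun t : R => g (edge_point i t)) arc_coord_within).
by move=> r rpq; apply: (edge_continuous (chG K)) => //; exact: (arc_coordP (arc rpq)).1.
Qed.

Lemma curve_within (g : R -> R) : (forall r, {for r, continuous g}) -> {within `[p, q], continuous g}.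
Proof. by move=> cg; exact: continuous_subspaceT. Qed.

Lemma component_continuous (y : R -> plane) : (forall r, {for r, continuous y}) ->
  (forall r, {for r, continuous (fun r => (y r).1)}) /\ (forall r, {for r, continuous (fun r => (y r).2)}).
Proof.
move=> cy; split => r; (apply: continuous_comp; first exact: cy); [exact: cvg_fst|exact: cvg_snd].
Qed.

Lemma arc_speed_within : {within `[p, q], continuous arc_speed}.
Proof.
have cX : {within `[p, q], continuous (fun r => (tang r).1)} by apply: (arc_within (g := 'D_(edge_dir i) (elt_x a F K))) => y Uy; exact: ((C2X K).1 _ Uy).2.
have cY : {within `[p, q], continuous (fun r => (tang r).2)} by apply: (arc_within (g := 'D_(edge_dir i) (elt_y a F K))) => y Uy; exact: ((C2Y K).1 _ Uy).2.
have [c1 c2] := component_continuous (fun r => (Ck1_derive1 hx1 (r := r) I).2).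
have k1 := curve_within c1; have k2 := curve_within c2.
apply/subspace_continuousP => r rpq.
have D0 := edge_tangent_gt0 (chG K) (C2X K) (C2Y K) i (edge_point_std i (arc_coordP (arc rpq)).1).
move/subspace_continuousP/(_ r rpq): cX => cX; move/subspace_continuousP/(_ r rpq): cY => cY.
move/subspace_continuousP/(_ r rpq): k1 => k1; move/subspace_continuousP/(_ r rpq): k2 => k2.
apply: cvgM; first by apply: cvgD; apply: cvgM; [exact: k1|exact: cX|exact: k2|exact: cY].
apply: cvgV; first by rewrite gt_eqF.
by apply: cvgD; apply: cvgM; [exact: cX|exact: cX|exact: cY|exact: cY].
Qed.

Definition arc_rate (r : R) : R := curl_density (sg r) * arc_speed r.

Lemma arc_rate_within : {within `[p, q], continuous arc_rate}.
Proof.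
have cd : {within `[p, q], continuous (fun r => curl_density (sg r))}.
  apply: (within_continuous_comp arc_coord_within) => r rpq; apply: curl_density_continuous.
  exact: (arc_coordP (arc rpq)).1.
by move=> r; apply: cvgM; [exact: cd|exact: arc_speed_within].
Qed.

Lemma arc_rate_integral (W : R -> R) : (forall t : R, t \in `[0, 1] -> is_derive t 1 W (curl_density t)) ->
  \int[mu]_(r in `[p, q]) arc_rate r = W (sg q) - W (sg p).
Proof.
move=> dW; have cW : {within `[p, q], continuous (fun r => W (sg r))}.
  apply: (within_continuous_comp arc_coord_within) => r rpq.
  have [d _] := dW _ (arc_coordP (arc rpq)).1.
  by apply: differentiable_continuous; exact/derivable1_diffP.
have dWs r : r \in `]p, q[ -> is_derive r 1 (fun r => W (sg r)) (arc_rate r).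
  move=> rpq; have [a01 _] := arc_coordP (arc (subset_itv_oo_cc rpq)).
  exact: (is_derive1_comp (dW _ a01) (arc_speed_derive (arco rpq)).1).
exact: (FTC2_oo (f := arc_rate) pq cW arc_rate_within dWs (fun _ _ => erefl)).
Qed.

Lemma arc_monotone : p < q -> 0 < s K * (sg q - sg p).
Proof.
move=> plq; have d1 r : r \in `]p, q[ -> is_derive r 1 sg (arc_speed r).
  by move=> rpq; exact: (arc_speed_derive (arco rpq)).1.
have [r rpq ->] := MVT plq d1 arc_coord_within.
by rewrite mulrA mulr_gt0 ?subr_gt0//; exact: (arc_speed_derive (arco rpq)).2.
Qed.

Let e1' r := (derive1 ell r).1.
Let e2' r := (derive1 ell r).2.
Let G1 r := Dx K (pt r).
Let G2 r := Dy K (pt r).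
Let H1' r := 'D_(edge_dir i) (Dx K) (pt r) * arc_speed r.
Let H2' r := 'D_(edge_dir i) (Dy K) (pt r) * arc_speed r.

(** The product rule written out with the traces from [K]: it is the derivative of [arc_product] on
    the open arc and continuous on the closed one, as the fundamental theorem requires. *)
Definition arc_product_rate (r : R) : R :=
  (e1' r * G1 r + e2' r * G2 r + ((ell r).1 * H1' r + (ell r).2 * H2' r)) * (- (ell r).2 * G1 r + (ell r).1 * G2 r) +
  ((ell r).1 * G1 r + (ell r).2 * G2 r) * (- e2' r * G1 r + e1' r * G2 r + (- (ell r).2 * H1' r + (ell r).1 * H2' r)).

Lemma arc_product_rate_within : {within `[p, q], continuous arc_product_rate}.
Proof.
have [c1 c2] := component_continuous (fun r => (Ck1_derive1 (field_C1 hell) (r := r) I).2).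
have ce r : {for r, continuous ell}.
  by have [d _] := Ck1_derive1 (field_C1 hell) (r := r) I; apply: differentiable_continuous; exact/derivable1_diffP.
have [c3 c4] := component_continuous ce.
have k1 := curve_within c1; have k2 := curve_within c2; have k3 := curve_within c3; have k4 := curve_within c4.
have k5 : {within `[p, q], continuous G1} by apply: arc_within => y Uy; exact: C1_continuous C1g1 Uy.
have k6 : {within `[p, q], continuous G2} by apply: arc_within => y Uy; exact: C1_continuous C1g2 Uy.
have k7 : {within `[p, q], continuous H1'}.
  move=> r; apply: cvgM; last exact: arc_speed_within.
  by apply: (arc_within (g := 'D_(edge_dir i) (Dx K))) => y Uy; exact: (C1g1 Uy).2.
have k8 : {within `[p, q], continuous H2'}.
  move=> r; apply: cvgM; last exact: arc_speed_within.
  by apply: (arc_within (g := 'D_(edge_dir i) (Dy K))) => y Uy; exact: (C1g2 Uy).2.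
have M (f g : R -> R) : {within `[p, q], continuous f} -> {within `[p, q], continuous g} -> {within `[p, q], continuous (fun r => f r * g r)}.
  by move=> cf cg r; apply: cvgM; [exact: cf|exact: cg].
have A (f g : R -> R) : {within `[p, q], continuous f} -> {within `[p, q], continuous g} -> {within `[p, q], continuous (fun r => f r + g r)}.
  by move=> cf cg r; apply: cvgD; [exact: cf|exact: cg].
have N (f : R -> R) : {within `[p, q], continuous f} -> {within `[p, q], continuous (fun r => - f r)}.
  by move=> cf r; apply: cvgN; exact: cf.
have n2 := N _ k2; have n4 := N _ k4.
exact: (A _ _ (M _ _ (A _ _ (A _ _ (M _ _ k1 k5) (M _ _ k2 k6)) (A _ _ (M _ _ k3 k7) (M _ _ k4 k8))) (A _ _ (M _ _ n4 k5) (M _ _ k3 k6)))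
  (M _ _ (A _ _ (M _ _ k3 k5) (M _ _ k4 k6)) (A _ _ (A _ _ (M _ _ n2 k5) (M _ _ k1 k6)) (A _ _ (M _ _ n4 k7) (M _ _ k3 k8))))).
Qed.

Lemma field_along_derive r : r \in `]p, q[ ->
  is_derive r 1 (d_along a F v x ell) (e1' r * G1 r + e2' r * G2 r + ((ell r).1 * H1' r + (ell r).2 * H2' r)) /\
  is_derive r 1 (d_along a F v x (fun r => perp (ell r)))
    (- e2' r * G1 r + e1' r * G2 r + (- (ell r).2 * H1' r + (ell r).1 * H2' r)).
Proof.
move=> rpq; have zi := arco rpq.
have N : \forall u \near r, edge K i (x u).
  by apply: filterS (boundary_edge_near hO hbd hT hC zi) => u; exact: in_edge_edge.
have d5 : is_derive r 1 G1 (H1' r) := arc_grad_derive C1g1 zi.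
have d6 : is_derive r 1 G2 (H2' r) := arc_grad_derive C1g2 zi.
have [d1 d2] := derive_components (Ck1_derive1 (field_C1 hell) (r := r) I).1.
split.
  have n : \forall u \near r, ((fun u => (ell u).1) * G1 + (fun u => (ell u).2) * G2) u = d_along a F v x ell u.
    by apply: filterS N => u Eu; rewrite d_along_edge.
  have := near_eq_is_derive n (is_deriveD (is_deriveM d1 d5) (is_deriveM d2 d6)).
  suff -> : e1' r * G1 r + e2' r * G2 r + ((ell r).1 * H1' r + (ell r).2 * H2' r) =
    (ell r).1 *: H1' r + G1 r *: (derive1 ell r).1 + ((ell r).2 *: H2' r + G2 r *: (derive1 ell r).2) by [].
  rewrite /GRing.scale /= /e1' /e2'; move: (G1 r) (G2 r) (H1' r) (H2' r) (ell r) (derive1 ell r) => *; ring.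
have n : \forall u \near r, ((fun u => (ell u).1) * G2 - (fun u => (ell u).2) * G1) u = d_along a F v x (fun r => perp (ell r)) u.
  by apply: filterS N => u Eu; rewrite d_along_edge// /perp /= mulNr addrC.
have := near_eq_is_derive n (is_deriveB (is_deriveM d1 d6) (is_deriveM d2 d5)).
suff -> : - e2' r * G1 r + e1' r * G2 r + (- (ell r).2 * H1' r + (ell r).1 * H2' r) =
  (ell r).1 *: H2' r + G2 r *: (derive1 ell r).1 - ((ell r).2 *: H1' r + G1 r *: (derive1 ell r).2) by [].
rewrite /GRing.scale /= /e1' /e2'; move: (G1 r) (G2 r) (H1' r) (H2' r) (ell r) (derive1 ell r) => *; ring.
Qed.

Lemma arc_product_derive r : r \in `]p, q[ -> is_derive r 1 arc_product (arc_product_rate r).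
Proof.
move=> rpq; have [d1 d2] := field_along_derive rpq; have zE := arc (subset_itv_oo_cc rpq).
have := is_deriveM d1 d2.
rewrite /GRing.scale /= !d_along_edge//.
suff -> : arc_product_rate r = ((ell r).1 * G1 r + (ell r).2 * G2 r) * (- e2' r * G1 r + e1' r * G2 r + (- (ell r).2 * H1' r + (ell r).1 * H2' r)) +
 (- (ell r).2 * G1 r + (ell r).1 * G2 r) * (e1' r * G1 r + e2' r * G2 r + ((ell r).1 * H1' r + (ell r).2 * H2' r)) by [].
by rewrite /arc_product_rate addrC; congr (_ + _); rewrite mulrC.
Qed.

Lemma arc_product_integral : \int[mu]_(r in `[p, q]) derive1 arc_product r = arc_product q - arc_product p.
Proof.
have cP : {within `[p, q], continuous arc_product}.
  have Er : {in `[p, q]%classic, (fun u => ((ell u).1 * G1 u + (ell u).2 * G2 u) * ((- (ell u).2) * G1 u + (ell u).1 * G2 u)) =1 arc_product}.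
    by move=> u; rewrite inE => upq; rewrite /arc_product !d_along_edge//; exact: arc.
  apply: (subspace_eq_continuous Er).
  have k5 : {within `[p, q], continuous G1} by apply: arc_within => y Uy; exact: C1_continuous C1g1 Uy.
  have k6 : {within `[p, q], continuous G2} by apply: arc_within => y Uy; exact: C1_continuous C1g2 Uy.
  have ce r : {for r, continuous ell}.
    by have [d _] := Ck1_derive1 (field_C1 hell) (r := r) I; apply: differentiable_continuous; exact/derivable1_diffP.
  have [c3 c4] := component_continuous ce.
  have k3 := curve_within c3; have k4 := curve_within c4.
  apply/subspace_continuousP => r rpq.
  move/subspace_continuousP/(_ r rpq): k5 => k5; move/subspace_continuousP/(_ r rpq): k6 => k6.
  move/subspace_continuousP/(_ r rpq): k3 => k3; move/subspace_continuousP/(_ r rpq): k4 => k4.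
  have lim : ((ell u).1 * G1 u + (ell u).2 * G2 u) * ((- (ell u).2) * G1 u + (ell u).1 * G2 u) @[u --> within `[p, q] (nbhs r)]
     --> ((ell r).1 * G1 r + (ell r).2 * G2 r) * ((- (ell r).2) * G1 r + (ell r).1 * G2 r).
    apply: cvgM; first by apply: cvgD; apply: cvgM; [exact: k3|exact: k5|exact: k4|exact: k6].
    apply: cvgD; apply: cvgM; [apply: cvgN; exact: k4|exact: k5|exact: k3|exact: k6].
  exact: lim.
apply: (FTC2_oo pq cP arc_product_rate_within) => r rpq; first exact: arc_product_derive.
by rewrite derive1E; exact: (derive_val (is_derive := arc_product_derive rpq)).
Qed.

Hypotheses (p0 : 0 <= p) (qL : q <= L).

Lemma boundary_term_arc r : r \in `]p, q[ ->
  boundary_term a F v x ell theta r = arc_rate r - arc_product_rate r.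
Proof.
move=> rpq; have zE := arc (subset_itv_oo_cc rpq).
have rL : r \in `]0, L[.
  move: rpq; rewrite !in_itv/= => /andP[pr rq]; apply/andP; split; first exact: le_lt_trans p0 pr.
  exact: lt_le_trans rq qL.
have [d1 _] := field_along_derive rpq; have fe := field_derive rL.
have ee : (ell r).1 * (ell r).1 + (ell r).2 * (ell r).2 = 1.
  by have := congr1 (fun y => y ^+ 2) (field_unit hell r); rewrite sqr_enorm expr1n.
have dE : derive1 (d_along a F v x ell) r =
    e1' r * G1 r + e2' r * G2 r + ((ell r).1 * H1' r + (ell r).2 * H2' r).
  by rewrite derive1E; exact: (derive_val (is_derive := d1)).
rewrite /boundary_term /grad_norm2 dE !boundary_trace// d_along_edge//.
rewrite /arc_product_rate /e1' /e2' fe /arc_rate.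
have := boundary_identity (derive1 theta r - chi x r) (G1 r) (G2 r) (H1' r) (H2' r) ee.
have -> : curl_density (sg r) * arc_speed r = G1 r * H2' r - G2 r * H1' r.
  by rewrite /curl_density /G1 /G2 /H1' /H2'; move: ('D_(edge_dir i) _ _) ('D_(edge_dir i) _ _) (Dx K _) (Dy K _) => *; ring.
by rewrite !grad_along_e1 !grad_along_e2 /perp /= /GRing.scale /=.
Qed.

Lemma boundary_term_integral (W : R -> R) : (forall t : R, t \in `[0, 1] -> is_derive t 1 W (curl_density t)) ->
  [/\ mu.-integrable `[p, q] (EFin \o boundary_term a F v x ell theta),
      mu.-integrable `[p, q] (EFin \o derive1 arc_product) &
      \int[mu]_(r in `[p, q]) boundary_term a F v x ell theta r =
      W (sg q) - W (sg p) - \int[mu]_(r in `[p, q]) derive1 arc_product r].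
Proof.
move=> dW.
have cd : {within `[p, q], continuous (fun r => arc_rate r - arc_product_rate r)}.
  by move=> r; apply: cvgB; [exact: arc_rate_within|exact: arc_product_rate_within].
have ed r : r \in `]p, q[ -> derive1 arc_product r = arc_product_rate r.
  by move=> rpq; rewrite derive1E; exact: (derive_val (is_derive := arc_product_derive rpq)).
split; [exact: integrable_oo boundary_term_arc cd|exact: integrable_oo ed arc_product_rate_within|].
rewrite (eq_Rintegral_oo boundary_term_arc cd) (eq_Rintegral_oo ed arc_product_rate_within).
rewrite -(arc_rate_integral dW) RintegralB//; apply: continuous_compact_integrable; try exact: segment_compact.
  exact: arc_rate_within.
exact: arc_product_rate_within.
Qed.

End Arc.

End OneEdge.
End BoundaryArcs.

Lemma Rintegral_sum_seq {R : realType} (a b : R) (J : eqType) (r : seq J) (f : J -> R -> R) :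
  (forall j, j \in r -> (@lebesgue_measure R).-integrable `[a, b] (EFin \o f j)) ->
  (@lebesgue_measure R).-integrable `[a, b] (EFin \o (fun t => \sum_(j <- r) f j t)) /\
  \int[@lebesgue_measure R]_(t in `[a, b]) (\sum_(j <- r) f j t) =
  \sum_(j <- r) \int[@lebesgue_measure R]_(t in `[a, b]) f j t.
Proof.
elim: r => [_|j r IH ir].
  have -> : (fun t : R => \sum_(j <- [::]) f j t) = (fun=> 0) by apply/funext => t; rewrite big_nil.
  split; last by rewrite big_nil Rintegral_cst// mul0r.
  by apply: continuous_itv_integrable => t _; exact: cvg_cst.
have ij := ir j (mem_head _ _).
have [i1 i2] := IH (fun k kr => ir k (mem_behead (s := j :: r) kr)).
have -> : (fun t : R => \sum_(j <- j :: r) f j t) = (fun t => f j t + \sum_(k <- r) f k t).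
  by apply/funext => t; rewrite big_cons.
rewrite big_cons -i2; split; last by rewrite RintegralD.
exact: (integrableD _ ij i1).
Qed.

Lemma both_signs {R : realType} (S u0 u1 : R) : 0 < S * (u1 - u0) -> 0 < S * (u0 - u1) -> False.
Proof. by rewrite -[u0 - u1]opprB mulrN oppr_gt0 => /lt_trans/[apply]; rewrite ltxx. Qed.

Lemma arc_ends {R : realType} (S u0 u1 : R) (W : R -> R) : S = 1 \/ S = -1 ->
  (u0 = 0 /\ u1 = 1) \/ (u0 = 1 /\ u1 = 0) -> 0 < S * (u1 - u0) -> W u1 - W u0 = S * (W 1 - W 0).
Proof. by move=> [] -> [] [-> ->] h; lra. Qed.

Lemma sum_fibers {V : nmodType} {I : finType} {J : eqType} (P : pred I) (f : I -> J) (r : seq J) (c : I -> V) :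
  uniq r -> (forall i, P i -> f i \in r) ->
  \sum_(j <- r) \sum_(i | P i && (f i == j)) c i = \sum_(i | P i) c i.
Proof.
move=> ur Pr; rewrite (exchange_big_dep P)/=; last by move=> j i _ /andP[].
apply: eq_bigr => i Pi; rewrite -big_filter.
have -> : [seq j <- r | P i && (f i == j)] = [:: f i].
  by rewrite -(filter_pred1_uniq ur (Pr i Pi)); apply: eq_filter => j; rewrite Pi /= eq_sym.
by rewrite big_seq1.
Qed.

(** * Summation over the boundary edges *)

Section BoundarySum.
Context {R : realType}.
Local Notation plane := (R * R)%type.
Local Notation T0 := (@std_triangle R).
Local Notation mu := (@lebesgue_measure R).
Implicit Types (p q n z e : plane) (i j : 'I_3).

Variables (a : 'I_3 -> plane) (T : finType) (F : T -> plane -> plane).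
Implicit Types (K : T) (E : set plane).
Local Notation G K := (chart_map (elt_x a F K) (elt_y a F K)).
Local Notation elt := (elt a F).
Local Notation edge := (edge a F).
Local Notation vertex := (vertex a F).
Local Notation is_edge := (is_edge a F).
Local Notation is_vertex := (is_vertex a F).
Local Notation in_edge := (in_edge a F).
Variables (Omega : set plane) (L : R) (x : R -> plane).
Hypotheses (hO : bounded_domain Omega) (hbd : C2_boundary Omega L x)
  (hT : exact_triangulation a F Omega).
Variables (U : T -> set plane) (s c : T -> R).
Hypothesis hC : forall K, C2chart (elt_x a F K) (elt_y a F K) (U K) (s K) (c K).
Let chG K := C2chart_chart (hC K).
Let C2X K := C2chart_x (hC K).
Let C2Y K := C2chart_y (hC K).
Let J0 K := C2chart_det (hC K).

Variables (v : plane -> R) (w : T -> plane -> R).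
Hypotheses (C2w : forall K, C2 (U K) (w K))
  (vw : forall K q, std_interior q -> v (G K q) = w K q).
Hypothesis hvert : forall K z, is_vertex K z -> C1_at a F v z.
Variables (ell : R -> plane) (theta : R -> R).
Hypothesis hell : oblique_field L x ell theta.

Local Notation curl K := (curl_term (elt_x a F K) (elt_y a F K) (s K) (w K)).
Local Notation bt := (boundary_term a F v x ell theta).
Local Notation Psi := (arc_product a F x v ell).
Local Notation "'dPsi'" := (derive1 Psi).
Local Notation sg K i := (arc_coord a F x K i).

(** A cut-off on all of [[0, L]], because the parameters of an edge through the base point form two
    pieces of that interval. *)
Definition on_edge K i (f : R -> R) (r : R) : R := if `[< edge K i (x r) >] then f r else 0.

Lemma vertex_edge_point K i (t : R) : t = 0 \/ t = 1 -> is_vertex K (G K (edge_point i t)).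
Proof.
by case=> ->; [have [j ->] := @edge_point0 R i|have [j ->] := @edge_point1 R i]; exists j; rewrite vertexE.
Qed.

Lemma edge_closed K i : closed (edge K i).
Proof. by apply: compact_closed; [exact: plane_hausdorff|exact: (edge_compact hC)]. Qed.

Lemma curve_near (A : set plane) r : closed A -> ~ A (x r) -> \forall u \near r, ~ A (x u).
Proof.
move=> cA nA; have : nbhs (x r) (~` A) by apply: open_nbhs_nbhs; split => //; apply: closed_openC.
exact: (curve_continuous hbd (r := r)).
Qed.

(** Away from its end points, being on the edge is an open and a closed condition on the
    parameter. *)
Lemma arc_dichotomy K i (p q : R) : (forall r, r \in `]p, q[ ->
    x r <> G K (edge_point i 0) /\ x r <> G K (edge_point i 1)) ->
  (forall r, r \in `]p, q[ -> in_edge K i (x r)) \/ (forall r, r \in `]p, q[ -> ~ edge K i (x r)).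
Proof.
move=> nv; have [[r0 r0pq E0]|none] := pselect (exists2 r, r \in `]p, q[ & edge K i (x r)); last first.
  by right => r rpq Er; apply: none; exists r.
left => r rpq; have [n0 n1] := nv r rpq; apply: in_edgeP n0 n1.
apply: (locally_constant (P := fun r => edge K i (x r)) _ _ r0pq rpq E0) => u upq Eu.
  have [m0 m1] := nv u upq.
  by apply: filterS (boundary_edge_near hO hbd hT hC (in_edgeP Eu m0 m1)) => t; exact: in_edge_edge.
exact: (curve_near (@edge_closed K i) Eu).
Qed.

Lemma arc_closure K i (p q : R) : p < q -> (forall r, r \in `]p, q[ -> in_edge K i (x r)) ->
  forall r, r \in `[p, q] -> edge K i (x r).
Proof.
move=> pq arc r rpq; apply: contrapT => nE; have N := curve_near (@edge_closed K i) nE.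
have [e e0 He] : exists2 e : R, 0 < e & forall u, `|u - r| < e -> ~ edge K i (x u).
  move: N => /nbhs_ballP[e /= e0 E]; exists e => // u h; apply: E.
  by rewrite /ball /= distrC.
pose m := (p + q) / 2.
pose d := Num.min (e / 2) ((q - p) / 4).
have d0 : 0 < d by rewrite lt_min; apply/andP; split; lra.
have de : d <= e / 2 by rewrite ge_min lexx.
have dq : d <= (q - p) / 4 by rewrite ge_min lexx orbT.
move: rpq; rewrite in_itv/= => /andP[pr rq].
have [rm|mr] := leP r m.
  apply: (He (r + d)); last by apply/in_edge_edge/arc; rewrite in_itv/=; apply/andP; split; move: rm; rewrite /m; lra.
  by rewrite addrC addKr gtr0_norm//; lra.
apply: (He (r - d)); last by apply/in_edge_edge/arc; rewrite in_itv/=; apply/andP; split; move: mr; rewrite /m; lra.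
by rewrite addrAC subrr add0r normrN gtr0_norm//; lra.
Qed.

Lemma midpoint_oo (p q : R) : p < q -> (p + q) / 2 \in `]p, q[.
Proof. by move=> pq; rewrite in_itv/=; apply/andP; split; lra. Qed.

(** The number [d] is the contribution of the piece to the circulation. For [p = q] the first
    alternative holds vacuously, with [d = 0]. *)
Lemma arc_piece K i (p q : R) (W : R -> R) : edge K i `<=` boundary Omega ->
  0 <= p -> p <= q -> q <= L ->
  (forall r, r \in `]p, q[ -> x r <> G K (edge_point i 0) /\ x r <> G K (edge_point i 1)) ->
  (forall t : R, t \in `[0, 1] -> is_derive t 1 W (curl_density a F w K i t)) ->
  [/\ mu.-integrable `[p, q] (EFin \o on_edge K i bt), mu.-integrable `[p, q] (EFin \o on_edge K i dPsi) &
   exists2 d : R, \int[mu]_(r in `[p, q]) on_edge K i bt r = d - \int[mu]_(r in `[p, q]) on_edge K i dPsi r &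
     ((forall r, r \in `]p, q[ -> in_edge K i (x r)) /\ d = W (sg K i q) - W (sg K i p)) \/
     ((forall r, r \in `]p, q[ -> ~ edge K i (x r)) /\ d = 0)].
Proof.
move=> EO p0; rewrite le_eqVlt => /orP[/eqP <- qL nv dW|pq qL nv dW].
  have it (f : R -> R) : mu.-integrable `[p, p] (EFin \o f).
    apply: (integrable_oo (g := fun=> 0)); last by apply: continuous_subspaceT => t; exact: cvg_cst.
    by move=> t; rewrite in_itv/= => /andP[h1 /(lt_trans h1)]; rewrite ltxx.
  split; [exact: it|exact: it|exists 0].
    by rewrite !set_itv1 !Rintegral_set1 subrr.
  left; split; last by rewrite subrr.
  by move=> r; rewrite in_itv/= => /andP[h1 /(lt_trans h1)]; rewrite ltxx.
have [arc|none] := arc_dichotomy nv.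
  have ac := arc_closure pq arc.
  have [i1 i2 E] := boundary_term_integral hO hbd hT hC C2w vw hvert hell EO (ltW pq) ac arc p0 qL dW.
  have same (f : R -> R) (r : R) : r \in `[p, q] -> on_edge K i f r = f r.
    by move=> rpq; rewrite /on_edge asboolT//; exact: ac.
  have ii (f : R -> R) : mu.-integrable `[p, q] (EFin \o f) -> mu.-integrable `[p, q] (EFin \o on_edge K i f).
    by move=> fi; apply: eq_integrable fi => // r; rewrite inE /= => rpq; rewrite same.
  split; [exact: ii|exact: ii|exists (W (sg K i q) - W (sg K i p)); last by left].
  by rewrite (eq_Rintegral_itv (same bt)) (eq_Rintegral_itv (same dPsi)).
have zero (f : R -> R) (r : R) : r \in `]p, q[ -> on_edge K i f r = (fun=> 0) r.
  by move=> rpq; rewrite /on_edge asboolF//; exact: none.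
have c0 : {within `[p, q], continuous ((fun=> 0) : R -> R)} by apply: continuous_subspaceT => t; exact: cvg_cst.
split; [exact: integrable_oo (zero bt) c0|exact: integrable_oo (zero dPsi) c0|exists 0; last by right].
by rewrite (eq_Rintegral_oo (zero bt) c0) (eq_Rintegral_oo (zero dPsi) c0) Rintegral_cst// mul0r subrr.
Qed.

Lemma curve_L : x L = x 0. Proof. by rewrite -[in LHS](add0r L) (curve_periodic hbd). Qed.

Lemma L_gt0 : 0 < L. Proof. exact: (length_gt0 hbd). Qed.

Lemma arc_coord_periodic K i r : sg K i (r + L) = sg K i r.
Proof. by rewrite /arc_coord (curve_periodic hbd). Qed.

Lemma boundary_param z : boundary Omega z -> exists2 r, r \in `[0, L[ & x r = z.
Proof.
rewrite -(curve_onto hbd) => -[r /=]; rewrite in_itv/= => /andP[r0]; rewrite le_eqVlt => /orP[/eqP -> <-|rL <-].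
  by exists 0; rewrite ?in_itv/= ?lexx ?L_gt0// curve_L.
by exists r; rewrite // in_itv/= r0.
Qed.

Section OneEdge.
Variables (K : T) (i : 'I_3) (W : R -> R) (s0 s1 : R).
Hypotheses (EO : edge K i `<=` boundary Omega)
  (dW : forall t : R, t \in `[0, 1] -> is_derive t 1 W (curl_density a F w K i t))
  (s0L : s0 \in `[0, L[) (s1L : s1 \in `[0, L[) (s01 : s0 < s1)
  (ends : (x s0 = G K (edge_point i 0) /\ x s1 = G K (edge_point i 1)) \/
          (x s0 = G K (edge_point i 1) /\ x s1 = G K (edge_point i 0))).

Let end_param r : r \in `[0, L[ -> r <> s0 -> r <> s1 ->
  x r <> G K (edge_point i 0) /\ x r <> G K (edge_point i 1).
Proof.
move=> rL n0 n1; have inj (u : R) : u \in `[0, L[ -> x r = x u -> r = u by move=> uL; exact: (curve_simple hbd).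
by case: ends => -[<- <-]; split=> /inj h; [apply: n0|apply: n1|apply: n1|apply: n0]; exact: h.
Qed.

Let s0b : 0 <= s0 /\ s0 < L. Proof. by move: s0L; rewrite in_itv/= => /andP[]. Qed.
Let s1b : 0 <= s1 /\ s1 < L. Proof. by move: s1L; rewrite in_itv/= => /andP[]. Qed.

Let free (p q r : R) : 0 <= p -> q <= L -> r \in `]p, q[ -> (q <= s0 \/ (s0 <= p /\ q <= s1) \/ s1 <= p) ->
  x r <> G K (edge_point i 0) /\ x r <> G K (edge_point i 1).
Proof.
move=> p0 qL; have h01 := s01; have [a1 a2] := s0b; have [b1 b2] := s1b.
rewrite in_itv/= => /andP[pr rq] h; apply: end_param.
- by rewrite in_itv/=; apply/andP; split; lra.
- by move=> E; rewrite E in pr rq; case: h => [|[[? ?]|?]]; lra.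
- by move=> E; rewrite E in pr rq; case: h => [|[[? ?]|?]]; lra.
Qed.

(** The complementary arc, from [s1] through the base point to [s0], becomes an interval by running
    past [L] with the periodic extension. *)
Let freeJ (r : R) : r \in `]s1, s0 + L[ -> x r <> G K (edge_point i 0) /\ x r <> G K (edge_point i 1).
Proof.
have h01 := s01; have [a1 a2] := s0b; have [b1 b2] := s1b.
rewrite in_itv/= => /andP[h1 h2]; have [rL|Lr] := ltP r L.
  by apply: end_param; [rewrite in_itv/=; apply/andP; split; lra|move=> E; lra|move=> E; lra].
have E : x r = x (r - L) by rewrite -[in LHS](subrK L r) (curve_periodic hbd).
by rewrite E; apply: end_param; [rewrite in_itv/=; apply/andP; split; lra|move=> E'; lra|move=> E'; lra].
Qed.

Let shift r : r \in `]0, s0[ -> r + L \in `]s1, s0 + L[.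
Proof.
have [b1 b2] := s1b.
by rewrite !in_itv/= => /andP[? ?]; apply/andP; split; lra.
Qed.

Let sub r : r \in `]s1, L[ -> r \in `]s1, s0 + L[.
Proof.
have [a1 a2] := s0b.
by rewrite !in_itv/= => /andP[? ?]; apply/andP; split; lra.
Qed.

Let sL : s1 < s0 + L.
Proof. have [a1 a2] := s0b; have [b1 b2] := s1b; lra. Qed.

Let end_values : (sg K i s0 = 0 /\ sg K i s1 = 1) \/ (sg K i s0 = 1 /\ sg K i s1 = 0).
Proof.
have z01 : (0 : R) \in `[0, 1] by rewrite in_itv/= lexx ler01.
have o01 : (1 : R) \in `[0, 1] by rewrite in_itv/= lexx ler01.
case: ends => -[E0 E1]; [left|right]; split.
- exact: (arc_coord_unique hC z01 E0).
- exact: (arc_coord_unique hC o01 E1).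
- exact: (arc_coord_unique hC o01 E0).
- exact: (arc_coord_unique hC z01 E1).
Qed.

Let no_arc (p q : R) : p < q -> (forall r, r \in `]p, q[ -> in_edge K i (x r)) ->
  (forall r, r \in `]p, q[ -> ~ edge K i (x r)) -> False.
Proof.
by move=> pq h1 h2; have m := midpoint_oo pq; apply: (h2 _ m); apply: in_edge_edge; exact: h1.
Qed.

Let arc_exists : (forall r, r \in `]s0, s1[ -> ~ edge K i (x r)) ->
  (forall r, r \in `]s1, s0 + L[ -> ~ edge K i (x r)) -> False.
Proof.
move=> nI nJ; have [a1 a2] := s0b; have [b1 b2] := s1b; have Lp := L_gt0; have h01 := s01.
have xs r : x (r + L) = x r by exact: (curve_periodic hbd).
have [z zi] := edge_midpoint a F K i.
have [r rL xr] := boundary_param (EO (in_edge_edge zi)); rewrite -xr in zi.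
have vx (u : R) : x u = G K (edge_point i 0) \/ x u = G K (edge_point i 1) -> r <> u.
  move=> h E; apply: (in_edge_not_vertex hC zi); rewrite E.
  by case: h => ->; apply: vertex_edge_point; [left|right].
have r0 : r <> s0 by apply: vx; case: ends => -[]; auto.
have r1 : r <> s1 by apply: vx; case: ends => -[]; auto.
move: rL; rewrite in_itv/= => /andP[rp rl].
have [h|h|//] := ltgtP r s0.
  apply: (nJ (r + L)); first by rewrite in_itv/=; apply/andP; split; lra.
  by rewrite xs; exact: in_edge_edge.
have [h'|h'|//] := ltgtP r s1.
  by apply: (nI r); [rewrite in_itv/= h|exact: in_edge_edge].
by apply: (nJ r); [rewrite in_itv/=; apply/andP; split; lra|exact: in_edge_edge].
Qed.

(* the positively oriented boundary curve runs through exactly one of the two arcs between the end points *)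
Lemma boundary_edge_integral :
  [/\ mu.-integrable `[0, L] (EFin \o on_edge K i bt), mu.-integrable `[0, L] (EFin \o on_edge K i dPsi) &
   \int[mu]_(r in `[0, L]) on_edge K i bt r = s K * (W 1 - W 0) - \int[mu]_(r in `[0, L]) on_edge K i dPsi r].
Proof.
have [a1 a2] := s0b; have [b1 b2] := s1b; have Lp := L_gt0.
have f1 r : r \in `]0, s0[ -> _ := fun h => free (lexx 0) (ltW a2) h (or_introl (lexx _)).
have f2 r : r \in `]s0, s1[ -> _ := fun h => free a1 (ltW b2) h (or_intror (or_introl (conj (lexx _) (lexx _)))).
have f3 r : r \in `]s1, L[ -> _ := fun h => free b1 (lexx _) h (or_intror (or_intror (lexx _))).
have [i1 j1 [d1 E1 D1]] := arc_piece EO (lexx 0) a1 (ltW a2) f1 dW.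
have [i2 j2 [d2 E2 D2]] := arc_piece EO a1 (ltW s01) (ltW b2) f2 dW.
have [i3 j3 [d3 E3 D3]] := arc_piece EO b1 (ltW b2) (lexx _) f3 dW.
have [i12 E12] := integrable_itv_cat a1 (ltW s01) i1 i2.
have [j12 F12] := integrable_itv_cat a1 (ltW s01) j1 j2.
have [i123 E123] := integrable_itv_cat b1 (ltW b2) i12 i3.
have [j123 F123] := integrable_itv_cat b1 (ltW b2) j12 j3.
split => //; rewrite E123 E12 F123 F12 E1 E2 E3.
suff Ed : d1 + d2 + d3 = s K * (W 1 - W 0).
  rewrite -Ed; move: (\int[mu]_(r in _) _) (\int[mu]_(r in _) _) (\int[mu]_(r in _) _) => *; ring.
have sg1 : s K = 1 \/ s K = -1 := chart_sign (chG K).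
have dI := arc_dichotomy f2; have dJ := arc_dichotomy freeJ.
have mI (h : forall r, r \in `]s0, s1[ -> in_edge K i (x r)) : 0 < s K * (sg K i s1 - sg K i s0).
  exact: (arc_monotone hO hbd hT hC (arc_closure s01 h) h s01).
have mJ (h : forall r, r \in `]s1, s0 + L[ -> in_edge K i (x r)) : 0 < s K * (sg K i s0 - sg K i s1).
  by have := arc_monotone hO hbd hT hC (arc_closure sL h) h sL; rewrite arc_coord_periodic.
have xs r : x (r + L) = x r by exact: (curve_periodic hbd).
(* If both arcs lay on the edge, the edge parameter would have to move both ways with the same sign
   of speed; if neither did, the edge would have no relative interior. When it is the complementary
   arc, the pieces on [[0, s0]] and [[s1, L]] are joined at the base point. *)
case: dI dJ => [I|nI] [J|nJ].
- by case: (both_signs (mI I) (mJ J)).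
- have -> : d2 = W (sg K i s1) - W (sg K i s0) by case: D2 => -[h ->//]; case: (no_arc s01 I h).
  have -> : d3 = 0.
    by case: D3 => -[h ->//]; case: (no_arc b2 h) => r /sub; exact: nJ.
  have -> : d1 = 0.
    case: D1 => -[h ->//]; move: a1; rewrite le_eqVlt => /orP[/eqP <-|s0p]; first by rewrite subrr.
    by case: (no_arc s0p h) => r /shift/nJ; rewrite xs.
  by rewrite add0r addr0; exact: arc_ends sg1 end_values (mI I).
- have -> : d2 = 0 by case: D2 => -[h ->//]; case: (no_arc s01 h nI).
  have -> : d3 = W (sg K i 0) - W (sg K i s1).
    case: D3 => -[h ->]; first by rewrite -(arc_coord_periodic K i 0) add0r.
    by case: (no_arc b2 (fun r hr => J r (sub hr)) h).
  have -> : d1 = W (sg K i s0) - W (sg K i 0).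
    case: D1 => -[h ->//]; move: a1; rewrite le_eqVlt => /orP[/eqP <-|s0p]; first by rewrite subrr.
    by case: (no_arc s0p _ h) => r /shift/J; rewrite xs.
  rewrite addr0 addrA subrK; apply: arc_ends sg1 _ (mJ J).
  by case: end_values => -[h0 h1]; [right|left].
by case: (arc_exists nI nJ).
Qed.

End OneEdge.

Lemma boundary_edge_curl K i : edge K i `<=` boundary Omega ->
  [/\ mu.-integrable `[0, L] (EFin \o on_edge K i bt), mu.-integrable `[0, L] (EFin \o on_edge K i dPsi) &
   \int[mu]_(r in `[0, L]) on_edge K i bt r = curl K i - \int[mu]_(r in `[0, L]) on_edge K i dPsi r].
Proof.
move=> EO; have [W dW ->] := curl_primitive hC C2w K i.
have z01 : (0 : R) \in `[0, 1] by rewrite in_itv/= lexx ler01.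
have o01 : (1 : R) \in `[0, 1] by rewrite in_itv/= lexx ler01.
have m (t : R) : t \in `[0, 1] -> edge K i (G K (edge_point i t)) by move=> t01; rewrite edgeE; exists t.
have [r0 r0L E0] := boundary_param (EO _ (m 0 z01)); have [r1 r1L E1] := boundary_param (EO _ (m 1 o01)).
have [h|h|h] := ltgtP r0 r1.
- by apply: (boundary_edge_integral EO dW r0L r1L h); left.
- by apply: (boundary_edge_integral EO dW r1L r0L h); right.
exfalso; have : G K (edge_point i 0) = G K (edge_point i 1) by rewrite -E0 -E1 h.
move=> /(chart_inj (chG K) (edge_point_std i z01) (edge_point_std i o01))/edge_point_inj/eqP.
by rewrite eq_sym oner_eq0.
Qed.

(** The product is expressed through [ell], which closes up, and not through [theta], which may
    change by a multiple of 2 pi in one turn. *)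
Lemma product_periodic : Psi L = Psi 0.
Proof.
have eL : ell L = ell 0 by rewrite -[in LHS](add0r L) (field_periodic hell).
by rewrite /arc_product /d_along eL curve_L.
Qed.

Definition boundary_pair : pred (T * 'I_3) := fun k => `[< edge k.1 k.2 `<=` boundary Omega >].

Lemma boundary_point_edge r : ~ (exists K, is_vertex K (x r)) ->
  exists K i, in_edge K i (x r).
Proof.
move=> nv; have [[clu _] nOu] := boundary_curve hO hbd r.
move: clu; rewrite -(mesh_cover hT) => -[K _ Kr].
have [/(elt_interior_Omega hbd hT) //|/elt_edgesP[i Ei]] := elt_edges_or hC Kr.
exists K, i; apply: in_edgeP Ei _ _ => E; apply: nv; exists K; rewrite E; apply: vertex_edge_point; [by left|by right].
Qed.

Variables (nu : T -> set plane -> plane) (tau : set plane -> plane).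
Hypothesis hnu : forall K E, interior_edges a F Omega E -> is_edge K E ->
  outer_unit_normal a F K E (nu K E).
Hypothesis htau : forall E, interior_edges a F Omega E -> unit_tangent E (tau E).

(** The relative interior of an interior edge lies in [Omega], which the curve avoids. *)
Lemma boundary_point_edge_boundary K i r : in_edge K i (x r) -> edge K i `<=` boundary Omega.
Proof.
move=> zi; apply: contrapT => nE; have iE : interior_edges a F Omega (edge K i) by split => //; exists K, i.
have ie : is_edge K (edge K i) by exists i.
have [K' KK [i' EE]] := mesh_edge_shared hT ie nE; rewrite eq_sym in KK.
have := in_edge_Omega hbd hT hC hnu htau KK EE iE zi.
exact: (boundary_curve hO hbd r).2.
Qed.

(** Between consecutive vertices exactly one boundary edge carries the curve, so the sum of the
    cut-offs is the derivative of [Psi] except at finitely many points. The increments telescope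
    around the closed curve. *)
Lemma sum_product_integral :
  \sum_(k | boundary_pair k) \int[mu]_(r in `[0, L]) on_edge k.1 k.2 dPsi r = 0.
Proof.
rewrite -big_filter; set ks := [seq _ <- _ | _].
have ik k : k \in ks -> mu.-integrable `[0, L] (EFin \o on_edge k.1 k.2 dPsi).
  by rewrite mem_filter => /andP[/asboolP bk _]; case: (boundary_edge_curl bk).
have [iS <-] := Rintegral_sum_seq ik.
(* Parameters of the vertices. For a vertex off the curve the default value of [get] merely adds one
   more cutting point. *)
pose par (k : T * 'I_3) : R := get [set r : R | (r \in `[0, L[) /\ x r = vertex k.1 k.2].
rewrite (FTC2_finite (V := map par (enum (predT : pred (T * 'I_3)))) (Psi := Psi) (ltW L_gt0) iS).
  by rewrite product_periodic subrr.
move=> p q p0 pq qL hV; move: (pq); rewrite le_eqVlt => /orP[/eqP <-|plq].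
  by rewrite set_itv1 Rintegral_set1 subrr.
have nv r : r \in `]p, q[ -> ~ (exists K, is_vertex K (x r)).
  move=> rpq [K [j E]]; have kin : (K, j) \in enum (predT : pred (T * 'I_3)) by rewrite mem_enum.
  have := hV (par (K, j)) (map_f par kin).
  suff -> : par (K, j) = r by rewrite rpq.
  have rL : r \in `[0, L[ by move: rpq; rewrite !in_itv/= => /andP[? ?]; apply/andP; split; lra.
  have [h1 h2] := getPex (P := [set r : R | (r \in `[0, L[) /\ x r = vertex K j]) (ex_intro _ r (conj rL E)).
  by apply: (curve_simple hbd) => //; rewrite E.
have [K [i zi]] := boundary_point_edge (nv _ (midpoint_oo plq)).
have EO := boundary_point_edge_boundary zi.
have arc : forall r, r \in `]p, q[ -> in_edge K i (x r).
  have [//|none] : (forall r, r \in `]p, q[ -> in_edge K i (x r)) \/ (forall r, r \in `]p, q[ -> ~ edge K i (x r)).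
    apply: arc_dichotomy => r rpq; split=> E; apply: (nv r rpq); exists K; rewrite E;
      apply: vertex_edge_point; [by left|by right].
  by case: (none _ (midpoint_oo plq)); exact: in_edge_edge.
have ac := arc_closure plq arc.
have key r : r \in `]p, q[ -> \sum_(k <- ks) on_edge k.1 k.2 dPsi r = dPsi r.
  move=> rpq; rewrite /ks big_filter (bigD1 (K, i))/=; last exact/asboolP.
  rewrite {1}/on_edge asboolT; last exact/in_edge_edge/arc.
  rewrite big1 ?addr0// => -[K' i'] /andP[_ ne]; rewrite /on_edge /= asboolF// => E'.
  have KK := boundary_edge_elements hO hbd hT hC EO (arc r rpq) (edge_sub_elt E').
  rewrite KK in E' ne; have ii := in_edge_unique hC (arc r rpq) E'.
  by rewrite ii eqxx in ne.
rewrite -(arc_product_integral hO hbd hT hC C2w vw hvert hell EO pq ac arc).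
have rw := arc_product_rate_within hbd hC C2w hell ac.
have ed r : r \in `]p, q[ -> dPsi r = arc_product_rate a F x w ell K i r.
  move=> rpq; rewrite derive1E.
  exact: (derive_val (is_derive := arc_product_derive hO hbd hT hC C2w vw hvert hell EO ac arc rpq)).
rewrite (eq_Rintegral_oo ed rw); apply: eq_Rintegral_oo rw => r rpq.
by rewrite key// ed.
Qed.

Lemma boundary_sum : \sum_(k | boundary_pair k) curl k.1 k.2 =
  \sum_(k | boundary_pair k) \int[mu]_(r in `[0, L]) on_edge k.1 k.2 bt r.
Proof.
transitivity (\sum_(k | boundary_pair k) curl k.1 k.2 -
  \sum_(k | boundary_pair k) \int[mu]_(r in `[0, L]) on_edge k.1 k.2 dPsi r).
  by rewrite sum_product_integral subr0.
rewrite -sumrB; apply/esym/eq_bigr => k /asboolP bk.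
by case: (boundary_edge_curl bk).
Qed.

End BoundarySum.

(** * Assembly *)

Section Polynomials.
Context {R : realType}.
Local Notation plane := (R * R)%type.
Implicit Types (f g : plane -> R).

Lemma C2_affine_form (c0 c1 c2 : R) : C2 setT (fun z : plane => c0 + z.1 * c1 + z.2 * c2).
Proof.
have D (u : plane) : 'D_u (fun z : plane => c0 + z.1 * c1 + z.2 * c2) = cst (u.1 * c1 + u.2 * c2).
  by apply/funext => z; rewrite (affine_form_differentiable c0 c1 c2 z).2.
split=> [z _|u]; last by rewrite D; exact: C1_cst.
split; first exact: (affine_form_differentiable c0 c1 c2 z).1.
by move=> u; rewrite D; exact: cvg_cst.
Qed.

Lemma C2D f g : C2 setT f -> C2 setT g -> C2 setT (f \+ g).
Proof.
move=> [f1 f2] [g1 g2]; split; first exact: C1D openT f1 g1.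
move=> u; apply: (C1_open_ext (f := 'D_u f \+ 'D_u g) openT) => [z _|].
  by rewrite /= [RHS]deriveD//; apply: diff_derivable; [exact: (f1 z I).1|exact: (g1 z I).1].
exact: C1D openT (f2 u) (g2 u).
Qed.

Lemma C2M f g : C2 setT f -> C2 setT g -> C2 setT (f \* g).
Proof.
move=> [f1 f2] [g1 g2]; split; first exact: C1M openT f1 g1.
move=> u; apply: (C1_open_ext (f := (f \* 'D_u g) \+ (g \* 'D_u f)) openT) => [z _|].
  by rewrite /= [RHS]deriveM//; apply: diff_derivable; [exact: (f1 z I).1|exact: (g1 z I).1].
by apply: C1D; [exact: openT|exact: C1M openT f1 (g2 u)|exact: C1M openT g1 (f2 u)].
Qed.

Lemma C2_const (k : R) : C2 setT (fun _ : plane => k).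
Proof.
have -> : (fun _ : plane => k) = (fun z : plane => k + z.1 * 0 + z.2 * 0) by apply/funext => z; rewrite !mulr0 !addr0.
exact: C2_affine_form.
Qed.

Lemma C2_exp f (n : nat) : C2 setT f -> C2 setT (fun z => f z ^+ n).
Proof.
move=> Cf; elim: n => [|n IH]; first exact: C2_const.
have -> : (fun z => f z ^+ n.+1) = f \* (fun z => f z ^+ n) by apply/funext => z; rewrite exprS.
exact: C2M.
Qed.

Lemma C2_sum (n : nat) (f : 'I_n -> plane -> R) : (forall i, C2 setT (f i)) ->
  C2 setT (fun z => \sum_(i < n) f i z).
Proof.
elim: n f => [|n IH] f Cf.
  have -> : (fun z => \sum_(i < 0) f i z) = (fun=> 0) by apply/funext => z; rewrite big_ord0.
  exact: C2_const.
have -> : (fun z => \sum_(i < n.+1) f i z) = (fun z => \sum_(i < n) f (widen_ord (leqnSn n) i) z) \+ f ord_max.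
  by apply/funext => z; rewrite big_ord_recr.
by apply: C2D; [exact: IH|exact: Cf].
Qed.

Lemma poly_le_C2 (k : nat) f : poly_le k f -> C2 setT f.
Proof.
move=> [c fE]; have -> : f = fun p => \sum_(i < k.+1) \sum_(j < (k - i).+1) c i j * p.1 ^+ i * p.2 ^+ j.
  by apply/funext.
have C1' : C2 setT (fst : plane -> R).
  have -> : (fst : plane -> R) = (fun z : plane => 0 + z.1 * 1 + z.2 * 0) by apply/funext => z; rewrite mulr1 mulr0 add0r addr0.
  exact: C2_affine_form.
have C2' : C2 setT (snd : plane -> R).
  have -> : (snd : plane -> R) = (fun z : plane => 0 + z.1 * 0 + z.2 * 1) by apply/funext => z; rewrite mulr1 mulr0 !add0r.
  exact: C2_affine_form.
apply: C2_sum => i; apply: C2_sum => j.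
have Cm := C2M (C2M (C2_const (c i j)) (@C2_exp _ i C1')) (@C2_exp _ j C2').
exact: Cm.
Qed.

End Polynomials.

(** Passes from sums over edges as point sets to sums over pairs of an element and an index: one
    pair for each boundary edge and two for each interior one. *)
Lemma fsbig_fibers {R : realType} {I : finType} {J : choiceType} (P : pred I) (f : I -> J) (A : set J)
    (g : J -> R) (c : I -> R) :
  (forall j, A j <-> exists2 i, P i & f i = j) ->
  (forall j, A j -> g j = \sum_(i | P i && (f i == j)) c i) ->
  \sum_(j \in A) g j = \sum_(i | P i) c i.
Proof.
move=> AP gE; pose r := undup [seq f i | i <- enum P].
have ur : uniq r by exact: undup_uniq.
have mr j : j \in r <-> exists2 i, P i & f i = j.
  rewrite /r mem_undup; split=> [/mapP[i]|[i Pi <-]]; last by rewrite map_f ?mem_enum.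
  by rewrite mem_enum => Pi ->; exists i.
have -> : A = [set` r] by apply/seteqP; split => j /=; [move=> /AP/mr|move=> /mr/AP].
rewrite -fsbig_seq// -(sum_fibers c ur (f := f) (P := P)); last by move=> i Pi; apply/mr; exists i.
by apply: eq_big_seq => j /mr/AP; exact: gE.
Qed.

Lemma Rintegral_restrict {R : realType} (A : set R) (P : R -> Prop) (f : R -> R) :
  \int[@lebesgue_measure R]_(r in [set r | A r /\ P r]) f r =
  \int[@lebesgue_measure R]_(r in A) (if `[< P r >] then f r else 0).
Proof.
rewrite (@Rintegral_mkcond _ _ R (@lebesgue_measure R) A) (@Rintegral_mkcond _ _ R (@lebesgue_measure R) [set r | A r /\ P r]).
congr (Rintegral _ _ _); apply/funext => r; rewrite !patchE.
case: (asboolP (P r)) => Pr; last by rewrite if_same memNset// => -[].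
by congr (if _ then _ else _); apply/idP/idP; rewrite !inE /= => // -[].
Qed.

Lemma combine_sums {V : nmodType} (A H C B I B' I' : V) :
  A = H + C -> C = B + I -> B = B' -> I = I' -> A = H + I' + B'.
Proof. by move=> -> -> -> ->; rewrite [B' + I']addrC addrA. Qed.

Lemma sum_split_pair {V : nmodType} {I J : finType} (f g : I -> V) (c : I * J -> V) :
  (forall i, f i = g i + \sum_j c (i, j)) -> \sum_i f i = \sum_i g i + \sum_q c q.
Proof.
move=> E; rewrite (eq_bigr _ (fun i _ => E i)) big_split; congr (_ + _).
by rewrite pair_bigA; apply: eq_bigr => -[].
Qed.

Unset Implicit Arguments.

Theorem theorem3p9 (R : realType)
  (Omega : set (R * R)) (L : R) (x : R -> R * R)
  (hOmega : bounded_domain Omega) (hbd : C2_boundary Omega L x)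
  (ell : R -> R * R) (theta : R -> R) (hell : oblique_field L x ell theta)
  (a : 'I_3 -> R * R) (ha : noncollinear a)
  (T : finType) (F : T -> R * R -> R * R)
  (hT : exact_triangulation a F Omega)
  (nu : T -> set (R * R) -> R * R)
  (hnu : forall (K : T) (E : set (R * R)), interior_edges a F Omega E ->
     is_edge a F K E -> outer_unit_normal a F K E (nu K E))
  (tau : set (R * R) -> R * R)
  (htau : forall E : set (R * R), interior_edges a F Omega E ->
     unit_tangent E (tau E))
  (k : nat) (hk : (3 <= k)%N)
  (v : R * R -> R) (hv : in_Vh a F Omega k v) :
  \sum_(K : T) \int[area]_(p in elt a F K) (laplacian a F v K p ^+ 2) =
    \sum_(K : T) \int[area]_(p in elt a F K) hess_norm2 a F v K p
    + 2 * \sum_(E \in interior_edges a F Omega)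
        edge_integral E (tau E)
          (fun p => jump_dn a F v nu E p * d2t a F v (tau E) p)
    + \sum_(E \in boundary_edges a F Omega)
        \int[@lebesgue_measure R]_(s in [set s | s \in `[0, L] /\ E (x s)])
          boundary_term a F v x ell theta s.
Proof.
have [hH1 hPK hvert] := hv.
have h1 K : exists d : set (R * R) * R * R, C2chart (elt_x a F K) (elt_y a F K) d.1.1 d.1.2 d.2.
  have [U [s [c h]]] := exists_C2chart ha (mesh_elements hT K).
  by exists (U, s, c).
have [d hd] := choice h1.
pose U K := (d K).1.1; pose s K := (d K).1.2; pose c K := (d K).2.
have hC K : C2chart (elt_x a F K) (elt_y a F K) (U K) (s K) (c K) by exact: hd.
have h2 K : exists vhat : R * R -> R, C2 setT vhat /\
    forall p, ref_triangle a p -> (elt a F K)° (F K p) -> v (F K p) = vhat p.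
  by have [vhat /poly_le_C2 ? ?] := hPK K; exists vhat.
have [vhat hvhat] := choice h2.
(* The polynomial lives on the given reference triangle; the charts start from the standard one. *)
pose w K := vhat K \o ref_map a.
have C2w K : C2 (U K) (w K).
  have [h _] := hvhat K.
  have h' : C2 setT (w K) by apply: (C2_affine_comp (U := setT)) => //; exact: openT.
  by split; [exact: C1_sub h'.1|move=> u; exact: C1_sub (h'.2 u)].
have vw K q : std_interior q -> v (chart_map (elt_x a F K) (elt_y a F K) q) = w K q.
  move=> Iq; rewrite elt_mapE; apply: (hvhat K).2.
    by rewrite ref_triangleE; exists q => //; exact: std_interior_sub.
  by rewrite -elt_mapE (elt_interior hC); exists q.
pose curl (q : T * 'I_3) := curl_term (elt_x a F q.1) (elt_y a F q.1) (s q.1) (w q.1) q.2.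
have elementE K : \int[area]_(p in elt a F K) (laplacian a F v K p ^+ 2) =
    \int[area]_(p in elt a F K) hess_norm2 a F v K p + \sum_i curl (K, i).
  have ch := hC K.
  have trD2 e e' p : std_triangle p -> D2 a F v K e e' (chart_map (elt_x a F K) (elt_y a F K) p) =
      hess_along (elt_x a F K) (elt_y a F K) (w K) e e' p by exact: (elt_trace_derive2 hC C2w vw).
  have E p := hess_along_e (elt_x a F K) (elt_y a F K) (w K) p.
  rewrite eltE.
  apply: (element_identity (C2chart_chart ch) (C2chart_x ch) (C2chart_y ch) (C2chart_det ch) (C2w K)
    (h11 := D2 a F v K e1 e1) (h12 := D2 a F v K e1 e2) (h21 := D2 a F v K e2 e1) (h22 := D2 a F v K e2 e2)) => p Tp.
  - by rewrite trD2//; case: (E p).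
  - by rewrite trD2//; case: (E p).
  - by rewrite trD2//; case: (E p).
  - by rewrite trD2//; case: (E p).
have totalE := sum_split_pair elementE.
pose bp := boundary_pair a F Omega.
pose eg (q : T * 'I_3) := edge a F q.1 q.2.
(* The edges of one element are distinct as sets, so the fibre over an interior edge consists of
   exactly one pair for each of its two elements. *)
have eg_inj K i j : edge a F K i = edge a F K j -> i = j.
  move=> E; have [z zi] := edge_midpoint a F K i.
  by apply/esym; apply: (in_edge_unique hC zi); rewrite -E; exact: in_edge_edge.
have boundaryE : \sum_(q | bp q) curl q = \sum_(E \in boundary_edges a F Omega)
    \int[@lebesgue_measure R]_(r in [set r | r \in `[0, L] /\ E (x r)]) boundary_term a F v x ell theta r.
  rewrite (boundary_sum hOmega hbd hT hC C2w vw hvert hell hnu htau).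
  apply/esym/(fsbig_fibers (f := eg)).
    move=> E; split=> [[[K [i ->]] EO]|[[K i] /asboolP EO <-]]; last by split => //; exists K, i.
    by exists (K, i) => //; apply/asboolP.
  move=> E [[K [i ->]] EO].
  rewrite (big_pred1 (K, i)) /=.
    exact: Rintegral_restrict.
  move=> [K' i']; apply/andP/eqP => [[/asboolP EO' /eqP E']|[-> ->]]; last by split; [apply/asboolP|].
  by have [/= -> ->] := boundary_edge_unique hOmega hbd hT hC EO (esym E').
have interiorE : \sum_(q | ~~ bp q) curl q = 2 * \sum_(E \in interior_edges a F Omega)
    edge_integral E (tau E) (fun p => jump_dn a F v nu E p * d2t a F v (tau E) p).
  rewrite mulr_fsumr; apply/esym/(fsbig_fibers (f := eg)).
    move=> E; split=> [[[K [i ->]] EO]|[[K i] /asboolPn EO <-]]; last by split => //; exists K, i.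
    by exists (K, i) => //; apply/asboolPn.
  move=> E [[K [i ->]] EO]; have ie : is_edge a F K (edge a F K i) by exists i.
  have iE : interior_edges a F Omega (edge a F K i) by split => //; exists K.
  have [K' KK [i' EE]] := mesh_edge_shared hT ie EO; rewrite eq_sym in KK.
  rewrite (@sum_two _ _ _ _ (K, i) (K', i')).
  - by rewrite -(interior_edge_sum hOmega hbd hT hC C2w vw hnu htau hH1 hvert KK EE iE).
  - by apply: contra KK => /eqP[->].
  - by rewrite eqxx andbT; apply/asboolPn.
  - by rewrite /eg /= -EE eqxx andbT; apply/asboolPn; rewrite /= -EE.
  move=> [K2 i2] /andP[_ /eqP E2].
  have ie2 : is_edge a F K2 (edge a F K i) by exists i2.
  have [h|h] := interior_edge_elements hT hC hnu htau KK EE iE ie2; rewrite h in E2 *.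
    by left; rewrite (eg_inj K i2 i E2).
  by right; rewrite (eg_inj K' i2 i' (etrans E2 EE)).
have splitE : \sum_q curl q = \sum_(q | bp q) curl q + \sum_(q | ~~ bp q) curl q by rewrite (bigID bp).
exact: (combine_sums totalE splitE boundaryE interiorE).
Qed.
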